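(* There exist constants $\beta>0$ and $c>0$ such that if $f\in L^2(\mathbf{R})$ satisfies $\|f\|_{L^2}=A$ and $$0<\varepsilon\le\|e^{\frac{it\Delta}{2}}f\|_{L^6_{t,x}(\mathbf{R}\times\mathbf{R})},$$ then $$\sup_{z\in T^*\mathbf{R},\ \lambda>0,\ t\in\mathbf{R}}\bigl|\langle\pi(z)S_\lambda\psi,\ e^{\frac{it\Delta}{2}}f\rangle_{L^2(\mathbf{R})}\bigr|\ \ge\ c\,\varepsilon\Bigl(\frac{\varepsilon}{A}\Bigr)^{\beta}.$$
   Context: $e^{it\Delta/2}$ is the propagator of the free Schrödinger equation $i\partial_tu=-\frac12\partial_x^2u$ on $\mathbf{R}$. (By the Strichartz inequality the $L^6_{t,x}$ norm above is always $\lesssim\|f\|_{L^2}$.) For $\lambda>0$ and $z=(x_0,\xi_0)\in T^*\mathbf{R}\cong\mathbf{R}_x\times\mathbf{R}_\xi$, define $S_\lambda f(x)=\lambda^{-1/2}f(\lambda^{-1}x)$ and $\pi(x_0,\xi_0)f(x)=e^{i(x-x_0)\xi_0}f(x-x_0)$. The function $\psi$ is a fixed real, even Schwartz function on $\mathbf{R}$ with $\|\psi\|_{L^2}=(2\pi)^{-1/2}$. *)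

(* Defs.v *)
From HB Require Import structures.
From mathcomp Require Import all_boot all_order all_algebra.
From mathcomp Require Import complex.
From mathcomp Require Import all_classical all_reals all_analysis.

Set Implicit Arguments.
Unset Strict Implicit.
Unset Printing Implicit Defensive.
Import Order.TTheory GRing.Theory Num.Theory.
Import numFieldNormedType.Exports.
Local Open Scope classical_set_scope.
Local Open Scope ring_scope.

Section complex_valued.
Context {d : measure_display} {T : measurableType d} {R : realType}.

Definition cmeasurable (f : T -> R[i]) : Prop :=
  measurable_fun [set: T] (fun x => complex.Re (f x)) /\
  measurable_fun [set: T] (fun x => complex.Im (f x)).

Definition cLnorm (mu : {measure set T -> \bar R}) (p : \bar R)
    (f : T -> R[i]) : \bar R :=
  'N[mu]_p [ (fun x => (Normc.normc (f x))%:E) ]%E.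

Definition cintegral (mu : {measure set T -> \bar R}) (D : set T)
    (f : T -> R[i]) : R[i] :=
  ((\int[mu]_(x in D) complex.Re (f x))
   +i* (\int[mu]_(x in D) complex.Im (f x)))%C.

End complex_valued.

Section schrodinger.
Context {R : realType}.
Local Notation mu := (@lebesgue_measure R).

(* Elements of L^2(R) are handled through (Borel) representatives. *)
Definition inL2 (f : R -> R[i]) : Prop :=
  cmeasurable f /\ (cLnorm mu 2%:E f < +oo)%E.

Definition inner (f g : R -> R[i]) : R[i] :=
  cintegral mu [set: R] (fun x => f x * (g x)^*%C).

Definition expi (theta : R) : R[i] := (cos theta +i* sin theta)%C.

Definition truncated_fourier (n : nat) (f : R -> R[i]) (xi : R) : R[i] :=
  cintegral mu `[- n%:R, n%:R] (fun x => expi (- (x * xi)) * f x).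

(* F is (a representative of) the Plancherel extension to L^2 of
   f |-> \int e^{-i x xi} f(x) dx. *)
Definition is_fourier (f F : R -> R[i]) : Prop :=
  [/\ inL2 f, inL2 F &
      (fun n : nat => cLnorm mu 2%:E (fun xi => F xi - truncated_fourier n f xi))
        @ \oo --> 0%E].

(* g = e^{i t Delta / 2} f in L^2, the Fourier multiplier with symbol
   e^{- i t xi^2 / 2}. *)
Definition is_propagator (t : R) (f g : R -> R[i]) : Prop :=
  exists2 F : R -> R[i], is_fourier f F &
    is_fourier g (fun xi => expi (- (t * xi ^+ 2 / 2)) * F xi).

(* (t, x) |-> u t x represents (e^{i t Delta / 2} f)(x).  Each u t is determined
   by f up to a null set; requiring joint measurability therefore determines u
   up to a null set of R x R, so that its space-time norms depend on f only. *)
Definition free_evolution (f : R -> R[i]) (u : R -> R -> R[i]) : Prop :=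
  cmeasurable (fun tx : R * R => u tx.1 tx.2) /\
  forall t : R, is_propagator t f (u t).

Definition spacetime_norm (p : \bar R) (u : R -> R -> R[i]) : \bar R :=
  cLnorm (mu \x mu)%E p (fun tx : R * R => u tx.1 tx.2).

Definition schwartz (psi : R -> R) : Prop :=
  (forall (n : nat) (x : R), derivable (derive1n n psi) x 1) /\
  (forall m n : nat, exists C : R,
     forall x : R, `|x| ^+ m * `|derive1n n psi x| <= C).

Definition scaling (lam : R) (f : R -> R[i]) : R -> R[i] :=
  fun x => ((lam `^ (- 2^-1))%:C)%C * f (lam^-1 * x).

(* z = (x_0, xi_0) *)
Definition phase_translation (z : R * R) (f : R -> R[i]) : R -> R[i] :=
  fun x => expi ((x - z.1) * z.2) * f (x - z.1).

Definition embedC (psi : R -> R) : R -> R[i] := fun x => ((psi x)%:C)%C.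

End schrodinger.

(* Main.v *)
Require Import Defs.
From HB Require Import structures.
From mathcomp Require Import all_boot all_order all_algebra.
From mathcomp Require Import complex ring lra.
From mathcomp Require Import all_classical all_reals all_analysis.
From mathcomp Require Import measurable_realfun.
Set Implicit Arguments.
Unset Strict Implicit.
Unset Printing Implicit Defensive.
Import Order.TTheory GRing.Theory Num.Theory.
Import numFieldNormedType.Exports.
Local Open Scope classical_set_scope.
Local Open Scope ring_scope.

(** Proof idea.  Write [extension h] for the evolution of the frequency profile
    [h].  Let [M] be the supremum over wave packets and [A] the L2 norm; it is
    enough to prove [||u||_6^6 <= C M^2 A^4], which gives the exponent 2.

    For a cut-off [g] of the conjugate of [(extension h)^3], expanding the cube
    turns [\int |extension h|^6] into the integral over frequency triples of
    [h h h] against the Fourier transform [gamma] of [g], evaluated at the total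
    energy and momentum.  The triple is localised by writing 1 as an average, over
    centres [c] and inverse widths [s], of Gaussian weights
    [s^4 r^4 exp(-s^2 \sum_i (xi_i - c)^2)], where [r^2], the spread of the triple,
    is a function of energy and momentum only.  Hence half of each weight can be
    attached to [gamma], and the other half to [h h h], where it splits as a
    tensor product.  The evolution of the localised triple is the product of one
    wave packet transform, at most [M s^(-1/2)], and a bilinear term in which the
    factor [(xi_1 - xi_2)^2] makes the transversal bilinear estimate available.
    After the arithmetic-geometric mean inequality, Plancherel bounds the [gamma]
    part by [\int |extension h|^6], which is absorbed.

    The window [psi] is replaced by Gaussians through the inversion formula for
    the short-time Fourier transform of a Gaussian with window [psi].  The passage
    from Gaussian-damped profiles to arbitrary L2 data uses almost everywhere
    convergence of Gaussian means and Fatou's lemma. *)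

(** * Complex-valued measurable functions and integrals *)

(** The powers in the localising weight are dictated by scaling: integrating over [c] costs [s^-1],
    and [s^3 r^4 exp(-s^2 r^2) ds] is invariant under dilations, so the total mass of the weight is
    the same for all triples with [r > 0]. The same invariance recurs on the side of [h]. The
    bilinear estimate divides by the Jacobian [|xi_1 - xi_2|], which degenerates on the diagonal;
    the factor [(xi_1 - xi_2)^2], squared, turns this into [|xi_1 - xi_2|^3], whose integral over
    [c] and [s] is bounded uniformly in the two frequencies. All scales are thus summed at once,
    without dyadic decomposition or logarithmic loss. One bilinear term suffices because [r^2] is a
    symmetric combination of the squared differences, which all contribute the same amount once
    integrated against [h h h]. The image of a triple under energy and momentum is never treated as
    a function: it is only tested against continuous integrable functions. The final absorption
    presupposes a finite sextic integral; this comes from the cut-off and from the integrability of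
    the damped profile, and the resulting bound depends on neither. *)

Section complex_basics.
Context {R : realType}.
Implicit Types z w : R[i].

Lemma normc_ge0 z : 0 <= Normc.normc z.
Proof. by case: z => a b /=; exact: sqrtr_ge0. Qed.

Lemma normc_sqr z : Normc.normc z ^+ 2 = complex.Re z ^+ 2 + complex.Im z ^+ 2.
Proof. by case: z => a b /=; rewrite sqr_sqrtr// addr_ge0// sqr_ge0. Qed.

Lemma Re_le_normc z : `|complex.Re z| <= Normc.normc z.
Proof.
rewrite -(@ler_pXn2r _ 2) ?nnegrE ?normr_ge0 ?normc_ge0//.
by rewrite normc_sqr real_normK ?num_real// lerDl sqr_ge0.
Qed.

Lemma Im_le_normc z : `|complex.Im z| <= Normc.normc z.
Proof.
rewrite -(@ler_pXn2r _ 2) ?nnegrE ?normr_ge0 ?normc_ge0//.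
by rewrite normc_sqr real_normK ?num_real// lerDr sqr_ge0.
Qed.

Lemma normc_le_ReIm z : Normc.normc z <= `|complex.Re z| + `|complex.Im z|.
Proof.
rewrite -(@ler_pXn2r _ 2) ?nnegrE ?normc_ge0 ?addr_ge0//.
rewrite normc_sqr sqrrD !real_normK ?num_real// -addrA lerD2l lerDr.
by rewrite mulrn_wge0// mulr_ge0.
Qed.

Lemma normc_conj z : Normc.normc (z^*)%C = Normc.normc z.
Proof. by case: z => a b /=; rewrite sqrrN. Qed.

Lemma normc_real (r : R) : Normc.normc (r%:C)%C = `|r|.
Proof. by rewrite /= expr0n addr0 sqrtr_sqr. Qed.

Lemma normc_expi (t : R) : Normc.normc (expi t) = 1.
Proof. by rewrite /= cos2Dsin2 sqrtr1. Qed.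

Lemma normcX z n : Normc.normc (z ^+ n) = Normc.normc z ^+ n.
Proof.
elim: n => [|n ih]; first by rewrite !expr0 Normc.normc1.
by rewrite !exprS Normc.normcM ih.
Qed.

Lemma expi0 : expi (0 : R) = 1.
Proof. by rewrite /expi sin0 cos0. Qed.

Lemma conj_expi (t : R) : ((expi t)^*)%C = expi (- t).
Proof. by rewrite /expi sinN cosN. Qed.

Lemma ReM z w : complex.Re (z * w) =
  complex.Re z * complex.Re w - complex.Im z * complex.Im w.
Proof. by case: z w => a b []. Qed.

Lemma ImM z w : complex.Im (z * w) =
  complex.Re z * complex.Im w + complex.Im z * complex.Re w.
Proof. by case: z w => a b []. Qed.

Lemma ReD z w : complex.Re (z + w) = complex.Re z + complex.Re w.
Proof. by case: z w => a b []. Qed.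

Lemma ImD z w : complex.Im (z + w) = complex.Im z + complex.Im w.
Proof. by case: z w => a b []. Qed.

Lemma ReN z : complex.Re (- z) = - complex.Re z.
Proof. by case: z. Qed.

Lemma ImN z : complex.Im (- z) = - complex.Im z.
Proof. by case: z. Qed.

Lemma Re_conj z : complex.Re (z^*)%C = complex.Re z.
Proof. by case: z. Qed.

Lemma Im_conj z : complex.Im (z^*)%C = - complex.Im z.
Proof. by case: z. Qed.

Lemma cplx_eq z w : complex.Re z = complex.Re w -> complex.Im z = complex.Im w -> z = w.
Proof. by case: z w => a b [c e] /= -> ->. Qed.

Lemma expiD (s t : R) : expi (s + t) = expi s * expi t.
Proof.
by apply: cplx_eq; rewrite (ReM, ImM) /expi /= ?cosD// sinD addrC mulrC [X in X + _]mulrC.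
Qed.

Lemma mulc_conj z : z * (z^*)%C = ((Normc.normc z ^+ 2)%:C)%C.
Proof.
apply: cplx_eq; rewrite (ReM, ImM) Re_conj Im_conj /= ?normc_sqr; first by rewrite mulrN opprK !expr2.
by rewrite mulrN mulrC addNr.
Qed.

End complex_basics.

Section cmeasurable_theory.
Context {d : measure_display} {T : measurableType d} {R : realType}.
Implicit Types f g : T -> R[i].

Lemma cmeasurable_normc f : cmeasurable f ->
  measurable_fun [set: T] (fun x => Normc.normc (f x)).
Proof.
move=> [mr mi].
have -> : (fun x => Normc.normc (f x)) =
    (fun x => Num.sqrt (complex.Re (f x) ^+ 2 + complex.Im (f x) ^+ 2)).
  by apply/funext => x; case: (f x).
apply: (measurableT_comp (@continuous_measurable_fun R _ (@sqrt_continuous R))).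
by apply: measurable_funD; apply: measurable_funX.
Qed.

Lemma cmeasurableM f g : cmeasurable f -> cmeasurable g ->
  cmeasurable (fun x => f x * g x).
Proof.
move=> [fr fi] [gr gi]; split.
  under eq_fun do rewrite ReM.
  by apply: measurable_funB; apply: measurable_funM.
under eq_fun do rewrite ImM.
by apply: measurable_funD; apply: measurable_funM.
Qed.

Lemma cmeasurableD f g : cmeasurable f -> cmeasurable g ->
  cmeasurable (fun x => f x + g x).
Proof.
move=> [fr fi] [gr gi]; split.
  by under eq_fun do rewrite ReD; apply: measurable_funD.
by under eq_fun do rewrite ImD; apply: measurable_funD.
Qed.

Lemma cmeasurableN f : cmeasurable f -> cmeasurable (fun x => - f x).
Proof.
move=> [fr fi]; split.
  by under eq_fun do rewrite ReN; apply: measurableT_comp.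
by under eq_fun do rewrite ImN; apply: measurableT_comp.
Qed.

Lemma cmeasurableB f g : cmeasurable f -> cmeasurable g ->
  cmeasurable (fun x => f x - g x).
Proof. by move=> mf mg; apply: cmeasurableD => //; exact: cmeasurableN. Qed.

Lemma cmeasurable_conj f : cmeasurable f -> cmeasurable (fun x => (f x)^*%C).
Proof.
move=> [fr fi]; split; first by under eq_fun do rewrite Re_conj.
by under eq_fun do rewrite Im_conj; apply: measurableT_comp.
Qed.

Lemma cmeasurableX f n : cmeasurable f -> cmeasurable (fun x => f x ^+ n).
Proof.
move=> mf; elim: n => [|n ih].
  by split; exact: measurable_cst.
by under eq_fun do rewrite exprS; exact: cmeasurableM.
Qed.

Lemma cmeasurable_cst (z : R[i]) : cmeasurable (fun _ : T => z).
Proof. by split; exact: measurable_cst. Qed.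

Lemma cmeasurable_real (h : T -> R) : measurable_fun [set: T] h ->
  cmeasurable (fun x => ((h x)%:C)%C).
Proof. by move=> mh; split => //=; exact: measurable_cst. Qed.

Lemma cmeasurable_expi (h : T -> R) : measurable_fun [set: T] h ->
  cmeasurable (fun x => expi (h x)).
Proof.
move=> mh; split => /=.
  apply: (measurableT_comp _ mh); apply: continuous_measurable_fun.
  exact: continuous_cos.
apply: (measurableT_comp _ mh); apply: continuous_measurable_fun.
exact: continuous_sin.
Qed.

Lemma cmeasurable_comp d' (T' : measurableType d') (h : T' -> T) f :
  measurable_fun [set: T'] h -> cmeasurable f -> cmeasurable (fun x => f (h x)).
Proof.
by move=> mh [fr fi]; split;
  [apply: (measurableT_comp fr mh)|apply: (measurableT_comp fi mh)].
Qed.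

End cmeasurable_theory.

Section complex_integral.
Context {d : measure_display} {T : measurableType d} {R : realType}.
Variable mu : {measure set T -> \bar R}.
Implicit Types f g : T -> R[i].

Definition cintegrable f :=
  mu.-integrable [set: T] (EFin \o (fun x => complex.Re (f x))) /\
  mu.-integrable [set: T] (EFin \o (fun x => complex.Im (f x))).

Definition cint f : R[i] := cintegral mu [set: T] f.

Lemma Re_cint f : complex.Re (cint f) = (\int[mu]_x complex.Re (f x)).
Proof. by []. Qed.

Lemma Im_cint f : complex.Im (cint f) = (\int[mu]_x complex.Im (f x)).
Proof. by []. Qed.

Lemma cintegrable_measurable f : cintegrable f -> cmeasurable f.
Proof.
by move=> [/measurable_int/measurable_EFinP ? /measurable_int/measurable_EFinP ?]; split.
Qed.

Lemma integrable_normc f : cintegrable f ->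
  mu.-integrable [set: T] (fun x => (Normc.normc (f x))%:E).
Proof.
move=> If; have mf := cintegrable_measurable If; case: If => ir ii.
have := integrableD measurableT (integrable_abse ir) (integrable_abse ii).
apply: le_integrable => //.
  by apply/measurable_EFinP; exact: cmeasurable_normc.
move=> x _ /=; rewrite lee_fin ger0_norm ?normc_ge0//.
by rewrite (le_trans (normc_le_ReIm _))// ler_norm.
Qed.

Lemma cintegrable_le f (g : T -> R) : cmeasurable f ->
  mu.-integrable [set: T] (EFin \o g) ->
  (forall x, Normc.normc (f x) <= g x) -> cintegrable f.
Proof.
move=> [mr mi] ig fg; split; apply: (le_integrable measurableT _ _ ig).
- exact/measurable_EFinP.
- move=> x _ /=; rewrite lee_fin (le_trans (Re_le_normc _))//.
  by rewrite (le_trans (fg x))// ler_norm.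
- exact/measurable_EFinP.
- move=> x _ /=; rewrite lee_fin (le_trans (Im_le_normc _))//.
  by rewrite (le_trans (fg x))// ler_norm.
Qed.

Lemma cintegrable_lty f : cmeasurable f ->
  (\int[mu]_x (Normc.normc (f x))%:E < +oo)%E -> cintegrable f.
Proof.
move=> mf fin; apply: (cintegrable_le mf (g := fun x => Normc.normc (f x))) => //.
apply/integrableP; split.
  by apply/measurable_EFinP; exact: cmeasurable_normc.
by under eq_integral do rewrite /= ger0_norm ?normc_ge0//.
Qed.

Lemma eq_cint f g : f =1 g -> cint f = cint g.
Proof. by move/funext ->. Qed.

Lemma cintegrableD f g : cintegrable f -> cintegrable g ->
  cintegrable (fun x => f x + g x).
Proof.
move=> [fr fi] [gr gi]; split.
  have := (integrableD measurableT fr gr); apply: eq_integrable => // x _ /=.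
  by rewrite ReD EFinD.
have := (integrableD measurableT fi gi); apply: eq_integrable => // x _ /=.
by rewrite ImD EFinD.
Qed.

Lemma cintegrable_conj f : cintegrable f -> cintegrable (fun x => (f x)^*%C).
Proof.
move=> [fr fi]; split.
  by have := fr; apply: eq_integrable => // x _ /=; rewrite Re_conj.
have := (integrableN fi); apply: eq_integrable => // x _ /=.
by rewrite Im_conj EFinN.
Qed.

Lemma cintegrableZ (z : R[i]) f : cintegrable f -> cintegrable (fun x => z * f x).
Proof.
move=> If; apply: (@cintegrable_le _ (fun x => Normc.normc z * Normc.normc (f x))).
- by apply: cmeasurableM; [exact: cmeasurable_cst|exact: cintegrable_measurable].
- by have := integrableZl measurableT (Normc.normc z) (integrable_normc If).
- by move=> x; rewrite Normc.normcM.
Qed.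

Lemma cintD f g : cintegrable f -> cintegrable g ->
  cint (fun x => f x + g x) = cint f + cint g.
Proof.
move=> [fr fi] [gr gi]; apply: cplx_eq.
  rewrite ReD !Re_cint -RintegralD//.
  by apply: eq_Rintegral => x _; rewrite ReD.
rewrite ImD !Im_cint -RintegralD//.
by apply: eq_Rintegral => x _; rewrite ImD.
Qed.

Lemma cint_conj f : cintegrable f -> cint (fun x => (f x)^*%C) = ((cint f)^*)%C.
Proof.
move=> [fr fi]; apply: cplx_eq.
  by rewrite Re_conj !Re_cint; apply: eq_Rintegral => x _; rewrite Re_conj.
rewrite Im_conj !Im_cint -mulN1r -RintegralZl//.
by apply: eq_Rintegral => x _; rewrite Im_conj mulN1r.
Qed.

Lemma cintZ (z : R[i]) f : cintegrable f -> cint (fun x => z * f x) = z * cint f.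
Proof.
move=> [fr fi]; apply: cplx_eq.
  rewrite ReM !Re_cint !Im_cint -!RintegralZl// -RintegralB//.
  - by apply: eq_Rintegral => x _; rewrite ReM.
  - exact: (integrableZl measurableT (complex.Re z) fr).
  - exact: (integrableZl measurableT (complex.Im z) fi).
rewrite ImM !Re_cint !Im_cint -!RintegralZl// -RintegralD//.
- by apply: eq_Rintegral => x _; rewrite ImM.
- exact: (integrableZl measurableT (complex.Re z) fi).
- exact: (integrableZl measurableT (complex.Im z) fr).
Qed.

Lemma cintZr (z : R[i]) f : cintegrable f -> cint (fun x => f x * z) = cint f * z.
Proof.
by move=> If; rewrite [RHS]mulrC -cintZ//; apply: eq_cint => x; rewrite mulrC.
Qed.

Lemma cintN f : cintegrable f -> cint (fun x => - f x) = - cint f.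
Proof.
by move=> If; rewrite -mulN1r -cintZ//; apply: eq_cint => x; rewrite mulN1r.
Qed.

Lemma cintB f g : cintegrable f -> cintegrable g ->
  cint (fun x => f x - g x) = cint f - cint g.
Proof.
move=> If Ig; rewrite cintD//; first by rewrite cintN.
by have := cintegrableZ (-1) Ig; under eq_fun do rewrite mulN1r.
Qed.

Lemma cint_real (h : T -> R) : cint (fun x => ((h x)%:C)%C) = ((\int[mu]_x h x)%:C)%C.
Proof. by apply: cplx_eq; rewrite ?Re_cint ?Im_cint//= Rintegral_cst// mul0r. Qed.

(** Multiplying by the conjugate of the integral rotates it onto the positive real axis, where only
    the real part of the integrand counts, and this is at most the modulus. A vanishing integral is
    treated apart because its modulus is cancelled. *)
Lemma le_normc_cint f : cintegrable f ->
  Normc.normc (cint f) <= \int[mu]_x Normc.normc (f x).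
Proof.
move=> If; set z := cint f.
have In := integrable_normc If.
have [z0|z0] := eqVneq (Normc.normc z) 0.
  by rewrite z0; apply: Rintegral_ge0 => x _; exact: normc_ge0.
have zp : 0 < Normc.normc z by rewrite lt_neqAle eq_sym z0 normc_ge0.
rewrite -(ler_pM2l zp) -expr2 -RintegralZl//.
have -> : Normc.normc z ^+ 2 = complex.Re (z^*%C * z) by rewrite mulrC mulc_conj.
have Izf := cintegrableZ z^*%C If.
rewrite /z -cintZ// -/z Re_cint; apply: le_Rintegral => //.
- by case: Izf.
- exact: (integrableZl measurableT (Normc.normc z) In).
- move=> x _; rewrite (le_trans (ler_norm _))// (le_trans (Re_le_normc _))//.
  by rewrite Normc.normcM normc_conj.
Qed.

Lemma le_normc_cinte f : cintegrable f ->
  ((Normc.normc (cint f))%:E <= \int[mu]_x (Normc.normc (f x))%:E)%E.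
Proof.
move=> If; have In := integrable_normc If.
rewrite -[leRHS]fineK; first by rewrite lee_fin; exact: le_normc_cint.
exact: integrable_fin_num.
Qed.

End complex_integral.

(** * Fubini and Tonelli theorems for real and complex integrands *)

Section real_fubini.
Context d1 d2 (T1 : measurableType d1) (T2 : measurableType d2) (R : realType).
Variable m1 : {sigma_finite_measure set T1 -> \bar R}.
Variable m2 : {sigma_finite_measure set T2 -> \bar R}.
Variable f : T1 * T2 -> R.
Hypothesis If : (m1 \x m2)%E.-integrable [set: T1 * T2] (EFin \o f).

(** [Rintegral] sends an infinite inner integral to 0, so the real and the extended inner integrals
    are compared only at points whose section is integrable; these are almost all points. *)
Let ae1 : ae_eq m1 [set: T1] (fun x => (\int[m2]_y f (x, y))%:E)
  (fun x => \int[m2]_y (f (x, y))%:E)%E.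
Proof.
have := ae_integrable1 If; apply: filterS => x Ix _.
by rewrite /Rintegral fineK//; exact: integrable_fin_num.
Qed.

Let ae2 : ae_eq m2 [set: T2] (fun y => (\int[m1]_x f (x, y))%:E)
  (fun y => \int[m1]_x (f (x, y))%:E)%E.
Proof.
have := ae_integrable2 If; apply: filterS => x Ix _.
by rewrite /Rintegral fineK//; exact: integrable_fin_num.
Qed.

Let mF : measurable_fun [set: T1] (fun x => \int[m2]_y (f (x, y))%:E)%E.
Proof. exact: (measurable_fubini_F If). Qed.

Let mG : measurable_fun [set: T2] (fun y => \int[m1]_x (f (x, y))%:E)%E.
Proof. exact: (measurable_fubini_G If). Qed.

Let mFr : measurable_fun [set: T1] (fun x => \int[m2]_y f (x, y)).
Proof. exact: (measurableT_comp (fine_measurable measurableT) mF). Qed.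

Let mGr : measurable_fun [set: T2] (fun y => \int[m1]_x f (x, y)).
Proof. exact: (measurableT_comp (fine_measurable measurableT) mG). Qed.

Lemma integrable_Rintegral1 :
  m1.-integrable [set: T1] (EFin \o (fun x => \int[m2]_y f (x, y))).
Proof.
have IF := integrable_fubini_F If.
apply/integrableP; split.
  by apply/measurable_EFinP; exact: mFr.
have /integrableP[_] := IF; congr (_ < _)%E; apply: ae_eq_integral => //=.
- by apply: measurableT_comp => //; apply: (measurable_int m1 IF).
- by apply/measurable_EFinP; apply: measurableT_comp => //; exact: mFr.
- by have := ae1; apply: filterS => x /(_ I) /= xE _; rewrite /fubini_F /= -xE.
Qed.

Lemma integrable_Rintegral2 :
  m2.-integrable [set: T2] (EFin \o (fun y => \int[m1]_x f (x, y))).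
Proof.
have IG : m2.-integrable [set: T2] (fun y => \int[m1]_x (f (x, y))%:E)%E.
  apply/integrableP; split; first exact: mG.
  have mf := measurable_int _ If.
  apply: le_lt_trans ((integrable21ltyP m1 m2 mf).1 If).
  apply: ge0_le_integral => //.
  - exact: measurableT_comp.
  - apply: (measurable_fun_fubini_tonelli_G (abse \o (EFin \o f))) => //=.
    exact: measurableT_comp.
  - move=> y _; apply: le_abse_integral => //; apply: (measurableT_comp mf) => //.
apply/integrableP; split.
  by apply/measurable_EFinP; exact: mGr.
have /integrableP[_] := IG; congr (_ < _)%E; apply: ae_eq_integral => //=.
- by apply: measurableT_comp => //; apply: mG.
- by apply/measurable_EFinP; apply: measurableT_comp => //; exact: mGr.
- by have := ae2; apply: filterS => x /(_ I) /= xE _; rewrite -xE.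
Qed.

Lemma Rfubini1 : \int[m1]_x \int[m2]_y f (x, y) = \int[(m1 \x m2)%E]_z f z.
Proof.
rewrite [LHS]/Rintegral [RHS]/Rintegral; congr fine.
rewrite -(integral12_prod_meas1 If); apply: ae_eq_integral => //=.
exact: measurable_int integrable_Rintegral1.
Qed.

Lemma Rfubini2 : \int[m2]_y \int[m1]_x f (x, y) = \int[(m1 \x m2)%E]_z f z.
Proof.
rewrite [LHS]/Rintegral [RHS]/Rintegral; congr fine.
rewrite -(integral21_prod_meas1 If); apply: ae_eq_integral => //=.
exact: measurable_int integrable_Rintegral2.
Qed.

End real_fubini.

(* The library's canonical sigma-finite structure on [m1 \x m2] is registered
   for finite measures only, so iterated products need a copy. *)
Definition prodm {d1 d2} {T1 : measurableType d1} {T2 : measurableType d2}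
    {R : realType} (m1 : {sigma_finite_measure set T1 -> \bar R})
    (m2 : {sigma_finite_measure set T2 -> \bar R}) :
  set (T1 * T2) -> \bar R := (m1 \x m2)%E.

Section prodm_instances.
Context d1 d2 (T1 : measurableType d1) (T2 : measurableType d2) (R : realType).
Variable m1 : {sigma_finite_measure set T1 -> \bar R}.
Variable m2 : {sigma_finite_measure set T2 -> \bar R}.

HB.instance Definition _ := Measure.copy (prodm m1 m2) (m1 \x m2)%E.

Let prodm_sigma_finite : sigma_finite setT (prodm m1 m2).
Proof.
have /sigma_finiteP[F [TF ndF Foo]] := sigma_finiteT m1.
have /sigma_finiteP[G [TG ndG Goo]] := sigma_finiteT m2.
exists (fun n => F n `*` G n).
  rewrite -setXTT TF TG predeqE => -[x y]; split.
    move=> [/= [n _ Fnx] [k _ Gky]]; exists (maxn n k) => //; split.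
    - by move: x Fnx; exact/subsetPset/ndF/leq_maxl.
    - by move: y Gky; exact/subsetPset/ndG/leq_maxr.
  by move=> [n _ []/= ? ?]; split; exists n.
move=> k; have [? ?] := Foo k; have [? ?] := Goo k.
split; first exact: measurableX.
by rewrite /prodm product_measure1E// lte_mul_pinfty// ge0_fin_numE.
Qed.

HB.instance Definition _ := Measure_isSigmaFinite.Build _ _ _ (prodm m1 m2)
  prodm_sigma_finite.

Local Open Scope ereal_scope.

Lemma tonelli1 (f : T1 * T2 -> \bar R) : measurable_fun [set: T1 * T2] f ->
  (forall z, 0 <= f z) -> \int[prodm m1 m2]_z f z = \int[m1]_x \int[m2]_y f (x, y).
Proof. by move=> mf f0; rewrite -[RHS](fubini_tonelli1 f). Qed.

Lemma tonelli2 (f : T1 * T2 -> \bar R) : measurable_fun [set: T1 * T2] f ->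
  (forall z, 0 <= f z) -> \int[prodm m1 m2]_z f z = \int[m2]_y \int[m1]_x f (x, y).
Proof. by move=> mf f0; rewrite -[RHS](fubini_tonelli2 f). Qed.

Lemma tonelli12 (f : T1 * T2 -> \bar R) : measurable_fun [set: T1 * T2] f ->
  (forall z, 0 <= f z) ->
  \int[m1]_x \int[m2]_y f (x, y) = \int[m2]_y \int[m1]_x f (x, y).
Proof. by move=> mf f0; rewrite -tonelli1// tonelli2. Qed.

End prodm_instances.

Section complex_fubini.
Context d1 d2 (T1 : measurableType d1) (T2 : measurableType d2) (R : realType).
Variable m1 : {sigma_finite_measure set T1 -> \bar R}.
Variable m2 : {sigma_finite_measure set T2 -> \bar R}.

Lemma cfubini1 (f : T1 * T2 -> R[i]) : cintegrable (prodm m1 m2) f ->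
  cint m1 (fun x => cint m2 (fun y => f (x, y))) = cint (prodm m1 m2) f.
Proof.
by move=> [fr fi]; apply: cplx_eq; [rewrite !Re_cint (Rfubini1 fr)|rewrite !Im_cint (Rfubini1 fi)].
Qed.

Lemma cfubini2 (f : T1 * T2 -> R[i]) : cintegrable (prodm m1 m2) f ->
  cint m2 (fun y => cint m1 (fun x => f (x, y))) = cint (prodm m1 m2) f.
Proof.
by move=> [fr fi]; apply: cplx_eq; [rewrite !Re_cint (Rfubini2 fr)|rewrite !Im_cint (Rfubini2 fi)].
Qed.

Lemma cfubini (f : T1 * T2 -> R[i]) : cintegrable (prodm m1 m2) f ->
  cint m1 (fun x => cint m2 (fun y => f (x, y))) =
  cint m2 (fun y => cint m1 (fun x => f (x, y))).
Proof. by move=> If; rewrite cfubini1// cfubini2. Qed.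

Lemma cintegrable_cint1 (f : T1 * T2 -> R[i]) : cintegrable (prodm m1 m2) f ->
  cintegrable m1 (fun x => cint m2 (fun y => f (x, y))).
Proof.
by move=> [fr fi]; split; [exact: (integrable_Rintegral1 fr)|exact: (integrable_Rintegral1 fi)].
Qed.

Lemma cintegrable_cint2 (f : T1 * T2 -> R[i]) : cintegrable (prodm m1 m2) f ->
  cintegrable m2 (fun y => cint m1 (fun x => f (x, y))).
Proof.
by move=> [fr fi]; split; [exact: (integrable_Rintegral2 fr)|exact: (integrable_Rintegral2 fi)].
Qed.

Lemma cintegrable_prod (f : T1 -> R[i]) (g : T2 -> R[i]) :
  cintegrable m1 f -> cintegrable m2 g ->
  cintegrable (prodm m1 m2) (fun z => f z.1 * g z.2).
Proof.
move=> If Ig.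
have mf := cintegrable_measurable If; have mg := cintegrable_measurable Ig.
have mfg : cmeasurable (fun z : T1 * T2 => f z.1 * g z.2).
  by apply: cmeasurableM; [apply: (cmeasurable_comp _ mf)|apply: (cmeasurable_comp _ mg)].
apply: cintegrable_lty => //.
rewrite tonelli1//=; last 2 first.
- by apply/measurable_EFinP; exact: cmeasurable_normc.
- by move=> z; rewrite lee_fin normc_ge0.
under eq_integral => x _.
  under eq_integral do rewrite Normc.normcM EFinM.
  rewrite ge0_integralZl//; last 3 first.
  - by apply/measurable_EFinP; exact: cmeasurable_normc.
  - by move=> y _; rewrite lee_fin normc_ge0.
  - by rewrite lee_fin normc_ge0.
  over.
rewrite ge0_integralZr//=; last 3 first.
- by apply/measurable_EFinP; exact: cmeasurable_normc.
- by move=> y _; rewrite lee_fin normc_ge0.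
- by apply: integral_ge0 => y _; rewrite lee_fin normc_ge0.
have nf := integrable_fin_num measurableT (integrable_normc If).
have ng := integrable_fin_num measurableT (integrable_normc Ig).
by rewrite ltey_eq fin_numM.
Qed.

Lemma cint_prod (f : T1 -> R[i]) (g : T2 -> R[i]) :
  cintegrable m1 f -> cintegrable m2 g ->
  cint (prodm m1 m2) (fun z => f z.1 * g z.2) = cint m1 f * cint m2 g.
Proof.
move=> If Ig; rewrite -cfubini1; last exact: cintegrable_prod.
by rewrite -cintZr//; apply: eq_cint => x /=; rewrite cintZ.
Qed.

End complex_fubini.

(** * Complex limits and dominated convergence *)

Section complex_cvg.
Context {R : realType}.


Lemma normc_cvg_Re (z_ : nat -> R[i]) (z : R[i]) : Normc.normc (z_ n - z) @[n --> \oo] --> 0 ->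
  complex.Re (z_ n) @[n --> \oo] --> complex.Re z.
Proof.
move=> cf; apply/cvgrPdist_le => e e0.
move/cvgrPdist_le: cf => /(_ e e0); apply: filterS => n.
rewrite sub0r normrN (ger0_norm (normc_ge0 _)); apply: le_trans.
by rewrite distrC -ReN -ReD; exact: Re_le_normc.
Qed.

Lemma normc_cvg_Im (z_ : nat -> R[i]) (z : R[i]) : Normc.normc (z_ n - z) @[n --> \oo] --> 0 ->
  complex.Im (z_ n) @[n --> \oo] --> complex.Im z.
Proof.
move=> cf; apply/cvgrPdist_le => e e0.
move/cvgrPdist_le: cf => /(_ e e0); apply: filterS => n.
rewrite sub0r normrN (ger0_norm (normc_ge0 _)); apply: le_trans.
by rewrite distrC -ImN -ImD; exact: Im_le_normc.
Qed.

Lemma cvg_ReIm_normc (z_ : nat -> R[i]) (z : R[i]) : complex.Re (z_ n) @[n --> \oo] --> complex.Re z ->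
  complex.Im (z_ n) @[n --> \oo] --> complex.Im z ->
  Normc.normc (z_ n - z) @[n --> \oo] --> 0.
Proof.
move=> cr ci; apply/cvgrPdist_le => e e0.
have e20 : 0 < e / 2 by rewrite divr_gt0.
move/cvgrPdist_le: cr => /(_ _ e20) cr; move/cvgrPdist_le: ci => /(_ _ e20) ci.
near=> n; rewrite sub0r normrN (ger0_norm (normc_ge0 _)).
rewrite (le_trans (normc_le_ReIm _))// ReD ImD ReN ImN (splitr e).
by apply: lerD; rewrite distrC; near: n.
Unshelve. all: by end_near. Qed.

End complex_cvg.

Section complex_dct.
Context {d : measure_display} {T : measurableType d} {R : realType}.
Variable mu : {measure set T -> \bar R}.

Lemma Rdct (f_ : nat -> T -> R) (f g : T -> R) :
  (forall n, measurable_fun [set: T] (f_ n)) -> measurable_fun [set: T] f ->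
  (forall x, f_ n x @[n --> \oo] --> f x) ->
  mu.-integrable [set: T] (EFin \o g) ->
  (forall n x, `|f_ n x| <= g x) ->
  (\int[mu]_x f_ n x) @[n --> \oo] --> \int[mu]_x f x.
Proof.
move=> mf_ mf cf ig fg.
have [] := @dominated_convergence _ _ _ mu _ measurableT (fun n => EFin \o f_ n)
  (EFin \o f) (EFin \o g).
- by move=> n; exact/measurable_EFinP.
- exact/measurable_EFinP.
- by apply/aeW => x _ /=; apply: cvg_EFin; [exact: nearW|exact: cf].
- exact: ig.
- by apply/aeW => x n _ /=; rewrite lee_fin.
move=> If _ cv; apply: fine_cvg; rewrite fineK//; exact: integrable_fin_num.
Qed.

Lemma cint_dct (f_ : nat -> T -> R[i]) (f : T -> R[i]) (g : T -> R) :
  (forall n, cmeasurable (f_ n)) -> cmeasurable f ->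
  (forall x, Normc.normc (f_ n x - f x) @[n --> \oo] --> 0) ->
  mu.-integrable [set: T] (EFin \o g) ->
  (forall n x, Normc.normc (f_ n x) <= g x) ->
  Normc.normc (cint mu (f_ n) - cint mu f) @[n --> \oo] --> 0.
Proof.
move=> mf_ mf cf ig fg.
have cr x := normc_cvg_Re (cf x); have ci x := normc_cvg_Im (cf x).
have Cr := @Rdct (fun n x => complex.Re (f_ n x)) (fun x => complex.Re (f x)) g
  (fun n => (mf_ n).1) mf.1 cr ig (fun n x => le_trans (Re_le_normc _) (fg n x)).
have Ci := @Rdct (fun n x => complex.Im (f_ n x)) (fun x => complex.Im (f x)) g
  (fun n => (mf_ n).2) mf.2 ci ig (fun n x => le_trans (Im_le_normc _) (fg n x)).
exact: cvg_ReIm_normc.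
Qed.

End complex_dct.

(** * Gaussian integrals and their Fourier transforms *)

Section affine_change_of_variable.
Context {R : realType}.
Local Notation mu := (@lebesgue_measure R).
Local Open Scope ereal_scope.

Let affine (a b : R) (x : measurableTypeR R) : measurableTypeR R := (a * x + b)%R.

Let measurable_affine a b : measurable_fun [set: measurableTypeR R] (affine a b).
Proof.
by apply: measurable_funD => //; apply: measurable_funM.
Qed.

Let affine_image a b : {measure set (measurableTypeR R) -> \bar R} :=
  measure_function_pushforward__canonical__measure_function_Measure
    mu (measurable_affine a b).

(** Lebesgue measure is determined by its values on half-open intervals, so it is enough to compare
    the two measures there. *)
Let affine_measure (a b : R) (a0 : (0 < a)%R) (A : set (measurableTypeR R)) :
  measurable A -> mu A = mscale (NngNum (ltW a0)) (affine_image a b) A.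
Proof.
apply: lebesgue_measure_unique => // _ [[c e]] _ <-.
transitivity (a%:E * mu (affine a b @^-1` `]c, e])); last by [].
have -> : affine a b @^-1` `]c, e] = [set` `](c - b) / a, (e - b) / a]%R].
  apply/seteqP; split => x /=; rewrite !in_itv/= /affine.
    by move=> /andP[h1 h2]; rewrite ltr_pdivrMr// ler_pdivlMr// ltrBlDr lerBrDr mulrC h1 h2.
  by rewrite ltr_pdivrMr// ler_pdivlMr// ltrBlDr lerBrDr mulrC.
rewrite !lebesgue_measure_itv/= !lte_fin ltr_pdivrMr// divfK ?gt_eqF// ltrD2r.
case: ifPn => _; last by rewrite mule0.
by rewrite -!EFinD -EFinM -mulrBl mulrC divfK ?gt_eqF//; congr EFin; ring.
Qed.

Lemma ge0_integral_affine (a b : R) (f : R -> \bar R) : (0 < a)%R ->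
  measurable_fun [set: R] f -> (forall x, 0 <= f x) ->
  \int[mu]_x f x = a%:E * \int[mu]_x f (a * x + b)%R.
Proof.
move=> a0 mf f0.
transitivity (\int[mscale (NngNum (ltW a0)) (affine_image a b)]_x f x).
  by apply: eq_measure_integral => A mA _; exact: affine_measure.
rewrite ge0_integral_mscale//=; congr (_ * _).
by rewrite (ge0_integral_pushforward (measurable_affine a b)).
Qed.

Lemma ge0_integral_shift (b : R) (f : R -> \bar R) :
  measurable_fun [set: R] f -> (forall x, 0 <= f x) ->
  \int[mu]_x f (x + b)%R = \int[mu]_x f x.
Proof.
move=> mf f0; rewrite (ge0_integral_affine b ltr01 mf f0) mul1e.
by under [RHS]eq_integral do rewrite mul1r.
Qed.

Lemma ge0_integral_opp (f : R -> \bar R) :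
  measurable_fun [set: R] f -> (forall x, 0 <= f x) ->
  \int[mu]_x f (- x)%R = \int[mu]_x f x.
Proof.
move=> mf f0.
have mN : measurable_fun [set: measurableTypeR R] (-%R : measurableTypeR R -> measurableTypeR R).
  exact: oppr_measurable.
transitivity (\int[pushforward mu (-%R : _ -> measurableTypeR R)]_x f x).
  by rewrite (ge0_integral_pushforward mN).
by apply: eq_measure_integral => A mA _; exact: lebesgue_measureN.
Qed.

Lemma ge0_integral_rshift (b : R) (f : R -> \bar R) :
  measurable_fun [set: R] f -> (forall x, 0 <= f x) ->
  \int[mu]_x f (b - x)%R = \int[mu]_x f x.
Proof.
move=> mf f0; rewrite -[RHS](ge0_integral_shift b)// -[RHS]ge0_integral_opp//.
  by under eq_integral do rewrite addrC.
by apply: (measurableT_comp mf); exact: measurable_funD.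
Qed.

End affine_change_of_variable.

Section gaussian.
Context {R : realType}.
Local Notation mu := (@lebesgue_measure R).

Lemma measurable_gauss (a : R) : measurable_fun [set: R] (fun x : R => expR (- (a * x ^+ 2))).
Proof.
by apply: measurableT_comp => //; apply: measurableT_comp => //; apply: measurable_funM.
Qed.

Lemma integral_gauss (a b : R) : 0 < a ->
  (\int[mu]_x (expR (- (a * (x - b) ^+ 2)))%:E)%E = (Num.sqrt (pi / a))%:E.
Proof.
move=> a0.
rewrite (@ge0_integral_shift R (- b) (fun x => (expR (- (a * x ^+ 2)))%:E)); last 2 first.
- by apply/measurable_EFinP; exact: measurable_gauss.
- by move=> x; rewrite lee_fin expR_ge0.
have sa : 0 < Num.sqrt a by rewrite sqrtr_gt0.
have := @integralT_gauss R.
rewrite (@ge0_integral_affine R (Num.sqrt a) 0 (fun x => (gauss_fun x)%:E) sa); last 2 first.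
- by apply/measurable_EFinP; exact: measurable_gauss_fun.
- by move=> x; rewrite lee_fin gauss_fun_ge0.
under eq_integral do rewrite addr0 /gauss_fun exprMn sqr_sqrtr ?(ltW a0)//.
move=> h; rewrite sqrtrM ?pi_ge0// sqrtrV ?(ltW a0)//.
have -> : (Num.sqrt pi / Num.sqrt a)%:E = ((Num.sqrt a)^-1%:E * (Num.sqrt pi)%:E)%E :> \bar R.
  by rewrite -EFinM mulrC.
by rewrite -h muleA -EFinM mulVf ?gt_eqF// mul1e.
Qed.

Lemma integrable_gauss (a b : R) : 0 < a ->
  mu.-integrable [set: R] (EFin \o (fun x => expR (- (a * (x - b) ^+ 2)))).
Proof.
move=> a0; apply/integrableP; split.
  apply/measurable_EFinP; apply: (measurableT_comp (measurable_gauss a)).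
  exact: measurable_funD.
under eq_integral do rewrite /= ger0_norm ?expR_ge0//.
by rewrite integral_gauss// ltry.
Qed.

Lemma integrable_gauss0 (a : R) : 0 < a ->
  mu.-integrable [set: R] (EFin \o (fun x => expR (- (a * x ^+ 2)))).
Proof.
by move=> a0; have := integrable_gauss 0 a0; under eq_fun do rewrite subr0.
Qed.

(** From [1 + y <= exp y] at [y = x^2 / 2]. It serves to trade polynomial factors for a fraction of
    a Gaussian exponent. *)
Lemma norm_le_expR_sqr (x : R) : `|x| <= expR (x ^+ 2 / 2).
Proof.
apply: le_trans (expR_ge1Dx _); rewrite -subr_ge0 -(real_normK (num_real x)).
have -> : 1 + `|x| ^+ 2 / 2 - `|x| = ((`|x| - 1) ^+ 2 + 1) / 2 by field.
by rewrite divr_ge0// addr_ge0// sqr_ge0.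
Qed.

Lemma cvg_expRN_sqr (a : R) : 0 < a -> expR (- (a * (n%:R : R) ^+ 2)) @[n --> \oo] --> 0.
Proof.
move=> a0.
have c1 : (fun n : nat => (1 + a * n%:R)^-1) @ \oo --> (0 : R).
  apply/cvgrPdist_le => e e0; near=> n; rewrite sub0r normrN ger0_norm; last first.
    by rewrite invr_ge0 addr_ge0// mulr_ge0// ltW.
  rewrite invf_ple ?posrE//; last by rewrite ltr_wpDr// mulr_ge0// ltW.
  rewrite ler_wpDl// mulrC -ler_pdivrMr//.
  by near: n; exact: nbhs_infty_ger.
apply: (squeeze_cvgr _ (cvg_cst 0) c1); apply: nearW => n.
rewrite expR_ge0 expRN lef_pV2 ?posrE ?expR_gt0//; last first.
  by rewrite ltr_wpDr// mulr_ge0// ltW.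
apply: le_trans (expR_ge1Dx _); rewrite lerD2l ler_wpM2l ?(ltW a0)//.
by rewrite -natrX ler_nat; case: n => // n; rewrite expnS leq_pmulr// expn_gt0.
Unshelve. all: by end_near. Qed.

(** This is integration by parts on the whole line: the fundamental theorem on [[-n, n]] with
    boundary values tending to 0, and dominated convergence for the truncated integrals. *)
Lemma integral_derivative0 (H h : R -> R) :
  (forall x : R, is_derive x (1 : R) H (h x)) -> continuous h ->
  mu.-integrable [set: R] (EFin \o h) ->
  H n%:R @[n --> \oo] --> 0 -> H (- n%:R) @[n --> \oo] --> 0 ->
  \int[mu]_x h x = 0.
Proof.
move=> dH ch ih Hp Hn.
have mh : measurable_fun [set: R] h by exact: continuous_measurable_fun.
pose h_ n x := h x * \1_(`[- n%:R, n%:R]%classic : set R) x.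
have c1 : (\int[mu]_x h_ n x) @[n --> \oo] --> \int[mu]_x h x.
  apply: (@Rdct _ _ _ mu h_ h (fun x => `|h x|)) => //.
  - by move=> n; apply: measurable_funM => //; exact: measurable_indic.
  - move=> x; apply: cvg_near_cst; near=> n.
    rewrite /h_ indicE mem_set ?mulr1//= in_itv/= -ler_norml.
    by near: n; exact: nbhs_infty_ger.
  - exact: integrable_norm.
  - move=> n x; rewrite /h_ normrM ler_piMr// indicE.
    by case: (_ \in _); rewrite ?normr1 ?normr0.
have cH : continuous H.
  by move=> x; apply: differentiable_continuous; apply/derivable1_diffP; have [] := dH x.
have c2 : (\int[mu]_x h_ n x) @[n --> \oo] --> 0.
  have : (fun n : nat => H n%:R - H (- n%:R)) @ \oo --> 0 - 0 by exact: cvgB.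
  rewrite subr0; apply: cvg_trans; apply: near_eq_cvg; near=> n.
  have n0 : 0 < n%:R :> R by rewrite ltr0n; near: n; exact: nbhs_infty_gt.
  transitivity (\int[mu]_(x in `[- n%:R, n%:R]) h x); last first.
    rewrite Rintegral_mkcond; apply: eq_Rintegral => x _.
    by rewrite /h_ patchE indicE; case: (_ \in _); rewrite ?mulr1 ?mulr0.
  rewrite /Rintegral (@continuous_FTC2 _ h H)//.
  - by rewrite (lt_trans _ n0)// oppr_lt0.
  - exact: continuous_subspaceT.
  - split => [x _||]; [by have [] := dH x|apply: cvg_at_right_filter; exact: cH|
      apply: cvg_at_left_filter; exact: cH].
  - by move=> x _; rewrite derive1E; have [] := dH x.
exact: (cvg_unique _ c1 c2).
Unshelve. all: by end_near. Qed.

End gaussian.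

Section signed_change_of_variable.
Context {R : realType}.
Local Notation mu := (@lebesgue_measure R).
Local Open Scope ereal_scope.

Lemma integral_opp (f : R -> \bar R) : measurable_fun [set: R] f ->
  \int[mu]_x f (- x)%R = \int[mu]_x f x.
Proof.
move=> mf; rewrite [LHS]integralE [RHS]integralE.
have := ge0_integral_opp (measurable_funepos mf) (funepos_ge0 _).
have := ge0_integral_opp (measurable_funeneg mf) (funeneg_ge0 _).
move=> <- <-; congr (_ - _); apply: eq_integral => x _.
  by rewrite (funepos_comp f).
by rewrite (funeneg_comp f).
Qed.

Lemma integral_shift (b : R) (f : R -> \bar R) : measurable_fun [set: R] f ->
  \int[mu]_x f (x + b)%R = \int[mu]_x f x.
Proof.
move=> mf; rewrite [LHS]integralE [RHS]integralE.
have := ge0_integral_shift b (measurable_funepos mf) (funepos_ge0 _).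
have := ge0_integral_shift b (measurable_funeneg mf) (funeneg_ge0 _).
move=> <- <-; congr (_ - _); apply: eq_integral => x _.
  by rewrite (funepos_comp f).
by rewrite (funeneg_comp f).
Qed.

End signed_change_of_variable.

Section gaussian_fourier.
Context {R : realType}.
Local Notation mu := (@lebesgue_measure R).

Let f (s x : R) := expR (- (x ^+ 2)) * cos (s * x).

Let integrable_expRsq : mu.-integrable [set: R] (EFin \o (fun x => expR (- (x ^+ 2)))).
Proof.
have := @integrable_gauss0 R 1 ltr01.
by under eq_fun do rewrite mul1r.
Qed.

Lemma integrable_norm_gauss (a : R) : 0 < a ->
  mu.-integrable [set: R] (EFin \o (fun x : R => `|x| * expR (- (a * x ^+ 2)))).
Proof.
move=> a0.
have mg : measurable_fun [set: R] (fun x : R => `|x| * expR (- (a * x ^+ 2))).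
  by apply: measurable_funM; [exact: normr_measurable|exact: measurable_gauss].
have a20 : 0 < a / 2 by rewrite divr_gt0.
have sa : 0 < Num.sqrt a by rewrite sqrtr_gt0.
have := integrableZl measurableT (Num.sqrt a)^-1 (integrable_gauss0 a20).
apply: le_integrable => //; first exact/measurable_EFinP.
move=> x _; rewrite lee_fin.
rewrite (ger0_norm (mulr_ge0 (normr_ge0 _) (expR_ge0 _))).
rewrite ger0_norm; last by rewrite mulr_ge0 ?invr_ge0 ?expR_ge0 ?sqrtr_ge0.
rewrite ler_pdivlMl// mulrA -{1}(gtr0_norm sa) -normrM.
rewrite (le_trans (ler_wpM2r _ (norm_le_expR_sqr _))) ?expR_ge0//.
rewrite -expRD ler_expR exprMn sqr_sqrtr ?(ltW a0)//.
suff -> : a * x ^+ 2 / 2 - a * x ^+ 2 = - (a / 2 * x ^+ 2) by [].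
by field.
Qed.

Let is_derive_f (s x : R) : is_derive s (1 : R) (fun s => f s x) (- (x * expR (- (x ^+ 2)) * sin (s * x))).
Proof.
apply: is_derive_eq.
by rewrite /GRing.scale /= mulr0 add0r mulr1; ring.
Qed.

Let is_derive_H (s x : R) : is_derive x (1 : R)
  (fun x => expR (- (x ^+ 2)) * sin (s * x))
  (- (2 * (x * expR (- (x ^+ 2)) * sin (s * x))) + s * f s x).
Proof.
apply: is_derive_eq.
by rewrite /GRing.scale /= /f; ring.
Qed.

Let integrable_f (s : R) : mu.-integrable [set: R] (EFin \o f s).
Proof.
apply: (le_integrable measurableT _ _ integrable_expRsq).
  apply/measurable_EFinP; apply: continuous_measurable_fun => x.
  apply: differentiable_continuous; apply/derivable1_diffP.
  exact: ex_derive.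
move=> x _; rewrite lee_fin normrM ger0_norm ?expR_ge0// ler_piMr ?expR_ge0//.
by rewrite ler_norml cos_geN1 cos_le1.
Qed.

Let integrable_df (s : R) :
  mu.-integrable [set: R] (EFin \o (fun x : R => x * expR (- (x ^+ 2)) * sin (s * x))).
Proof.
have := @integrable_norm_gauss 1 ltr01; under eq_fun do rewrite mul1r.
apply: le_integrable => //.
  apply/measurable_EFinP; apply: continuous_measurable_fun => x.
  apply: differentiable_continuous; apply/derivable1_diffP.
  exact: ex_derive.
move=> x _ /=; rewrite lee_fin !normrM normr_id ler_piMr ?mulr_ge0//.
by rewrite ler_norml sin_geN1 sin_le1.
Qed.

Let Phi (s : R) := \int[mu]_x f s x.

(** The derivative of [exp(-x^2) sin(s x)] has integral zero. This expresses the [s]-derivative of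
    [Phi] through [Phi] itself, as [Phi' = - (s / 2) Phi]. *)
Let PhiE (s : R) : \int[mu]_x (x * expR (- (x ^+ 2)) * sin (s * x)) = s / 2 * Phi s.
Proof.
have i1 := integrableZl measurableT (-2) (integrable_df s).
have i2 := integrableZl measurableT s (integrable_f s).
have : \int[mu]_x (- (2 * (x * expR (- (x ^+ 2)) * sin (s * x))) + s * f s x) = 0.
  have c0 : expR (- ((n%:R : R) ^+ 2)) @[n --> \oo] --> 0.
    by have := @cvg_expRN_sqr R 1 ltr01; under eq_fun do rewrite mul1r.
  have c1 (v : nat -> R) : (forall n, `|v n| <= expR (- ((n%:R : R) ^+ 2))) -> v @ \oo --> 0.
    move=> hv; apply/norm_cvg0P; apply: (squeeze_cvgr _ (cvg_cst 0) c0).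
    by apply: nearW => n; rewrite normr_ge0 hv.
  apply: (integral_derivative0 (is_derive_H s)).
  - move=> x; apply: differentiable_continuous; apply/derivable1_diffP.
    exact: ex_derive.
  - have := integrableD measurableT i1 i2; apply: eq_integrable => // x _ /=.
    by rewrite -!EFinM -EFinD mulNr.
  - apply: c1 => n; rewrite normrM ger0_norm ?expR_ge0// ler_piMr ?expR_ge0//.
    by rewrite ler_norml sin_geN1 sin_le1.
  - apply: c1 => n; rewrite normrM ger0_norm ?expR_ge0// sqrrN ler_piMr ?expR_ge0//.
    by rewrite ler_norml sin_geN1 sin_le1.
under eq_Rintegral do rewrite -mulNr.
rewrite RintegralD// RintegralZl// RintegralZl// => h.
apply: (@mulfI _ 2) => //; move/eqP: h; rewrite addrC mulNr subr_eq0 => /eqP <-.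
by rewrite mulrA mulrCA divff// mulr1.
Qed.

Let is_derive_Phi (s : R) : is_derive s (1 : R) Phi (- (s / 2 * Phi s)).
Proof.
have ss : `]s - 1, s + 1[%classic s by rewrite /= in_itv/= ltrBlDr ltrDl ltr01.
have intG := @integrable_norm_gauss 1 ltr01.
have dom (y x : R) : `|partial1of2 f y x| <= `|x| * expR (- (1 * x ^+ 2)).
  rewrite /partial1of2 derive1E; have [_ ->] := is_derive_f y x.
  rewrite normrN !normrM mul1r (ger0_norm (expR_ge0 _)) ler_piMr ?mulr_ge0 ?expR_ge0//.
  by rewrite ler_norml sin_geN1 sin_le1.
have G0 (x : R) : 0 <= `|x| * expR (- (1 * x ^+ 2)) by rewrite mulr_ge0 ?expR_ge0.
have df (y x : R) : derivable (f^~ x) y 1 by have [] := is_derive_f y x.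
have D : derivable Phi s 1.
  exact: (@derivable_under_integral _ _ _ mu f setT measurableT s _ _ ss
    (fun x _ => integrable_f x) (fun x y _ _ => df x y) _ G0 intG (fun x y _ _ => dom x y)).
apply: DeriveDef => //; rewrite -derive1E.
rewrite (@differentiation_under_integral _ _ _ mu f setT measurableT s _ _ ss
  (fun x _ => integrable_f x) (fun x y _ _ => df x y) _ G0 intG (fun x y _ _ => dom x y)).
rewrite -PhiE -mulN1r -RintegralZl//; apply: eq_Rintegral => x _.
by rewrite /partial1of2 derive1E; have [_ ->] := is_derive_f s x; rewrite mulN1r.
Qed.

Lemma cos_transform_gauss (s : R) :
  \int[mu]_x (expR (- (x ^+ 2)) * cos (s * x)) = Num.sqrt pi * expR (- (s ^+ 2 / 4)).
Proof.
(* [exp(t^2 / 4)] is the integrating factor of [Phi' = - (t / 2) Phi]; the product is constant and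
   its value at 0 is the Gaussian integral. *)
have dW (t : R) : is_derive t (1 : R) (fun t => Phi t * expR (t ^+ 2 / 4)) 0.
  have dP := is_derive_Phi t; apply: is_derive_eq.
  by rewrite /GRing.scale /=; field.
have W t : Phi t * expR (t ^+ 2 / 4) = Phi 0 * expR (0 ^+ 2 / 4).
  exact: (@is_derive_0_is_cst _ (fun t => Phi t * expR (t ^+ 2 / 4)) t 0 dW).
have P0 : Phi 0 = Num.sqrt pi.
  rewrite /Phi /Rintegral /f.
  under eq_integral do rewrite mul0r cos0 mulr1.
  by rewrite integralT_gauss.
have := W s; rewrite P0 expr0n/= mul0r expR0 mulr1 => <-.
by rewrite -mulrA -expRD subrr expR0 mulr1.
Qed.

Lemma sin_transform_gauss (s : R) :
  \int[mu]_x (expR (- (x ^+ 2)) * sin (s * x)) = 0.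
Proof.
pose g (x : R) := expR (- (x ^+ 2)) * sin (s * x).
have mg : measurable_fun [set: R] (EFin \o g).
  apply/measurable_EFinP; apply: continuous_measurable_fun => x.
  by apply: differentiable_continuous; apply/derivable1_diffP; exact: ex_derive.
have gN x : g (- x) = - g x by rewrite /g sqrrN mulrN sinN mulrN.
have : \int[mu]_x g x = - \int[mu]_x g x.
  rewrite {1}/Rintegral -(integral_opp mg) -mulN1r -RintegralZl//.
    by apply: eq_Rintegral => x _; rewrite gN mulN1r.
  apply: (le_integrable measurableT _ _ integrable_expRsq); first exact: mg.
  move=> x _; rewrite lee_fin normrM ger0_norm ?expR_ge0// ler_piMr ?expR_ge0//.
  by rewrite ler_norml sin_geN1 sin_le1.
by move/eqP; rewrite -addr_eq0 -mulr2n mulrn_eq0/= => /eqP.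
Qed.

End gaussian_fourier.

Section gaussian_kernel.
Context {R : realType}.
Local Notation mu := (@lebesgue_measure R).

Lemma Rintegral_affine (a b : R) (f : R -> R) : 0 < a ->
  mu.-integrable [set: R] (EFin \o f) ->
  \int[mu]_x f x = a * \int[mu]_x f (a * x + b).
Proof.
move=> a0 intf; have mf := measurable_int mu intf.
have Ip := integrable_funepos measurableT intf.
have In := integrable_funeneg measurableT intf.
have ep := ge0_integral_affine b a0 (measurable_funepos mf) (funepos_ge0 _).
have en := ge0_integral_affine b a0 (measurable_funeneg mf) (funeneg_ge0 _).
have fin_scale (y : \bar R) : (a%:E * y)%E \is a fin_num -> y \is a fin_num.
  case: y => [r //||] /=; first by rewrite gt0_muley ?lte_fin.
  by rewrite gt0_muleNy ?lte_fin.
have := integrable_fin_num measurableT Ip; rewrite ep => /fin_scale fp.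
have := integrable_fin_num measurableT In; rewrite en => /fin_scale fn.
rewrite [LHS]/Rintegral integralE ep en -(fineK fp) -(fineK fn) -!EFinM -EFinD/=.
rewrite -mulrBr; congr (_ * _); rewrite [RHS]/Rintegral [in RHS]integralE.
have -> : (\int[mu]_x (fun x => (f (a * x + b))%:E)^\+ x =
  \int[mu]_x (EFin \o f)^\+ (a * x + b)%R)%E.
  apply: eq_integral => x _.
  exact: (congr1 (fun h => h x) (funepos_comp (EFin \o f) (fun x : R => a * x + b))).
have -> : (\int[mu]_x (fun x => (f (a * x + b))%:E)^\- x =
  \int[mu]_x (EFin \o f)^\- (a * x + b)%R)%E.
  apply: eq_integral => x _.
  exact: (congr1 (fun h => h x) (funeneg_comp (EFin \o f) (fun x : R => a * x + b))).
by rewrite -{2}(fineK fp) -{2}(fineK fn) -EFinB.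
Qed.

Lemma integral_gauss0 (a : R) : 0 < a ->
  (\int[mu]_x (expR (- (a * x ^+ 2)))%:E)%E = (Num.sqrt (pi / a))%:E.
Proof. by move=> /(integral_gauss 0) <-; apply: eq_integral => x _; rewrite subr0. Qed.

(** The Fourier transform of [exp(-a x^2)]. It is positive and has mass [2 pi] for every [a > 0], so
    for small [a] it is also an approximate identity of width about [sqrt a]; both roles are used
    throughout. *)
Definition gaussK (a s : R) : R := Num.sqrt (pi / a) * expR (- (s ^+ 2 / (4 * a))).

Lemma gaussK_ge0 (a s : R) : 0 <= gaussK a s.
Proof. by rewrite mulr_ge0 ?sqrtr_ge0 ?expR_ge0. Qed.

Lemma gaussKN (a s : R) : gaussK a (- s) = gaussK a s.
Proof. by rewrite /gaussK sqrrN. Qed.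

Lemma gaussK_gauss (a s : R) : gaussK a s =
  Num.sqrt (pi / a) * expR (- ((4 * a)^-1 * s ^+ 2)).
Proof. by rewrite /gaussK [_ / (4 * a)]mulrC. Qed.

Lemma measurable_gaussK (a : R) : measurable_fun [set: R] (gaussK a).
Proof.
rewrite (funext (gaussK_gauss a)).
by apply: measurable_funM => //; exact: measurable_gauss.
Qed.

Lemma integral_gaussK (a : R) : 0 < a ->
  (\int[mu]_s (gaussK a s)%:E = (2 * pi)%:E)%E.
Proof.
move=> a0; under eq_integral do rewrite gaussK_gauss EFinM.
have a40 : 0 < (4 * a)^-1 by rewrite invr_gt0 mulr_gt0.
rewrite ge0_integralZl//; last by apply/measurable_EFinP; exact: measurable_gauss.
rewrite integral_gauss0//; rewrite -EFinM invrK -sqrtrM ?divr_ge0 ?pi_ge0 ?(ltW a0)//.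
congr EFin; rewrite [X in Num.sqrt X](_ : _ = (2 * pi) ^+ 2).
  by rewrite sqrtr_sqr ger0_norm// mulr_ge0 ?pi_ge0.
by field; rewrite gt_eqF.
Qed.

Lemma cintegrable_gauss_expi (a b s : R) : 0 < a ->
  cintegrable mu (fun x => expi (x * s) * ((expR (- (a * (x - b) ^+ 2)))%:C)%C).
Proof.
move=> a0; have h := integrable_gauss b a0.
apply: (cintegrable_le _ h) => [|x].
  apply: cmeasurableM; last first.
    by apply: cmeasurable_real; have /measurable_EFinP := measurable_int mu h.
  by apply: cmeasurable_expi; exact: measurable_funM.
by rewrite Normc.normcM normc_expi mul1r normc_real ger0_norm ?expR_ge0.
Qed.

Lemma fourier_gauss (a s : R) : 0 < a ->
  cint mu (fun x => expi (x * s) * ((expR (- (a * x ^+ 2)))%:C)%C) =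
  ((gaussK a s)%:C)%C.
Proof.
move=> a0; have sa : 0 < Num.sqrt a by rewrite sqrtr_gt0.
pose r := Num.sqrt a.
have r0 : r != 0 by rewrite gt_eqF.
have ra : r ^+ 2 = a by rewrite sqr_sqrtr ?(ltW a0).
have i1 := @cintegrable_gauss_expi 1 0 (s / r) ltr01.
have E2 (x : R) : expi (x * s) * ((expR (- (a * x ^+ 2)))%:C)%C =
    (fun y => expi (y * (s / r)) * ((expR (- (1 * (y - 0) ^+ 2)))%:C)%C) (r * x + 0).
  have -> : a * x ^+ 2 = 1 * (r * x + 0 - 0) ^+ 2 by rewrite -ra; ring.
  by have -> : x * s = (r * x + 0) * (s / r) by field.
rewrite (@eq_cint _ _ _ mu _ _ E2); case: i1 => i1r i1i.
apply: cplx_eq.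
  rewrite Re_cint; apply: (mulfI r0).
  rewrite -(Rintegral_affine 0 sa i1r)/=.
  transitivity (\int[mu]_x (expR (- x ^+ 2) * cos (s / r * x))).
    by apply: eq_Rintegral => x _; rewrite !mulr0 !subr0 mul1r mulrC [x * _]mulrC.
  rewrite cos_transform_gauss /gaussK mulrA -sqrtrM ?(ltW a0)// mulrC.
  rewrite [a * _]mulrC divfK ?gt_eqF// mulrC; congr (_ * expR (- _)).
  by rewrite exprMn exprVn ra; field; rewrite gt_eqF.
rewrite Im_cint; apply: (mulfI r0).
rewrite -(Rintegral_affine 0 sa i1i)/=.
transitivity (\int[mu]_x (expR (- x ^+ 2) * sin (s / r * x))).
  by apply: eq_Rintegral => x _; rewrite mulr0 add0r !subr0 mul1r mulrC [x * _]mulrC.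
by rewrite sin_transform_gauss mulr0.
Qed.

End gaussian_kernel.

Section parametric_measurability.
Context d1 d2 (T1 : measurableType d1) (T2 : measurableType d2) (R : realType).
Variable m2 : {sigma_finite_measure set T2 -> \bar R}.

Lemma measurable_Rintegral_param (f : T1 * T2 -> R) : measurable_fun [set: T1 * T2] f ->
  measurable_fun [set: T1] (fun x => \int[m2]_y f (x, y)).
Proof.
move=> mf; apply: (measurableT_comp (fine_measurable measurableT)).
have mE : measurable_fun [set: T1 * T2] (EFin \o f) by exact/measurable_EFinP.
rewrite (_ : (fun x => \int[m2]_y (f (x, y))%:E)%E =
  (fun x => \int[m2]_y (EFin \o f)^\+ (x, y) - \int[m2]_y (EFin \o f)^\- (x, y))%E).
  apply: emeasurable_funB.
    exact: (measurable_fun_fubini_tonelli_F _ (measurable_funepos mE) (funepos_ge0 _)).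
  exact: (measurable_fun_fubini_tonelli_F _ (measurable_funeneg mE) (funeneg_ge0 _)).
apply/funext => x; rewrite integralE; congr (_ - _)%E; apply: eq_integral => y _.
  exact: (congr1 (fun h => h y) (funepos_comp (EFin \o f) (fun y => (x, y)))).
exact: (congr1 (fun h => h y) (funeneg_comp (EFin \o f) (fun y => (x, y)))).
Qed.

Lemma cmeasurable_cint (f : T1 * T2 -> R[i]) : cmeasurable f ->
  cmeasurable (fun x => cint m2 (fun y => f (x, y))).
Proof.
by move=> [fr fi]; split; [exact: (measurable_Rintegral_param fr)|exact: (measurable_Rintegral_param fi)].
Qed.

End parametric_measurability.

Section fatou_bound.
Context d (T : measurableType d) (R : realType) (m : {measure set T -> \bar R}).
Local Open Scope ereal_scope.

Lemma limn_einf_bound (u : nat -> \bar R) (B : \bar R) :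
  (forall n, u n <= B) -> limn_einf u <= B.
Proof.
move=> uB; rewrite limn_einf_lim; apply: lime_le; first exact: is_cvg_einfs.
apply: nearW => n; apply: le_trans (uB n); apply: ereal_inf_lbound.
by exists n => /=.
Qed.

Lemma fatou_bound (f_ : nat -> T -> R) (f : T -> R) (B : \bar R) :
  (forall n, measurable_fun [set: T] (f_ n)) -> (forall n x, (0 <= f_ n x)%R) ->
  (forall x, f_ n x @[n --> \oo] --> f x) ->
  (forall n, \int[m]_x (f_ n x)%:E <= B) -> \int[m]_x (f x)%:E <= B.
Proof.
move=> mf f0 cf fB.
have := @fatou _ _ _ m setT measurableT (fun n x => (f_ n x)%:E)
  (fun n => (measurable_EFinP _ _).2 (mf n)) (fun n x _ => f0 n x).
move=> h; apply: le_trans (le_trans h _); last exact: limn_einf_bound.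
rewrite (_ : \int[m]_x (f x)%:E = \int[m]_x limn_einf ((fun n x => (f_ n x)%:E)^~ x))//.
apply: eq_integral => x _; apply/esym.
have cE : (f_ n x)%:E @[n --> \oo] --> (f x)%:E.
  by apply: cvg_EFin; [exact: nearW|exact: cf].
by have [-> _] := cvg_limn_einf_sup cE.
Qed.

End fatou_bound.

(** * Plancherel-type inequalities *)

Section complex_morphisms.
Context {R : realType}.

Lemma real_complexM (r s : R) : ((r * s)%:C)%C = (r%:C)%C * (s%:C)%C.
Proof. exact: rmorphM. Qed.

Lemma conjcM (z w : R[i]) : ((z * w)^*)%C = (z^*)%C * (w^*)%C.
Proof. exact: rmorphM. Qed.

End complex_morphisms.

Section gaussian_plane.
Context {R : realType}.
Local Notation mu := (@lebesgue_measure R).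
Local Notation P := (prodm mu mu).

Definition gauss2 (eps : R) (z : R * R) : R :=
  expR (- (eps * z.1 ^+ 2)) * expR (- (eps * z.2 ^+ 2)).

Lemma gauss2_ge0 eps z : 0 <= gauss2 eps z.
Proof. by rewrite mulr_ge0 ?expR_ge0. Qed.

Lemma measurable_gauss2 eps : measurable_fun [set: R * R] (gauss2 eps).
Proof.
apply: measurable_funM; apply: (measurableT_comp (measurable_gauss eps)).
  exact: measurable_fst.
exact: measurable_snd.
Qed.

Lemma cintegrable_gauss_expi0 (a s : R) : 0 < a ->
  cintegrable mu (fun x => expi (x * s) * ((expR (- (a * x ^+ 2)))%:C)%C).
Proof.
by move=> /(cintegrable_gauss_expi 0 s); under eq_fun do rewrite subr0.
Qed.

Let split_gauss2 eps s1 s2 : (fun z : R * R =>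
    (expi (z.1 * s1) * expi (z.2 * s2)) * ((gauss2 eps z)%:C)%C) =
  (fun z => (expi (z.1 * s1) * ((expR (- (eps * z.1 ^+ 2)))%:C)%C) *
    (expi (z.2 * s2) * ((expR (- (eps * z.2 ^+ 2)))%:C)%C)).
Proof. by apply/funext => z; rewrite /gauss2 real_complexM mulrACA. Qed.

Lemma cintegrable_gauss2_expi (eps s1 s2 : R) : 0 < eps ->
  cintegrable P (fun z => (expi (z.1 * s1) * expi (z.2 * s2)) * ((gauss2 eps z)%:C)%C).
Proof.
move=> e0; rewrite split_gauss2.
exact: (cintegrable_prod (cintegrable_gauss_expi0 s1 e0) (cintegrable_gauss_expi0 s2 e0)).
Qed.

Lemma cintegrable_gauss2 (eps : R) : 0 < eps ->
  cintegrable P (fun z => ((gauss2 eps z)%:C)%C).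
Proof.
move=> /(cintegrable_gauss2_expi 0 0).
by under eq_fun do rewrite !mulr0 expi0 !mul1r.
Qed.

Lemma fourier_gauss2 (eps s1 s2 : R) : 0 < eps ->
  cint P (fun z => (expi (z.1 * s1) * expi (z.2 * s2)) * ((gauss2 eps z)%:C)%C) =
  ((gaussK eps s1 * gaussK eps s2)%:C)%C.
Proof.
move=> e0; rewrite split_gauss2.
rewrite (cint_prod (cintegrable_gauss_expi0 s1 e0) (cintegrable_gauss_expi0 s2 e0)).
by rewrite real_complexM; congr (_ * _); exact: fourier_gauss.
Qed.

End gaussian_plane.

(** * Oscillatory integrals and the Schur test *)

Section schur_plancherel.
Context d (X : measurableType d) (R : realType).
Variable m : {sigma_finite_measure set X -> \bar R}.
Local Notation mu := (@lebesgue_measure R).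
Local Notation P := (prodm mu mu).

Definition osc (p1 p2 : X -> R) (t x : R) (y : X) : R[i] :=
  expi (t * p1 y + x * p2 y).

(** The Fourier transform, at [(t, x)], of the image under [(p1, p2)] of the measure [m] with
    density [a]. One notion covers the planar Fourier transform, the free evolution of a profile and
    its tensor powers. *)
Definition osc_int (p1 p2 : X -> R) (a : X -> R[i]) (t x : R) : R[i] :=
  cint m (fun y => osc p1 p2 t x y * a y).

Variables (p1 p2 : X -> R).
Hypotheses (mp1 : measurable_fun [set: X] p1) (mp2 : measurable_fun [set: X] p2).

Lemma cmeasurable_osc2 :
  cmeasurable (fun z : (R * R) * X => osc p1 p2 z.1.1 z.1.2 z.2).
Proof.
apply: cmeasurable_expi; apply: measurable_funD; apply: measurable_funM.
- by apply: measurableT_comp.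
- by apply: measurableT_comp.
- by apply: measurableT_comp.
- by apply: measurableT_comp.
Qed.

Lemma normc_osc t x y : Normc.normc (osc p1 p2 t x y) = 1.
Proof. exact: normc_expi. Qed.

Lemma cmeasurable_osc t x : cmeasurable (osc p1 p2 t x).
Proof. by apply: cmeasurable_expi; apply: measurable_funD; apply: measurable_funM. Qed.

Lemma cintegrable_osc (a : X -> R[i]) t x : cintegrable m a ->
  cintegrable m (fun y => osc p1 p2 t x y * a y).
Proof.
move=> Ia; apply: (cintegrable_le _ (integrable_normc Ia)) => [|y].
  apply: cmeasurableM; [exact: cmeasurable_osc|exact: cintegrable_measurable Ia].
by rewrite Normc.normcM normc_osc mul1r.
Qed.

Lemma cmeasurable_osc_int (a : X -> R[i]) : cmeasurable a ->
  cmeasurable (fun z : R * R => osc_int p1 p2 a z.1 z.2).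
Proof.
move=> ma; apply: (@cmeasurable_cint _ _ _ _ _ m (fun w => osc p1 p2 w.1.1 w.1.2 w.2 * a w.2)).
apply: cmeasurableM; first exact: cmeasurable_osc2.
exact: (cmeasurable_comp _ ma).
Qed.

Lemma normc_osc_int (a : X -> R[i]) t x : cintegrable m a ->
  Normc.normc (osc_int p1 p2 a t x) <= \int[m]_y Normc.normc (a y).
Proof.
move=> Ia; apply: (le_trans (le_normc_cint (cintegrable_osc t x Ia))).
apply: le_Rintegral => //.
- exact: (integrable_normc (cintegrable_osc t x Ia)).
- exact: (integrable_normc Ia).
- by move=> y _; rewrite Normc.normcM normc_osc mul1r.
Qed.

End schur_plancherel.

Section regularized_inner.
Context d (X : measurableType d) d' (Y : measurableType d') (R : realType).
Variables (m : {sigma_finite_measure set X -> \bar R}) (m' : {sigma_finite_measure set Y -> \bar R}).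
Local Notation mu := (@lebesgue_measure R).
Local Notation P := (prodm mu mu).

Variables (p1 p2 : X -> R) (q1 q2 : Y -> R).
Hypotheses (mp1 : measurable_fun [set: X] p1) (mp2 : measurable_fun [set: X] p2).
Hypotheses (mq1 : measurable_fun [set: Y] q1) (mq2 : measurable_fun [set: Y] q2).

Let oscJ t x y y' : osc p1 p2 t x y * (osc q1 q2 t x y')^*%C =
  expi (t * (p1 y - q1 y')) * expi (x * (p2 y - q2 y')).
Proof.
by rewrite /osc conj_expi -!expiD; congr expi; ring.
Qed.

(** The Gaussian cut-off makes the integrand absolutely integrable in all variables. By Fubini the
    [(t, x)] integral may be done first, and it produces the Gaussian kernel in the phase
    differences. Two different measure spaces are allowed because the Parseval pairing compares an
    image measure with a function on the plane. *)
Lemma regularized_inner (a : X -> R[i]) (b : Y -> R[i]) (eps : R) :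
  cintegrable m a -> cintegrable m' b -> 0 < eps ->
  cintegrable P (fun z => ((gauss2 eps z)%:C)%C *
     (osc_int m p1 p2 a z.1 z.2 * (osc_int m' q1 q2 b z.1 z.2)^*%C)) /\
  cintegrable (prodm m m') (fun w => a w.1 * (b w.2)^*%C *
     ((gaussK eps (p1 w.1 - q1 w.2) * gaussK eps (p2 w.1 - q2 w.2))%:C)%C) /\
  cint P (fun z => ((gauss2 eps z)%:C)%C *
     (osc_int m p1 p2 a z.1 z.2 * (osc_int m' q1 q2 b z.1 z.2)^*%C)) =
  cint (prodm m m') (fun w => a w.1 * (b w.2)^*%C *
     ((gaussK eps (p1 w.1 - q1 w.2) * gaussK eps (p2 w.1 - q2 w.2))%:C)%C).
Proof.
move=> Ia Ib e0.
have ma := cintegrable_measurable Ia.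
have mb := cintegrable_measurable Ib.
have Ibj := cintegrable_conj Ib.
pose Phi (zw : (R * R) * (X * Y)) : R[i] :=
  ((gauss2 eps zw.1)%:C)%C * ((osc p1 p2 zw.1.1 zw.1.2 zw.2.1 * a zw.2.1) *
    (osc q1 q2 zw.1.1 zw.1.2 zw.2.2 * b zw.2.2)^*%C).
have Iab := cintegrable_prod Ia Ibj.
have IPhi : cintegrable (prodm P (prodm m m')) Phi.
  have I0 := cintegrable_prod (cintegrable_gauss2 e0) Iab.
  apply: (cintegrable_le _ (integrable_normc I0)) => [|zw]; last first.
    by rewrite /Phi !Normc.normcM !normc_conj !Normc.normcM !normc_osc !mul1r.
  have mg := cintegrable_measurable (cintegrable_gauss2 e0).
  have m1 := cmeasurable_osc2 mp1 mp2.
  have m2 := cmeasurable_osc2 mq1 mq2.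
  have mf1 : measurable_fun [set: (R * R) * (X * Y)] (fun zw => (zw.1, zw.2.1)).
    by apply: measurable_fun_pair => //; apply: measurableT_comp.
  have mf2 : measurable_fun [set: (R * R) * (X * Y)] (fun zw => (zw.1, zw.2.2)).
    by apply: measurable_fun_pair => //; apply: measurableT_comp.
  apply: cmeasurableM; first exact: (cmeasurable_comp _ mg).
  apply: cmeasurableM.
    apply: cmeasurableM; first exact: (cmeasurable_comp mf1 m1).
    by apply: (cmeasurable_comp _ ma); apply: measurableT_comp.
  apply: cmeasurable_conj.
  apply: cmeasurableM; first exact: (cmeasurable_comp mf2 m2).
  by apply: (cmeasurable_comp _ mb); apply: measurableT_comp.
have inner1 z : cint (prodm m m') (fun w => Phi (z, w)) =
    ((gauss2 eps z)%:C)%C * (osc_int m p1 p2 a z.1 z.2 * (osc_int m' q1 q2 b z.1 z.2)^*%C).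
  have Ioa := cintegrable_osc mp1 mp2 z.1 z.2 Ia.
  have Iob := cintegrable_osc mq1 mq2 z.1 z.2 Ib.
  rewrite /Phi /= cintZ; last exact: (cintegrable_prod Ioa (cintegrable_conj Iob)).
  by rewrite (cint_prod Ioa (cintegrable_conj Iob)) cint_conj.
have inner2 w : cint P (fun z => Phi (z, w)) =
    a w.1 * (b w.2)^*%C * ((gaussK eps (p1 w.1 - q1 w.2) * gaussK eps (p2 w.1 - q2 w.2))%:C)%C.
  rewrite -fourier_gauss2// -cintZ; last exact: cintegrable_gauss2_expi.
  congr cint; apply/funext => z; rewrite /Phi/= conjcM.
  rewrite [X in _ * X](_ : _ = a w.1 * (b w.2)^*%C * (osc p1 p2 z.1 z.2 w.1 * (osc q1 q2 z.1 z.2 w.2)^*%C)); last by ring.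
  by rewrite oscJ [LHS]mulrC -[LHS]mulrA.
split; first by have := cintegrable_cint1 IPhi; congr cintegrable; apply/funext => z; rewrite inner1.
split; first by have := cintegrable_cint2 IPhi; congr cintegrable; apply/funext => w; rewrite inner2.
transitivity (cint P (fun z => cint (prodm m m') (fun w => Phi (z, w)))).
  by congr cint; apply/funext => z; rewrite inner1.
by rewrite (cfubini IPhi); congr cint; apply/funext => w; rewrite inner2.
Qed.

End regularized_inner.

Section regularized_square.
Context d (X : measurableType d) (R : realType).
Variables (m : {sigma_finite_measure set X -> \bar R}).
Local Notation mu := (@lebesgue_measure R).
Local Notation P := (prodm mu mu).

Variables (p1 p2 : X -> R).
Hypotheses (mp1 : measurable_fun [set: X] p1) (mp2 : measurable_fun [set: X] p2).

(** In the diagonal case the left side is its own modulus, so absolute values can be put inside the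
    right side; the kernel is already positive. *)
Lemma regularized_square (a : X -> R[i]) (eps : R) : cintegrable m a -> 0 < eps ->
  (\int[P]_z (gauss2 eps z * Normc.normc (osc_int m p1 p2 a z.1 z.2) ^+ 2)%:E <=
   \int[prodm m m]_w (Normc.normc (a w.1) * Normc.normc (a w.2) *
     (gaussK eps (p1 w.1 - p1 w.2) * gaussK eps (p2 w.1 - p2 w.2)))%:E)%E.
Proof.
move=> Ia e0.
have [I1 [I2 e12]] := regularized_inner mp1 mp2 mp1 mp2 Ia Ia e0.
pose h z := gauss2 eps z * Normc.normc (osc_int m p1 p2 a z.1 z.2) ^+ 2.
have h0 z : 0 <= h z by rewrite mulr_ge0 ?gauss2_ge0 ?sqr_ge0.
have hE : (fun z => ((gauss2 eps z)%:C)%C *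
     (osc_int m p1 p2 a z.1 z.2 * (osc_int m p1 p2 a z.1 z.2)^*%C)) = (fun z => ((h z)%:C)%C).
  by apply/funext => z; rewrite mulc_conj -real_complexM.
rewrite hE cint_real in I1 e12.
have nh : Normc.normc (((\int[P]_z h z)%:C)%C) = \int[P]_z h z.
  by rewrite normc_real ger0_norm//; apply: Rintegral_ge0 => z _.
have -> : (\int[P]_z (h z)%:E = (\int[P]_z h z)%:E)%E.
  rewrite fineK//; have [Ih _] := I1; exact: (integrable_fin_num measurableT Ih).
rewrite -nh e12; apply: (le_trans (le_normc_cinte I2)).
rewrite le_eqVlt; apply/orP; left; apply/eqP; apply: eq_integral => w _.
rewrite !Normc.normcM normc_conj normc_real ger0_norm//.
by rewrite mulr_ge0 ?gaussK_ge0.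
Qed.

End regularized_square.

Section schur_bound.
Context d (X : measurableType d) (R : realType).
Variable m : {sigma_finite_measure set X -> \bar R}.
Local Notation mu := (@lebesgue_measure R).
Local Notation P := (prodm mu mu).

(** This is [2 a b <= a^2 w / v + b^2 v / w]. Division by 0 returns 0, so where a weight vanishes
    the corresponding number has to vanish as well. *)
Lemma schur_amgm (a b v w : R) : 0 <= a -> 0 <= b -> 0 <= v -> 0 <= w ->
  (v = 0 -> a = 0) -> (w = 0 -> b = 0) ->
  a * b <= 2^-1 * (a ^+ 2 / v * w) + 2^-1 * (b ^+ 2 / w * v).
Proof.
move=> a0 b0 v0 w0 va wb.
have r0 : 0 <= 2^-1 * (a ^+ 2 / v * w) + 2^-1 * (b ^+ 2 / w * v).
  by rewrite addr_ge0// !mulr_ge0 ?invr_ge0 ?sqr_ge0.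
have [/va az|vn] := eqVneq v 0; first by rewrite (le_trans _ r0)// az mul0r.
have [/wb bz|wn] := eqVneq w 0; first by rewrite (le_trans _ r0)// bz mulr0.
have vp : 0 < v by rewrite lt_neqAle eq_sym vn.
have wp : 0 < w by rewrite lt_neqAle eq_sym wn.
rewrite -subr_ge0.
have -> : 2^-1 * (a ^+ 2 / v * w) + 2^-1 * (b ^+ 2 / w * v) - a * b =
    (a * w - b * v) ^+ 2 / (2 * v * w) by field; rewrite vn wn.
by rewrite divr_ge0 ?sqr_ge0// !mulr_ge0.
Qed.

Lemma cvg_gauss_cutoff (x : R) : expR (- (n.+1%:R^-1 * x ^+ 2)) @[n --> \oo] --> (1 : R).
Proof.
have h : - (n.+1%:R^-1 * x ^+ 2) @[n --> \oo] --> (0 : R).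
  rewrite -[X in _ --> X]oppr0; apply: cvgN; rewrite -(mul0r (x ^+ 2)).
  by apply: cvgM; [exact: cvg_harmonic|exact: cvg_cst].
by have := cvg_comp _ _ h (@continuous_expR R 0); rewrite expR0.
Qed.

Lemma cvg_gauss2 (z : R * R) : gauss2 n.+1%:R^-1 z @[n --> \oo] --> (1 : R).
Proof. by rewrite -[X in _ --> X]mul1r; apply: cvgM; exact: cvg_gauss_cutoff. Qed.

Variables (p1 p2 : X -> R).
Hypotheses (mp1 : measurable_fun [set: X] p1) (mp2 : measurable_fun [set: X] p2).

(* Schur test with weight [w] for the positive kernel produced by a Gaussian
   cut-off; letting the cut-off disappear gives the Plancherel-type bound. *)
Lemma schur_plancherel (a : X -> R[i]) (w : X -> R) (S : R) :
  0 <= S -> cintegrable m a -> measurable_fun [set: X] w -> (forall y, 0 <= w y) ->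
  (forall y, w y = 0 -> a y = 0) ->
  (forall eps y, 0 < eps -> (\int[m]_y' (w y' *
    (gaussK eps (p1 y' - p1 y) * gaussK eps (p2 y' - p2 y)))%:E <= S%:E)%E) ->
  (\int[P]_z (Normc.normc (osc_int m p1 p2 a z.1 z.2) ^+ 2)%:E <=
   S%:E * \int[m]_y (Normc.normc (a y) ^+ 2 / w y)%:E)%E.
Proof.
move=> S0 Ia mw w0 wa hS.
have ma := cintegrable_measurable Ia.
have mV := cmeasurable_osc_int m mp1 mp2 ma.
have mna := cmeasurable_normc ma.
have mq : measurable_fun [set: X] (fun y => Normc.normc (a y) ^+ 2 / w y).
  apply: measurable_funM; first exact: measurable_funX.
  rewrite (_ : (fun y => (w y)^-1) = (fun y => w y `^ (-1))).
    by apply: (measurableT_comp (measurable_powR _) mw).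
  by apply/funext => y; rewrite powR_inv1.
have q0 y : 0 <= Normc.normc (a y) ^+ 2 / w y by rewrite divr_ge0 ?sqr_ge0.
apply: (@fatou_bound _ _ _ P (fun n z => gauss2 n.+1%:R^-1 z *
  Normc.normc (osc_int m p1 p2 a z.1 z.2) ^+ 2)
  (fun z => Normc.normc (osc_int m p1 p2 a z.1 z.2) ^+ 2)).
- move=> n; apply: measurable_funM; first exact: measurable_gauss2.
  by apply: measurable_funX; exact: cmeasurable_normc.
- by move=> n z; rewrite mulr_ge0 ?gauss2_ge0 ?sqr_ge0.
- move=> z; rewrite -[X in _ --> X]mul1r; apply: cvgM; last exact: cvg_cst.
  exact: cvg_gauss2.
move=> n; set eps := n.+1%:R^-1.
have e0 : 0 < eps by rewrite invr_gt0.
apply: (le_trans (regularized_square mp1 mp2 Ia e0)).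
pose K (y y' : X) := gaussK eps (p1 y' - p1 y) * gaussK eps (p2 y' - p2 y).
have K0 y y' : 0 <= K y y' by rewrite mulr_ge0 ?gaussK_ge0.
have KC y y' : K y y' = K y' y.
  by rewrite /K -[in LHS](opprB (p1 y)) -[in LHS](opprB (p2 y)) !gaussKN.
have mK : measurable_fun [set: X * X] (fun z => K z.1 z.2).
  by apply: measurable_funM; apply: (measurableT_comp (measurable_gaussK eps));
    apply: measurable_funB; apply: measurableT_comp.
(* By [schur_amgm] the kernel integrand is at most half of [F] plus half of its transpose.
   Integrating first in the variable that carries only [w] and the kernel, the hypothesis bounds
   either half by [S]. *)
pose F (z : X * X) := Normc.normc (a z.1) ^+ 2 / w z.1 * (w z.2 * K z.1 z.2).
have F0 z : 0 <= F z by apply: mulr_ge0 => //; exact: mulr_ge0.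
have mF : measurable_fun [set: X * X] F.
  apply: measurable_funM; first by apply: (measurableT_comp mq).
  by apply: measurable_funM => //; apply: (measurableT_comp mw).
have mF' : measurable_fun [set: X * X] (fun z : X * X => F (z.2, z.1)).
  by apply: (measurableT_comp mF); apply: measurable_swap.
have FS : (\int[prodm m m]_z (F z)%:E <= S%:E * \int[m]_y (Normc.normc (a y) ^+ 2 / w y)%:E)%E.
  rewrite tonelli1//=; last by apply/measurable_EFinP.
  rewrite muleC -ge0_integralZr//; last 2 first.
  - exact/measurable_EFinP.
  - by move=> y _; rewrite lee_fin.
  apply: ge0_le_integral => //.
  - by move=> y _; apply: integral_ge0 => y' _; rewrite lee_fin.
  - by apply: (measurable_fun_fubini_tonelli_F (EFin \o F)) => //; apply/measurable_EFinP.
  - by apply: emeasurable_funM => //; apply/measurable_EFinP.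
  - move=> y _; rewrite /F /=; under eq_integral do rewrite EFinM.
    rewrite ge0_integralZl//.
    + by apply: lee_wpmul2l; rewrite ?lee_fin//; exact: hS.
    + apply/measurable_EFinP; apply: measurable_funM => //.
      exact: (measurableT_comp mK (pair1_measurable y)).
    + by move=> y' _; rewrite lee_fin mulr_ge0.
    + by rewrite lee_fin.
have FS' : (\int[prodm m m]_z (F (z.2, z.1))%:E <= S%:E * \int[m]_y (Normc.normc (a y) ^+ 2 / w y)%:E)%E.
  rewrite tonelli2//=; last 2 first.
  - exact/measurable_EFinP.
  - by move=> z; rewrite lee_fin.
  have := FS; rewrite tonelli1//; exact/measurable_EFinP.
set B := (S%:E * _)%E in FS FS' *.
have -> : B = (2^-1%:E * B + 2^-1%:E * B)%E.
  rewrite -ge0_muleDl ?lee_fin ?invr_ge0// -EFinD.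
  have -> : 2^-1 + 2^-1 = 1 :> R by field.
  by rewrite mul1e.
apply: (@le_trans _ _ (\int[prodm m m]_z (2^-1 * F z + 2^-1 * F (z.2, z.1))%:E)%E).
  apply: ge0_le_integral => //.
  - by move=> z _; rewrite lee_fin !mulr_ge0 ?normc_ge0 ?gaussK_ge0.
  - apply/measurable_EFinP; apply: measurable_funM.
      by apply: measurable_funM; apply: (measurableT_comp mna).
    have := mK; congr measurable_fun; apply/funext => z /=.
    by rewrite KC.
  - by apply/measurable_EFinP; apply: measurable_funD; apply: measurable_funM.
  - move=> z _; rewrite lee_fin -/(K z.2 z.1) /F/= [K z.2 z.1]KC.
    have := ler_wpM2r (K0 z.1 z.2) (schur_amgm (normc_ge0 (a z.1))
      (normc_ge0 (a z.2)) (w0 z.1) (w0 z.2) _ _).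
    move: (K z.1 z.2) => k h; apply: (le_trans (h _ _)).
    + by move=> /wa ->; exact: Normc.normc0.
    + by move=> /wa ->; exact: Normc.normc0.
    + by rewrite mulrDl !mulrA.
clearbody F; under eq_integral do rewrite EFinD !EFinM.
rewrite ge0_integralD//; last 4 first.
- by move=> z _; rewrite -EFinM lee_fin mulr_ge0.
- by apply/measurable_EFinP; apply: measurable_funM.
- by move=> z _; rewrite -EFinM lee_fin mulr_ge0.
- by apply/measurable_EFinP; apply: measurable_funM.
rewrite !ge0_integralZl//; last 4 first.
- by apply/measurable_EFinP.
- by move=> z _; rewrite lee_fin.
- by apply/measurable_EFinP.
- by move=> z _; rewrite lee_fin.
by apply: leeD; apply: lee_wpmul2l.
Qed.

End schur_bound.

Section plancherel.
Context {R : realType}.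
Local Notation mu := (@lebesgue_measure R).
Local Notation P := (prodm mu mu).

Lemma integral_gaussK_shift (eps y : R) : 0 < eps ->
  (\int[mu]_x (gaussK eps (x - y))%:E = (2 * pi)%:E)%E.
Proof.
move=> e0; rewrite -(integral_gaussK e0).
apply: (@ge0_integral_shift R (- y) (fun x => (gaussK eps x)%:E)).
  by apply/measurable_EFinP; exact: measurable_gaussK.
by move=> x; rewrite lee_fin gaussK_ge0.
Qed.

Lemma measurable_gaussK_shift (eps y : R) :
  measurable_fun [set: R] (fun x => gaussK eps (x - y)).
Proof. by apply: (measurableT_comp (measurable_gaussK eps)); exact: measurable_funB. Qed.

Lemma ge0_integral_prod (f g : R -> R) : measurable_fun [set: R] f ->
  measurable_fun [set: R] g -> (forall x, 0 <= f x) -> (forall x, 0 <= g x) ->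
  (\int[P]_z (f z.1 * g z.2)%:E = \int[mu]_x (f x)%:E * \int[mu]_x (g x)%:E)%E.
Proof.
move=> mf mg f0 g0.
rewrite tonelli1/=; last 2 first.
- apply/measurable_EFinP; apply: measurable_funM.
    by apply: (measurableT_comp mf); exact: measurable_fst.
  by apply: (measurableT_comp mg); exact: measurable_snd.
- by move=> z; rewrite lee_fin mulr_ge0.
have mg' : measurable_fun [set: R] (fun x => (g x)%:E) by exact/measurable_EFinP.
have mf' : measurable_fun [set: R] (fun x => (f x)%:E) by exact/measurable_EFinP.
transitivity (\int[mu]_x ((f x)%:E * \int[mu]_y (g y)%:E))%E.
  apply: eq_integral => x _; rewrite -ge0_integralZl ?lee_fin//.
  by move=> y _; rewrite lee_fin.
rewrite ge0_integralZr//.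
- by move=> x _; rewrite lee_fin.
- by apply: integral_ge0 => y _; rewrite lee_fin.
Qed.

Lemma plancherel2 (g : R * R -> R[i]) : cintegrable P g ->
  (\int[P]_z (Normc.normc (osc_int P (fun w => w.1) (fun w => w.2) g z.1 z.2) ^+ 2)%:E <=
   ((2 * pi) ^+ 2)%:E * \int[P]_w (Normc.normc (g w) ^+ 2)%:E)%E.
Proof.
move=> Ig.
have := @schur_plancherel _ _ _ P (fun w => w.1) (fun w => w.2) measurable_fst measurable_snd
  g (fun=> 1) ((2 * pi) ^+ 2) (sqr_ge0 _) Ig (measurable_cst _) (fun=> ler01) _ _.
under [X in (_ -> _ -> _ <= _ * X)%E]eq_integral do rewrite divr1.
apply.
  by move=> y /eqP; rewrite oner_eq0.
move=> eps y e0; under eq_integral do rewrite mul1r.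
rewrite (ge0_integral_prod (measurable_gaussK_shift eps y.1) (measurable_gaussK_shift eps y.2)).
- by rewrite !integral_gaussK_shift// -EFinM expr2.
- by move=> x; exact: gaussK_ge0.
- by move=> x; exact: gaussK_ge0.
Qed.

Definition fourierC (f : R -> R[i]) (s : R) : R[i] :=
  cint mu (fun x => expi (s * x) * f x).

Lemma cintegrable_fourierC (f : R -> R[i]) (s : R) : cintegrable mu f ->
  cintegrable mu (fun x => expi (s * x) * f x).
Proof.
move=> If; apply: (cintegrable_le _ (integrable_normc If)) => [|x].
  apply: cmeasurableM; last exact: cintegrable_measurable If.
  by apply: cmeasurable_expi; exact: measurable_funM.
by rewrite Normc.normcM normc_expi mul1r.
Qed.

Lemma cmeasurable_fourierC (f : R -> R[i]) : cmeasurable f -> cmeasurable (fourierC f).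
Proof.
move=> mf; apply: (@cmeasurable_cint _ _ (measurableTypeR R) (measurableTypeR R) R mu (fun z => expi (z.1 * z.2) * f z.2)).
apply: cmeasurableM.
  apply: cmeasurable_expi; apply: measurable_funM; [exact: measurable_fst|exact: measurable_snd].
by apply: (cmeasurable_comp _ mf); exact: measurable_snd.
Qed.

(* Tensoring with a Gaussian, for which equality holds, reduces the
   one-dimensional inequality to the planar one. *)
Lemma plancherel1 (f : R -> R[i]) : cintegrable mu f ->
  (\int[mu]_s (Normc.normc (fourierC f s) ^+ 2)%:E <=
   (2 * pi)%:E * \int[mu]_x (Normc.normc (f x) ^+ 2)%:E)%E.
Proof.
move=> If.
pose g (x : R) := expR (- (2^-1 * x ^+ 2)).
have h0 : 0 < 2^-1 :> R by rewrite invr_gt0.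
have Ig : cintegrable mu (fun x => ((g x)%:C)%C).
  have := cintegrable_gauss_expi0 0 h0.
  by under eq_fun do rewrite mulr0 expi0 mul1r.
have g0 x : 0 <= g x by exact: expR_ge0.
have g2E x : g x ^+ 2 = expR (- (1 * x ^+ 2)).
  by rewrite /g -expRM_natl; congr expR; field.
have VE z : osc_int P (fun w => w.1) (fun w => w.2) (fun w => f w.1 * ((g w.2)%:C)%C) z.1 z.2 =
    fourierC f z.1 * ((gaussK 2^-1 z.2)%:C)%C.
  rewrite -fourier_gauss//.
  have Ig' : cintegrable mu (fun x => expi (z.2 * x) * ((g x)%:C)%C).
    exact: cintegrable_fourierC.
  transitivity (fourierC f z.1 * cint mu (fun x => expi (z.2 * x) * ((g x)%:C)%C)); last first.
    by congr (_ * _); congr cint; apply/funext => x; rewrite mulrC [_ * z.2]mulrC mulrC.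
  rewrite -(cint_prod (cintegrable_fourierC z.1 If) Ig').
  by congr cint; apply/funext => w; rewrite /osc expiD mulrACA.
have gK2 (x : R) : gaussK 2^-1 x ^+ 2 = 2 * pi * expR (- (1 * x ^+ 2)).
  rewrite /gaussK exprMn sqr_sqrtr ?divr_ge0 ?pi_ge0// -expRM_natl invrK [pi * 2]mulrC.
  by congr (_ * expR _); field.
have mf := cintegrable_measurable If.
have mnf2 : measurable_fun [set: R] (fun x => Normc.normc (f x) ^+ 2).
  by apply: measurable_funX; exact: cmeasurable_normc.
have mnF2 : measurable_fun [set: R] (fun x => Normc.normc (fourierC f x) ^+ 2).
  by apply: measurable_funX; apply: cmeasurable_normc; exact: cmeasurable_fourierC.
have sq0 (z : R[i]) : 0 <= Normc.normc z ^+ 2 by exact: sqr_ge0.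
have pi20 : 0 <= 2 * pi :> R by rewrite mulr_ge0 ?pi_ge0.
have mg1 := @measurable_gauss R 1.
have mg2 : measurable_fun [set: R] (fun x : R => 2 * pi * expR (- (1 * x ^+ 2))).
  exact: measurable_funM.
have eA := ge0_integral_prod mnF2 mg2 (fun=> sq0 _) (fun x => mulr_ge0 pi20 (expR_ge0 _)).
have eB := ge0_integral_prod mnf2 mg1 (fun=> sq0 _) (fun x => expR_ge0 _).
have : (\int[mu]_s (Normc.normc (fourierC f s) ^+ 2)%:E *
     \int[mu]_x (2 * pi * expR (- (1 * x ^+ 2)))%:E <=
    ((2 * pi) ^+ 2)%:E * (\int[mu]_x (Normc.normc (f x) ^+ 2)%:E *
     \int[mu]_x (expR (- (1 * x ^+ 2)))%:E))%E.
  rewrite -eA -eB.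
  have := plancherel2 (cintegrable_prod If Ig); congr (_ <= _ * _)%E; apply: eq_integral => z _.
    by rewrite VE Normc.normcM exprMn normc_real real_normK ?num_real// gK2.
  by rewrite Normc.normcM exprMn normc_real real_normK ?num_real// g2E.
under [X in (_ * X <= _ -> _)%E]eq_integral do rewrite EFinM.
rewrite ge0_integralZl//; last by apply/measurable_EFinP; exact: measurable_gauss.
rewrite !integral_gauss0// divr1 => h.
have c0 : 0 < 2 * pi * Num.sqrt pi :> R.
  by rewrite !mulr_gt0 ?pi_gt0 ?sqrtr_gt0 ?pi_gt0.
rewrite -(@lee_pmul2l _ (2 * pi * Num.sqrt pi)%:E)// ?lte_fin//.
move: h; rewrite -EFinM muleC => h; apply: (le_trans h).
rewrite [X in (_ * X)%E]muleC !muleA -!EFinM expr2.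
by rewrite le_eqVlt; apply/orP; left; apply/eqP; congr (_%:E * _)%E; ring.
Qed.

End plancherel.

(** * The bilinear estimate *)

Section tonelli_measurability.
Context d1 d2 (T1 : measurableType d1) (T2 : measurableType d2) (R : realType).
Variable m1 : {sigma_finite_measure set T1 -> \bar R}.
Variable m2 : {sigma_finite_measure set T2 -> \bar R}.
Variable f : T1 * T2 -> R.
Hypotheses (mf : measurable_fun [set: T1 * T2] f) (f0 : forall z, 0 <= f z).

Lemma measurable_int1 : measurable_fun [set: T2] (fun y => \int[m1]_x (f (x, y))%:E)%E.
Proof.
apply: (measurable_fun_fubini_tonelli_G (EFin \o f)) => [|z]; last by rewrite lee_fin.
exact/measurable_EFinP.
Qed.

Lemma measurable_int2 : measurable_fun [set: T1] (fun x => \int[m2]_y (f (x, y))%:E)%E.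
Proof.
apply: (measurable_fun_fubini_tonelli_F (EFin \o f)) => [|z]; last by rewrite lee_fin.
exact/measurable_EFinP.
Qed.

End tonelli_measurability.

Section bilinear_estimate.
Context {R : realType}.
Local Notation mu := (@lebesgue_measure R).
Local Notation P := (prodm mu mu).

(** The weight [2 y] is the Jacobian of [y^2] on the half-line, so the substitution leads to part of
    the total mass [2 pi] of the kernel. *)
Let quad_half (eps A : R) : 0 < eps ->
  (\int[mu]_(y in `[0%R, +oo[) (`|2 * y| * gaussK eps (y ^+ 2 + A))%:E <= (2 * pi)%:E)%E.
Proof.
move=> e0.
pose h (y : R) := `|2 * y| * gaussK eps (y ^+ 2 + A).
have h0 y : 0 <= h y by rewrite mulr_ge0 ?gaussK_ge0.
have mh : measurable_fun [set: R] h.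
  apply: measurable_funM; first by apply: measurableT_comp => //; exact: measurable_funM.
  apply: (measurableT_comp (measurable_gaussK eps)).
  by apply: measurable_funD => //; exact: measurable_funX.
have cv := @ge0_cvgn_integral _ mu h h0 mh.
rewrite -(cvg_lim _ cv)//; apply: lime_le; first by apply/cvg_ex; eexists; exact: cv.
apply: nearW => n.
pose F (y : R) := y ^+ 2.
have dF (x : R) : is_derive x 1 F (2 * x).
  by apply: is_derive_eq; rewrite /GRing.scale /=; ring.
have F'E : F^`()%classic = (fun x => 2 * x).
  by apply/funext => x; rewrite derive1E; have [_ ->] := dF x.
have cF : continuous F by move=> x; exact: exprn_continuous.
have c2 : continuous (fun x : R => 2 * x) by move=> x; exact: mulrl_continuous.
pose G (x : R) := gaussK eps (x + A).
have cG : continuous G.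
  move=> x; apply: differentiable_continuous; apply/derivable1_diffP.
  by rewrite /G /gaussK; exact: ex_derive.
have := @integration_by_substitution_increasing R F G 0 n%:R (ler0n _ _).
rewrite F'E => sub.
rewrite [leLHS](_ : _ = \int[mu]_(x in `[0%R, n%:R]) (((G \o F) * ( *%R 2)) x)%:E)%E; last first.
  apply: eq_integral => x; rewrite inE/= in_itv/= => /andP[x0 _].
  by rewrite /h ger0_norm ?mulr_ge0//; congr EFin; exact: mulrC.
rewrite -sub.
- rewrite -(@integral_gaussK_shift R eps (- A) e0).
  under [leRHS]eq_integral do rewrite opprK.
  apply: ge0_subset_integral => //.
  + by apply/measurable_EFinP; exact: continuous_measurable_fun.
  + by move=> x _; rewrite lee_fin gaussK_ge0.
- move=> x y; rewrite !in_itv/= => /andP[x0 _] /andP[y0 _] xy.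
  by rewrite /F ltr_pXn2r// nnegrE.
- by move=> x _; exact: c2.
- by apply/cvg_ex; exists (2 * 0); apply: cvg_at_right_filter; exact: c2.
- by apply/cvg_ex; exists (2 * n%:R); apply: cvg_at_left_filter; exact: c2.
- split => [x _||]; [by have [] := dF x|apply: cvg_at_right_filter; exact: cF|
      apply: cvg_at_left_filter; exact: cF].
- exact: continuous_subspaceT.
Qed.

(** The integrand is even, and each of the two branches of the square root contributes at most
    [2 pi]. *)
Lemma quad_gaussK (eps A : R) : 0 < eps ->
  (\int[mu]_y (`|2 * y| * gaussK eps (y ^+ 2 + A))%:E <= (4 * pi)%:E)%E.
Proof.
move=> e0; rewrite ge0_symfun_integralT.
- have -> : (4 * pi)%:E = (2%:E * (2 * pi)%:E)%E :> \bar R.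
    by rewrite -EFinM; congr EFin; ring.
  apply: lee_wpmul2l; first by rewrite lee_fin.
  have := quad_half A e0; congr (_ <= _)%E; congr integral.
  by apply/seteqP; split => x /=; rewrite in_itv/= andbT.
- by move=> y; rewrite mulr_ge0 ?gaussK_ge0.
- have c1 : continuous (fun y : R => gaussK eps (y ^+ 2 + A)).
    move=> y; apply: differentiable_continuous; apply/derivable1_diffP.
    by rewrite /gaussK; exact: ex_derive.
  move=> y; apply: cvgM; last exact: c1.
  by apply: cvg_norm; exact: mulrl_continuous.
- by move=> y /=; rewrite mulrN normrN sqrrN.
Qed.

Definition xi_sum (z : R * R) : R := z.1 + z.2.
Definition xi_energy (z : R * R) : R := - ((z.1 ^+ 2 + z.2 ^+ 2) / 2).

Lemma measurable_xi_sum : measurable_fun [set: R * R] xi_sum.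
Proof. by apply: measurable_funD; [exact: measurable_fst|exact: measurable_snd]. Qed.

Lemma measurable_xi_energy : measurable_fun [set: R * R] xi_energy.
Proof.
apply: measurableT_comp => //; apply: measurable_funM => //.
by apply: measurable_funD; apply: measurable_funX; [exact: measurable_fst|exact: measurable_snd].
Qed.

(** [|xi_1 - xi_2|] is the Jacobian of the map from two frequencies to their energy and momentum,
    and a generic fibre of that map has two points. This gives twice the planar mass [(2 pi)^2],
    which is the constant. *)
Lemma bilinear_schur (eps q0 s0 : R) : 0 < eps ->
  (\int[P]_z (`|z.1 - z.2| * (gaussK eps (xi_energy z - q0) * gaussK eps (xi_sum z - s0)))%:E
   <= (8 * pi ^+ 2)%:E)%E.
Proof.
move=> e0; pose F (z : R * R) := `|z.1 - z.2| *
  (gaussK eps (xi_energy z - q0) * gaussK eps (xi_sum z - s0)).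
have F0 z : 0 <= F z by rewrite !mulr_ge0 ?gaussK_ge0.
have mF : measurable_fun [set: R * R] F.
  apply: measurable_funM.
    apply: measurableT_comp => //.
    by apply: measurable_funB; [exact: measurable_fst|exact: measurable_snd].
  apply: measurable_funM; apply: (measurableT_comp (measurable_gaussK eps)).
    by apply: measurable_funB => //; exact: measurable_xi_energy.
  by apply: measurable_funB => //; exact: measurable_xi_sum.
have m1 (f : R -> R * R) : measurable_fun [set: R] f -> measurable_fun [set: R] (fun x => (F (f x))%:E).
  by move=> mf; apply/measurable_EFinP; exact: (measurableT_comp mF mf).
change (\int[P]_z (F z)%:E <= (8 * pi ^+ 2)%:E)%E.
rewrite tonelli1; last 2 first.
- exact/measurable_EFinP.
- by move=> z; rewrite lee_fin.
pose F1 (w : R * R) := F (w.1, w.2 - w.1).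
have mF1 : measurable_fun [set: R * R] F1.
  apply: (measurableT_comp mF); apply: measurable_fun_pair; first exact: measurable_fst.
  by apply: measurable_funB; [exact: measurable_snd|exact: measurable_fst].
have F10 z : 0 <= F1 z by exact: F0.
have e1 : (\int[mu]_x \int[mu]_y (F (x, y))%:E = \int[mu]_x \int[mu]_s (F1 (x, s))%:E)%E.
  apply: eq_integral => x _; rewrite -(@ge0_integral_shift R (- x) (fun y => (F (x, y))%:E))//.
    by apply: m1; exact: pair1_measurable.
  by move=> y; rewrite lee_fin.
have F10' z : (0 <= (F1 z)%:E)%E by rewrite lee_fin; exact: F10.
rewrite e1 (@tonelli12 _ _ _ _ _ mu mu (fun w => (F1 w)%:E)); last 2 first.
- exact/measurable_EFinP.
- exact: F10'.
have inner (s : R) : (\int[mu]_x (F1 (x, s))%:E <= (gaussK eps (s - s0))%:E * (4 * pi)%:E)%E.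
  (* At fixed momentum [s], centring at [s / 2] makes the energy equal to [- (y^2 + s^2 / 4)] and
     the frequency difference equal to [2 y]. *)
  rewrite -(@ge0_integral_shift R (s / 2) (fun x => (F1 (x, s))%:E)); last 2 first.
  - by apply/measurable_EFinP; apply: (measurableT_comp mF1); exact: pair2_measurable.
  - by move=> y; exact: F10'.
  rewrite (_ : (fun x => _) = (fun y => (gaussK eps (s - s0))%:E *
      (`|2 * y| * gaussK eps (y ^+ 2 + (s ^+ 2 / 4 + q0)))%:E)%E); last first.
    apply/funext => y; rewrite -EFinM /F1 /F /xi_sum /xi_energy /=; congr EFin.
    have -> : y + s / 2 - (s - (y + s / 2)) = 2 * y by field.
    have -> : y + s / 2 + (s - (y + s / 2)) - s0 = s - s0 by ring.
    have -> : - (((y + s / 2) ^+ 2 + (s - (y + s / 2)) ^+ 2) / 2) - q0 =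
      - (y ^+ 2 + (s ^+ 2 / 4 + q0)) by field.
    by rewrite gaussKN; ring.
  rewrite ge0_integralZl; last 4 first.
  - exact: measurableT.
  - apply/measurable_EFinP; apply: measurable_funM.
      by apply: measurableT_comp => //; exact: measurable_funM.
    apply: (measurableT_comp (measurable_gaussK eps)).
    by apply: measurable_funD => //; exact: measurable_funX.
  - by move=> y _; rewrite lee_fin mulr_ge0 ?gaussK_ge0.
  - by rewrite lee_fin gaussK_ge0.
  apply: lee_wpmul2l; first by rewrite lee_fin gaussK_ge0.
  exact: quad_gaussK.
apply: (@le_trans _ _ (\int[mu]_s ((gaussK eps (s - s0)%R)%:E * (4 * pi)%:E)%E)%E).
  apply: ge0_le_integral.
  - exact: measurableT.
  - by move=> s _; apply: integral_ge0 => x _; exact: F10'.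
  - exact: (measurable_int1 mu mF1 F10).
  - by apply: emeasurable_funM; [apply/measurable_EFinP; exact: measurable_gaussK_shift|exact: measurable_cst].
  - by move=> s _; exact: inner.
rewrite ge0_integralZr; last 4 first.
- exact: measurableT.
- by apply/measurable_EFinP; exact: measurable_gaussK_shift.
- by move=> y _; rewrite lee_fin gaussK_ge0.
- by rewrite lee_fin mulr_ge0 ?pi_ge0.
rewrite (integral_gaussK_shift s0 e0) -EFinM lee_fin.
by rewrite (_ : 2 * pi * (4 * pi) = 8 * pi ^+ 2); [exact: lexx|ring].
Qed.

(** The Schur weight [|xi_1 - xi_2|] vanishes on the diagonal, which is why [b] has to vanish
    there. *)
Lemma bilinear_L2 (b : R * R -> R[i]) : cintegrable P b ->
  (forall z, z.1 = z.2 -> b z = 0) ->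
  (\int[P]_z (Normc.normc (osc_int P xi_energy xi_sum b z.1 z.2) ^+ 2)%:E <=
   (8 * pi ^+ 2)%:E * \int[P]_w (Normc.normc (b w) ^+ 2 / `|w.1 - w.2|)%:E)%E.
Proof.
move=> Ib b0.
apply: (@schur_plancherel _ _ R P _ _ measurable_xi_energy measurable_xi_sum b
  (fun w => `|w.1 - w.2|) (8 * pi ^+ 2)).
- by rewrite mulr_ge0 ?sqr_ge0.
- exact: Ib.
- apply: measurableT_comp => //.
  by apply: measurable_funB; [exact: measurable_fst|exact: measurable_snd].
- by move=> z; exact: normr_ge0.
- by move=> z /normr0_eq0/subr0_eq; exact: b0.
- by move=> eps y e0; exact: bilinear_schur.
Qed.

End bilinear_estimate.

(** * Approximate identities and the Parseval pairing *)

Section approximate_identity.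
Context {R : realType}.
Local Notation mu := (@lebesgue_measure R).
Local Notation P := (prodm mu mu).

Definition cvgC (z_ : nat -> R[i]) (z : R[i]) := Normc.normc (z_ n - z) @[n --> \oo] --> 0.

Definition seq_continuous2 (eta : R * R -> R[i]) := forall (u v : nat -> R) (s q : R),
  u n @[n --> \oo] --> s -> v n @[n --> \oo] --> q ->
  cvgC (fun n => eta (u n, v n)) (eta (s, q)).

Lemma gaussK_scale (r s : R) : 0 < r ->
  gaussK (r ^+ 2) (r * s) = r^-1 * gaussK 1 s.
Proof.
move=> r0; rewrite /gaussK divr1 sqrtrM ?pi_ge0// sqrtrV ?sqr_ge0// sqrtr_sqr (gtr0_norm r0).
rewrite (_ : (r * s) ^+ 2 / (4 * r ^+ 2) = s ^+ 2 / (4 * 1)); last by field; rewrite gt_eqF.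
by rewrite [Num.sqrt pi / r]mulrC mulrA.
Qed.

Lemma gaussK_sym (eps x y : R) : gaussK eps (x - y) = gaussK eps (y - x).
Proof. by rewrite -opprB gaussKN. Qed.

Definition gaussK2 (eps : R) (z w : R * R) : R :=
  gaussK eps (z.1 - w.1) * gaussK eps (z.2 - w.2).

Lemma gaussK2_ge0 eps z w : 0 <= gaussK2 eps z w.
Proof. by rewrite mulr_ge0 ?gaussK_ge0. Qed.

Lemma measurable_gaussK2 eps z : measurable_fun [set: R * R] (gaussK2 eps z).
Proof.
apply: measurable_funM; apply: (measurableT_comp (measurable_gaussK eps));
  exact: measurable_funB.
Qed.

Lemma integral_gaussK2 eps z : 0 < eps ->
  (\int[P]_w (gaussK2 eps z w)%:E = ((2 * pi) ^+ 2)%:E)%E.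
Proof.
move=> e0; have mK y : measurable_fun [set: R] (fun x => gaussK eps (y - x)).
  by apply: (measurableT_comp (measurable_gaussK eps)); exact: measurable_funB.
have iK y : (\int[mu]_x (gaussK eps (y - x))%:E = (2 * pi)%:E)%E.
  rewrite -(integral_gaussK_shift y e0); apply: eq_integral => x _.
  by rewrite gaussK_sym.
have := ge0_integral_prod (mK z.1) (mK z.2) (fun=> gaussK_ge0 _ _) (fun=> gaussK_ge0 _ _).
by rewrite !iK -EFinM expr2.
Qed.

Lemma integrable_gaussK2 eps z : 0 < eps ->
  P.-integrable [set: R * R] (EFin \o gaussK2 eps z).
Proof.
move=> e0; apply/integrableP; split.
  by apply/measurable_EFinP; exact: measurable_gaussK2.
under eq_integral do rewrite /= ger0_norm ?gaussK2_ge0//.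
by rewrite integral_gaussK2// ltry.
Qed.

(** Writing the parameter as [r^2] makes [r] the width of the kernel. After rescaling, the kernel is
    fixed and [r] occurs only inside [G], so dominated convergence applies as [r] tends to 0. *)
Lemma gaussK2_rescale (G : R * R -> R) (r : R) (z : R * R) : 0 < r ->
  measurable_fun [set: R * R] G -> (forall w, 0 <= G w) ->
  (\int[P]_w (G w * gaussK2 (r ^+ 2) z w)%:E =
   \int[P]_w (G (r * w.1 + z.1, r * w.2 + z.2)%R * gaussK2 1 (0, 0) w)%:E)%E.
Proof.
move=> r0 mG G0.
have mGK : measurable_fun [set: R * R] (fun w => G w * gaussK2 (r ^+ 2) z w).
  by apply: measurable_funM => //; exact: measurable_gaussK2.
have GK0 w : 0 <= G w * gaussK2 (r ^+ 2) z w by rewrite mulr_ge0 ?gaussK2_ge0.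
have maff (a b : R) : measurable_fun [set: R] (fun x : R => a * x + b).
  by apply: measurable_funD => //; exact: measurable_funM.
have mA : measurable_fun [set: R * R] (fun w : R * R => (r * w.1 + z.1, r * w.2 + z.2)).
  apply: measurable_fun_pair.
    by apply: (measurableT_comp (maff r z.1)); exact: measurable_fst.
  by apply: (measurableT_comp (maff r z.2)); exact: measurable_snd.
have E0 w : (0 <= (G w * gaussK2 (r ^+ 2) z w)%:E)%E by rewrite lee_fin.
have E1 w : (0 <= (G (r * w.1 + z.1, r * w.2 + z.2)%R * gaussK2 1 (0, 0) w)%:E)%E.
  by rewrite lee_fin mulr_ge0 ?gaussK2_ge0.
rewrite tonelli1; [|exact/measurable_EFinP|exact: E0].
rewrite tonelli1; [|apply/measurable_EFinP|exact: E1]; last first.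
  by apply: measurable_funM; [exact: (measurableT_comp mG mA)|exact: measurable_gaussK2].
rewrite (@ge0_integral_affine R r z.1 (fun x => \int[mu]_y (G (x, y) * gaussK2 (r ^+ 2) z (x, y))%:E)%E) => //; last 2 first.
- exact: (measurable_int2 mu mGK GK0).
- by move=> x; apply: integral_ge0 => y _; exact: E0.
rewrite -ge0_integralZl; last 4 first.
- exact: measurableT.
- have := measurable_int2 mu mGK GK0 => h.
  exact: (measurableT_comp h (maff r z.1)).
- by move=> x _; apply: integral_ge0 => y _; exact: E0.
- by rewrite lee_fin ltW.
apply: eq_integral => x _.
rewrite (@ge0_integral_affine R r z.2 (fun y => (G (r * x + z.1, y) * gaussK2 (r ^+ 2) z (r * x + z.1, y))%:E)%E) => //; last first.
  apply/measurable_EFinP; apply: (measurableT_comp mGK); exact: pair1_measurable.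
pose H y := (G (r * x + z.1, r * y + z.2) * gaussK2 (r ^+ 2) z (r * x + z.1, r * y + z.2))%:E.
have mH : measurable_fun [set: R] H.
  apply/measurable_EFinP; apply: (measurableT_comp mGK).
  by apply: measurable_fun_pair => //; exact: maff.
have rE0 : (0 <= r%:E)%E by rewrite lee_fin ltW.
have H0 y : (0 <= H y)%E by exact: E0.
rewrite -(@ge0_integralZl _ _ _ mu _ measurableT H mH r%:E (fun y _ => H0 y) rE0).
rewrite -(@ge0_integralZl _ _ _ mu _ measurableT _ (measurable_funeM r%:E mH) r%:E
  (fun y _ => mule_ge0 rE0 (H0 y)) rE0).
apply: eq_integral => y _; rewrite /H -!EFinM; congr EFin.
rewrite /gaussK2 /= !sub0r !gaussKN.
rewrite (gaussK_sym _ z.1) (gaussK_sym _ z.2) !addrK !gaussK_scale//.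
by field; rewrite gt_eqF.
Qed.

Lemma approx_identity2 (eta : R * R -> R[i]) (B : R) (z : R * R) :
  cmeasurable eta -> (forall w, Normc.normc (eta w) <= B) -> seq_continuous2 eta ->
  cvgC (fun n => cint P (fun w => eta w * ((gaussK2 (n.+1%:R^-1 ^+ 2) z w)%:C)%C))
    ((((2 * pi) ^+ 2)%:C)%C * eta z).
Proof.
move=> meta etaB ceta.
pose r n : R := n.+1%:R^-1.
have r0 n : 0 < r n by rewrite invr_gt0.
have r20 n : 0 < r n ^+ 2 by rewrite exprn_gt0.
have B0 : 0 <= B by exact: le_trans (normc_ge0 _) (etaB z).
have mKc n : cmeasurable (fun w => ((gaussK2 (r n ^+ 2) z w)%:C)%C).
  by apply: cmeasurable_real; exact: measurable_gaussK2.
have nK n w : Normc.normc (((gaussK2 (r n ^+ 2) z w)%:C)%C) = gaussK2 (r n ^+ 2) z w.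
  by rewrite normc_real ger0_norm ?gaussK2_ge0.
have IeK (f : R * R -> R[i]) C n : cmeasurable f -> (forall w, Normc.normc (f w) <= C) ->
    cintegrable P (fun w => f w * ((gaussK2 (r n ^+ 2) z w)%:C)%C).
  move=> mf fC; have := integrableZl measurableT C (integrable_gaussK2 z (r20 n)).
  move/(@cintegrable_le _ _ _ P); apply.
    by apply: cmeasurableM; [exact: mf|exact: mKc].
  by move=> w; rewrite Normc.normcM nK ler_wpM2r ?gaussK2_ge0.
pose G w := Normc.normc (eta w - eta z).
have G0 w : 0 <= G w by exact: normc_ge0.
have G2B w : G w <= 2 * B.
  rewrite /G (le_trans (le_normcD _ _))// normcN mulrDl mul1r.
  by apply: lerD; exact: etaB.
have mG : measurable_fun [set: R * R] G.
  by apply: cmeasurable_normc; apply: cmeasurableB => //; exact: cmeasurable_cst.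
pose J n w := G (r n * w.1 + z.1, r n * w.2 + z.2) * gaussK2 1 (0, 0) w.
have mJ n : measurable_fun [set: R * R] (J n).
  have maff (c : R) : measurable_fun [set: R] (fun x : R => r n * x + c).
    by apply: measurable_funD => //; exact: measurable_funM.
  apply: measurable_funM; last exact: measurable_gaussK2.
  apply: (measurableT_comp mG); apply: measurable_fun_pair.
    by apply: (measurableT_comp (maff z.1)); exact: measurable_fst.
  by apply: (measurableT_comp (maff z.2)); exact: measurable_snd.
have J0 n w : 0 <= J n w by rewrite mulr_ge0 ?gaussK2_ge0.
have IK1 := integrableZl measurableT (2 * B) (integrable_gaussK2 (0, 0) ltr01).
have JB n w : `|J n w| <= 2 * B * gaussK2 1 (0, 0) w.
  by rewrite ger0_norm// ler_wpM2r ?gaussK2_ge0.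
have IJ n : P.-integrable [set: R * R] (EFin \o J n).
  apply: (le_integrable measurableT _ _ IK1); first by apply/measurable_EFinP; exact: mJ.
  by move=> w _; rewrite -EFinM lee_fin (le_trans (JB n w))// ler_norm.
have bound n : Normc.normc (cint P (fun w => eta w * ((gaussK2 (r n ^+ 2) z w)%:C)%C) -
     (((2 * pi) ^+ 2)%:C)%C * eta z) <=
   \int[P]_w J n w.
  have -> : (((2 * pi) ^+ 2)%:C)%C * eta z =
      cint P (fun w => eta z * ((gaussK2 (r n ^+ 2) z w)%:C)%C).
    have I1 : cintegrable P (fun w => ((gaussK2 (r n ^+ 2) z w)%:C)%C).
      have := IeK (fun=> 1) 1 n (cmeasurable_cst 1) (fun=> _).
      by under eq_fun do rewrite mul1r; apply; rewrite Normc.normc1.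
    rewrite cintZ// cint_real mulrC; congr (_ * (_%:C)%C).
    by rewrite /Rintegral integral_gaussK2.
  have Ie := IeK eta B n meta etaB.
  have Iz := IeK (fun=> eta z) B n (cmeasurable_cst _) (fun=> etaB z).
  rewrite -cintB// -lee_fin.
  have -> : (fun w => eta w * ((gaussK2 (r n ^+ 2) z w)%:C)%C - eta z * ((gaussK2 (r n ^+ 2) z w)%:C)%C) =
     (fun w => (eta w - eta z) * ((gaussK2 (r n ^+ 2) z w)%:C)%C).
    by apply/funext => w; rewrite mulrBl.
  have Id : cintegrable P (fun w => (eta w - eta z) * ((gaussK2 (r n ^+ 2) z w)%:C)%C).
    apply: (IeK _ (2 * B)) => //; apply: cmeasurableB => //; exact: cmeasurable_cst.
  apply: (le_trans (le_normc_cinte Id)).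
  have -> : (\int[P]_w (Normc.normc ((eta w - eta z) * ((gaussK2 (r n ^+ 2) z w)%:C)%C))%:E =
      \int[P]_w (G w * gaussK2 (r n ^+ 2) z w)%:E)%E.
    by apply: eq_integral => w _; rewrite Normc.normcM nK.
  rewrite gaussK2_rescale// /Rintegral fineK; first exact: lexx.
  exact: (integrable_fin_num measurableT (IJ n)).
have cr0 (x y : R) : r n * x + y @[n --> \oo] --> y.
  rewrite -[X in _ --> X]add0r -[X in _ --> X + _](mul0r x).
  apply: cvgD; last exact: cvg_cst.
  by apply: cvgM; [exact: cvg_harmonic|exact: cvg_cst].
have cJ : (\int[P]_w J n w) @[n --> \oo] --> \int[P]_w (0 : R).
  apply: (@Rdct _ _ _ P J (fun=> 0) (fun w => 2 * B * gaussK2 1 (0, 0) w)) => //.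
  move=> w; rewrite -(mul0r (gaussK2 1 (0, 0) w)); apply: cvgM; last exact: cvg_cst.
  have := ceta _ _ _ _ (cr0 w.1 z.1) (cr0 w.2 z.2).
  by rewrite -surjective_pairing.
have z0 : \int[P]_w (0 : R) = 0 by rewrite /Rintegral integral0.
rewrite z0 in cJ.
apply: (squeeze_cvgr _ (cvg_cst 0) cJ); apply: nearW => n.
by rewrite normc_ge0 bound.
Qed.

End approximate_identity.

Section cvgC_theory.
Context {R : realType}.

Lemma normc_dist (z w : R[i]) : `|Normc.normc z - Normc.normc w| <= Normc.normc (z - w).
Proof.
have tri (a b : R[i]) : Normc.normc a - Normc.normc b <= Normc.normc (a - b).
  by rewrite lerBlDr (le_trans _ (le_normcD _ _))// subrK.
by rewrite ler_norml tri andbT lerNl opprB (le_trans (tri _ _))// -normcN opprB.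
Qed.

Lemma cvgC_normc (u : nat -> R[i]) (l : R[i]) : cvgC u l ->
  Normc.normc (u n) @[n --> \oo] --> Normc.normc l.
Proof.
move=> cu; apply/cvgrPdist_le => e e0.
move/cvgrPdist_le: cu => /(_ _ e0); apply: filterS => n.
rewrite sub0r normrN (ger0_norm (normc_ge0 _)); apply: le_trans.
by rewrite distrC; exact: normc_dist.
Qed.

Lemma cvgC_le (u : nat -> R[i]) (l : R[i]) (B : \bar R) : cvgC u l ->
  (forall n, ((Normc.normc (u n))%:E <= B)%E) -> ((Normc.normc l)%:E <= B)%E.
Proof.
move=> cu uB.
have cE : (Normc.normc (u n))%:E @[n --> \oo] --> (Normc.normc l)%:E.
  by apply: cvg_EFin; [exact: nearW|exact: cvgC_normc].
rewrite -(cvg_lim _ cE)//; apply: lime_le; first by apply/cvg_ex; exists (Normc.normc l)%:E.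
exact: nearW.
Qed.

Lemma cvgCZ (z : R[i]) (u : nat -> R[i]) (l : R[i]) : cvgC u l ->
  cvgC (fun n => z * u n) (z * l).
Proof.
move=> cu; rewrite /cvgC; under eq_fun do rewrite -mulrBr Normc.normcM.
by rewrite -(mulr0 (Normc.normc z)); apply: cvgM => //; exact: cvg_cst.
Qed.

Lemma cvgC_uniq (u : nat -> R[i]) (l l' : R[i]) : cvgC u l -> cvgC u l' -> l = l'.
Proof.
move=> cu cu'; apply: cplx_eq.
  exact: cvg_unique (normc_cvg_Re cu) (normc_cvg_Re cu').
exact: cvg_unique (normc_cvg_Im cu) (normc_cvg_Im cu').
Qed.

Lemma cvgC_ReIm (u : nat -> R[i]) (l : R[i]) :
  complex.Re (u n) @[n --> \oo] --> complex.Re l ->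
  complex.Im (u n) @[n --> \oo] --> complex.Im l -> cvgC u l.
Proof. exact: cvg_ReIm_normc. Qed.

Lemma cvgCM (u v : nat -> R[i]) (l k : R[i]) : cvgC u l -> cvgC v k ->
  cvgC (fun n => u n * v n) (l * k).
Proof.
move=> cu cv; have ur := normc_cvg_Re cu; have ui := normc_cvg_Im cu.
have vr := normc_cvg_Re cv; have vi := normc_cvg_Im cv.
apply: cvgC_ReIm; rewrite (ReM, ImM); under eq_fun do rewrite (ReM, ImM).
  by apply: cvgB; apply: cvgM.
by apply: cvgD; apply: cvgM.
Qed.

Lemma cvgC_real (u : nat -> R) (l : R) : u n @[n --> \oo] --> l ->
  cvgC (fun n => ((u n)%:C)%C) ((l%:C)%C).
Proof. by move=> cu; apply: cvgC_ReIm => //=; exact: cvg_cst. Qed.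

Lemma cvgC_expi (u : nat -> R) (l : R) : u n @[n --> \oo] --> l ->
  cvgC (fun n => expi (u n)) (expi l).
Proof.
move=> cu; apply: cvgC_ReIm => /=.
  exact: (cvg_comp _ _ cu (@continuous_cos R l)).
exact: (cvg_comp _ _ cu (@continuous_sin R l)).
Qed.

Lemma cvgC_cst (z : R[i]) : cvgC (fun=> z) z.
Proof. by apply: cvgC_ReIm; exact: cvg_cst. Qed.

End cvgC_theory.

Section approximate_identity1.
Context {R : realType}.
Local Notation mu := (@lebesgue_measure R).
Local Notation P := (prodm mu mu).

Definition seq_continuous (phi : R -> R[i]) := forall (u : nat -> R) (s : R),
  u n @[n --> \oo] --> s -> cvgC (fun n => phi (u n)) (phi s).

Lemma cintegrable_bounded_gaussK (phi : R -> R[i]) (B : R) (eps x : R) : 0 < eps ->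
  cmeasurable phi -> (forall w, Normc.normc (phi w) <= B) ->
  cintegrable mu (fun y => phi y * ((gaussK eps (x - y))%:C)%C).
Proof.
move=> e0 mphi phiB.
have IK : mu.-integrable [set: R] (EFin \o (fun y => gaussK eps (x - y))).
  apply/integrableP; split.
    apply/measurable_EFinP; apply: (measurableT_comp (measurable_gaussK eps)).
    exact: measurable_funB.
  under eq_integral do rewrite /= ger0_norm ?gaussK_ge0// gaussK_sym.
  by rewrite integral_gaussK_shift// ltry.
have := integrableZl measurableT B IK.
move/(@cintegrable_le _ _ _ mu); apply.
  apply: cmeasurableM; first exact: mphi.
  by apply: cmeasurable_real; have /measurable_EFinP := measurable_int mu IK.
move=> y; rewrite Normc.normcM normc_real (ger0_norm (gaussK_ge0 _ _)).
by rewrite ler_wpM2r ?gaussK_ge0.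
Qed.

(** Deduced from the planar statement for a function constant in the second variable, in which the
    kernel contributes a factor [2 pi] that is divided out. *)
Lemma approx_identity1 (phi : R -> R[i]) (B : R) (x : R) :
  cmeasurable phi -> (forall w, Normc.normc (phi w) <= B) -> seq_continuous phi ->
  cvgC (fun n => cint mu (fun y => phi y * ((gaussK (n.+1%:R^-1 ^+ 2) (x - y))%:C)%C))
    (((2 * pi)%:C)%C * phi x).
Proof.
move=> mphi phiB cphi.
pose eps n : R := n.+1%:R^-1 ^+ 2.
have e0 n : 0 < eps n by rewrite exprn_gt0// invr_gt0.
have m2 : cmeasurable (fun w : R * R => phi w.1).
  by apply: (cmeasurable_comp _ mphi); exact: measurable_fst.
have := @approx_identity2 R (fun w => phi w.1) B (x, 0) m2 (fun=> phiB _) (fun u v s q cu _ => cphi u s cu).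
have c2 : ((2 * pi)%:C)%C != 0 :> R[i].
  by rewrite eq_complex /= eqxx andbT mulf_neq0// gt_eqF// pi_gt0.
move=> /(cvgCZ (((2 * pi)%:C)%C)^-1).
rewrite mulrA [X in X * phi _](_ : _ = ((2 * pi)%:C)%C); last first.
  by rewrite expr2 (real_complexM (2 * pi) (2 * pi)) mulrA mulVf// mul1r.
apply: cvg_trans; apply: near_eq_cvg; apply: nearW => n; congr (Normc.normc (_ - _)).
have I1 := cintegrable_bounded_gaussK x (e0 n) mphi phiB.
have I2 : cintegrable mu (fun y => ((gaussK (eps n) (0 - y))%:C)%C).
  have := @cintegrable_bounded_gaussK (fun=> 1) 1 _ 0 (e0 n) (cmeasurable_cst 1) (fun=> _).
  by under eq_fun do rewrite mul1r; apply; rewrite Normc.normc1.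
have -> : (fun w : R * R => phi w.1 * ((gaussK2 (n.+1%:R^-1 ^+ 2) (x, 0) w)%:C)%C) =
    (fun w => (phi w.1 * ((gaussK (eps n) (x - w.1))%:C)%C) * ((gaussK (eps n) (0 - w.2))%:C)%C).
  by apply/funext => w; rewrite /gaussK2 real_complexM mulrA.
rewrite (cint_prod I1 I2) cint_real.
have -> : \int[mu]_y gaussK (eps n) (0 - y) = 2 * pi.
  rewrite /Rintegral; under eq_integral do rewrite gaussK_sym.
  by rewrite integral_gaussK_shift.
by rewrite mulrCA mulVf// mulr1.
Qed.

End approximate_identity1.

Section parseval_pairing.
Context d (X : measurableType d) (R : realType).
Variable m : {sigma_finite_measure set X -> \bar R}.
Local Notation mu := (@lebesgue_measure R).
Local Notation P := (prodm mu mu).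
Variables (p1 p2 : X -> R).
Hypotheses (mp1 : measurable_fun [set: X] p1) (mp2 : measurable_fun [set: X] p2).

Lemma mul_amgm (k x y : R) : 0 < k -> x * y <= k / 2 * x ^+ 2 + (2 * k)^-1 * y ^+ 2.
Proof.
move=> k0; rewrite -subr_ge0.
have -> : k / 2 * x ^+ 2 + (2 * k)^-1 * y ^+ 2 - x * y = (k * x - y) ^+ 2 / (2 * k).
  by field; rewrite gt_eqF.
by rewrite divr_ge0 ?sqr_ge0// mulr_ge0// ltW.
Qed.

(* Parseval's identity for the push-forward of [a] under [(p1, p2)], which is
   not given by a function: it is tested against [eta]. *)
Lemma parseval_pairing (a : X -> R[i]) (eta : R * R -> R[i]) (B k : R) :
  cintegrable m a -> cintegrable P eta -> (forall w, Normc.normc (eta w) <= B) ->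
  seq_continuous2 eta -> 0 < k ->
  (((2 * pi) ^+ 2 * Normc.normc (cint m (fun y => a y * eta (p1 y, p2 y))))%:E <=
   (k / 2)%:E * \int[P]_z (Normc.normc (osc_int m p1 p2 a z.1 z.2) ^+ 2)%:E +
   ((2 * k)^-1 * (2 * pi) ^+ 2)%:E * \int[P]_w (Normc.normc (eta w) ^+ 2)%:E)%E.
Proof.
move=> Ia Ie etaB ceta k0.
have ma := cintegrable_measurable Ia; have meta := cintegrable_measurable Ie.
have Ib := cintegrable_conj Ie.
pose W z := osc_int P (fun w => w.1) (fun w => w.2) (fun w => (eta w)^*%C) z.1 z.2.
pose V z := osc_int m p1 p2 a z.1 z.2.
pose eps n : R := n.+1%:R^-1 ^+ 2.
have e0 n : 0 < eps n by rewrite exprn_gt0// invr_gt0.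
have mpp : measurable_fun [set: X] (fun y => (p1 y, p2 y)) by exact: measurable_fun_pair.
have metap : cmeasurable (fun y => eta (p1 y, p2 y)) by exact: (cmeasurable_comp mpp meta).
(* The smoothing of [eta] at the phase point of [y]: bounded by [(2 pi)^2 B] and convergent to
   [(2 pi)^2 eta], hence suited to dominated convergence against [a]. *)
pose A n y := cint P (fun w => eta w * ((gaussK2 (eps n) (p1 y, p2 y) w)%:C)%C).
have cA y := @approx_identity2 R eta B (p1 y, p2 y) meta etaB ceta.
have B0 : 0 <= B by exact: le_trans (normc_ge0 _) (etaB (0, 0)).
have I1 n z : cintegrable P (fun w => eta w * ((gaussK2 (eps n) z w)%:C)%C).
  have := integrableZl measurableT B (integrable_gaussK2 z (e0 n)).
  move/(@cintegrable_le _ _ _ P); apply.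
    by apply: cmeasurableM => //; apply: cmeasurable_real; exact: measurable_gaussK2.
  by move=> w; rewrite Normc.normcM normc_real (ger0_norm (gaussK2_ge0 _ _ _)) ler_wpM2r ?gaussK2_ge0.
have AB n y : Normc.normc (A n y) <= (2 * pi) ^+ 2 * B.
  rewrite -lee_fin (le_trans (le_normc_cinte (I1 n _)))// EFinM muleC.
  rewrite -(integral_gaussK2 (p1 y, p2 y) (e0 n)) -ge0_integralZl//; last 2 first.
  - by apply/measurable_EFinP; exact: measurable_gaussK2.
  - by move=> w _; rewrite lee_fin gaussK2_ge0.
  apply: ge0_le_integral => //.
  - by move=> w _; rewrite lee_fin normc_ge0.
  - by apply/measurable_EFinP; apply: cmeasurable_normc; exact: cintegrable_measurable (I1 n _).
  - by apply/measurable_EFinP; apply: measurable_funM => //; exact: measurable_gaussK2.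
  - move=> w _; rewrite -EFinM lee_fin.
    by rewrite Normc.normcM normc_real (ger0_norm (gaussK2_ge0 _ _ _)) ler_wpM2r ?gaussK2_ge0.
have reg n := @regularized_inner _ _ _ _ R m P p1 p2 (fun w => w.1) (fun w => w.2) mp1 mp2
  measurable_fst measurable_snd a _ (eps n) Ia Ib (e0 n).
(* [W] is the transform of the conjugate of [eta], because the regularised inner product conjugates
   its second argument. *)
have E n : cint P (fun z => ((gauss2 (eps n) z)%:C)%C * (V z * (W z)^*%C)) = cint m (fun y => a y * A n y).
  have [_ [I2 ->]] := reg n; rewrite -(cfubini1 I2); apply: eq_cint => y /=.
  rewrite -cintZ//; apply: eq_cint => w /=; rewrite conjcK /gaussK2/=.
  by rewrite mulrA.
have mA n : cmeasurable (A n).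
  apply: (@cmeasurable_cint _ _ _ _ _ P (fun yw => eta yw.2 * ((gaussK2 (eps n) (p1 yw.1, p2 yw.1) yw.2)%:C)%C)).
  apply: cmeasurableM; first by apply: (cmeasurable_comp _ meta); exact: measurable_snd.
  apply: cmeasurable_real; apply: measurable_funM; apply: (measurableT_comp (measurable_gaussK _));
    apply: measurable_funB.
  - by apply: (measurableT_comp mp1); exact: measurable_fst.
  - by apply: (measurableT_comp measurable_fst); exact: measurable_snd.
  - by apply: (measurableT_comp mp2); exact: measurable_fst.
  - by apply: (measurableT_comp measurable_snd); exact: measurable_snd.
have lim : cvgC (fun n => cint m (fun y => a y * A n y))
    ((((2 * pi) ^+ 2)%:C)%C * cint m (fun y => a y * eta (p1 y, p2 y))).
  have Iae : cintegrable m (fun y => a y * eta (p1 y, p2 y)).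
    have := integrableZl measurableT B (integrable_normc Ia).
    move/(@cintegrable_le _ _ _ m); apply; first exact: cmeasurableM.
    by move=> y; rewrite Normc.normcM mulrC ler_wpM2r ?normc_ge0.
  rewrite -cintZ//.
  apply: (@cint_dct _ _ _ m (fun n y => a y * A n y) _ (fun y => (2 * pi) ^+ 2 * B * Normc.normc (a y))).
  - by move=> n; apply: cmeasurableM; [exact: ma|exact: mA].
  - by apply: cmeasurableM; [exact: cmeasurable_cst|exact: cintegrable_measurable Iae].
  - by move=> y; rewrite mulrCA; apply: cvgCZ; exact: cA.
  - exact: (integrableZl measurableT ((2 * pi) ^+ 2 * B) (integrable_normc Ia)).
  - by move=> n y; rewrite Normc.normcM mulrC ler_wpM2r ?normc_ge0.
have nlim : (2 * pi) ^+ 2 * Normc.normc (cint m (fun y => a y * eta (p1 y, p2 y))) =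
    Normc.normc ((((2 * pi) ^+ 2)%:C)%C * cint m (fun y => a y * eta (p1 y, p2 y))).
  by rewrite Normc.normcM normc_real ger0_norm ?sqr_ge0.
rewrite nlim; apply: (cvgC_le lim) => n; rewrite -E.
have [I2 _] := reg n; apply: (le_trans (le_normc_cinte I2)).
have mV : cmeasurable V by exact: cmeasurable_osc_int.
have mW : cmeasurable W.
  by apply: cmeasurable_osc_int; [exact: measurable_fst|exact: measurable_snd|exact: cmeasurable_conj].
have mV2 : measurable_fun [set: R * R] (fun z => Normc.normc (V z) ^+ 2).
  by apply: measurable_funX; exact: cmeasurable_normc.
have mW2 : measurable_fun [set: R * R] (fun z => Normc.normc (W z) ^+ 2).
  by apply: measurable_funX; exact: cmeasurable_normc.
have k20 : 0 <= k / 2 by rewrite divr_ge0// ltW.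
have k2i0 : 0 <= (2 * k)^-1 by rewrite invr_ge0 mulr_ge0// ltW.
have pl := plancherel2 Ib.
(* The cut-off is at most 1 and is dropped; the weighted arithmetic-geometric mean separates [V]
   from [W], and Plancherel for [W] accounts for the second [(2 pi)^2]. *)
apply: (@le_trans _ _ (\int[P]_z (k / 2 * Normc.normc (V z) ^+ 2 + (2 * k)^-1 * Normc.normc (W z) ^+ 2)%:E)%E).
  apply: ge0_le_integral.
  - exact: measurableT.
  - by move=> z _; rewrite lee_fin normc_ge0.
  - by apply/measurable_EFinP; apply: cmeasurable_normc; exact: cintegrable_measurable I2.
  - by apply/measurable_EFinP; apply: measurable_funD; exact: measurable_funM.
  - move=> z _; rewrite lee_fin Normc.normcM normc_real Normc.normcM normc_conj.
    apply: le_trans (mul_amgm _ _ k0); rewrite -[leRHS]mul1r ler_wpM2r ?mulr_ge0 ?normc_ge0//.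
    rewrite ger0_norm ?gauss2_ge0// /gauss2 mulr_ile1 ?expR_ge0//.
      by rewrite expR_le1 oppr_le0 mulr_ge0 ?sqr_ge0// ltW.
    by rewrite expR_le1 oppr_le0 mulr_ge0 ?sqr_ge0// ltW.
have m1 : measurable_fun [set: R * R] (fun z => (Normc.normc (V z) ^+ 2)%:E) by exact/measurable_EFinP.
have m2 : measurable_fun [set: R * R] (fun z => (Normc.normc (W z) ^+ 2)%:E) by exact/measurable_EFinP.
have -> : (\int[P]_z (k / 2 * Normc.normc (V z) ^+ 2 + (2 * k)^-1 * Normc.normc (W z) ^+ 2)%:E =
  (k / 2)%:E * \int[P]_z (Normc.normc (V z) ^+ 2)%:E + (2 * k)^-1%:E * \int[P]_z (Normc.normc (W z) ^+ 2)%:E)%E.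
  under eq_integral do rewrite EFinD (EFinM (k / 2)) (EFinM (2 * k)^-1).
  rewrite ge0_integralD//; last 4 first.
  - by move=> z _; rewrite -EFinM lee_fin mulr_ge0 ?sqr_ge0.
  - exact: measurable_funeM.
  - by move=> z _; rewrite -EFinM lee_fin mulr_ge0 ?sqr_ge0.
  - exact: measurable_funeM.
  rewrite !ge0_integralZl//.
  - by move=> z _; rewrite lee_fin sqr_ge0.
  - by move=> z _; rewrite lee_fin sqr_ge0.
apply: leeD; first exact: lexx.
rewrite [X in (_ <= X%:E * _)%E]mulrC EFinM [X in (_ <= X * _)%E]muleC -muleA.
apply: lee_wpmul2l; first by rewrite lee_fin.
move: pl; congr (_ <= _ * _)%E; apply: eq_integral => w _.
by rewrite normc_conj.
Qed.

End parseval_pairing.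

(** * The sextic estimate for integrable profiles *)

Section moments.
Context {R : realType}.
Local Notation mu := (@lebesgue_measure R).
Local Notation P := (prodm mu mu).

(** The denominator 18 is chosen so that the cube costs only [x^2 / 6] and the square only
    [x^2 / 9]. This leaves the Gaussian exponents [5 / 6] and [7 / 18] in the two moment
    integrals. *)
Lemma norm_le_expR_third (x : R) : `|x| <= 3 * expR (x ^+ 2 / 18).
Proof.
have := norm_le_expR_sqr (x / 3); rewrite normrM normfV (ger0_norm (ler0n _ 3)).
rewrite ler_pdivrMr// mulrC.
by have -> : (x / 3) ^+ 2 / 2 = x ^+ 2 / 18 by field.
Qed.

Definition moment3 : R := \int[mu]_s (`|s| ^+ 3 * expR (- (s ^+ 2))).
Definition moment2 : R := \int[mu]_s (s ^+ 2 * expR (- (s ^+ 2 / 2))).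

Lemma measurable_normX_gauss n (a : R) :
  measurable_fun [set: R] (fun s : R => `|s| ^+ n * expR (- (a * s ^+ 2))).
Proof.
apply: measurable_funM; last exact: measurable_gauss.
by apply: measurable_funX; exact: normr_measurable.
Qed.

Lemma integrable_moment3 :
  mu.-integrable [set: R] (EFin \o (fun s : R => `|s| ^+ 3 * expR (- (s ^+ 2)))).
Proof.
have a0 : 0 < 5 / 6 :> R by [].
have := integrableZl measurableT 27 (integrable_gauss0 a0).
apply: le_integrable => //.
  apply/measurable_EFinP; apply: eq_measurable_fun (measurable_normX_gauss 3 1) => s _.
  by rewrite mul1r.
move=> s _; rewrite /= lee_fin [leLHS]ger0_norm ?mulr_ge0 ?exprn_ge0 ?expR_ge0// [leRHS]ger0_norm ?mulr_ge0 ?expR_ge0//.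
have -> : 27 * expR (- (5 / 6 * s ^+ 2)) = (3 * expR (s ^+ 2 / 18)) ^+ 3 * expR (- (s ^+ 2)).
  rewrite exprMn -expRM_natr -[RHS]mulrA -expRD.
  have -> : s ^+ 2 / 18 * 3%:R - s ^+ 2 = - (5 / 6 * s ^+ 2) by field.
  by congr (_ * _); ring.
rewrite ler_wpM2r ?expR_ge0// lerXn2r ?nnegrE ?mulr_ge0 ?expR_ge0//.
exact: norm_le_expR_third.
Qed.

Lemma integrable_moment2 :
  mu.-integrable [set: R] (EFin \o (fun s : R => s ^+ 2 * expR (- (s ^+ 2 / 2)))).
Proof.
have a0 : 0 < 7 / 18 :> R by [].
have := integrableZl measurableT 9 (integrable_gauss0 a0).
apply: le_integrable => //.
  apply/measurable_EFinP; apply: eq_measurable_fun (measurable_normX_gauss 2 2^-1) => s _.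
  by rewrite real_normK ?num_real// [2^-1 * _]mulrC.
move=> s _; rewrite /= lee_fin ger0_norm; last exact: (mulr_ge0 (sqr_ge0 _) (expR_ge0 _)).
rewrite ger0_norm; last exact: (mulr_ge0 (ler0n _ 9) (expR_ge0 _)).
have -> : 9 * expR (- (7 / 18 * s ^+ 2)) = (3 * expR (s ^+ 2 / 18)) ^+ 2 * expR (- (s ^+ 2 / 2)).
  rewrite exprMn -expRM_natr -[RHS]mulrA -expRD.
  have -> : s ^+ 2 / 18 * 2%:R - s ^+ 2 / 2 = - (7 / 18 * s ^+ 2) by field.
  by congr (_ * _); ring.
rewrite ler_wpM2r ?expR_ge0// -[s ^+ 2]real_normK ?num_real//.
rewrite lerXn2r ?nnegrE ?mulr_ge0 ?expR_ge0//.
by rewrite real_normK ?num_real//; exact: norm_le_expR_third.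
Qed.

Lemma moment3E : (\int[mu]_s (`|s| ^+ 3 * expR (- (s ^+ 2)))%:E = moment3%:E)%E.
Proof. by rewrite /moment3 /Rintegral fineK// integrable_fin_num//; exact: integrable_moment3. Qed.

Lemma moment2E : (\int[mu]_s (s ^+ 2 * expR (- (s ^+ 2 / 2)))%:E = moment2%:E)%E.
Proof. by rewrite /moment2 /Rintegral fineK// integrable_fin_num//; exact: integrable_moment2. Qed.

Lemma moment2_ge0 : 0 <= moment2.
Proof. by rewrite /moment2; apply: Rintegral_ge0 => s _; rewrite mulr_ge0 ?sqr_ge0 ?expR_ge0. Qed.

(** Positivity matters because this moment ends up in a denominator. The interval [[1, 2]] alone
    already gives a positive contribution. *)
Lemma moment3_gt0 : 0 < moment3.
Proof.
rewrite -lte_fin -moment3E; apply: (@lt_le_trans _ _ (\int[mu]_(s in `[1%R, 2%R]) (expR (- (4 : R)))%:E)%E).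
  rewrite integral_cst//= lebesgue_measure_itv/= lte_fin ltr1n -EFinB -EFinM lte_fin.
  by rewrite mulr_gt0 ?expR_gt0// subr_gt0 ltr1n.
apply: (@le_trans _ _ (\int[mu]_(s in `[1%R, 2%R]) (`|s| ^+ 3 * expR (- (s ^+ 2)))%:E)%E).
  apply: ge0_le_integral => //.
  - apply/measurable_EFinP; apply: measurable_funTS.
    by apply: eq_measurable_fun (measurable_normX_gauss 3 1) => s _; rewrite mul1r.
  - move=> s /=; rewrite in_itv/= => /andP[s1 s2]; rewrite lee_fin.
    rewrite -[leLHS]mul1r ler_pM ?expR_ge0//.
      by rewrite exprn_ege1// ger0_norm// (le_trans _ s1).
    rewrite ler_expR lerN2; nra.
apply: ge0_subset_integral => //.
apply/measurable_EFinP.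
by apply: eq_measurable_fun (measurable_normX_gauss 3 1) => s _; rewrite mul1r.
Qed.

(** With [sigma = s sqrt(rho)], [|s|^3 rho^2 ds] is [|sigma|^3 d sigma]: the spread disappears from
    the integral. *)
Lemma moment3_scale (rho : R) : 0 < rho ->
  (\int[mu]_s (`|s| ^+ 3 * (rho ^+ 2 * expR (- (s ^+ 2 * rho))))%:E = moment3%:E)%E.
Proof.
move=> rho0; have q0 : 0 < Num.sqrt rho by rewrite sqrtr_gt0.
rewrite -moment3E; symmetry; rewrite (@ge0_integral_affine R (Num.sqrt rho) 0 _ q0); last 2 first.
- apply/measurable_EFinP.
  by apply: eq_measurable_fun (measurable_normX_gauss 3 1) => s _; rewrite mul1r.
- by move=> s; rewrite lee_fin mulr_ge0 ?exprn_ge0 ?expR_ge0.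
rewrite -ge0_integralZl; last 4 first.
- exact: measurableT.
- apply/measurable_EFinP; apply: (@measurableT_comp _ _ _ _ _ _ (fun s : R => `|s| ^+ 3 * expR (- (s ^+ 2)))).
    by apply: eq_measurable_fun (measurable_normX_gauss 3 1) => s _; rewrite mul1r.
  by apply: measurable_funD => //; exact: measurable_funM.
- by move=> s _; rewrite lee_fin mulr_ge0 ?exprn_ge0 ?expR_ge0.
- by rewrite lee_fin (ltW q0).
apply: eq_integral => s _; rewrite -EFinM addr0 exprMn sqr_sqrtr ?(ltW rho0)//.
rewrite normrM exprMn (ger0_norm (ltW q0)) [rho * _]mulrC; congr (_%:E).
have -> : Num.sqrt rho ^+ 3 = Num.sqrt rho * rho by rewrite exprS sqr_sqrtr ?(ltW rho0).
have -> : rho ^+ 2 = Num.sqrt rho * Num.sqrt rho * rho by rewrite -expr2 sqr_sqrtr ?(ltW rho0).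
by ring.
Qed.

(** With [sigma = s |d|], [s^2 |d|^3 ds] is [sigma^2 d sigma]. Only an inequality is claimed because
    the left side is 0 when [d = 0]. *)
Lemma moment2_scale (d : R) :
  (\int[mu]_s (s ^+ 2 * (`|d| ^+ 3 * expR (- (s ^+ 2 * (d ^+ 2 / 2)))))%:E <= moment2%:E)%E.
Proof.
have [->|dn0] := eqVneq d 0.
  rewrite (eq_integral (fun=> 0%E)) ?integral0 ?lee_fin ?moment2_ge0// => s _.
  by rewrite normr0 expr0n/= mul0r mulr0.
have d0 : 0 < `|d| by rewrite normr_gt0.
rewrite -moment2E [leRHS](@ge0_integral_affine R `|d| 0 _ d0); last 2 first.
- apply/measurable_EFinP; apply: eq_measurable_fun (measurable_normX_gauss 2 2^-1) => s _.
  by rewrite real_normK ?num_real// [2^-1 * _]mulrC.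
- by move=> s; rewrite lee_fin mulr_ge0 ?sqr_ge0 ?expR_ge0.
rewrite -ge0_integralZl; last 4 first.
- exact: measurableT.
- apply/measurable_EFinP; apply: (@measurableT_comp _ _ _ _ _ _ (fun s : R => s ^+ 2 * expR (- (s ^+ 2 / 2)))).
    apply: eq_measurable_fun (measurable_normX_gauss 2 2^-1) => s _.
    by rewrite real_normK ?num_real// [2^-1 * _]mulrC.
  by apply: measurable_funD => //; exact: measurable_funM.
- by move=> s _; rewrite lee_fin mulr_ge0 ?sqr_ge0 ?expR_ge0.
- by rewrite lee_fin normr_ge0.
rewrite le_eqVlt; apply/orP; left; apply/eqP; apply: eq_integral => s _.
rewrite -EFinM addr0 exprMn real_normK ?num_real//; congr (_%:E).
have -> : `|d| ^+ 3 = `|d| * d ^+ 2 by rewrite (exprS `|d| 2) real_normK ?num_real.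
have -> : d ^+ 2 * s ^+ 2 / 2 = s ^+ 2 * (d ^+ 2 / 2) by field.
by ring.
Qed.

(** A Gaussian in the centre with inverse width [|s|] has mass proportional to [1 / |s|], and the
    factor [|y.2|] cancels this. At [s = 0], where the Gaussian degenerates, both sides vanish
    thanks to [H 0 = 0]. *)
Lemma integral_gauss_center (A m : R) (H : R -> R) : 0 < A ->
  measurable_fun [set: R] H -> (forall s, 0 <= H s) -> H 0 = 0 ->
  (\int[P]_y (`|y.2| * H y.2 * expR (- (A * y.2 ^+ 2 * (y.1 - m) ^+ 2)))%:E =
   (Num.sqrt (pi / A))%:E * \int[mu]_s (H s)%:E)%E.
Proof.
move=> A0 mH H0 H00.
rewrite tonelli2; last 2 first.
- apply/measurable_EFinP; apply: measurable_funM.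
    by apply: measurable_funM; apply: measurableT_comp => //; exact: measurableT_comp.
  apply: measurableT_comp => //; apply: measurableT_comp => //.
  apply: measurable_funM.
    by apply: measurable_funM => //; apply: measurable_funX; exact: measurable_snd.
  by apply: measurable_funX; apply: measurable_funB => //; exact: measurable_fst.
- by move=> y; rewrite lee_fin !mulr_ge0 ?expR_ge0.
rewrite -ge0_integralZl; last 4 first.
- exact: measurableT.
- exact/measurable_EFinP.
- by move=> s _; rewrite lee_fin.
- by rewrite lee_fin sqrtr_ge0.
apply: eq_integral => s _ /=.
have [->|sn0] := eqVneq s 0.
  by rewrite (eq_integral (fun=> 0%E)) ?integral0 ?H00 ?mule0// => c _; rewrite normr0 !mul0r.
have s0 : 0 < s ^+ 2 by rewrite exprn_even_gt0.
under eq_integral do rewrite EFinM.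
rewrite ge0_integralZl; last 4 first.
- exact: measurableT.
- apply/measurable_EFinP; apply: measurableT_comp => //; apply: measurableT_comp => //.
  by apply: measurable_funM => //; apply: measurable_funX; exact: measurable_funB.
- by move=> c _; rewrite lee_fin expR_ge0.
- by rewrite lee_fin mulr_ge0.
rewrite (integral_gauss m (mulr_gt0 A0 s0)) -[LHS]EFinM -[RHS]EFinM; congr (_%:E).
have -> : pi / A = pi / (A * s ^+ 2) * s ^+ 2 by field; rewrite sn0 gt_eqF.
have p0 : 0 <= pi / (A * s ^+ 2).
  by apply: divr_ge0; [exact: pi_ge0|exact: ltW (mulr_gt0 A0 s0)].
by rewrite [X in _ = X * _](sqrtrM _ p0) sqrtr_sqr; ring.
Qed.

End moments.

Section osc_products.
Context d1 d2 (X1 : measurableType d1) (X2 : measurableType d2) (R : realType).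
Variables (m1 : {sigma_finite_measure set X1 -> \bar R}).
Variables (m2 : {sigma_finite_measure set X2 -> \bar R}).

(** Additive phases make the exponential factor, so evolution turns tensor products into pointwise
    products. *)
Lemma osc_int_prod (p1 p2 : X1 -> R) (q1 q2 : X2 -> R) (r1 r2 : X1 * X2 -> R)
    (a : X1 -> R[i]) (b : X2 -> R[i]) (t x : R) :
  measurable_fun [set: X1] p1 -> measurable_fun [set: X1] p2 ->
  measurable_fun [set: X2] q1 -> measurable_fun [set: X2] q2 ->
  (forall w, r1 w = p1 w.1 + q1 w.2) -> (forall w, r2 w = p2 w.1 + q2 w.2) ->
  cintegrable m1 a -> cintegrable m2 b ->
  osc_int (prodm m1 m2) r1 r2 (fun w => a w.1 * b w.2) t x =
  osc_int m1 p1 p2 a t x * osc_int m2 q1 q2 b t x.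
Proof.
move=> mp1 mp2 mq1 mq2 r1E r2E Ia Ib; rewrite /osc_int -cint_prod.
- by apply: eq_cint => w; rewrite /osc r1E r2E !mulrDr addrACA expiD; ring.
- exact: cintegrable_osc.
- exact: cintegrable_osc.
Qed.

End osc_products.

Section osc_linear.
Context d (X : measurableType d) (R : realType).
Variable m : {sigma_finite_measure set X -> \bar R}.
Variables (p1 p2 : X -> R).
Hypotheses (mp1 : measurable_fun [set: X] p1) (mp2 : measurable_fun [set: X] p2).

Lemma osc_intD (a b : X -> R[i]) (t x : R) : cintegrable m a -> cintegrable m b ->
  osc_int m p1 p2 (fun y => a y + b y) t x = osc_int m p1 p2 a t x + osc_int m p1 p2 b t x.
Proof.
move=> Ia Ib; rewrite /osc_int -cintD; try exact: cintegrable_osc.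
by apply: eq_cint => y; rewrite mulrDr.
Qed.

Lemma osc_intZ (z : R[i]) (a : X -> R[i]) (t x : R) : cintegrable m a ->
  osc_int m p1 p2 (fun y => z * a y) t x = z * osc_int m p1 p2 a t x.
Proof.
move=> Ia; rewrite /osc_int -cintZ; last exact: cintegrable_osc.
by apply: eq_cint => y; rewrite mulrCA.
Qed.

End osc_linear.

Section fourier_plane.
Context {R : realType}.
Local Notation mu := (@lebesgue_measure R).
Local Notation P := (prodm mu mu).

Lemma seq_continuous2_osc_int (g : R * R -> R[i]) : cintegrable P g ->
  seq_continuous2 (fun w => osc_int P (fun z => z.1) (fun z => z.2) g w.1 w.2).
Proof.
move=> Ig u v s q us vq; rewrite /osc_int.
apply: (@cint_dct _ _ _ P (fun n y => osc (fun z => z.1) (fun z => z.2) (u n) (v n) y * g y) _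
  (fun y => Normc.normc (g y))).
- move=> n; apply: cmeasurableM; last exact: cintegrable_measurable Ig.
  by apply: cmeasurable_osc; [exact: measurable_fst|exact: measurable_snd].
- apply: cmeasurableM; last exact: cintegrable_measurable Ig.
  by apply: cmeasurable_osc; [exact: measurable_fst|exact: measurable_snd].
- move=> y; apply: cvgCM; last exact: cvgC_cst.
  by apply: cvgC_expi; apply: cvgD; apply: cvgM => //; exact: cvg_cst.
- exact: integrable_normc Ig.
- by move=> n y; rewrite Normc.normcM normc_osc mul1r.
Qed.

End fourier_plane.

(** * Frequency triples, their spread, and Gaussian packets *)

Section triple_products.
Context {R : realType}.
Local Notation mu := (@lebesgue_measure R).
Local Notation P := (prodm mu mu).
Local Notation P3 := (prodm P mu).

Definition energy (xi : R) : R := - (xi ^+ 2 / 2).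
(** There is no factor [1 / (2 pi)]: on the profile given by the Fourier transform of a function,
    this is [2 pi] times the free evolution of that function. The powers of [2 pi] at the end of the
    proof come from here. *)
Definition extension (h : R -> R[i]) (t x : R) : R[i] := osc_int mu energy (fun xi => xi) h t x.
Definition xi_sum3 (w : R * R * R) : R := xi_sum w.1 + w.2.
Definition xi_energy3 (w : R * R * R) : R := xi_energy w.1 + energy w.2.

Lemma measurable_energy : measurable_fun [set: R] energy.
Proof.
by apply: measurableT_comp => //; exact: measurable_funM.
Qed.

Lemma measurable_xi_sum3 : measurable_fun [set: R * R * R] xi_sum3.
Proof.
apply: measurable_funD => //.
by apply: (measurableT_comp measurable_xi_sum); exact: measurable_fst.
Qed.

Lemma measurable_xi_energy3 : measurable_fun [set: R * R * R] xi_energy3.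
Proof.
apply: measurable_funD.
  by apply: (measurableT_comp measurable_xi_energy); exact: measurable_fst.
by apply: (measurableT_comp measurable_energy); exact: measurable_snd.
Qed.

Lemma extension_prod2 (f g : R -> R[i]) (t x : R) :
  cintegrable mu f -> cintegrable mu g ->
  osc_int P xi_energy xi_sum (fun w => f w.1 * g w.2) t x = extension f t x * extension g t x.
Proof.
move=> If Ig; apply: (@osc_int_prod _ _ _ _ _ mu mu energy (fun xi => xi) energy (fun xi => xi)) => //.
- exact: measurable_energy.
- exact: measurable_energy.
- by move=> w; rewrite /xi_energy /energy; field.
Qed.

Lemma extension_prod3 (f g k : R -> R[i]) (t x : R) :
  cintegrable mu f -> cintegrable mu g -> cintegrable mu k ->
  osc_int P3 xi_energy3 xi_sum3 (fun w => f w.1.1 * g w.1.2 * k w.2) t x =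
  extension f t x * extension g t x * extension k t x.
Proof.
move=> If Ig Ik; rewrite -extension_prod2//.
apply: (@osc_int_prod _ _ _ _ _ P mu xi_energy xi_sum energy (fun xi => xi) _ _
  (fun w => f w.1 * g w.2)) => //.
- exact: measurable_xi_energy.
- exact: measurable_xi_sum.
- exact: measurable_energy.
- exact: cintegrable_prod.
Qed.

Lemma cintegrable_prod3 (f g k : R -> R[i]) :
  cintegrable mu f -> cintegrable mu g -> cintegrable mu k ->
  cintegrable P3 (fun w => f w.1.1 * g w.1.2 * k w.2).
Proof.
by move=> If Ig Ik; apply: (@cintegrable_prod _ _ _ _ _ P mu (fun w => f w.1 * g w.2));
  [exact: cintegrable_prod|].
Qed.

(* The mean square deviation of the three frequencies, as a polynomial in
   their energy and momentum. *)
Definition spread (p : R * R) : R := - (2 * p.1) - p.2 ^+ 2 / 3.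

Lemma spreadE w : spread (xi_energy3 w, xi_sum3 w) =
  ((w.1.1 - w.1.2) ^+ 2 + (w.1.2 - w.2) ^+ 2 + (w.1.1 - w.2) ^+ 2) / 3.
Proof. by rewrite /spread /xi_energy3 /xi_sum3 /xi_energy /xi_sum /energy /=; field. Qed.

(** The decomposition of a sum of squares about the mean. It shows that a product of three equal
    Gaussian packets depends on the frequencies only through energy and momentum, which is what
    allows half of the weight to be moved to [gamma]. *)
Lemma spread_center w (c : R) :
  (w.1.1 - c) ^+ 2 + (w.1.2 - c) ^+ 2 + (w.2 - c) ^+ 2 =
  spread (xi_energy3 w, xi_sum3 w) + 3 * (c - xi_sum3 w / 3) ^+ 2.
Proof. by rewrite spreadE /xi_sum3 /xi_sum; field. Qed.

Lemma spread_ge0 w : 0 <= spread (xi_energy3 w, xi_sum3 w).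
Proof. by rewrite spreadE divr_ge0// !addr_ge0 ?sqr_ge0. Qed.

Lemma measurable_spread : measurable_fun [set: R * R] spread.
Proof.
apply: measurable_funB.
  by apply: measurableT_comp => //; apply: measurable_funM => //; exact: measurable_fst.
by apply: measurable_funM => //; apply: measurable_funX; exact: measurable_snd.
Qed.

(** The exponent carries a factor [1 / 2] because only half of the localising weight is attached to
    the frequencies. *)
Definition packet (s c : R) (xi : R) : R := expR (- (s ^+ 2 * (xi - c) ^+ 2 / 2)).

Lemma packet_ge0 s c xi : 0 <= packet s c xi. Proof. exact: expR_ge0. Qed.

Lemma packet_le1 s c xi : packet s c xi <= 1.
Proof. by rewrite expR_le1 oppr_le0 divr_ge0// mulr_ge0 ?sqr_ge0. Qed.

Lemma measurable_packet s c : measurable_fun [set: R] (packet s c).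
Proof.
apply: measurableT_comp => //; apply: measurableT_comp => //; apply: measurable_funM => //.
by apply: measurable_funM => //; apply: measurable_funX; exact: measurable_funB.
Qed.

Lemma packet_sqr_bound (s c xi : R) : s != 0 ->
  xi ^+ 2 * packet s c xi <= 2 * c ^+ 2 + 8 / s ^+ 2.
Proof.
move=> s0; have s20 : 0 < s ^+ 2 by rewrite exprn_even_gt0.
set y := s * (xi - c).
have y2 : y ^+ 2 <= 4 * expR (y ^+ 2 / 2).
  have := norm_le_expR_sqr (y / 2) => h.
  have : `|y / 2| ^+ 2 <= expR ((y / 2) ^+ 2 / 2) ^+ 2.
    by rewrite lerXn2r ?nnegrE ?expR_ge0.
  rewrite real_normK ?num_real// -expRM_natr.
  have -> : (y / 2) ^+ 2 / 2 * 2%:R = y ^+ 2 / 4 by field.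
  have : expR (y ^+ 2 / 4) <= expR (y ^+ 2 / 2).
    by rewrite ler_expR ler_wpM2l ?sqr_ge0// lef_pV2 ?posrE// ler_nat.
  rewrite expr_div_n; move: (expR (y ^+ 2 / 4)) (expR (y ^+ 2 / 2)) (y ^+ 2) => a b e; lra.
have pE : packet s c xi = (expR (y ^+ 2 / 2))^-1 by rewrite /packet /y exprMn expRN.
have xi2 : xi ^+ 2 <= 2 * c ^+ 2 + 2 * (y ^+ 2 / s ^+ 2).
  have -> : y ^+ 2 / s ^+ 2 = (xi - c) ^+ 2 by rewrite /y exprMn mulrAC divff ?mul1r// gt_eqF.
  by have := sqr_ge0 (xi - 2 * c); nra.
apply: (@le_trans _ _ ((2 * c ^+ 2 + 2 * (y ^+ 2 / s ^+ 2)) * packet s c xi)).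
  by rewrite ler_wpM2r ?packet_ge0.
rewrite mulrDl lerD//.
  by rewrite ler_piMr ?packet_le1// mulr_ge0 ?sqr_ge0.
rewrite pE ler_pdivrMr ?expR_gt0// mulrA ler_pdivrMr//.
have -> : 8 / s ^+ 2 * expR (y ^+ 2 / 2) * s ^+ 2 = 8 * expR (y ^+ 2 / 2).
  by field.
by move: y2; move: (expR (y ^+ 2 / 2)) (y ^+ 2) => a b; lra.
Qed.

(** [r^2] and [(xi_1 - xi_2)^2] expand into monomials of degree at most 2 in each frequency; the
    packet keeps each of them integrable against [h], about which only integrability is known. *)
Lemma cintegrable_packet_moment (h : R -> R[i]) (j : nat) (s c : R) :
  s != 0 -> (j <= 2)%N -> cintegrable mu h ->
  cintegrable mu (fun xi => ((xi ^+ j)%:C)%C * (h xi * ((packet s c xi)%:C)%C)).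
Proof.
move=> s0 j2 Ih; pose C := 1 + (2 * c ^+ 2 + 8 / s ^+ 2).
have := integrableZl measurableT C (integrable_normc Ih).
move/(@cintegrable_le _ _ _ mu); apply.
  apply: cmeasurableM; first by apply: cmeasurable_real; exact: measurable_funX.
  by apply: cmeasurableM; [exact: cintegrable_measurable Ih|apply: cmeasurable_real; exact: measurable_packet].
move=> xi; rewrite !Normc.normcM !normc_real mulrCA mulrC ler_wpM2r ?normc_ge0//.
rewrite (ger0_norm (packet_ge0 _ _ _)).
apply: (@le_trans _ _ ((1 + xi ^+ 2) * packet s c xi)).
  rewrite ler_wpM2r ?packet_ge0//; case: j j2 => [|[|[|//]]] _.
  - by rewrite expr0 normr1 lerDl sqr_ge0.
  - rewrite expr1 -[xi ^+ 2]real_normK ?num_real//.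
    by have := sqr_ge0 (`|xi| - 1); have := normr_ge0 xi; move: `|xi| => a; nra.
  - by rewrite ger0_norm ?sqr_ge0// lerDr.
by rewrite mulrDl mul1r lerD ?packet_le1// packet_sqr_bound.
Qed.

End triple_products.

Section integrable_cauchy.
Context {R : realType}.
Local Notation mu := (@lebesgue_measure R).

Lemma continuous_cauchy : continuous (fun x : R => (1 + x ^+ 2)^-1).
Proof.
move=> x; apply: cvgV; first by rewrite gt_eqF// ltr_wpDr// sqr_ge0.
by apply: cvgD; [exact: cvg_cst|exact: exprn_continuous].
Qed.

Lemma measurable_cauchy : measurable_fun [set: R] (fun x : R => (1 + x ^+ 2)^-1).
Proof. exact: continuous_measurable_fun continuous_cauchy. Qed.

Lemma integral_cauchy : (\int[mu]_x ((1 + x ^+ 2)^-1)%:E = pi%:E)%E.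
Proof.
rewrite ge0_symfun_integralT.
- have -> : [set x : R | 0 <= x] = `[0, +oo[%classic.
    by apply/seteqP; split => x /=; rewrite in_itv/= andbT.
  have -> : (\int[mu]_(x in `[0%R, +oo[) ((1 + x ^+ 2)^-1)%:E = (pi / 2)%:E)%E.
    by rewrite -integral0y_oneDsqr; exact: eq_integral.
  by rewrite -[2%E]/(2%:E) -EFinM; congr (_%:E); field.
- by move=> x; rewrite invr_ge0 addr_ge0 ?sqr_ge0.
- exact: continuous_cauchy.
- by move=> x /=; rewrite sqrrN.
Qed.

Lemma integrable_cauchy : mu.-integrable [set: R] (EFin \o (fun x : R => (1 + x ^+ 2)^-1)).
Proof.
apply/integrableP; split; first by apply/measurable_EFinP; exact: measurable_cauchy.
apply: le_lt_trans (ltry pi); rewrite -integral_cauchy le_eqVlt; apply/orP; left; apply/eqP; apply: eq_integral => x _.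
by rewrite /= ger0_norm// invr_ge0 addr_ge0 ?sqr_ge0.
Qed.

(** [(x + |x|) / 2] is the positive part of [x]. For positive [x], the terms of order 1 and 3 of the
    series of [exp (a x)] bound [x] and [x^3] separately, and their sum is [x (1 + x^2)]. *)
Lemma expR_decay (a x : R) : 0 < a ->
  (x + `|x|) / 2 * expR (- (a * ((x + `|x|) / 2))) <= (a^-1 + 6 / a ^+ 3) * (1 + x ^+ 2)^-1.
Proof.
move=> a0; have p0 : 0 < 1 + x ^+ 2 by rewrite ltr_wpDr// sqr_ge0.
have C0 : 0 <= a^-1 + 6 / a ^+ 3.
  by rewrite addr_ge0 ?invr_ge0 ?divr_ge0 ?exprn_ge0 ?(ltW a0).
have [x0|x0] := leP x 0.
  rewrite ler0_norm// subrr !mul0r mulr_ge0// invr_ge0; exact: ltW.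
rewrite gtr0_norm//; have -> : (x + x) / 2 = x by field.
rewrite expRN ler_pdivlMr// mulrAC ler_pdivrMr ?expR_gt0//.
have e1 := expR_ge1Dxn 0 (ltW (mulr_gt0 a0 x0)).
have e3 := expR_ge1Dxn 2 (ltW (mulr_gt0 a0 x0)).
move: e1 e3; rewrite expr1 (_ : 1`! = 1%N)// (_ : 3`! = 6%N)// divr1.
move: (expR _) => e e1 e3.
have h1 : x <= a^-1 * e.
  by rewrite -(ler_pM2l a0) mulrA mulfV ?gt_eqF// mul1r; apply: le_trans e1; rewrite lerDr.
have h3 : x ^+ 3 <= 6 / a ^+ 3 * e.
  have a3 : 0 < a ^+ 3 by rewrite exprn_gt0.
  rewrite mulrAC ler_pdivlMr// -exprMn [x * a]mulrC.
  have : (a * x) ^+ 3 / 6 <= e by apply: le_trans e3; rewrite lerDr.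
  by rewrite ler_pdivrMr// [6 * e]mulrC.
have -> : x * (1 + x ^+ 2) = x + x ^+ 3 by ring.
by rewrite mulrDl lerD.
Qed.

End integrable_cauchy.

(** * The half of the localising weight that lives on the energy-momentum plane *)

Section caps.
Context {R : realType}.
Local Notation mu := (@lebesgue_measure R).
Local Notation P := (prodm mu mu).

(** [spread] is nonnegative on energy-momentum pairs of actual triples, but negative elsewhere in
    the plane, where the Gaussian weight would grow without bound. Since [gamma] is integrated over
    the whole plane, the positive part is used; on triples nothing changes. *)
Definition spread_pos (p : R * R) : R := (spread p + `|spread p|) / 2.

Lemma spread_pos_ge0 p : 0 <= spread_pos p.
Proof. by rewrite divr_ge0// addrC -lerBlDr sub0r -normrN ler_norm. Qed.

Lemma spread_posE w : spread_pos (xi_energy3 w, xi_sum3 w) = spread (xi_energy3 w, xi_sum3 w).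
Proof. by rewrite /spread_pos ger0_norm ?spread_ge0//; field. Qed.

Lemma measurable_spread_pos : measurable_fun [set: R * R] spread_pos.
Proof.
apply: measurable_funM => //; apply: measurable_funD; first exact: measurable_spread.
by apply: (@measurableT_comp _ _ _ _ _ _ (fun x : R => `|x|)) => //; exact: measurable_spread.
Qed.

(** Its factor [r^2], together with the [r^2] of [spread_triple], makes up the [r^4] of the full
    weight. *)
Definition cap (s c : R) (p : R * R) : R :=
  spread_pos p * expR (- (s ^+ 2 * (spread_pos p + 3 * (c - p.2 / 3) ^+ 2) / 2)).

Lemma cap_ge0 s c p : 0 <= cap s c p.
Proof. by rewrite mulr_ge0 ?spread_pos_ge0 ?expR_ge0. Qed.

Lemma cap_split s c p : cap s c p =
  spread_pos p * expR (- (s ^+ 2 / 2 * spread_pos p)) *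
  expR (- (s ^+ 2 / 6 * (p.2 - 3 * c) ^+ 2)).
Proof. by rewrite /cap -[RHS]mulrA -expRD; congr (_ * expR _); field. Qed.

Lemma measurable_cap (s : R) (c : R) : measurable_fun [set: R * R] (cap s c).
Proof.
apply: measurable_funM; first exact: measurable_spread_pos.
apply: measurableT_comp => //; apply: measurableT_comp => //; apply: measurable_funM => //.
apply: measurable_funM => //; apply: measurable_funD; first exact: measurable_spread_pos.
apply: measurable_funM => //; apply: measurable_funX; apply: measurable_funB => //.
by apply: measurable_funM => //; exact: measurable_snd.
Qed.

Lemma cap_sqr s c p : cap s c p ^+ 2 =
  spread_pos p ^+ 2 * expR (- (s ^+ 2 * spread_pos p)) *
  expR (- (3 * s ^+ 2 * (c - p.2 / 3) ^+ 2)).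
Proof. by rewrite /cap exprMn -expRM_natr -[RHS]mulrA -expRD; congr (_ * expR _); field. Qed.

Let decay_const (s : R) := (s ^+ 2 / 2)^-1 + 6 / (s ^+ 2 / 2) ^+ 3.

(** The product of the spread with its exponential gives decay in the energy, the remaining Gaussian
    gives decay in the momentum; together they make the cap bounded and integrable, as the Parseval
    pairing demands. *)
Lemma cap_le s c p : s != 0 ->
  cap s c p <= decay_const s * ((1 + spread p ^+ 2)^-1 * expR (- (s ^+ 2 / 6 * (p.2 - 3 * c) ^+ 2))).
Proof.
move=> s0; have s20 : 0 < s ^+ 2 / 2 by rewrite divr_gt0// exprn_even_gt0.
by rewrite cap_split mulrA ler_wpM2r ?expR_ge0// expR_decay.
Qed.

Lemma cap_bounded s c : s != 0 -> exists C, forall p, cap s c p <= C.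
Proof.
move=> s0; have s20 : 0 < s ^+ 2 / 2 by rewrite divr_gt0// exprn_even_gt0.
have C0 : 0 <= decay_const s.
  by apply: addr_ge0; [rewrite invr_ge0|apply: divr_ge0 => //; apply: exprn_ge0]; exact: ltW.
exists (decay_const s) => p; apply: le_trans (cap_le c p s0) _.
rewrite ler_piMr// mulr_ile1 ?expR_ge0//.
- by rewrite invr_ge0 addr_ge0 ?sqr_ge0.
- by rewrite invf_le1 ?ltr_wpDr ?sqr_ge0// lerDl sqr_ge0.
- by rewrite expR_le1 oppr_le0 mulr_ge0 ?sqr_ge0// divr_ge0 ?sqr_ge0.
Qed.

(** At fixed momentum the spread is affine in the energy with slope -2, so reflection and dilation
    lead to half of the Cauchy integral; the half is discarded. *)
Lemma integral_spread_cauchy (b : R) :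
  (\int[mu]_x ((1 + spread (x, b) ^+ 2)^-1)%:E <= pi%:E)%E.
Proof.
rewrite -integral_cauchy.
have mc (k l : R) : measurable_fun [set: R] (fun x : R => ((1 + (k * x + l) ^+ 2)^-1)%:E).
  apply/measurable_EFinP; apply: (measurableT_comp measurable_cauchy).
  by apply: measurable_funD => //; exact: measurable_funM.
have p0 (z : R) : (0 <= ((1 + z ^+ 2)^-1)%:E)%E.
  by rewrite lee_fin invr_ge0 addr_ge0 ?sqr_ge0.
rewrite -(@ge0_integral_opp _ (fun x => ((1 + spread (x, b) ^+ 2)^-1)%:E)); last 2 first.
- move: (mc (-2) (- (b ^+ 2 / 3))); apply: eq_measurable_fun => x _.
  by rewrite /spread /= mulNr.
- by move=> x; exact: p0.
have two0 : (0 : R) < 2 by [].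
rewrite [leRHS](@ge0_integral_affine _ 2 (- (b ^+ 2 / 3)) _ two0); last 2 first.
- by apply/measurable_EFinP; exact: measurable_cauchy.
- by move=> x; exact: p0.
have -> : (\int[mu]_x ((1 + spread (- x, b) ^+ 2)^-1)%:E =
    \int[mu]_x ((1 + (2 * x - b ^+ 2 / 3) ^+ 2)^-1)%:E)%E.
  by apply: eq_integral => x _; rewrite /spread /= mulrN opprK.
apply: lee_pemull; last by rewrite lee_fin ler1n.
by apply: integral_ge0 => x _; exact: p0.
Qed.

Lemma integrable_cap s c : s != 0 -> P.-integrable [set: R * R] (EFin \o cap s c).
Proof.
move=> s0; have s20 : 0 < s ^+ 2 by rewrite exprn_even_gt0.
pose G (p : R * R) := (1 + spread p ^+ 2)^-1 * expR (- (s ^+ 2 / 6 * (p.2 - 3 * c) ^+ 2)).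
have mg : measurable_fun [set: R] (fun x : R => expR (- (s ^+ 2 / 6 * (x - 3 * c) ^+ 2))).
  by apply: (measurableT_comp (measurable_gauss _)); exact: measurable_funB.
have mG : measurable_fun [set: R * R] G.
  apply: measurable_funM.
    by apply: (measurableT_comp measurable_cauchy); exact: measurable_spread.
  by apply: (measurableT_comp mg); exact: measurable_snd.
have G0 p : 0 <= G p by rewrite mulr_ge0 ?expR_ge0// invr_ge0 addr_ge0 ?sqr_ge0.
have IG : P.-integrable [set: R * R] (EFin \o G).
  apply/integrableP; split; first exact/measurable_EFinP.
  have -> : (\int[P]_p `|(EFin \o G) p| = \int[P]_p (G p)%:E)%E.
    by apply: eq_integral => p _; rewrite /= ger0_norm.
  rewrite tonelli2; last 2 first.
  - exact/measurable_EFinP.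
  - by move=> p; rewrite lee_fin.
  have s60 : 0 < s ^+ 2 / 6 by rewrite divr_gt0.
  apply: (@le_lt_trans _ _ (pi%:E * \int[mu]_x (expR (- (s ^+ 2 / 6 * (x - 3 * c) ^+ 2)))%:E)%E); last first.
    by rewrite (integral_gauss _ s60) -EFinM ltry.
  rewrite -ge0_integralZl; last 4 first.
  - exact: measurableT.
  - exact/measurable_EFinP.
  - by move=> x _; rewrite lee_fin expR_ge0.
  - by rewrite lee_fin pi_ge0.
  apply: ge0_le_integral.
  - exact: measurableT.
  - by move=> y _; apply: integral_ge0 => x _; rewrite lee_fin.
  - exact: (measurable_int1 mu mG G0).
  - by apply: measurable_funeM; exact/measurable_EFinP.
  - move=> y _; rewrite /G/=.
    under eq_integral do rewrite mulrC EFinM.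
    rewrite ge0_integralZl; last 4 first.
    + exact: measurableT.
    + apply/measurable_EFinP; apply: (measurableT_comp measurable_cauchy).
      by apply: (measurableT_comp measurable_spread); exact: measurable_fun_pair.
    + by move=> x _; rewrite lee_fin invr_ge0 addr_ge0 ?sqr_ge0.
    + by rewrite lee_fin expR_ge0.
    rewrite muleC; apply: lee_wpmul2r; first by rewrite lee_fin expR_ge0.
    exact: integral_spread_cauchy.
apply: le_integrable (integrableZl measurableT (decay_const s) IG) => //.
  by apply/measurable_EFinP; exact: measurable_cap.
move=> p _; rewrite /= lee_fin ger0_norm ?cap_ge0//.
by apply: le_trans (ler_norm _); exact: cap_le.
Qed.

Lemma seq_continuous2_cap s c : forall (u v : nat -> R) (x y : R),
  u n @[n --> \oo] --> x -> v n @[n --> \oo] --> y ->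
  cap s c (u n, v n) @[n --> \oo] --> cap s c (x, y).
Proof.
move=> u v x y ux vy.
have sq (a : nat -> R) (l : R) : a n @[n --> \oo] --> l -> a n ^+ 2 @[n --> \oo] --> l ^+ 2.
  by move=> h; exact: (cvgM h h).
have cs : spread (u n, v n) @[n --> \oo] --> spread (x, y).
  apply: cvgB; first by apply: cvgN; apply: cvgM => //; exact: cvg_cst.
  by apply: cvgM; [exact: sq|exact: cvg_cst].
have cp : spread_pos (u n, v n) @[n --> \oo] --> spread_pos (x, y).
  by apply: cvgM; [apply: cvgD => //; exact: cvg_norm|exact: cvg_cst].
have ce : - (s ^+ 2 * (spread_pos (u n, v n) + 3 * (c - v n / 3) ^+ 2) / 2) @[n --> \oo] -->
    - (s ^+ 2 * (spread_pos (x, y) + 3 * (c - y / 3) ^+ 2) / 2).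
  apply: cvgN; apply: cvgM; last exact: cvg_cst.
  apply: cvgM; first exact: cvg_cst.
  apply: cvgD => //; apply: cvgM; first exact: cvg_cst.
  apply: sq; apply: cvgB; first exact: cvg_cst.
  by apply: cvgM => //; exact: cvg_cst.
by apply: cvgM => //; exact: (cvg_comp _ _ ce (@continuous_expR R _)).
Qed.

End caps.

(** * The evolution of a localised triple *)

Section wave_packets.
Context {R : realType}.
Local Notation mu := (@lebesgue_measure R).
Local Notation P := (prodm mu mu).
Local Notation P3 := (prodm P mu).
Variable h : R -> R[i].
Hypothesis Ih : cintegrable mu h.

Definition wave (s c xi : R) : R[i] := h xi * ((packet s c xi)%:C)%C.
Definition triple (f : R -> R[i]) (w : R * R * R) : R[i] := f w.1.1 * f w.1.2 * f w.2.
Definition spread_triple (s c : R) (w : R * R * R) : R[i] :=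
  ((spread (xi_energy3 w, xi_sum3 w))%:C)%C * triple (wave s c) w.
Definition wave_pair (s c : R) (w : R * R) : R[i] :=
  (((w.1 - w.2) ^+ 2)%:C)%C * (wave s c w.1 * wave s c w.2).

Let mom j s c xi := ((xi ^+ j)%:C)%C * wave s c xi.

Let Imom j s c : s != 0 -> (j <= 2)%N -> cintegrable mu (mom j s c).
Proof. by move=> s0 j2; exact: cintegrable_packet_moment. Qed.

Let wave_pairE s c w : wave_pair s c w =
  mom 2 s c w.1 * mom 0 s c w.2 + (mom 0 s c w.1 * mom 2 s c w.2 +
  (((-2) %:C)%C) * (mom 1 s c w.1 * mom 1 s c w.2)).
Proof.
rewrite /wave_pair /mom; case: (wave s c w.1) (wave s c w.2) => [a b] [a' b'].
by apply: cplx_eq; rewrite /= ; ring.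
Qed.

(** The coefficients come from [r^2 = (2 / 3) (\sum_i xi_i^2 - \sum_(i < j) xi_i xi_j)]. *)
Let spread_tripleE s c w : spread_triple s c w =
  (((2 / 3) %:C)%C) * (mom 2 s c w.1.1 * mom 0 s c w.1.2 * mom 0 s c w.2 +
  (mom 0 s c w.1.1 * mom 2 s c w.1.2 * mom 0 s c w.2 +
  mom 0 s c w.1.1 * mom 0 s c w.1.2 * mom 2 s c w.2)) +
  (((- (2 / 3)) %:C)%C) * (mom 1 s c w.1.1 * mom 1 s c w.1.2 * mom 0 s c w.2 +
  (mom 1 s c w.1.1 * mom 0 s c w.1.2 * mom 1 s c w.2 +
  mom 0 s c w.1.1 * mom 1 s c w.1.2 * mom 1 s c w.2)).
Proof.
rewrite /spread_triple /triple /mom spreadE.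
case: (wave s c w.1.1) (wave s c w.1.2) (wave s c w.2) => [a b] [a' b'] [a2 b2].
by apply: cplx_eq; rewrite /= ; field.
Qed.

Lemma cintegrable_wave_pair s c : s != 0 -> cintegrable P (wave_pair s c).
Proof.
move=> s0; have -> : wave_pair s c = (fun w => mom 2 s c w.1 * mom 0 s c w.2 +
    (mom 0 s c w.1 * mom 2 s c w.2 + (((-2) %:C)%C) * (mom 1 s c w.1 * mom 1 s c w.2))).
  by apply/funext => w; exact: wave_pairE.
apply: cintegrableD; first by apply: cintegrable_prod; exact: Imom.
apply: cintegrableD; first by apply: cintegrable_prod; exact: Imom.
by apply: cintegrableZ; apply: cintegrable_prod; exact: Imom.
Qed.

(** After integration, permuting the three identical factors has no effect. With [E_j] the evolution
    of the [j]-th moment of the packet, both sides equal [2 E_0 (E_2 E_0 - E_1^2)]: one factor [E_0]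
    splits off and the rest is bilinear. *)
Lemma extension_spread_triple s c t x : s != 0 ->
  cintegrable P3 (spread_triple s c) /\
  osc_int P3 xi_energy3 xi_sum3 (spread_triple s c) t x =
  extension (wave s c) t x * osc_int P xi_energy xi_sum (wave_pair s c) t x.
Proof.
move=> s0.
have mom0E : wave s c = mom 0 s c.
  by apply/funext => xi; rewrite /mom expr0 mul1r.
have -> : wave_pair s c = (fun w => mom 2 s c w.1 * mom 0 s c w.2 +
    (mom 0 s c w.1 * mom 2 s c w.2 + (((-2) %:C)%C) * (mom 1 s c w.1 * mom 1 s c w.2))).
  by apply/funext => w; exact: wave_pairE.
have -> : spread_triple s c = (fun w => 
  (((2 / 3) %:C)%C) * (mom 2 s c w.1.1 * mom 0 s c w.1.2 * mom 0 s c w.2 +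
  (mom 0 s c w.1.1 * mom 2 s c w.1.2 * mom 0 s c w.2 +
  mom 0 s c w.1.1 * mom 0 s c w.1.2 * mom 2 s c w.2)) +
  (((- (2 / 3)) %:C)%C) * (mom 1 s c w.1.1 * mom 1 s c w.1.2 * mom 0 s c w.2 +
  (mom 1 s c w.1.1 * mom 0 s c w.1.2 * mom 1 s c w.2 +
  mom 0 s c w.1.1 * mom 1 s c w.1.2 * mom 1 s c w.2))).
  by apply/funext => w; exact: spread_tripleE.
rewrite mom0E.
have J j : (j <= 2)%N -> cintegrable mu (mom j s c) by exact: Imom.
have T i j k : (i <= 2)%N -> (j <= 2)%N -> (k <= 2)%N ->
    cintegrable P3 (fun w => mom i s c w.1.1 * mom j s c w.1.2 * mom k s c w.2).
  by move=> i2 j2 k2; apply: cintegrable_prod3; exact: Imom.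
have D i j : (i <= 2)%N -> (j <= 2)%N ->
    cintegrable P (fun w => mom i s c w.1 * mom j s c w.2).
  by move=> i2 j2; apply: cintegrable_prod; exact: Imom.
have m3e := @measurable_xi_energy3 R; have m3s := @measurable_xi_sum3 R.
have me := @measurable_xi_energy R; have ms := @measurable_xi_sum R.
have A1 : cintegrable P3 (fun w => mom 2 s c w.1.1 * mom 0 s c w.1.2 * mom 0 s c w.2 +
  (mom 0 s c w.1.1 * mom 2 s c w.1.2 * mom 0 s c w.2 +
  mom 0 s c w.1.1 * mom 0 s c w.1.2 * mom 2 s c w.2)).
  by do 2 ?apply: cintegrableD; exact: T.
have A2 : cintegrable P3 (fun w => mom 1 s c w.1.1 * mom 1 s c w.1.2 * mom 0 s c w.2 +
  (mom 1 s c w.1.1 * mom 0 s c w.1.2 * mom 1 s c w.2 +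
  mom 0 s c w.1.1 * mom 1 s c w.1.2 * mom 1 s c w.2)).
  by do 2 ?apply: cintegrableD; exact: T.
split; first by apply: cintegrableD; exact: cintegrableZ.
rewrite osc_intD//; try exact: cintegrableZ.
rewrite !osc_intZ// !osc_intD//; try exact: T; try (apply: cintegrableD; exact: T);
  try exact: D; try (apply: cintegrableZ; exact: D);
  try (apply: cintegrableD; [exact: D|apply: cintegrableZ; exact: D]).
rewrite !extension_prod3; try exact: J.
rewrite osc_intZ//; last exact: D.
rewrite !extension_prod2; try exact: J.
case: (extension (mom 0 s c) t x) => a0 b0.
case: (extension (mom 1 s c) t x) => a1 b1.
case: (extension (mom 2 s c) t x) => a2 b2.
by apply: cplx_eq; rewrite /=; field.
Qed.

End wave_packets.

Lemma ge0_integrable d (T : measurableType d) (R : realType) (m : {measure set T -> \bar R})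
    (f : T -> R) : measurable_fun [set: T] f -> (forall x, 0 <= f x) ->
  (\int[m]_x (f x)%:E < +oo)%E -> m.-integrable [set: T] (EFin \o f).
Proof.
move=> mf f0 If; apply/integrableP; split; first exact/measurable_EFinP.
by under eq_integral do rewrite /= ger0_norm//.
Qed.

(** * Averaging over the centres and widths of packets *)

Section spread_weights.
Context {R : realType}.
Local Notation mu := (@lebesgue_measure R).
Local Notation P := (prodm mu mu).
Local Notation P3 := (prodm P mu).

Definition phase3 (w : R * R * R) : R * R := (xi_energy3 w, xi_sum3 w).

Lemma measurable_phase3 : measurable_fun [set: R * R * R] phase3.
Proof. by apply: measurable_fun_pair; [exact: measurable_xi_energy3|exact: measurable_xi_sum3]. Qed.

(* [y] is (centre, inverse width) of a Gaussian packet. *)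
Definition spread_weight (rho m : R) (y : R * R) : R :=
  `|y.2| * (`|y.2| ^+ 3 * (rho ^+ 2 * expR (- (y.2 ^+ 2 * rho)))) *
  expR (- (3 * y.2 ^+ 2 * (y.1 - m) ^+ 2)).

Definition weight_const : R := Num.sqrt (pi / 3) * moment3.

Lemma weight_const_gt0 : 0 < weight_const.
Proof. by rewrite mulr_gt0 ?moment3_gt0// sqrtr_gt0 divr_gt0 ?pi_gt0. Qed.

Lemma spread_weight_ge0 rho m y : 0 <= spread_weight rho m y.
Proof.
by rewrite /spread_weight; do ?[exact: expR_ge0|exact: sqr_ge0|exact: normr_ge0|
  exact: (exprn_ge0 3 (normr_ge0 _))|apply: mulr_ge0].
Qed.

Lemma measurable_spread_weight d (X : measurableType d) (rho m : X -> R) :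
  measurable_fun [set: X] rho -> measurable_fun [set: X] m ->
  measurable_fun [set: X * (R * R)] (fun v => spread_weight (rho v.1) (m v.1) v.2).
Proof.
move=> mrho mm.
have m1 : measurable_fun [set: X * (R * R)] (fun v => v.2.1).
  by apply: (measurableT_comp measurable_fst); exact: measurable_snd.
have m2 : measurable_fun [set: X * (R * R)] (fun v => v.2.2).
  by apply: (measurableT_comp measurable_snd); exact: measurable_snd.
have mr : measurable_fun [set: X * (R * R)] (fun v => rho v.1).
  by apply: (measurableT_comp mrho); exact: measurable_fst.
have mm' : measurable_fun [set: X * (R * R)] (fun v => m v.1).
  by apply: (measurableT_comp mm); exact: measurable_fst.
have mn : measurable_fun [set: X * (R * R)] (fun v => `|v.2.2|) by exact: measurableT_comp m2.
apply: measurable_funM.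
  apply: measurable_funM => //; apply: measurable_funM; first exact: measurable_funX.
  apply: measurable_funM; first exact: measurable_funX.
  apply: measurableT_comp => //; apply: measurableT_comp => //.
  by apply: measurable_funM => //; exact: measurable_funX.
apply: measurableT_comp => //; apply: measurableT_comp => //; apply: measurable_funM.
  by apply: measurable_funM => //; exact: measurable_funX.
by apply: measurable_funX; exact: measurable_funB.
Qed.

Lemma measurable_weight_profile (rho : R) :
  measurable_fun [set: R] (fun s : R => `|s| ^+ 3 * (rho ^+ 2 * expR (- (s ^+ 2 * rho)))).
Proof.
apply: measurable_funM; first by apply: measurable_funX; exact: normr_measurable.
apply: measurable_funM => //; apply: measurableT_comp => //; apply: measurableT_comp => //.
exact: measurable_funM.
Qed.

(** Scale invariance of the width integral and translation invariance of the centre integral make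
    the mass independent of [rho] and [m]; it is 0 exactly when [rho = 0], that is, when the three
    frequencies coincide. *)
Lemma integral_spread_weight (rho m : R) : 0 <= rho ->
  (\int[P]_y (spread_weight rho m y)%:E = (weight_const * (0 < rho)%R%:R)%:E)%E.
Proof.
rewrite le_eqVlt => /orP[/eqP <-|rho0].
  rewrite ltxx mulr0 (eq_integral (fun=> 0%E)) ?integral0// => y _.
  by rewrite /spread_weight expr0n/= !(mul0r, mulr0).
have three0 : (0 : R) < 3 by [].
rewrite (integral_gauss_center m three0
  (H := fun s => `|s| ^+ 3 * (rho ^+ 2 * expR (- (s ^+ 2 * rho))))); last 3 first.
- exact: measurable_weight_profile.
- by move=> s; do ?[exact: expR_ge0|exact: sqr_ge0|
    exact: (exprn_ge0 3 (normr_ge0 _))|apply: mulr_ge0].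
- by rewrite normr0 expr0n/= mul0r.
by rewrite moment3_scale// rho0 mulr1 -EFinM.
Qed.

(** For given first two frequencies only one value of the third contributes. This is applied to the
    triples of spread 0, which all lie in this diagonal. *)
Lemma negligible_diagonal (F : R * R * R -> R) :
  measurable_fun [set: R * R * R] F -> (forall w, 0 <= F w) ->
  (forall w, w.1.2 != w.2 -> F w = 0) -> (\int[P3]_w (F w)%:E = 0)%E.
Proof.
move=> mF F0 Fd; rewrite tonelli1; last 2 first.
- exact/measurable_EFinP.
- by move=> w; rewrite lee_fin.
rewrite (eq_integral (fun=> 0%E)) ?integral0// => z _.
rewrite -[RHS](integral_set1 (fun y : R => (F (z, y))%:E) z.2) [RHS]integral_mkcond.
apply: eq_integral => y _; rewrite patchE; case: ifPn => // yz.
by rewrite Fd//=; apply: contra yz => /eqP ->; rewrite inE.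
Qed.

(** Integrating the weight over its parameters first gives a constant, up to the triples of spread
    0. Fubini then exchanges this average with the integral over triples, and the modulus is taken
    parameter by parameter. *)
Lemma insert_spread_weight (F : R * R * R -> R[i]) : cintegrable P3 F ->
  ((weight_const * Normc.normc (cint P3 F))%:E <=
   \int[P]_y (Normc.normc (cint P3 (fun w =>
     F w * ((spread_weight (spread (phase3 w)) (xi_sum3 w / 3) y)%:C)%C)))%:E)%E.
Proof.
move=> IF; have mF := cintegrable_measurable IF.
have mrho : measurable_fun [set: R * R * R] (fun w => spread (phase3 w)).
  by apply: (measurableT_comp measurable_spread); exact: measurable_phase3.
have mm : measurable_fun [set: R * R * R] (fun w => xi_sum3 w / 3).
  by apply: measurable_funM => //; exact: measurable_xi_sum3.
have mW := measurable_spread_weight mrho mm.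
(* The weight has mass [weight_const * b w], so [b] records the triples on which it really averages
   to a positive constant. *)
pose b w : R := (0 < spread (phase3 w))%R%:R.
have mb : measurable_fun [set: R * R * R] b.
  have -> : b = \1_[set w | 0 < spread (phase3 w)].
    apply/funext => w; rewrite indicE /b; congr ((nat_of_bool _)%:R).
    by apply/idP/idP; rewrite inE.
  apply: measurable_indic.
  have := mrho measurableT _ (@measurable_itv R `]0, +oo[).
  rewrite setTI; congr measurable; apply/seteqP; split => w /=; rewrite in_itv/= ?andbT//.
have b01 w : 0 <= b w <= 1 by rewrite /b; case: (_ < _)%R; rewrite ?lexx ?ler01.
have IW w := integral_spread_weight (xi_sum3 w / 3) (spread_ge0 w).
pose Phi (v : (R * R * R) * (R * R)) : R[i] :=
  F v.1 * ((spread_weight (spread (phase3 v.1)) (xi_sum3 v.1 / 3) v.2)%:C)%C.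
have mPhi : cmeasurable Phi.
  apply: cmeasurableM; last exact: cmeasurable_real mW.
  by apply: (cmeasurable_comp _ mF); exact: measurable_fst.
have mWw w : measurable_fun [set: R * R] (spread_weight (spread (phase3 w)) (xi_sum3 w / 3)).
  have mp : measurable_fun [set: R * R] (fun y : R * R => (w, y)) by exact: measurable_fun_pair.
  exact: (measurableT_comp mW mp).
have IWr w : P.-integrable [set: R * R]
    (EFin \o spread_weight (spread (phase3 w)) (xi_sum3 w / 3)).
  apply: (@ge0_integrable _ _ _ P _ (mWw w) (fun y => spread_weight_ge0 _ _ y)).
  by move: (IW w) => ->; rewrite ltry.
have nPhi w : (\int[P]_y (Normc.normc (Phi (w, y)))%:E =
    (Normc.normc (F w) * (weight_const * b w))%:E)%E.
  rewrite EFinM -IW -ge0_integralZl; last 4 first.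
  - exact: measurableT.
  - by apply/measurable_EFinP; exact: mWw.
  - by move=> y _; rewrite lee_fin spread_weight_ge0.
  - by rewrite lee_fin normc_ge0.
  apply: eq_integral => y _.
  by rewrite /Phi Normc.normcM normc_real ger0_norm ?spread_weight_ge0.
have IPhi : cintegrable (prodm P3 P) Phi.
  apply: cintegrable_lty => //; rewrite tonelli1; last 2 first.
  - by apply/measurable_EFinP; exact: cmeasurable_normc.
  - by move=> v; rewrite lee_fin normc_ge0.
  under eq_integral do rewrite nPhi.
  have /integrableP[_] := integrableZl measurableT weight_const (integrable_normc IF).
  apply: le_lt_trans; apply: ge0_le_integral => //.
  - move=> w _; rewrite lee_fin; apply: (mulr_ge0 (normc_ge0 _)).
    by apply: (mulr_ge0 (ltW weight_const_gt0)); case/andP: (b01 w).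
  - apply/measurable_EFinP; apply: measurable_funM; first exact: cmeasurable_normc.
    exact: measurable_funM.
  - apply: measurableT_comp => //; apply: measurable_funeM.
    by apply/measurable_EFinP; exact: cmeasurable_normc.
  - move=> w _; rewrite -EFinM lee_fin ger0_norm; last first.
      by rewrite mulr_ge0 ?normc_ge0// ltW ?weight_const_gt0.
    rewrite mulrC ler_wpM2r ?normc_ge0// ler_piMr ?(ltW weight_const_gt0)//.
    by case/andP: (b01 w).
have cE : cint P3 (fun w => cint P (fun y => Phi (w, y))) =
    ((weight_const%:C)%C) * cint P3 (fun w => F w * ((b w)%:C)%C).
  have IFb : cintegrable P3 (fun w => F w * ((b w)%:C)%C).
    apply: (cintegrable_le _ (integrable_normc IF)).
      by apply: cmeasurableM => //; exact: cmeasurable_real.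
    move=> w; rewrite Normc.normcM normc_real ler_piMr ?normc_ge0//.
    by case/andP: (b01 w) => b0 b1; rewrite ger0_norm.
  rewrite -cintZ//; apply: eq_cint => w; rewrite /Phi/=.
  rewrite cintZ; last first.
    apply: (@cintegrable_le _ _ _ P _ _ _ (IWr w)); first exact: (cmeasurable_real (mWw w)).
    by move=> y; rewrite normc_real ger0_norm ?spread_weight_ge0.
  rewrite cint_real; have -> : \int[P]_y spread_weight (spread (phase3 w)) (xi_sum3 w / 3) y =
      weight_const * b w by rewrite /Rintegral IW.
  by rewrite (real_complexM weight_const (b w)); ring.
(* [b] differs from 1 only when all three frequencies agree, in particular only where the last two
   do, and this set is null. *)
have bF : cint P3 (fun w => F w * ((b w)%:C)%C) = cint P3 F.
  have IFb : cintegrable P3 (fun w => F w * ((b w)%:C)%C).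
    apply: (cintegrable_le _ (integrable_normc IF)).
      by apply: cmeasurableM => //; exact: cmeasurable_real.
    move=> w; rewrite Normc.normcM normc_real ler_piMr ?normc_ge0//.
    by case/andP: (b01 w) => b0 b1; rewrite ger0_norm.
  apply/eqP; rewrite -subr_eq0 -cintB//; apply/eqP; apply: Normc.eq0_normc; apply/eqP.
  rewrite eq_le normc_ge0 andbT -lee_fin.
  have IB : cintegrable P3 (fun w => F w * ((b w)%:C)%C - F w).
    have := cintegrableD IFb (cintegrableZ (-1) IF); congr cintegrable.
    by apply/funext => w; rewrite mulN1r.
  apply: le_trans (le_normc_cinte IB) _.
  rewrite negligible_diagonal//.
  - by apply: cmeasurable_normc; exact: cintegrable_measurable IB.
  - by move=> w; exact: normc_ge0.
  - move=> w w12; have -> : b w = 1; last by rewrite mulr1 subrr Normc.normc0.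
    rewrite /b; suff -> : 0 < spread (phase3 w) by [].
    rewrite spreadE divr_gt0// ltr_wpDr ?sqr_ge0// ltr_wpDl ?sqr_ge0//.
    by rewrite exprn_even_gt0//= subr_eq0.
have -> : weight_const * Normc.normc (cint P3 F) =
    Normc.normc (cint P (fun y => cint P3 (fun w => Phi (w, y)))).
  rewrite -(cfubini IPhi) cE bF Normc.normcM normc_real ger0_norm//.
  exact: ltW weight_const_gt0.
exact: (le_normc_cinte (cintegrable_cint2 IPhi)).
Qed.

End spread_weights.

(** * Splitting the weight, and the estimate for one packet parameter *)

Section main_estimate.
Context {R : realType}.
Local Notation mu := (@lebesgue_measure R).
Local Notation P := (prodm mu mu).
Local Notation P3 := (prodm P mu).
Variable h : R -> R[i].
Hypothesis Ih : cintegrable mu h.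

(** What remains of [|s|^3 |wave_pair|^2 / |xi_1 - xi_2|] once the factors [|h|^2] are taken out:
    the powers of the difference combine into a cube, and the two squared packets into a Gaussian in
    the difference times one about the midpoint. *)
Definition pair_weight (w y : R * R) : R :=
  `|y.2| * (y.2 ^+ 2 * (`|w.1 - w.2| ^+ 3 * expR (- (y.2 ^+ 2 * ((w.1 - w.2) ^+ 2 / 2))))) *
  expR (- (2 * y.2 ^+ 2 * (y.1 - (w.1 + w.2) / 2) ^+ 2)).

Lemma pair_weight_ge0 w y : 0 <= pair_weight w y.
Proof.
by rewrite /pair_weight; do ?[exact: expR_ge0|exact: sqr_ge0|exact: normr_ge0|
  exact: (exprn_ge0 3 (normr_ge0 _))|apply: mulr_ge0].
Qed.

Lemma measurable_pair_weight :
  measurable_fun [set: (R * R) * (R * R)] (fun v => pair_weight v.1 v.2).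
Proof.
have m1 : measurable_fun [set: (R * R) * (R * R)] (fun v => v.2.1).
  by apply: (measurableT_comp measurable_fst); exact: measurable_snd.
have m2 : measurable_fun [set: (R * R) * (R * R)] (fun v => v.2.2).
  by apply: (measurableT_comp measurable_snd); exact: measurable_snd.
have n1 : measurable_fun [set: (R * R) * (R * R)] (fun v => v.1.1).
  by apply: (measurableT_comp measurable_fst); exact: measurable_fst.
have n2 : measurable_fun [set: (R * R) * (R * R)] (fun v => v.1.2).
  by apply: (measurableT_comp measurable_snd); exact: measurable_fst.
have nd := measurable_funB n1 n2.
apply: measurable_funM.
  apply: measurable_funM; first exact: measurableT_comp m2.
  apply: measurable_funM; first exact: measurable_funX.
  apply: measurable_funM; first by apply: measurable_funX; exact: measurableT_comp nd.
  apply: measurableT_comp => //; apply: measurableT_comp => //.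
  apply: measurable_funM; first exact: measurable_funX.
  by apply: measurable_funM => //; exact: measurable_funX.
apply: measurableT_comp => //; apply: measurableT_comp => //; apply: measurable_funM.
  by apply: measurable_funM => //; exact: measurable_funX.
apply: measurable_funX; apply: measurable_funB => //.
by apply: measurable_funM => //; exact: measurable_funD.
Qed.

(** Scale invariance again: the bound does not depend on the two frequencies, so summing over all
    packets loses nothing. *)
Lemma integral_pair_weight w :
  (\int[P]_y (pair_weight w y)%:E <= (Num.sqrt (pi / 2) * moment2)%:E)%E.
Proof.
have two0 : (0 : R) < 2 by [].
rewrite (integral_gauss_center ((w.1 + w.2) / 2) two0
  (H := fun s => s ^+ 2 * (`|w.1 - w.2| ^+ 3 * expR (- (s ^+ 2 * ((w.1 - w.2) ^+ 2 / 2)))))); last 3 first.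
- apply: measurable_funM => //.
  apply: measurable_funM => //; apply: measurableT_comp => //; apply: measurableT_comp => //.
  exact: measurable_funM.
- by move=> s; do ?[exact: expR_ge0|exact: sqr_ge0|
    exact: (exprn_ge0 3 (normr_ge0 _))|apply: mulr_ge0].
- by rewrite expr0n/= mul0r.
rewrite EFinM; apply: lee_wpmul2l; first by rewrite lee_fin sqrtr_ge0.
exact: moment2_scale.
Qed.

Lemma packet_sqr (s c xi : R) : packet s c xi ^+ 2 = expR (- (s ^+ 2 * (xi - c) ^+ 2)).
Proof. by rewrite /packet -expRM_natr; congr expR; field. Qed.

Lemma wave_pair_weight (s c : R) w :
  `|s| ^+ 3 * (Normc.normc (wave_pair h s c w) ^+ 2 / `|w.1 - w.2|) =
  Normc.normc (h w.1) ^+ 2 * Normc.normc (h w.2) ^+ 2 * pair_weight w (c, s).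
Proof.
rewrite /wave_pair /wave !Normc.normcM !normc_real (ger0_norm (sqr_ge0 _)).
rewrite !(ger0_norm (packet_ge0 _ _ _)) !exprMn !packet_sqr /pair_weight/=.
have eE : expR (- (s ^+ 2 * (w.1 - c) ^+ 2)) * expR (- (s ^+ 2 * (w.2 - c) ^+ 2)) =
    expR (- (s ^+ 2 * ((w.1 - w.2) ^+ 2 / 2))) *
    expR (- (2 * s ^+ 2 * (c - (w.1 + w.2) / 2) ^+ 2)).
  by rewrite -!expRD; congr expR; field.
have s3 : `|s| ^+ 3 = `|s| * s ^+ 2 by rewrite (exprS `|s| 2) real_normK ?num_real.
(* For equal frequencies the quotient by 0 is 0, which agrees with the cube on the right. *)
have d4 : ((w.1 - w.2) ^+ 2) ^+ 2 / `|w.1 - w.2| = `|w.1 - w.2| ^+ 3.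
  have [->|d0] := eqVneq (w.1 - w.2) 0; first by rewrite normr0 !expr0n/= mul0r.
  rewrite -[(w.1 - w.2) ^+ 2]real_normK ?num_real// -exprM (exprSr _ 3) mulfK//.
  by rewrite normr_eq0.
rewrite -d4 s3; move: eE.
move: (expR (- (s ^+ 2 * (w.1 - c) ^+ 2))) (expR (- (s ^+ 2 * (w.2 - c) ^+ 2))) => e1 e2.
move: (expR (- (s ^+ 2 * ((w.1 - w.2) ^+ 2 / 2)))) (expR (- (2 * s ^+ 2 * (c - (w.1 + w.2) / 2) ^+ 2))) => e3 e4.
move: (Normc.normc (h w.1) ^+ 2) (Normc.normc (h w.2) ^+ 2) (`|w.1 - w.2|^-1) => n1 n2 i eE.
transitivity (`|s| * s ^+ 2 * ((w.1 - w.2) ^+ 2) ^+ 2 * n1 * n2 * i * (e1 * e2)); first by ring.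
by rewrite eE; ring.
Qed.

(** The weight [s^4 r^4 exp(...)] is the square of [s^2 r^2 exp(... / 2)]. One copy of
    [r^2 exp(... / 2)] is [r^2] times the three packets, by [spread_center]; the other is the
    cap. *)
Lemma spread_triple_weight (s c : R) (z : R[i]) w :
  ((s ^+ 4)%:C)%C * (spread_triple h s c w * (((cap s c (phase3 w))%:C)%C * z)) =
  triple h w * z * ((spread_weight (spread (phase3 w)) (xi_sum3 w / 3) (c, s))%:C)%C.
Proof.
have -> : spread_weight (spread (phase3 w)) (xi_sum3 w / 3) (c, s) =
    s ^+ 4 * (spread (phase3 w) * (packet s c w.1.1 * packet s c w.1.2 * packet s c w.2)) *
    cap s c (phase3 w).
  rewrite /spread_weight /cap spread_posE/=.
  have pE : packet s c w.1.1 * packet s c w.1.2 * packet s c w.2 =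
      expR (- (s ^+ 2 * (spread (phase3 w) + 3 * (c - xi_sum3 w / 3) ^+ 2) / 2)).
    by rewrite /packet -!expRD -spread_center; congr expR; field.
  have e2 : expR (- (s ^+ 2 * spread (phase3 w))) *
      expR (- (3 * s ^+ 2 * (c - xi_sum3 w / 3) ^+ 2)) =
      expR (- (s ^+ 2 * (spread (phase3 w) + 3 * (c - xi_sum3 w / 3) ^+ 2) / 2)) *
      expR (- (s ^+ 2 * (spread (phase3 w) + 3 * (c - xi_sum3 w / 3) ^+ 2) / 2)).
    by rewrite -!expRD; congr expR; field.
  have s4 : s ^+ 4 = `|s| * `|s| ^+ 3.
    by rewrite -exprS (exprM `|s| 2 2) real_normK ?num_real// -exprM.
  rewrite pE s4; rewrite /phase3 in e2 *; move: e2.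
  move: (expR (- (s ^+ 2 * spread (xi_energy3 w, xi_sum3 w)))) => a.
  move: (expR (- (3 * s ^+ 2 * (c - xi_sum3 w / 3) ^+ 2))) => b.
  move: (expR _) => e e2.
  transitivity (`|s| * `|s| ^+ 3 * spread (xi_energy3 w, xi_sum3 w) ^+ 2 * (a * b)); first by ring.
  by rewrite e2; ring.
rewrite /spread_triple /triple /wave !real_complexM; ring.
Qed.

Variable K : R.
Hypothesis HK : forall s c t x : R, s != 0 ->
  `|s| * Normc.normc (extension (wave h s c) t x) ^+ 2 <= K.

(** One factor [|s|] pays for the uniform bound on the packet evolution; the bilinear factor is left
    to [bilinear_L2]. *)
Lemma spread_triple_L2 (s c : R) : s != 0 ->
  (`|s|%:E * \int[P]_z (Normc.normc (osc_int P3 xi_energy3 xi_sum3 (spread_triple h s c) z.1 z.2) ^+ 2)%:E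
   <= (K * (8 * pi ^+ 2))%:E *
      \int[P]_w (Normc.normc (wave_pair h s c w) ^+ 2 / `|w.1 - w.2|)%:E)%E.
Proof.
move=> s0; have I2 := cintegrable_wave_pair Ih c s0.
have K0 : 0 <= K by apply: le_trans (HK 0 0 0 s0); rewrite mulr_ge0 ?sqr_ge0.
have [I3 _] := extension_spread_triple Ih c 0 0 s0.
have mV : measurable_fun [set: R * R] (fun z =>
    Normc.normc (osc_int P3 xi_energy3 xi_sum3 (spread_triple h s c) z.1 z.2) ^+ 2).
  apply: measurable_funX; apply: cmeasurable_normc; apply: cmeasurable_osc_int.
  - exact: measurable_xi_energy3.
  - exact: measurable_xi_sum3.
  - exact: cintegrable_measurable I3.
have mB : measurable_fun [set: R * R] (fun z =>
    Normc.normc (osc_int P xi_energy xi_sum (wave_pair h s c) z.1 z.2) ^+ 2).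
  apply: measurable_funX; apply: cmeasurable_normc; apply: cmeasurable_osc_int.
  - exact: measurable_xi_energy.
  - exact: measurable_xi_sum.
  - exact: cintegrable_measurable I2.
have bil := bilinear_L2 I2.
rewrite (EFinM K) -muleA; apply: (@le_trans _ _ (K%:E *
  \int[P]_z (Normc.normc (osc_int P xi_energy xi_sum (wave_pair h s c) z.1 z.2) ^+ 2)%:E)%E); last first.
  apply: lee_wpmul2l; first by rewrite lee_fin.
  by apply: bil => z z12; rewrite /wave_pair z12 subrr expr0n/= mul0r.
rewrite -ge0_integralZl; last 4 first.
- exact: measurableT.
- by apply/measurable_EFinP; exact: mV.
- by move=> z _; rewrite lee_fin sqr_ge0.
- by rewrite lee_fin.
rewrite -ge0_integralZl; last 4 first.
- exact: measurableT.
- by apply/measurable_EFinP; exact: mB.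
- by move=> z _; rewrite lee_fin sqr_ge0.
- by rewrite lee_fin.
apply: ge0_le_integral.
- exact: measurableT.
- by move=> z _; rewrite -EFinM lee_fin mulr_ge0 ?sqr_ge0.
- by apply: measurable_funeM; apply/measurable_EFinP; exact: mV.
- by apply: measurable_funeM; apply/measurable_EFinP; exact: mB.
move=> z _; rewrite -!EFinM lee_fin.
have [_ ->] := extension_spread_triple Ih c z.1 z.2 s0.
by rewrite Normc.normcM exprMn mulrA ler_wpM2r ?sqr_ge0// HK.
Qed.

End main_estimate.

(** * The cubic form tested against the transform of a space-time function *)

Section cubic_pairing.
Context {R : realType}.
Local Notation mu := (@lebesgue_measure R).
Local Notation P := (prodm mu mu).
Local Notation P3 := (prodm P mu).
Variables (h : R -> R[i]) (g : R * R -> R[i]) (K N k : R).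
Hypotheses (Ih : cintegrable mu h) (Ig : cintegrable P g) (k0 : 0 < k).
Hypothesis hN : (\int[mu]_xi (Normc.normc (h xi) ^+ 2)%:E = N%:E)%E.
Hypothesis HK : forall s c t x : R, s != 0 ->
  `|s| * Normc.normc (extension (wave h s c) t x) ^+ 2 <= K.

Let gamma (p : R * R) := osc_int P (fun z => z.1) (fun z => z.2) g p.1 p.2.

Let mgamma : cmeasurable gamma.
Proof.
apply: cmeasurable_osc_int; [exact: measurable_fst|exact: measurable_snd|].
exact: cintegrable_measurable Ig.
Qed.

Let gamma_le p : Normc.normc (gamma p) <= \int[P]_z Normc.normc (g z).
Proof. exact: (@normc_osc_int _ _ R P _ _ measurable_fst measurable_snd _ _ _ Ig). Qed.

Let K0 : 0 <= K.
Proof. by apply: le_trans (HK 0 0 0 (oner_neq0 R)); rewrite mulr_ge0 ?sqr_ge0. Qed.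

Let pair_density (v : (R * R) * (R * R)) : R :=
  Normc.normc (h v.1.1) ^+ 2 * Normc.normc (h v.1.2) ^+ 2 * pair_weight v.1 v.2.

Let gamma_density (v : (R * R) * (R * R)) : R :=
  Normc.normc (gamma v.1) ^+ 2 * spread_weight (spread_pos v.1) (v.1.2 / 3) v.2.

Let pair_density_ge0 v : 0 <= pair_density v.
Proof. by apply: mulr_ge0 (pair_weight_ge0 _ _); apply: mulr_ge0; exact: sqr_ge0. Qed.

Let gamma_density_ge0 v : 0 <= gamma_density v.
Proof. by apply: mulr_ge0 (spread_weight_ge0 _ _ _); exact: sqr_ge0. Qed.

Let mh2 : measurable_fun [set: R] (fun xi => Normc.normc (h xi) ^+ 2).
Proof. by apply: measurable_funX; apply: cmeasurable_normc; exact: cintegrable_measurable Ih. Qed.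

Let mpair_density : measurable_fun [set: (R * R) * (R * R)] pair_density.
Proof.
apply: measurable_funM; last exact: measurable_pair_weight.
apply: measurable_funM; apply: (measurableT_comp mh2).
  by apply: (measurableT_comp measurable_fst); exact: measurable_fst.
by apply: (measurableT_comp measurable_snd); exact: measurable_fst.
Qed.

Let mgamma2 : measurable_fun [set: R * R] (fun p => Normc.normc (gamma p) ^+ 2).
Proof. by apply: measurable_funX; exact: cmeasurable_normc. Qed.

Let mgamma_density : measurable_fun [set: (R * R) * (R * R)] gamma_density.
Proof.
apply: measurable_funM; first by apply: (measurableT_comp mgamma2); exact: measurable_fst.
have m3 : measurable_fun [set: R * R] (fun p : R * R => p.2 / 3).
  by apply: measurable_funM => //; exact: measurable_snd.
exact: (measurable_spread_weight measurable_spread_pos m3).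
Qed.

Let integral_pair_density :
  (\int[P]_y \int[P]_w (pair_density (w, y))%:E <=
   (Num.sqrt (pi / 2) * moment2 * N ^+ 2)%:E)%E.
Proof.
rewrite -(@tonelli12 _ _ _ _ _ P P (fun v => (pair_density v)%:E)); last 2 first.
- by apply/measurable_EFinP; exact: mpair_density.
- by move=> v; rewrite lee_fin.
have mf : measurable_fun [set: R * R] (fun w : R * R =>
    Normc.normc (h w.1) ^+ 2 * Normc.normc (h w.2) ^+ 2).
  apply: measurable_funM; apply: (measurableT_comp mh2); first exact: measurable_fst.
  exact: measurable_snd.
have f0 (w : R * R) : 0 <= Normc.normc (h w.1) ^+ 2 * Normc.normc (h w.2) ^+ 2.
  by apply: mulr_ge0; exact: sqr_ge0.
apply: (@le_trans _ _ ((Num.sqrt (pi / 2) * moment2)%:E *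
    \int[P]_w (Normc.normc (h w.1) ^+ 2 * Normc.normc (h w.2) ^+ 2)%:E)%E); last first.
  rewrite (ge0_integral_prod mh2 mh2); try by move=> x; exact: sqr_ge0.
  by rewrite hN -!EFinM expr2.
rewrite -ge0_integralZl; last 4 first.
- exact: measurableT.
- by apply/measurable_EFinP; exact: mf.
- by move=> w _; rewrite lee_fin.
- by rewrite lee_fin mulr_ge0 ?sqrtr_ge0 ?moment2_ge0.
apply: ge0_le_integral.
- exact: measurableT.
- by move=> w _; apply: integral_ge0 => y _; rewrite lee_fin.
- exact: (measurable_int2 P mpair_density pair_density_ge0).
- by apply: measurable_funeM; apply/measurable_EFinP; exact: mf.
move=> w _; rewrite muleC.
have -> : (\int[P]_y (pair_density (w, y))%:E =
    (Normc.normc (h w.1) ^+ 2 * Normc.normc (h w.2) ^+ 2)%:E * \int[P]_y (pair_weight w y)%:E)%E.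
  rewrite -ge0_integralZl; last 4 first.
  - exact: measurableT.
  - apply/measurable_EFinP.
    have mp : measurable_fun [set: R * R] (fun y : R * R => (w, y)) by exact: measurable_fun_pair.
    exact: (measurableT_comp measurable_pair_weight mp).
  - by move=> y _; rewrite lee_fin pair_weight_ge0.
  - by rewrite lee_fin.
  by apply: eq_integral => y _; rewrite -EFinM.
by apply: lee_wpmul2l; [rewrite lee_fin|exact: integral_pair_weight].
Qed.

(** Integrating the weight over packets first leaves [weight_const] or 0, according to whether
    [spread_pos] is positive; Plancherel handles what remains of [gamma]. *)
Let integral_gamma_density :
  (\int[P]_y \int[P]_p (gamma_density (p, y))%:E <=
   (weight_const)%:E * (((2 * pi) ^+ 2)%:E * \int[P]_z (Normc.normc (g z) ^+ 2)%:E))%E.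
Proof.
rewrite -(@tonelli12 _ _ _ _ _ P P (fun v => (gamma_density v)%:E)); last 2 first.
- by apply/measurable_EFinP; exact: mgamma_density.
- by move=> v; rewrite lee_fin.
have wc0 := ltW (@weight_const_gt0 R).
apply: (@le_trans _ _ (weight_const%:E * \int[P]_p (Normc.normc (gamma p) ^+ 2)%:E)%E); last first.
  apply: lee_wpmul2l; first by rewrite lee_fin.
  exact: plancherel2 Ig.
rewrite -ge0_integralZl; last 4 first.
- exact: measurableT.
- by apply/measurable_EFinP; exact: mgamma2.
- by move=> w _; rewrite lee_fin sqr_ge0.
- by rewrite lee_fin.
apply: ge0_le_integral.
- exact: measurableT.
- by move=> w _; apply: integral_ge0 => y _; rewrite lee_fin.
- exact: (measurable_int2 P mgamma_density gamma_density_ge0).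
- by apply: measurable_funeM; apply/measurable_EFinP; exact: mgamma2.
move=> p _; rewrite muleC.
have -> : (\int[P]_y (gamma_density (p, y))%:E =
    (Normc.normc (gamma p) ^+ 2)%:E * \int[P]_y (spread_weight (spread_pos p) (p.2 / 3) y)%:E)%E.
  rewrite -ge0_integralZl; last 4 first.
  - exact: measurableT.
  - apply/measurable_EFinP.
    have mp : measurable_fun [set: R * R] (fun y : R * R => (p, y)) by exact: measurable_fun_pair.
    have mw : measurable_fun [set: (R * R) * (R * R)]
        (fun v => spread_weight (spread_pos v.1) (v.1.2 / 3) v.2).
      have m3 : measurable_fun [set: R * R] (fun p : R * R => p.2 / 3).
        by apply: measurable_funM => //; exact: measurable_snd.
      exact: (measurable_spread_weight measurable_spread_pos m3).
    exact: (measurableT_comp mw mp).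
  - by move=> y _; rewrite lee_fin spread_weight_ge0.
  - by rewrite lee_fin sqr_ge0.
  by apply: eq_integral => y _; rewrite -EFinM.
apply: lee_wpmul2l; first by rewrite lee_fin sqr_ge0.
rewrite integral_spread_weight ?spread_pos_ge0// lee_fin ler_piMr//.
by case: (_ < _)%R; rewrite ?lexx ?ler01.
Qed.

(** The Parseval pairing with [eta] equal to the cap times [gamma]. The same [k] is used for all
    packets, so that the slices can be integrated. *)
Let slice_bound (s c : R) : s != 0 ->
  (((2 * pi) ^+ 2 * Normc.normc (cint P3 (fun w => triple h w * gamma (phase3 w) *
     ((spread_weight (spread (phase3 w)) (xi_sum3 w / 3) (c, s))%:C)%C)))%:E <=
   (k / 2 * (K * (8 * pi ^+ 2)))%:E * \int[P]_w (pair_density (w, (c, s)))%:E +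
   ((2 * k)^-1 * (2 * pi) ^+ 2)%:E * \int[P]_p (gamma_density (p, (c, s)))%:E)%E.
Proof.
move=> s0; have [I3 _] := extension_spread_triple Ih c 0 0 s0.
have s40 : 0 <= s ^+ 4 by rewrite exprn_even_ge0.
pose eta p := ((cap s c p)%:C)%C * gamma p.
have meta : cmeasurable eta by apply: cmeasurableM => //; apply: cmeasurable_real; exact: measurable_cap.
pose G := \int[P]_z Normc.normc (g z).
have gG p : Normc.normc (gamma p) <= G by exact: gamma_le.
have ceta p : Normc.normc (eta p) = cap s c p * Normc.normc (gamma p).
  by rewrite /eta Normc.normcM normc_real ger0_norm ?cap_ge0.
have Ieta : cintegrable P eta.
  have := integrableZl measurableT G (integrable_cap c s0).
  move/(@cintegrable_le _ _ _ P); apply => // p.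
  by rewrite ceta mulrC ler_wpM2r ?cap_ge0.
have [C capC] := cap_bounded c s0.
have etaC p : Normc.normc (eta p) <= C * G.
  by rewrite ceta ler_pM ?cap_ge0 ?normc_ge0.
have etac : seq_continuous2 eta.
  move=> u v x y ux vy; apply: cvgCM; last exact: (seq_continuous2_osc_int Ig ux vy).
  by apply: cvgC_real; exact: seq_continuous2_cap.
pose J := cint P3 (fun w => spread_triple h s c w * eta (phase3 w)).
pose V2 := (\int[P]_z (Normc.normc (osc_int P3 xi_energy3 xi_sum3 (spread_triple h s c) z.1 z.2) ^+ 2)%:E)%E.
pose E2 := (\int[P]_p (Normc.normc (eta p) ^+ 2)%:E)%E.
have pp : (((2 * pi) ^+ 2 * Normc.normc J)%:E <=
    (k / 2)%:E * V2 + ((2 * k)^-1 * (2 * pi) ^+ 2)%:E * E2)%E.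
  exact: (@parseval_pairing _ _ R P3 _ _ (@measurable_xi_energy3 R) (@measurable_xi_sum3 R)
    _ _ _ _ I3 Ieta etaC etac k0).
have JE : cint P3 (fun w => triple h w * gamma (phase3 w) *
     ((spread_weight (spread (phase3 w)) (xi_sum3 w / 3) (c, s))%:C)%C) = ((s ^+ 4)%:C)%C * J.
  rewrite -cintZ; last first.
    have mJ : cmeasurable (fun w => spread_triple h s c w * eta (phase3 w)).
      apply: cmeasurableM; first exact: cintegrable_measurable I3.
      by apply: (cmeasurable_comp _ meta); exact: measurable_phase3.
    have := integrableZl measurableT (C * G) (integrable_normc I3).
    move/(@cintegrable_le _ _ _ P3); apply; first exact: mJ.
    by move=> w; rewrite Normc.normcM mulrC ler_wpM2r ?normc_ge0.
  by apply: eq_cint => w; rewrite -(spread_triple_weight h s c (gamma (phase3 w))).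
apply: (@le_trans _ _ ((s ^+ 4)%:E * ((2 * pi) ^+ 2 * Normc.normc J)%:E)%E).
  by rewrite JE Normc.normcM normc_real ger0_norm// mulrCA EFinM.
apply: (@le_trans _ _ ((s ^+ 4)%:E * ((k / 2)%:E * V2 + ((2 * k)^-1 * (2 * pi) ^+ 2)%:E * E2))%E).
  by apply: lee_wpmul2l; [rewrite lee_fin|exact: pp].
have V20 : (0 <= V2)%E by apply: integral_ge0 => z _; rewrite lee_fin sqr_ge0.
have E20 : (0 <= E2)%E by apply: integral_ge0 => z _; rewrite lee_fin sqr_ge0.
have k20 : 0 <= k / 2 by rewrite divr_ge0// ltW.
have kk0 : 0 <= (2 * k)^-1 * (2 * pi) ^+ 2.
  by apply: mulr_ge0 (sqr_ge0 _); rewrite invr_ge0 mulr_ge0// ltW.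
rewrite ge0_muleDr; last 2 first.
- by apply: mule_ge0 => //; rewrite lee_fin.
- by apply: mule_ge0 => //; rewrite lee_fin.
(* For the triple, [|s|] is spent on the packet bound and [|s|^3] completes the pair density; for
   [gamma], the whole of [s^4] enters its density. *)
have s43 : s ^+ 4 = `|s| ^+ 3 * `|s|.
  by rewrite -exprSr (exprM `|s| 2 2) real_normK ?num_real// -exprM.
apply: leeD.
- rewrite muleCA (EFinM (k / 2)) -muleA; apply: lee_wpmul2l; first by rewrite lee_fin.
  rewrite s43 EFinM -muleA.
  have := spread_triple_L2 Ih HK c s0.
  move/(@lee_wpmul2l _ (`|s| ^+ 3)%:E); rewrite lee_fin exprn_ge0// => /(_ isT).
  move=> /le_trans; apply; rewrite muleCA; apply: lee_wpmul2l.
    by rewrite lee_fin mulr_ge0// mulr_ge0// sqr_ge0.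
  rewrite -ge0_integralZl; last 4 first.
  + exact: measurableT.
  + apply/measurable_EFinP; have mp : measurable_fun [set: R * R] (fun w : R * R => (w, (c, s))).
      exact: measurable_fun_pair.
    have md := measurableT_comp mpair_density mp.
    have : measurable_fun [set: R * R] (fun w => (`|s| ^+ 3)^-1 * pair_density (w, (c, s))).
      exact: measurable_funM.
    apply: eq_measurable_fun => w _.
    rewrite /pair_density/= -(wave_pair_weight h s c w) mulrA mulVf ?mul1r//.
    by rewrite expf_neq0// normr_eq0.
  + by move=> w _; rewrite lee_fin divr_ge0 ?sqr_ge0.
  + by rewrite lee_fin exprn_ge0.
  rewrite le_eqVlt; apply/orP; left; apply/eqP; apply: eq_integral => w _.
  by rewrite -EFinM wave_pair_weight.
- rewrite muleCA; apply: lee_wpmul2l; first by rewrite lee_fin.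
  rewrite -ge0_integralZl; last 4 first.
  + exact: measurableT.
  + by apply/measurable_EFinP; apply: measurable_funX; exact: cmeasurable_normc.
  + by move=> w _; rewrite lee_fin sqr_ge0.
  + by rewrite lee_fin.
  rewrite le_eqVlt; apply/orP; left; apply/eqP; apply: eq_integral => p _.
  rewrite -EFinM ceta exprMn cap_sqr /gamma_density /spread_weight/= s43; congr (_%:E); ring.
Qed.

Lemma cubic_pairing :
  (((2 * pi) ^+ 2 * (weight_const * Normc.normc (cint P3 (fun w => triple h w * gamma (phase3 w)))))%:E <=
   (k / 2 * (K * (8 * pi ^+ 2)) * (Num.sqrt (pi / 2) * moment2 * N ^+ 2))%:E +
   ((2 * k)^-1 * (2 * pi) ^+ 2 * (weight_const * (2 * pi) ^+ 2))%:E *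
     \int[P]_z (Normc.normc (g z) ^+ 2)%:E)%E.
Proof.
have IF : cintegrable P3 (fun w => triple h w * gamma (phase3 w)).
  have := integrableZl measurableT (\int[P]_z Normc.normc (g z))
    (integrable_normc (cintegrable_prod3 Ih Ih Ih)).
  move/(@cintegrable_le _ _ _ P3); apply.
    apply: cmeasurableM; first exact: cintegrable_measurable (cintegrable_prod3 Ih Ih Ih).
    by apply: (cmeasurable_comp _ mgamma); exact: measurable_phase3.
  by move=> w; rewrite Normc.normcM mulrC ler_wpM2r ?normc_ge0//; exact: gamma_le.
have k20 : 0 <= k / 2 * (K * (8 * pi ^+ 2)).
  by apply: mulr_ge0; [rewrite divr_ge0// ltW|rewrite mulr_ge0// mulr_ge0// sqr_ge0].
have kk0 : 0 <= (2 * k)^-1 * (2 * pi) ^+ 2.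
  by apply: mulr_ge0 (sqr_ge0 _); rewrite invr_ge0 mulr_ge0// ltW.
have mI1 := @measurable_int1 _ _ _ _ R P _ mpair_density pair_density_ge0.
have mI2 := @measurable_int1 _ _ _ _ R P _ mgamma_density gamma_density_ge0.
have mW : cmeasurable (fun y => cint P3 (fun w => triple h w * gamma (phase3 w) *
     ((spread_weight (spread (phase3 w)) (xi_sum3 w / 3) y)%:C)%C)).
  apply: (@cmeasurable_cint _ _ _ _ _ P3 (fun v : (R * R) * (R * R * R) =>
    triple h v.2 * gamma (phase3 v.2) *
     ((spread_weight (spread (phase3 v.2)) (xi_sum3 v.2 / 3) v.1)%:C)%C)).
  apply: cmeasurableM.
    by apply: (cmeasurable_comp _ (cintegrable_measurable IF)); exact: measurable_snd.
  apply: cmeasurable_real.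
  have mrho : measurable_fun [set: R * R * R] (fun w => spread (phase3 w)).
    by apply: (measurableT_comp measurable_spread); exact: measurable_phase3.
  have mm : measurable_fun [set: R * R * R] (fun w => xi_sum3 w / 3).
    by apply: measurable_funM => //; exact: measurable_xi_sum3.
  have mp : measurable_fun [set: (R * R) * (R * R * R)] (fun v => (v.2, v.1)).
    by apply: measurable_fun_pair; [exact: measurable_snd|exact: measurable_fst].
  exact: (measurableT_comp (measurable_spread_weight mrho mm) mp).
rewrite EFinM.
apply: (@le_trans _ _ (((2 * pi) ^+ 2)%:E * \int[P]_y (Normc.normc (cint P3 (fun w =>
     triple h w * gamma (phase3 w) *
     ((spread_weight (spread (phase3 w)) (xi_sum3 w / 3) y)%:C)%C)))%:E)%E).
  by apply: lee_wpmul2l; [rewrite lee_fin sqr_ge0|exact: insert_spread_weight IF].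
rewrite -ge0_integralZl; last 4 first.
- exact: measurableT.
- by apply/measurable_EFinP; exact: cmeasurable_normc.
- by move=> y _; rewrite lee_fin normc_ge0.
- by rewrite lee_fin sqr_ge0.
apply: (@le_trans _ _ (\int[P]_y (
   (k / 2 * (K * (8 * pi ^+ 2)))%:E * (\int[P]_w (pair_density (w, y))%:E) +
   ((2 * k)^-1 * (2 * pi) ^+ 2)%:E * (\int[P]_p (gamma_density (p, y))%:E)))%E).
  apply: ge0_le_integral.
  - exact: measurableT.
  - by move=> y _; rewrite -EFinM lee_fin; apply: mulr_ge0 (sqr_ge0 _) (normc_ge0 _).
  - by apply: measurable_funeM; apply/measurable_EFinP; exact: cmeasurable_normc.
  - exact: (emeasurable_funD (measurable_funeM _ mI1) (measurable_funeM _ mI2)).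
  (* [slice_bound] requires a nonzero inverse width; at [s = 0] the weight itself vanishes. *)
  move=> [c s] _; have [s0|s0] := eqVneq s 0.
    rewrite (_ : cint P3 _ = 0); last first.
      rewrite -[RHS](mul0r (cint P3 (fun w => triple h w * gamma (phase3 w)))) -cintZ//.
      apply: eq_cint => w; rewrite s0 /spread_weight /= normr0 !mul0r mulr0//.
    rewrite Normc.normc0 mule0; apply: adde_ge0; apply: mule_ge0.
    - by rewrite lee_fin.
    - by apply: integral_ge0 => w _; rewrite lee_fin.
    - by rewrite lee_fin.
    - by apply: integral_ge0 => w _; rewrite lee_fin.
  by rewrite -EFinM; exact: slice_bound.
rewrite ge0_integralD; last 5 first.
- exact: measurableT.
- move=> y _; apply: mule_ge0; first by rewrite lee_fin.
  by apply: integral_ge0 => w _; rewrite lee_fin.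
- exact: (measurable_funeM _ mI1).
- move=> y _; apply: mule_ge0; first by rewrite lee_fin.
  by apply: integral_ge0 => w _; rewrite lee_fin.
- exact: (measurable_funeM _ mI2).
rewrite ge0_integralZl; last 4 first.
- exact: measurableT.
- exact: mI1.
- by move=> y _; apply: integral_ge0 => w _; rewrite lee_fin.
- by rewrite lee_fin.
rewrite ge0_integralZl; last 4 first.
- exact: measurableT.
- exact: mI2.
- by move=> y _; apply: integral_ge0 => w _; rewrite lee_fin.
- by rewrite lee_fin.
apply: leeD.
- rewrite (EFinM (k / 2 * (K * (8 * pi ^+ 2)))); apply: lee_wpmul2l; first by rewrite lee_fin.
  exact: integral_pair_density.
- rewrite (EFinM ((2 * k)^-1 * (2 * pi) ^+ 2)) -muleA; apply: lee_wpmul2l; first by rewrite lee_fin.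
  by rewrite (EFinM weight_const) -muleA; exact: integral_gamma_density.
Qed.

End cubic_pairing.

(** * Absorption and removal of the cut-off *)

Section sextic_bound.
Context {R : realType}.
Local Notation mu := (@lebesgue_measure R).
Local Notation P := (prodm mu mu).
Local Notation P3 := (prodm P mu).
Variables (h : R -> R[i]) (K N : R).
Hypothesis Ih : cintegrable mu h.
Hypothesis hN : (\int[mu]_xi (Normc.normc (h xi) ^+ 2)%:E = N%:E)%E.
Hypothesis HK : forall s c t x : R, s != 0 ->
  `|s| * Normc.normc (extension (wave h s c) t x) ^+ 2 <= K.

(** The constant obtained by solving the inequality of [cubic_pairing], at [k = (2 pi)^2], for the
    sextic integral. *)
Definition sextic_const : R := 8 * pi ^+ 2 * (Num.sqrt (pi / 2) * moment2) / weight_const.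

Let u (z : R * R) := extension h z.1 z.2.

Let mu_ : cmeasurable u.
Proof.
by apply: cmeasurable_osc_int; [exact: measurable_energy| |exact: cintegrable_measurable Ih].
Qed.

Let U := \int[mu]_xi Normc.normc (h xi).

Let uU z : Normc.normc (u z) <= U.
Proof. by apply: normc_osc_int => //; exact: measurable_energy. Qed.

Let U0 : 0 <= U. Proof. exact: le_trans (normc_ge0 _) (uU (0, 0)). Qed.

Let gauss2_le1 eps z : 0 <= eps -> gauss2 eps z <= 1 :> R.
Proof.
by move=> e0; rewrite /gauss2 mulr_ile1 ?expR_ge0// expR_le1 oppr_le0 mulr_ge0 ?sqr_ge0.
Qed.

(** Testing against the cut-off cube gives the regularised sextic integral [X] on the left and at
    most half of it on the right. [X] is finite because [u] is bounded and the cut-off is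
    integrable, so it can be subtracted. *)
Let regularized_sextic (eps : R) : 0 < eps ->
  (\int[P]_z (gauss2 eps z * Normc.normc (u z) ^+ 6)%:E <= (sextic_const * K * N ^+ 2)%:E)%E.
Proof.
move=> e0; pose g z := ((gauss2 eps z)%:C)%C * ((u z)^*%C) ^+ 3.
have mg : cmeasurable g.
  apply: cmeasurableM; first by apply: cmeasurable_real; exact: measurable_gauss2.
  by apply: cmeasurableX; exact: cmeasurable_conj.
have Ig2 := integrable_normc (cintegrable_gauss2 e0).
have ng2 z : Normc.normc (((gauss2 eps z)%:C)%C : R[i]) = gauss2 eps z.
  by rewrite normc_real ger0_norm ?gauss2_ge0.
have ng z : Normc.normc (g z) = gauss2 eps z * Normc.normc (u z) ^+ 3.
  by rewrite /g Normc.normcM ng2 normcX normc_conj.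
have Ig : cintegrable P g.
  have := integrableZl measurableT (U ^+ 3) Ig2.
  move/(@cintegrable_le _ _ _ P); apply=> // z.
  rewrite ng2 ng mulrC ler_wpM2r ?gauss2_ge0//.
  by rewrite lerXn2r ?nnegrE ?normc_ge0.
have mX : measurable_fun [set: R * R] (fun z => gauss2 eps z * Normc.normc (u z) ^+ 6).
  apply: measurable_funM; first exact: measurable_gauss2.
  by apply: measurable_funX; exact: cmeasurable_normc.
have X0 z : 0 <= gauss2 eps z * Normc.normc (u z) ^+ 6.
  by apply: mulr_ge0; [exact: gauss2_ge0|apply: exprn_ge0; exact: normc_ge0].
have IX : P.-integrable [set: R * R] (EFin \o (fun z => gauss2 eps z * Normc.normc (u z) ^+ 6)).
  have := integrableZl measurableT (U ^+ 6) Ig2.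
  apply: le_integrable => //; first by apply/measurable_EFinP; exact: mX.
  move=> z _; rewrite ng2 -EFinM /= lee_fin (ger0_norm (X0 z)) ger0_norm; last first.
    by apply: mulr_ge0; [exact: exprn_ge0|exact: gauss2_ge0].
  by rewrite mulrC ler_wpM2r ?gauss2_ge0// lerXn2r ?nnegrE ?normc_ge0.
pose X := \int[P]_z (gauss2 eps z * Normc.normc (u z) ^+ 6).
have XE : (\int[P]_z (gauss2 eps z * Normc.normc (u z) ^+ 6)%:E = X%:E)%E.
  by rewrite /X /Rintegral fineK//; apply: integrable_fin_num.
have XR : 0 <= X by rewrite -lee_fin -XE; apply: integral_ge0 => z _; rewrite lee_fin.
(* [(2 pi)^2] is the value of [k] for which the coefficient of the [gamma] term is exactly half of
   the coefficient on the left. *)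
have k0 : 0 < (2 * pi) ^+ 2 :> R by rewrite exprn_gt0// mulr_gt0// pi_gt0.
pose gamma p := osc_int P (fun z => z.1) (fun z => z.2) g p.1 p.2.
have I3 := cintegrable_prod3 Ih Ih Ih.
(* By Fubini, pairing the triple product with the transform of [g] is integrating [g] against [u^3];
   with [g] equal to the cut-off times the cube of the conjugate of [u], this is [X]. *)
have JX : cint P3 (fun w => triple h w * gamma (phase3 w)) = (X%:C)%C.
  pose Phi (v : (R * R * R) * (R * R)) :=
    osc (fun z => z.1) (fun z => z.2) (phase3 v.1).1 (phase3 v.1).2 v.2 *
    (triple h v.1 * g v.2).
  have IPhi : cintegrable (prodm P3 P) Phi.
    have I4 := cintegrable_prod I3 Ig.
    apply: (@cintegrable_le _ _ _ (prodm P3 P) _ _ _ (integrable_normc I4)).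
      apply: cmeasurableM; last exact: cintegrable_measurable I4.
      have mo := @cmeasurable_osc2 _ (R * R)%type R (fun z => z.1) (fun z => z.2)
        measurable_fst measurable_snd.
      have mp : measurable_fun [set: (R * R * R) * (R * R)] (fun v => (phase3 v.1, v.2)).
        apply: measurable_fun_pair; last exact: measurable_snd.
        by apply: (measurableT_comp measurable_phase3); exact: measurable_fst.
      exact: (cmeasurable_comp mp mo).
    by move=> v; rewrite /Phi Normc.normcM normc_osc mul1r.
  have -> : cint P3 (fun w => triple h w * gamma (phase3 w)) =
      cint P3 (fun w => cint P (fun z => Phi (w, z))).
    apply: eq_cint => w; rewrite /gamma /osc_int -cintZ; last first.
      by apply: cintegrable_osc => //; [exact: measurable_fst|exact: measurable_snd].
    by apply: eq_cint => z; rewrite /Phi/= mulrCA.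
  rewrite (cfubini IPhi) /X -cint_real; apply: eq_cint => z.
  transitivity (g z * osc_int P3 xi_energy3 xi_sum3 (triple h) z.1 z.2).
    rewrite /osc_int -cintZ; last first.
      by apply: cintegrable_osc => //; [exact: measurable_xi_energy3|exact: measurable_xi_sum3].
    apply: eq_cint => w; rewrite /Phi/= /osc/= [xi_energy3 w * _]mulrC [xi_sum3 w * _]mulrC; ring.
  rewrite extension_prod3// -/(u z) real_complexM.
  have -> : ((Normc.normc (u z) ^+ 6)%:C)%C = (u z * (u z)^*%C) ^+ 3 :> R[i].
    by rewrite mulc_conj (exprM _ 2 3) !exprS !real_complexM.
  by rewrite /g; ring.
have := cubic_pairing Ih Ig k0 hN HK; rewrite -/gamma JX normc_real (ger0_norm XR).
have wc0 := @weight_const_gt0 R.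
have gX : (\int[P]_z (Normc.normc (g z) ^+ 2)%:E <= X%:E)%E.
  rewrite -XE; apply: ge0_le_integral.
  - exact: measurableT.
  - by move=> z _; rewrite lee_fin sqr_ge0.
  - by apply/measurable_EFinP; apply: measurable_funX; exact: cmeasurable_normc.
  - by apply/measurable_EFinP; exact: mX.
  move=> z _; rewrite lee_fin ng exprMn -exprM ler_wpM2r ?exprn_ge0 ?normc_ge0//.
  by rewrite expr2 ler_piMr ?gauss2_ge0// gauss2_le1// ltW.
have kk0 : 0 <= (2 * (2 * pi) ^+ 2)^-1 * (2 * pi) ^+ 2 * (weight_const * (2 * pi) ^+ 2) :> R.
  apply: mulr_ge0; last by apply: mulr_ge0; apply: ltW.
  by apply: mulr_ge0; [rewrite invr_ge0 mulr_ge0// ltW|exact: ltW].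
move=> /le_trans /(_ (leeD (lexx _) (lee_wpmul2l _ gX))).
rewrite lee_fin kk0 => /(_ isT); rewrite -EFinM -EFinD lee_fin => main.
rewrite XE lee_fin /sextic_const.
have p0 := @pi_gt0 R.
have -> : 8 * pi ^+ 2 * (Num.sqrt (pi / 2) * moment2) / weight_const * K * N ^+ 2 =
    8 * pi ^+ 2 * (Num.sqrt (pi / 2) * moment2) * K * N ^+ 2 / weight_const by ring.
rewrite ler_pdivlMr//.
rewrite -(ler_pM2l (_ : 0 < (2 * pi) ^+ 2 / 2)); last by rewrite divr_gt0.
have e1 : (2 * (2 * pi) ^+ 2)^-1 * (2 * pi) ^+ 2 * (weight_const * (2 * pi) ^+ 2) * X =
    (2 * pi) ^+ 2 / 2 * (X * weight_const).
  by have := k0; move: ((2 * pi) ^+ 2 : R) => q q0; field; rewrite gt_eqF.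
move: main; rewrite e1 => main.
have -> : (2 * pi) ^+ 2 / 2 * (8 * pi ^+ 2 * (Num.sqrt (pi / 2) * moment2) * K * N ^+ 2) =
    (2 * pi) ^+ 2 / 2 * (K * (8 * pi ^+ 2)) * (Num.sqrt (pi / 2) * moment2 * N ^+ 2) by ring.
move: main; have -> : (2 * pi) ^+ 2 * (weight_const * X) =
    (2 * pi) ^+ 2 / 2 * (X * weight_const) + (2 * pi) ^+ 2 / 2 * (X * weight_const) by field.
by rewrite lerD2r.
Qed.

(** The regularised bound does not involve [eps], so Fatou's lemma removes the cut-off. *)
Lemma sextic_bound :
  (\int[P]_z (Normc.normc (extension h z.1 z.2) ^+ 6)%:E <= (sextic_const * K * N ^+ 2)%:E)%E.
Proof.
apply: (@fatou_bound _ _ _ P (fun n z => gauss2 n.+1%:R^-1 z * Normc.normc (u z) ^+ 6)).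
- move=> n; apply: measurable_funM; first exact: measurable_gauss2.
  by apply: measurable_funX; exact: cmeasurable_normc.
- by move=> n z; apply: mulr_ge0; [exact: gauss2_ge0|apply: exprn_ge0; exact: normc_ge0].
- move=> z; rewrite -[X in _ --> X]mul1r; apply: cvgM; [exact: cvg_gauss2|exact: cvg_cst].
- by move=> n; apply: regularized_sextic; rewrite invr_gt0.
Qed.

Lemma sextic_const_ge0 : 0 <= sextic_const.
Proof.
apply: divr_ge0 (ltW weight_const_gt0).
by apply: mulr_ge0; apply: mulr_ge0; rewrite ?sqr_ge0 ?sqrtr_ge0 ?moment2_ge0.
Qed.

End sextic_bound.

(** * Fourier transforms of square-integrable functions *)

Lemma normcN (R : realType) (z : R[i]) : Normc.normc (- z) = Normc.normc z.
Proof. by case: z => a b /=; rewrite !sqrrN. Qed.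

Section square_integrable.
Context {R : realType}.
Local Notation mu := (@lebesgue_measure R).

Definition sqnorm (f : R -> R[i]) : \bar R := (\int[mu]_x (Normc.normc (f x) ^+ 2)%:E)%E.

Lemma measurable_sqr_normc (f : R -> R[i]) : cmeasurable f ->
  measurable_fun [set: R] (fun x => Normc.normc (f x) ^+ 2).
Proof. by move=> mf; apply: measurable_funX; exact: cmeasurable_normc. Qed.

Lemma sqnorm_ge0 f : (0 <= sqnorm f)%E.
Proof. by apply: integral_ge0 => x _; rewrite lee_fin sqr_ge0. Qed.

Lemma sqr_cLnorm f : (cLnorm mu 2%:E f `^ 2)%E = sqnorm f.
Proof.
rewrite /cLnorm poweR_Lnorm ?pnatr_eq0//; apply: eq_integral => x _.
by rewrite gee0_abs ?lee_fin ?normc_ge0// poweR_EFin powR_mulrn ?normc_ge0.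
Qed.

Lemma cLnorm_sqnorm f (A : R) : 0 <= A -> cLnorm mu 2%:E f = A%:E -> sqnorm f = (A ^+ 2)%:E.
Proof. by move=> A0 fA; rewrite -sqr_cLnorm fA poweR_EFin powR_mulrn. Qed.

Lemma inL2_sqnorm f : inL2 f -> (sqnorm f < +oo)%E.
Proof. by case=> _ h; rewrite -sqr_cLnorm poweR_lty. Qed.

Lemma integrable_sqr_normc f : cmeasurable f -> (sqnorm f < +oo)%E ->
  mu.-integrable [set: R] (EFin \o (fun x => Normc.normc (f x) ^+ 2)).
Proof.
move=> mf h; apply: (@ge0_integrable _ _ _ mu _ (measurable_sqr_normc mf)) => //.
by move=> x; exact: sqr_ge0.
Qed.

Lemma cintegrable_mul f g : cmeasurable f -> cmeasurable g ->
  (sqnorm f < +oo)%E -> (sqnorm g < +oo)%E -> cintegrable mu (fun x => f x * g x).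
Proof.
move=> mf mg f2 g2.
have := integrableD measurableT (integrable_sqr_normc mf f2) (integrable_sqr_normc mg g2).
move/(@cintegrable_le _ _ _ mu); apply; first exact: cmeasurableM.
move=> x; rewrite Normc.normcM.
have := sqr_ge0 (Normc.normc (f x) - Normc.normc (g x)).
have := mulr_ge0 (normc_ge0 (f x)) (normc_ge0 (g x)).
move: (Normc.normc (f x)) (Normc.normc (g x)) => a b; nra.
Qed.

Lemma sqnormD_le f g : cmeasurable f -> cmeasurable g ->
  (sqnorm (fun x => f x + g x)%R <= 2%:E * sqnorm f + 2%:E * sqnorm g)%E.
Proof.
move=> mf mg; have m1 := measurable_sqr_normc mf; have m2 := measurable_sqr_normc mg.
have two0 : (0 <= 2%:E :> \bar R)%E by rewrite lee_fin.
rewrite /sqnorm -!ge0_integralZl; try exact: measurableT; try exact: two0;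
  try (by apply/measurable_EFinP); try (by move=> x _; rewrite lee_fin sqr_ge0).
rewrite -ge0_integralD; last 5 first.
- exact: measurableT.
- by move=> x _; rewrite -EFinM lee_fin; apply: mulr_ge0 => //; exact: sqr_ge0.
- by apply: measurable_funeM; exact/measurable_EFinP.
- by move=> x _; rewrite -EFinM lee_fin; apply: mulr_ge0 => //; exact: sqr_ge0.
- by apply: measurable_funeM; exact/measurable_EFinP.
apply: ge0_le_integral.
- exact: measurableT.
- by move=> x _; rewrite lee_fin sqr_ge0.
- by apply/measurable_EFinP; apply: measurable_sqr_normc; exact: cmeasurableD.
- by apply: emeasurable_funD; apply: measurable_funeM; exact/measurable_EFinP.
move=> x _; rewrite -!EFinM -EFinD lee_fin.
have tr : Normc.normc (f x + g x) <= Normc.normc (f x) + Normc.normc (g x) by exact: (@le_normcD R (f x) (g x)).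
apply: (@le_trans _ _ ((Normc.normc (f x) + Normc.normc (g x)) ^+ 2)).
  by rewrite lerXn2r ?nnegrE ?addr_ge0 ?normc_ge0.
have := sqr_ge0 (Normc.normc (f x) - Normc.normc (g x)).
by move: (Normc.normc (f x)) (Normc.normc (g x)) => a b; nra.
Qed.

(** Continuity of the pairing in the L2 norm, through a weighted arithmetic-geometric mean in the
    role of the Cauchy-Schwarz inequality. *)
Lemma pairing_small (phi : R -> R[i]) (eps : R) : cmeasurable phi -> (sqnorm phi < +oo)%E ->
  0 < eps -> exists2 e : R, 0 < e & forall D, cmeasurable D -> (sqnorm D <= e%:E)%E ->
    Normc.normc (cint mu (fun x => D x * phi x)) <= eps.
Proof.
move=> mphi phi2 e0; pose Phi := fine (sqnorm phi).
have PhiE : sqnorm phi = Phi%:E by rewrite /Phi fineK// ge0_fin_numE ?sqnorm_ge0.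
have Phi0 : 0 <= Phi by rewrite fine_ge0// sqnorm_ge0.
(* Adding 1 keeps [k] positive when [phi] vanishes. With [e = eps / k] each of the two terms is at
   most [eps / 2]. *)
pose k := (Phi + 1) / eps; have k0 : 0 < k by rewrite divr_gt0// ltr_wpDl.
exists (eps / k); first exact: divr_gt0.
move=> D mD D2; have D2y : (sqnorm D < +oo)%E by exact: le_lt_trans D2 (ltry _).
have ID := cintegrable_mul mD mphi D2y phi2.
have m1 := measurable_sqr_normc mD; have m2 := measurable_sqr_normc mphi.
rewrite -lee_fin (le_trans (le_normc_cinte ID))//.
have k2 : 0 <= k / 2 by rewrite divr_ge0// ltW.
have k2i : 0 <= (2 * k)^-1 by rewrite invr_ge0 mulr_ge0// ltW.
apply: (@le_trans _ _ ((k / 2)%:E * sqnorm D + (2 * k)^-1%:E * sqnorm phi)%E).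
  rewrite /sqnorm -ge0_integralZl; last 4 first.
  - exact: measurableT.
  - exact/measurable_EFinP.
  - by move=> x _; rewrite lee_fin sqr_ge0.
  - by rewrite lee_fin.
  rewrite -ge0_integralZl; last 4 first.
  - exact: measurableT.
  - exact/measurable_EFinP.
  - by move=> x _; rewrite lee_fin sqr_ge0.
  - by rewrite lee_fin.
  rewrite -ge0_integralD; last 5 first.
  - exact: measurableT.
  - by move=> x _; rewrite -EFinM lee_fin; apply: mulr_ge0 => //; exact: sqr_ge0.
  - by apply: measurable_funeM; exact/measurable_EFinP.
  - by move=> x _; rewrite -EFinM lee_fin; apply: mulr_ge0 => //; exact: sqr_ge0.
  - by apply: measurable_funeM; exact/measurable_EFinP.
  apply: ge0_le_integral.
  - exact: measurableT.
  - by move=> x _; rewrite lee_fin normc_ge0.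
  - by apply/measurable_EFinP; apply: cmeasurable_normc; exact: cmeasurableM.
  - by apply: emeasurable_funD; apply: measurable_funeM; exact/measurable_EFinP.
  by move=> x _; rewrite -!EFinM -EFinD lee_fin Normc.normcM mul_amgm.
rewrite PhiE; apply: (@le_trans _ _ ((k / 2)%:E * (eps / k)%:E + (2 * k)^-1%:E * Phi%:E)%E).
  by apply: leeD => //; apply: lee_wpmul2l; rewrite ?lee_fin.
rewrite -!EFinM -EFinD lee_fin /k.
have P1 : 0 < Phi + 1 by rewrite ltr_wpDl.
have -> : (Phi + 1) / eps / 2 * (eps / ((Phi + 1) / eps)) + (2 * ((Phi + 1) / eps))^-1 * Phi =
    eps * (1 + Phi / (Phi + 1)) / 2.
  by field; rewrite !gt_eqF.
rewrite ler_pdivrMr// ler_wpM2l ?(ltW e0)//.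
have : Phi / (Phi + 1) <= 1 by rewrite ler_pdivrMr// mul1r lerDl.
by move: (Phi / _) => a; lra.
Qed.

End square_integrable.

Section fourier_L2.
Context {R : realType}.
Local Notation mu := (@lebesgue_measure R).
Local Notation P := (prodm mu mu).

(** A truncated square-integrable function is integrable, so the results on integrable functions
    apply to its Fourier transform, which is the truncated transform up to the sign of the
    frequency. *)
Definition truncation (n : nat) (f : R -> R[i]) (x : R) : R[i] :=
  ((\1_(`[- n%:R, n%:R]%classic : set R) x : R)%:C)%C * f x.

Lemma truncated_fourierE n f xi : truncated_fourier n f xi = fourierC (truncation n f) (- xi).
Proof.
rewrite /truncated_fourier /fourierC /cint /cintegral; congr Complex.
- rewrite Rintegral_mkcond; apply: eq_Rintegral => x _; rewrite patchE.
  rewrite /truncation mulNr mulrC [x * xi]mulrC indicE; case: ifPn => xn.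
    by rewrite [in RHS]mulrCA mul1r mulrC.
  by rewrite mul0r mulr0.
- rewrite Rintegral_mkcond; apply: eq_Rintegral => x _; rewrite patchE.
  rewrite /truncation mulNr mulrC [x * xi]mulrC indicE; case: ifPn => xn.
    by rewrite [in RHS]mulrCA mul1r mulrC.
  by rewrite mul0r mulr0.
Qed.

Lemma normc_truncation n f x : Normc.normc (truncation n f x) <= Normc.normc (f x).
Proof.
rewrite Normc.normcM normc_real indicE; case: (_ \in _); rewrite ?normr1 ?mul1r//.
by rewrite normr0 mul0r normc_ge0.
Qed.

Lemma cmeasurable_truncation n f : cmeasurable f -> cmeasurable (truncation n f).
Proof.
move=> mf; apply: cmeasurableM => //; apply: cmeasurable_real.
exact: measurable_indic.
Qed.

Lemma cintegrable_truncation n f : cmeasurable f -> (sqnorm f < +oo)%E ->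
  cintegrable mu (truncation n f).
Proof.
move=> mf f2; apply: cintegrable_mul => //.
  by apply: cmeasurable_real; exact: measurable_indic.
rewrite /sqnorm (_ : (\int[mu]_x _)%E = (\int[mu]_x (\1_(`[- n%:R, n%:R]%classic : set R) x)%:E)%E).
  rewrite integral_indic// setIT.
  rewrite [X in (X < _)%E](@lebesgue_measure_itv R `[- n%:R, n%:R])/=.
  by case: ifP => _; rewrite -?EFinB ltry.
apply: eq_integral => x _; rewrite normc_real real_normK ?num_real// indicE.
by case: (_ \in _); rewrite ?expr1n ?expr0n.
Qed.

Lemma cvg_truncation n f x : (`|x| <= n%:R) -> truncation n f x = f x.
Proof.
move=> xn; rewrite /truncation indicE mem_set ?mul1r//=.
by rewrite in_itv/= -ler_norml.
Qed.

Lemma is_fourier_near (f F : R -> R[i]) (e : R) : is_fourier f F -> 0 < e ->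
  \forall n \near \oo, (sqnorm (fun xi => F xi - truncated_fourier n f xi)%R <= e%:E)%E.
Proof.
move=> [_ _ /fine_cvgP[Ffin Fcvg]] e0.
have s0 : 0 < Num.sqrt e by rewrite sqrtr_gt0.
near=> n; rewrite -sqr_cLnorm.
have fn : cLnorm mu 2%:E (fun xi => F xi - truncated_fourier n f xi) \is a fin_num by near: n.
have lt : `|0 - fine (cLnorm mu 2%:E (fun xi => F xi - truncated_fourier n f xi))| < Num.sqrt e.
  by near: n; move/cvgrPdist_lt : Fcvg; exact.
rewrite -(fineK fn) poweR_EFin lee_fin powR_mulrn; last by rewrite fine_ge0// Lnorm_ge0.
move: lt; rewrite sub0r normrN ger0_norm ?fine_ge0 ?Lnorm_ge0// => lt.
rewrite -[leRHS]sqr_sqrtr ?(ltW e0)// lerXn2r ?nnegrE ?sqrtr_ge0 ?(ltW lt)//.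
by rewrite fine_ge0// Lnorm_ge0.
Unshelve. all: by end_near. Qed.

Lemma cmeasurable_truncated_fourier n (f : R -> R[i]) : cmeasurable f -> cmeasurable (truncated_fourier n f).
Proof.
move=> mf; have -> : truncated_fourier n f = (fun xi => fourierC (truncation n f) (- xi)).
  by apply/funext => xi; exact: truncated_fourierE.
apply: (@cmeasurable_comp _ _ _ _ _ (fun xi : R => - xi)); first exact: oppr_measurable.
by apply: cmeasurable_fourierC; exact: cmeasurable_truncation.
Qed.

Lemma sqnorm_truncated_fourier n (f : R -> R[i]) : cmeasurable f -> (sqnorm f < +oo)%E ->
  (sqnorm (truncated_fourier n f) <= (2 * pi)%:E * sqnorm f)%E.
Proof.
move=> mf f2; have I := cintegrable_truncation n mf f2.
have mF := cmeasurable_fourierC (cmeasurable_truncation n mf).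
rewrite /sqnorm; have -> : (\int[mu]_xi (Normc.normc (truncated_fourier n f xi) ^+ 2)%:E =
    \int[mu]_xi (Normc.normc (fourierC (truncation n f) xi) ^+ 2)%:E)%E.
  rewrite -[RHS]ge0_integral_opp; last 2 first.
  - by apply/measurable_EFinP; exact: measurable_sqr_normc.
  - by move=> x; rewrite lee_fin sqr_ge0.
  by apply: eq_integral => xi _; rewrite truncated_fourierE.
apply: (le_trans (plancherel1 I)); apply: lee_wpmul2l.
  by rewrite lee_fin mulr_ge0// pi_ge0.
apply: ge0_le_integral.
- exact: measurableT.
- by move=> x _; rewrite lee_fin sqr_ge0.
- by apply/measurable_EFinP; apply: measurable_sqr_normc; exact: cmeasurable_truncation.
- by apply/measurable_EFinP; exact: measurable_sqr_normc.
- by move=> x _; rewrite lee_fin lerXn2r ?nnegrE ?normc_ge0// normc_truncation.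
Qed.

(** The limit is taken through [sqnormD_le], which costs a factor 2 over the Plancherel constant
    [2 pi]; the size of the constant does not matter for the theorem. *)
Lemma is_fourier_sqnorm (f F : R -> R[i]) : is_fourier f F ->
  (sqnorm F <= (4 * pi)%:E * sqnorm f)%E.
Proof.
move=> fF; have [[mf f2] [mF F2] _] := fF.
apply/lee_addgt0Pr => e e0; have e20 : 0 < e / 2 by rewrite divr_gt0.
have [n _ /(_ n (leqnn n)) hn] := is_fourier_near fF e20.
have mT := cmeasurable_truncated_fourier n mf.
have -> : sqnorm F = sqnorm (fun xi => truncated_fourier n f xi + (F xi - truncated_fourier n f xi)).
  by congr sqnorm; apply/funext => xi; ring.
apply: (le_trans (sqnormD_le mT (cmeasurableB mF mT))); apply: leeD.
  have -> : (4 * pi)%:E = (2%:E * (2 * pi)%:E)%E :> \bar R by rewrite -EFinM; congr (_%:E); ring.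
  rewrite -muleA; apply: lee_wpmul2l; first by rewrite lee_fin.
  exact: sqnorm_truncated_fourier (inL2_sqnorm (conj mf f2)).
have -> : e%:E = (2%:E * (e / 2)%:E)%E by rewrite -EFinM; congr (_%:E); field.
by apply: lee_wpmul2l; rewrite ?lee_fin.
Qed.

(** Different representatives of the Fourier transform agree in every L2 pairing. Each is close in
    L2 to the same truncated transform, so no pointwise comparison is made. *)
Lemma is_fourier_uniq (f F F' phi : R -> R[i]) : is_fourier f F -> is_fourier f F' ->
  cmeasurable phi -> (sqnorm phi < +oo)%E ->
  cint mu (fun xi => F xi * phi xi) = cint mu (fun xi => F' xi * phi xi).
Proof.
move=> fF fF' mphi phi2; have [[mf f2] [mF F2] _] := fF; have [_ [mF' F2'] _] := fF'.
have IF := cintegrable_mul mF mphi (inL2_sqnorm (conj mF F2)) phi2.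
have IF' := cintegrable_mul mF' mphi (inL2_sqnorm (conj mF' F2')) phi2.
apply/eqP; rewrite -subr_eq0 -cintB//; apply/eqP; apply: Normc.eq0_normc.
apply/eqP; rewrite eq_le normc_ge0 andbT; apply/ler_addgt0Pr => eps eps0; rewrite add0r.
have [e e0 small] := pairing_small mphi phi2 eps0.
have e40 : 0 < e / 4 by rewrite divr_gt0.
have [n _ hn] := is_fourier_near fF e40; have [n' _ hn'] := is_fourier_near fF' e40.
have {hn} := hn (maxn n n') (leq_maxl _ _); have {hn'} := hn' (maxn n n') (leq_maxr _ _).
move: (maxn n n') => N h' h; have mT := cmeasurable_truncated_fourier N mf.
have -> : cint mu (fun xi => F xi * phi xi - F' xi * phi xi) =
    cint mu (fun xi => (F xi - F' xi) * phi xi).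
  by apply: eq_cint => xi; rewrite mulrBl.
apply: small; first exact: cmeasurableB.
have -> : (fun xi => F xi - F' xi) = (fun xi => (F xi - truncated_fourier N f xi) +
    - (F' xi - truncated_fourier N f xi)) by apply/funext => xi; ring.
apply: le_trans (sqnormD_le (cmeasurableB mF mT) (cmeasurableN (cmeasurableB mF' mT))) _.
have -> : sqnorm (fun x => - (F' x - truncated_fourier N f x)) =
    sqnorm (fun x => F' x - truncated_fourier N f x).
  by apply: eq_integral => x _; rewrite normcN.
have -> : e%:E = (2%:E * (e / 4)%:E + 2%:E * (e / 4)%:E)%E.
  by rewrite -!EFinM -EFinD; congr (_%:E); field.
by apply: leeD; apply: lee_wpmul2l; rewrite ?lee_fin.
Qed.

Lemma fourier_exchange (f phi : R -> R[i]) : cintegrable mu f -> cintegrable mu phi ->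
  cint mu (fun xi => fourierC f (- xi) * phi xi) = cint mu (fun x => f x * fourierC phi (- x)).
Proof.
move=> If Iphi.
pose G (z : R * R) := expi (- (z.1 * z.2)) * (phi z.1 * f z.2).
have Ipf := cintegrable_prod Iphi If.
have IG : cintegrable P G.
  apply: (@cintegrable_le _ _ _ P _ _ _ (integrable_normc Ipf)).
    apply: cmeasurableM; last exact: cintegrable_measurable Ipf.
    apply: cmeasurable_expi; apply: measurableT_comp => //.
    by apply: measurable_funM; [exact: measurable_fst|exact: measurable_snd].
  by move=> z; rewrite /G Normc.normcM normc_expi mul1r.
transitivity (cint mu (fun xi => cint mu (fun x => G (xi, x)))).
  apply: eq_cint => xi; rewrite /fourierC -cintZr; last exact: cintegrable_fourierC.
  by apply: eq_cint => x; rewrite /G/= mulNr; ring.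
rewrite (cfubini IG); apply: eq_cint => x; rewrite /fourierC -cintZ; last exact: cintegrable_fourierC.
by apply: eq_cint => xi; rewrite /G/= mulNr [x * xi]mulrC; ring.
Qed.

(** For truncations of [g] this is Fubini. On the left the passage to the limit uses the L2
    convergence that defines [G], on the right dominated convergence. *)
Lemma parseval_fourier (g G phi : R -> R[i]) : is_fourier g G -> cintegrable mu phi ->
  (sqnorm phi < +oo)%E ->
  cint mu (fun xi => G xi * phi xi) = cint mu (fun x => g x * fourierC phi (- x)).
Proof.
move=> gG Iphi phi2; have [[mg g2] [mG G2] _] := gG.
have mphi := cintegrable_measurable Iphi.
have gy := inL2_sqnorm (conj mg g2); have Gy := inL2_sqnorm (conj mG G2).
pose ph x := fourierC phi (- x).
have mph : cmeasurable ph.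
  apply: (@cmeasurable_comp _ _ _ _ _ (fun xi : R => - xi)); first exact: oppr_measurable.
  exact: cmeasurable_fourierC.
have phy : (sqnorm ph < +oo)%E.
  rewrite /sqnorm (_ : (\int[mu]_x _ = \int[mu]_x (Normc.normc (fourierC phi x) ^+ 2)%:E)%E).
    apply: le_lt_trans (plancherel1 Iphi) _.
    by apply: lte_mul_pinfty => //; rewrite lee_fin mulr_ge0// pi_ge0.
  rewrite -[RHS]ge0_integral_opp//.
  - by apply/measurable_EFinP; apply: measurable_sqr_normc; exact: cmeasurable_fourierC.
  - by move=> x; rewrite lee_fin sqr_ge0.
have Igp := cintegrable_mul mg mph gy phy.
have c : cvgC (fun n => cint mu (fun x => truncation n g x * ph x)) (cint mu (fun x => g x * ph x)).
  apply: (@cint_dct _ _ _ mu (fun n x => truncation n g x * ph x) _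
    (fun x => Normc.normc (g x * ph x))).
  - by move=> n; apply: cmeasurableM => //; exact: cmeasurable_truncation.
  - exact: cintegrable_measurable Igp.
  - move=> x; apply: cvg_near_cst; near=> n; rewrite cvg_truncation ?subrr ?Normc.normc0//.
    by near: n; exact: nbhs_infty_ger.
  - exact: integrable_normc Igp.
  - by move=> n x; rewrite (Normc.normcM (truncation n g x)) (Normc.normcM (g x)) ler_wpM2r ?normc_ge0//; exact: normc_truncation.
apply/eqP; rewrite -subr_eq0; apply/eqP; apply: Normc.eq0_normc.
apply/eqP; rewrite eq_le normc_ge0 andbT; apply/ler_addgt0Pr => eps eps0; rewrite add0r.
have e20 : 0 < eps / 2 by rewrite divr_gt0.
have [e e0 small] := pairing_small mphi phi2 e20.
have : \forall n \near \oo, Normc.normc (cint mu (fun xi => G xi * phi xi) - cint mu (fun x => g x * ph x)) <= eps.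
  near=> n.
  have mT := cmeasurable_truncated_fourier n mg.
  have Tn : cint mu (fun xi => truncated_fourier n g xi * phi xi) =
      cint mu (fun x => truncation n g x * ph x).
    transitivity (cint mu (fun xi => fourierC (truncation n g) (- xi) * phi xi)).
      by apply: eq_cint => xi; rewrite truncated_fourierE.
    exact: (fourier_exchange (cintegrable_truncation n mg gy) Iphi).
  have Ty : (sqnorm (truncated_fourier n g) < +oo)%E.
    apply: le_lt_trans (sqnorm_truncated_fourier n mg gy) _.
    by apply: lte_mul_pinfty => //; rewrite lee_fin mulr_ge0// pi_ge0.
  have -> : cint mu (fun xi => G xi * phi xi) - cint mu (fun x => g x * ph x) =
      cint mu (fun xi => (G xi - truncated_fourier n g xi) * phi xi) +
      (cint mu (fun x => truncation n g x * ph x) - cint mu (fun x => g x * ph x)).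
    rewrite -Tn addrA; congr (_ - _).
    rewrite -cintD; last 2 first.
    - apply: cintegrable_mul => //; first exact: cmeasurableB.
      by near: n; have [N _ hN] := is_fourier_near gG e0; exists N => // n /hN h; exact: le_lt_trans h (ltry _).
    - exact: cintegrable_mul.
    by apply: eq_cint => xi; ring.
  apply: le_trans (@le_normcD R _ _) _; rewrite [leRHS](splitr eps); apply: lerD.
    apply: small; first exact: cmeasurableB.
    by near: n; exact: is_fourier_near.
  near: n; move/cvgrPdist_le : c => /(_ _ e20); apply: filterS => n.
  by rewrite sub0r normrN ger0_norm ?normc_ge0.
by case=> n _ /(_ n (leqnn n)).
Unshelve. all: by end_near. Qed.

End fourier_L2.

(** * Gaussian means at Lebesgue points *)

Section gaussian_differentiation.
Context {R : realType}.
Local Notation mu := (@lebesgue_measure R).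
Variables (f : R -> R) (x : R).
Hypotheses (mf : measurable_fun [set: R] f)
  (f2 : (\int[mu]_y ((f y) ^+ 2)%:E < +oo)%E) (fx : lebesgue_pt f x).

Let r_ (n : nat) : R := n.+1%:R^-1.
Let r_gt0 n : 0 < r_ n. Proof. by rewrite invr_gt0. Qed.
Let D y := `|f y - f x|.
Let mD : measurable_fun [set: R] D.
Proof. by apply: measurableT_comp => //; exact: measurable_funB. Qed.

(* A Gaussian is dominated by a superposition of indicators of balls. *)
Let gauss_balls (y : R) : ((expR (- (y ^+ 2 / 4)))%:E <=
  (expR (4^-1))%:E * \int[mu]_rho ((`|y| < rho)%R%:R * expR (- (rho ^+ 2 / 8)))%:E)%E.
Proof.
have m8 : measurable_fun [set: R] (fun rho : R => (`|y| < rho)%R%:R * expR (- (rho ^+ 2 / 8)) : R).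
  apply: measurable_funM.
    have -> : (fun rho : R => (`|y| < rho)%R%:R : R) = \1_(`]`|y|, +oo[%classic).
      by apply/funext => rho; rewrite indicE mem_setE in_itv/= andbT.
    by apply: measurable_indic; exact: measurable_itv.
  have : measurable_fun [set: R] (fun rho : R => expR (- (8^-1 * rho ^+ 2))) by exact: measurable_gauss.
  by apply: eq_measurable_fun => rho _; rewrite mulrC.
(* Since [(|y| + 1)^2 <= 2 y^2 + 2], the Gaussian is bounded by its value at radius [|y| + 1], and
   the radii between [|y|] and [|y| + 1], an interval of length 1, already give this much. *)
apply: (@le_trans _ _ ((expR (4^-1))%:E * (expR (- ((`|y| + 1) ^+ 2 / 8)))%:E)%E).
  rewrite -EFinM lee_fin -expRD ler_expR -[y ^+ 2]real_normK ?num_real//.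
  by have := sqr_ge0 (`|y| - 1); move: `|y| => a; nra.
apply: lee_wpmul2l; first by rewrite lee_fin expR_ge0.
move: m8; set a : R := `|y| => m8; have a0 : 0 <= a := normr_ge0 y.
apply: (@le_trans _ _ (\int[mu]_(rho in `]a, (a + 1)%R]) (expR (- ((a + 1) ^+ 2 / 8)))%:E)%E).
  rewrite integral_cst//= lebesgue_measure_itv/= lte_fin ltrDl ltr01 -EFinD -EFinM lee_fin.
  by rewrite addrAC subrr add0r mulr1.
apply: (@le_trans _ _ (\int[mu]_(rho in `]a, (a + 1)%R]) ((a < rho)%R%:R * expR (- (rho ^+ 2 / 8)))%:E)%E).
  apply: ge0_le_integral => //.
  - by apply/measurable_EFinP; exact: measurable_funTS.
  - move=> rho /=; rewrite in_itv/= => /andP[h1 h2]; rewrite lee_fin h1 mul1r ler_expR lerN2.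
    rewrite ler_pM2r ?invr_gt0// lerXn2r ?nnegrE ?addr_ge0//.
    exact: le_trans a0 (ltW h1).
by apply: ge0_subset_integral => //; apply/measurable_EFinP.
Qed.

Let avg (n : nat) (rho : R) : \bar R := (\int[mu]_y ((`|y| < rho)%R%:R * D (r_ n * y + x))%:E)%E.

Let mball : measurable_fun [set: R * R] (fun z : R * R => (`|z.1| < z.2)%R%:R : R).
Proof.
have -> : (fun z : R * R => (`|z.1| < z.2)%R%:R : R) = \1_[set z : R * R | `|z.1| < z.2].
  by apply/funext => z; rewrite indicE; congr ((nat_of_bool _)%:R); apply/idP/idP; rewrite inE.
apply: measurable_indic.
have m1 : measurable_fun [set: R * R] (fun z : R * R => z.2 - `|z.1|).
  by apply: measurable_funB; [exact: measurable_snd|apply: measurableT_comp => //; exact: measurable_fst].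
have := m1 measurableT _ (@measurable_itv R `]0, +oo[).
by rewrite setTI; congr measurable; apply/seteqP; split => z /=; rewrite in_itv/= ?andbT subr_gt0.
Qed.

Let mavgf n : measurable_fun [set: R * R] (fun z : R * R => (`|z.1| < z.2)%R%:R * D (r_ n * z.1 + x)).
Proof.
apply: measurable_funM; first exact: mball.
apply: (measurableT_comp mD); apply: measurable_funD => //.
by apply: measurable_funM => //; exact: measurable_fst.
Qed.

Let avgf_ge0 n (z : R * R) : 0 <= (`|z.1| < z.2)%R%:R * D (r_ n * z.1 + x).
Proof. by apply: mulr_ge0 => //; exact: normr_ge0. Qed.

Let mavg n : measurable_fun [set: R] (avg n).
Proof. exact: (measurable_int1 mu (mavgf n) (avgf_ge0 n)). Qed.

(** Undoing the dilation by [r_ n] turns the integral over the ball of radius [rho] into one over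
    the ball about [x] of radius [r_ n * rho]; the factor [2 rho] is what normalisation by the
    measure of that ball leaves. *)
Let avgE n rho : 0 < rho -> avg n rho = ((2 * rho)%:E * davg f x (r_ n * rho))%E.
Proof.
move=> rho0; have rr0 : 0 < r_ n * rho by exact: mulr_gt0.
have mb : measurable (ball x (r_ n * rho)) by exact: measurable_ball.
rewrite /davg /iavg lebesgue_measure_ball ?(ltW rr0)// inver mulrn_eq0/= gt_eqF//.
rewrite muleA -EFinM integral_mkcond.
have -> : 2 * rho * (r_ n * rho *+ 2)^-1 = (r_ n)^-1.
  by rewrite -mulr_natl; field; rewrite !gt_eqF// r_gt0.
have mG : measurable_fun [set: R] (fun y : R => (((`|x - y| < r_ n * rho)%R%:R : R) * D y)%:E).
  apply/measurable_EFinP; apply: measurable_funM => //.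
  have := @measurable_indic _ _ R [set: R] _ mb; apply: eq_measurable_fun => y _.
  by rewrite indicE; congr ((nat_of_bool _)%:R); apply/idP/idP; rewrite inE.
have -> : (\int[mu]_y ((fun z => `|(f z - f x)%:E|) \_ (ball x (r_ n * rho))) y =
    \int[mu]_y ((`|x - y| < r_ n * rho)%R%:R * D y)%:E)%E.
  apply: eq_integral => y _; rewrite patchE; case: ifPn => /=.
    by rewrite inE => hy; rewrite (hy : `|x - y| < _) mul1r.
  by rewrite notin_setE => /negP/negbTE hy; rewrite (hy : (`|x - y| < _) = _) mul0r.
rewrite (@ge0_integral_affine _ _ x _ (r_gt0 n) mG); last first.
  by move=> y; rewrite lee_fin; apply: mulr_ge0 => //; exact: normr_ge0.
rewrite muleA -EFinM mulVf ?gt_eqF ?r_gt0// mul1e; apply: eq_integral => y _.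
congr ((_ * _)%:E); congr ((nat_of_bool _)%:R).
by rewrite opprD addrCA subrr addr0 normrN normrM gtr0_norm ?r_gt0// ltr_pM2l ?r_gt0.
Qed.

Let C2 := fine (\int[mu]_y ((f y) ^+ 2)%:E).
Let C2E : (\int[mu]_y ((f y) ^+ 2)%:E = C2%:E)%E.
Proof. by rewrite /C2 fineK// ge0_fin_numE//; apply: integral_ge0 => y _; rewrite lee_fin sqr_ge0. Qed.

(** This covers the radii about which the Lebesgue point property says nothing. By [|f| <= f^2 + 1],
    square integrability controls averages over large balls. *)
Let davg_le r : 0 < r -> (davg f x r <= (C2 / (2 * r) + 1 + `|f x|)%:E)%E.
Proof.
move=> r0; have mb : measurable (ball x r) by exact: measurable_ball.
have r20 : 0 < r *+ 2 by rewrite mulrn_wgt0.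
have mf2 : measurable_fun [set: R] (fun y => f y ^+ 2) by exact: measurable_funX.
rewrite /davg /iavg lebesgue_measure_ball ?(ltW r0)// inver gt_eqF//.
have -> : (C2 / (2 * r) + 1 + `|f x|)%:E = (((r *+ 2)^-1)%:E * (C2%:E + (1 + `|f x|)%:E * (r *+ 2)%:E))%E.
  change ((C2 / (2 * r) + 1 + `|f x|)%:E = ((r *+ 2)^-1 * (C2 + (1 + `|f x|) * (r *+ 2)))%:E).
  by congr (_%:E); rewrite -mulr_natl; field; rewrite gt_eqF.
apply: lee_wpmul2l; first by rewrite lee_fin invr_ge0 ltW.
apply: (@le_trans _ _ (\int[mu]_(y in ball x r) ((f y ^+ 2)%:E + (1 + `|f x|)%:E))%E).
  apply: ge0_le_integral => //.
  - apply: measurableT_comp => //; apply/measurable_EFinP; apply: measurable_funTS.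
    exact: measurable_funB.
  - by apply: emeasurable_funD => //; apply/measurable_EFinP; exact: measurable_funTS.
  - move=> y _; rewrite -EFinD /= lee_fin; apply: (le_trans (ler_normB _ _)).
    rewrite addrA lerD2r -[f y ^+ 2]real_normK ?num_real//.
    by have := sqr_ge0 (`|f y| - 1); have := normr_ge0 (f y); move: `|f y| => a; nra.
rewrite ge0_integralD//; last 2 first.
- by move=> y _; rewrite lee_fin sqr_ge0.
- by apply/measurable_EFinP; exact: measurable_funTS.
apply: leeD.
  rewrite -C2E; apply: ge0_subset_integral => //.
  - by apply/measurable_EFinP.
  - by move=> y _; rewrite lee_fin sqr_ge0.
by rewrite integral_cst// -(lebesgue_measure_ball x (ltW r0)).
Qed.

Let a (r : R) := fine (davg f x r).

Let aE r : 0 < r -> davg f x r = (a r)%:E.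
Proof.
by move=> r0; rewrite /a fineK// ge0_fin_numE ?davg_ge0//; exact: le_lt_trans (davg_le r0) (ltry _).
Qed.

Let a_ge0 r : 0 <= a r. Proof. by rewrite fine_ge0// davg_ge0. Qed.

Let a_cvg (eps : R) : 0 < eps -> exists2 r0 : R, 0 < r0 & forall r, 0 < r -> r < r0 -> a r <= eps.
Proof.
move=> eps0; have /fine_cvgP[_ c] := fx.
have /cvgrPdist_le/(_ _ eps0) [r0 /= r00 H] := c.
exists r0 => // r rpos rr0; have := H r; rewrite /= sub0r normrN gtr0_norm// => /(_ rr0 rpos).
by rewrite sub0r normrN ger0_norm// a_ge0.
Qed.

(** Small radii are controlled by the Lebesgue point property and the others by [davg_le], whose
    bound decreases with the radius. *)
Let a_bounded : exists2 C : R, 0 <= C & forall r, 0 < r -> a r <= C.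
Proof.
have [r0 r00 H] := a_cvg ltr01.
have C20 : 0 <= C2 by rewrite -lee_fin -C2E; apply: integral_ge0 => y _; rewrite lee_fin sqr_ge0.
have B0 : 0 <= C2 / (2 * r0) by rewrite divr_ge0// mulr_ge0// ltW.
exists (C2 / (2 * r0) + 1 + `|f x|); first by rewrite !addr_ge0.
move=> r rpos; have [rr0|rr0] := ltP r r0.
  by apply: le_trans (H _ rpos rr0) _; rewrite -addrA addrCA lerDl addr_ge0.
rewrite -lee_fin -aE//; apply: (le_trans (davg_le rpos)); rewrite lee_fin !lerD2r.
by rewrite ler_wpM2l// lef_pV2 ?posrE ?mulr_gt0// ler_pM2l.
Qed.

Let Phi n (rho : R) : R := expR (- (rho ^+ 2 / 8)) * fine (avg n rho).

Let avgE0 n rho : rho <= 0 -> avg n rho = 0%E.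
Proof.
move=> rho0; rewrite /avg (eq_integral (fun=> 0%E)) ?integral0// => y _.
by rewrite ltNge (le_trans rho0)// mul0r.
Qed.

Let PhiE n rho : 0 < rho -> Phi n rho = expR (- (rho ^+ 2 / 8)) * (2 * rho * a (r_ n * rho)).
Proof. by move=> rho0; rewrite /Phi avgE// aE// mulr_gt0. Qed.

Let Phi0 n rho : rho <= 0 -> Phi n rho = 0.
Proof. by move=> rho0; rewrite /Phi avgE0//= mulr0. Qed.

Let Phi_ge0 n rho : 0 <= Phi n rho.
Proof.
have [rho0|rho0] := leP rho 0; first by rewrite Phi0.
by rewrite PhiE// !mulr_ge0 ?expR_ge0 ?a_ge0// ltW.
Qed.

Let m8 : measurable_fun [set: R] (fun rho : R => expR (- (rho ^+ 2 / 8))).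
Proof.
have : measurable_fun [set: R] (fun rho : R => expR (- (8^-1 * rho ^+ 2))) by exact: measurable_gauss.
by apply: eq_measurable_fun => rho _; rewrite mulrC.
Qed.

Let mPhi n : measurable_fun [set: R] (Phi n).
Proof.
apply: measurable_funM; first exact: m8.
exact: (measurableT_comp (fine_measurable measurableT) (mavg n)).
Qed.

Let cvg_Phi rho : Phi n rho @[n --> \oo] --> 0.
Proof.
have [rho0|rho0] := leP rho 0.
  by apply: cvg_near_cst; near=> n; rewrite Phi0.
apply/cvgrPdist_le => eps eps0; pose c := expR (- (rho ^+ 2 / 8)) * (2 * rho).
have c0 : 0 < c by rewrite mulr_gt0 ?expR_gt0// mulr_gt0.
have [r0 r00 H] := a_cvg (divr_gt0 eps0 c0).
have rr : 0 < r0 / rho by exact: divr_gt0.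
near=> n; rewrite sub0r normrN ger0_norm ?Phi_ge0// PhiE// mulrA -/c -ler_pdivlMl// [c^-1 * _]mulrC.
apply: H; first exact: mulr_gt0.
rewrite -ltr_pdivlMr//; near: n.
have := @near_infty_natSinv_lt R (PosNum rr); exact.
Unshelve. all: by end_near. Qed.

Let Phi_dom : exists2 g : R -> R, mu.-integrable [set: R] (EFin \o g) &
  forall n rho, `|Phi n rho| <= g rho.
Proof.
have [C C0 aC] := a_bounded; have e0 : 0 < 8^-1 :> R by [].
exists (fun rho => 2 * C * (`|rho| * expR (- (8^-1 * rho ^+ 2)))).
  exact: (integrableZl measurableT (2 * C) (integrable_norm_gauss e0)).
move=> n rho; rewrite ger0_norm ?Phi_ge0//; have [rho0|rho0] := leP rho 0.
  by rewrite Phi0// !mulr_ge0 ?expR_ge0.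
rewrite PhiE// gtr0_norm// [8^-1 * _]mulrC.
have -> : 2 * C * (rho * expR (- (rho ^+ 2 / 8))) = expR (- (rho ^+ 2 / 8)) * (2 * rho * C) by ring.
by rewrite ler_wpM2l ?expR_ge0// ler_wpM2l ?mulr_ge0 ?(ltW rho0)// aC// mulr_gt0.
Qed.

(** Pointwise convergence is the Lebesgue point property at radius [r_ n * rho]; the uniform bound
    on averages gives a Gaussian majorant in [rho]. *)
Let cvg_int_Phi : \int[mu]_rho Phi n rho @[n --> \oo] --> 0.
Proof.
have [g Ig gP] := Phi_dom.
have z : \int[mu]_rho (fun=> 0 : R) rho = 0 by rewrite /Rintegral integral0.
rewrite -[X in _ --> X]z; apply: (@Rdct _ _ _ mu Phi (fun=> 0) g) => //.
Qed.

Let IPhi n : mu.-integrable [set: R] (EFin \o Phi n).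
Proof.
have [g Ig gP] := Phi_dom.
apply: le_integrable Ig => //; first by apply/measurable_EFinP; exact: mPhi.
by move=> rho _; rewrite /= lee_fin (le_trans (gP n rho))// ler_norm.
Qed.

Let K n y := gaussK (r_ n ^+ 2) (x - y).

Let mK n : measurable_fun [set: R] (K n).
Proof. by apply: (measurableT_comp (measurable_gaussK _)); exact: measurable_funB. Qed.

Let IK n : (\int[mu]_y (K n y)%:E = (2 * pi)%:E)%E.
Proof.
rewrite -(integral_gaussK_shift x (exprn_gt0 2 (r_gt0 n))); apply: eq_integral => y _.
by rewrite /K gaussK_sym.
Qed.

Let K_ge0 n y : 0 <= K n y. Proof. exact: gaussK_ge0. Qed.

Let integrable_K n : mu.-integrable [set: R] (EFin \o K n).
Proof.
apply: (@ge0_integrable _ _ _ mu _ (mK n)); first by move=> y; exact: K_ge0.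
by move: (IK n) => ->; rewrite ltry.
Qed.

Let integrable_fK n : mu.-integrable [set: R] (EFin \o (fun y => f y * K n y)).
Proof.
have If2 : mu.-integrable [set: R] (EFin \o (fun y => f y ^+ 2)).
  apply: (@ge0_integrable _ _ _ mu) => //; first exact: measurable_funX.
  by move=> y; exact: sqr_ge0.
pose k := Num.sqrt (pi / r_ n ^+ 2).
have kK y : K n y <= k.
  rewrite /K /gaussK ler_piMr ?sqrtr_ge0// expR_le1 oppr_le0 divr_ge0 ?sqr_ge0//.
  by rewrite mulr_ge0// sqr_ge0.
have := integrableD measurableT (integrableZl measurableT k If2) (integrable_K n).
apply: le_integrable => //; first by apply/measurable_EFinP; apply: measurable_funM => //; exact: mK.
move=> y _; rewrite -EFinM -EFinD /= lee_fin normrM (ger0_norm (K_ge0 n y)).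
apply: le_trans (ler_norm _).
apply: (@le_trans _ _ ((f y ^+ 2 + 1) * K n y)).
  rewrite ler_wpM2r ?K_ge0// -[f y ^+ 2]real_normK ?num_real//.
  by have := sqr_ge0 (`|f y| - 1); have := normr_ge0 (f y); move: `|f y| => b; nra.
by rewrite mulrDl mul1r lerD2r mulrC ler_wpM2r ?sqr_ge0.
Qed.

(** The kernel is rescaled to unit width, dominated by balls, and Tonelli exchanges the point with
    the radius, so that only averages over balls about [x] remain. *)
Let DK_le n : (\int[mu]_y (D y * K n y)%:E <=
  (Num.sqrt pi * expR (4^-1))%:E * (\int[mu]_rho Phi n rho)%:E)%E.
Proof.
have -> : (\int[mu]_y (D y * K n y)%:E =
    \int[mu]_y (Num.sqrt pi * (D (r_ n * y + x) * expR (- (y ^+ 2 / 4))))%:E)%E.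
  rewrite (@ge0_integral_affine _ _ x _ (r_gt0 n)); last 2 first.
  - by apply/measurable_EFinP; apply: measurable_funM; [exact: mD|exact: mK].
  - by move=> y; rewrite lee_fin; apply: mulr_ge0 (K_ge0 _ _); exact: normr_ge0.
  rewrite -ge0_integralZl; last 4 first.
  - exact: measurableT.
  - apply/measurable_EFinP.
    have ma : measurable_fun [set: R] (fun y => r_ n * y + x).
      by apply: measurable_funD => //; exact: measurable_funM.
    apply: measurable_funM; first exact: measurableT_comp mD ma.
    exact: (measurableT_comp (mK n) ma).
  - by move=> y _; rewrite lee_fin; apply: mulr_ge0 (K_ge0 _ _); exact: normr_ge0.
  - by rewrite lee_fin ltW.
  apply: eq_integral => y _; rewrite -EFinM /K opprD addrCA subrr addr0 gaussKN.
  rewrite gaussK_scale// /gaussK divr1 mulr1; congr (_%:E).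
  by move: (r_ n) (r_gt0 n) => r r0; field; rewrite gt_eqF.
have mDy : measurable_fun [set: R] (fun y => D (r_ n * y + x)).
  by apply: (measurableT_comp mD); apply: measurable_funD => //; exact: measurable_funM.
have m4 : measurable_fun [set: R] (fun y : R => expR (- (y ^+ 2 / 4))).
  have : measurable_fun [set: R] (fun y : R => expR (- (4^-1 * y ^+ 2))) by exact: measurable_gauss.
  by apply: eq_measurable_fun => y _; rewrite mulrC.
pose G (z : R * R) := expR (- (z.2 ^+ 2 / 8)) * ((`|z.1| < z.2)%R%:R * D (r_ n * z.1 + x)).
have mG : measurable_fun [set: R * R] G.
  apply: measurable_funM; last exact: mavgf.
  by apply: (measurableT_comp m8); exact: measurable_snd.
have G0 z : 0 <= G z by apply: mulr_ge0 (avgf_ge0 n z); exact: expR_ge0.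
have s0 : 0 <= Num.sqrt pi * expR (4^-1) :> R by rewrite mulr_ge0 ?sqrtr_ge0 ?expR_ge0.
apply: (@le_trans _ _ ((Num.sqrt pi * expR (4^-1))%:E * \int[mu]_y \int[mu]_rho (G (y, rho))%:E)%E).
  rewrite -ge0_integralZl; last 4 first.
  - exact: measurableT.
  - exact: (measurable_int2 mu mG G0).
  - by move=> y _; apply: integral_ge0 => rho _; rewrite lee_fin.
  - by rewrite lee_fin.
  apply: ge0_le_integral.
  - exact: measurableT.
  - move=> y _; rewrite lee_fin; apply: mulr_ge0; first exact: sqrtr_ge0.
    by apply: mulr_ge0 (expR_ge0 _); exact: normr_ge0.
  - apply/measurable_EFinP; apply: measurable_funM => //; exact: measurable_funM.
  - by apply: measurable_funeM; exact: (measurable_int2 mu mG G0).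
  move=> y _; have D0 : 0 <= D (r_ n * y + x) by exact: normr_ge0.
  have mb8 : measurable_fun [set: R] (fun rho : R => (`|y| < rho)%R%:R * expR (- (rho ^+ 2 / 8)) : R).
    apply: measurable_funM; last exact: m8.
    have mp : measurable_fun [set: R] (fun rho : R => (y, rho)) by exact: measurable_fun_pair.
    exact: (measurableT_comp mball mp).
  have -> : (\int[mu]_rho (G (y, rho))%:E =
      (D (r_ n * y + x))%:E * \int[mu]_rho ((`|y| < rho)%R%:R * expR (- (rho ^+ 2 / 8)))%:E)%E.
    rewrite -ge0_integralZl; last 4 first.
    - exact: measurableT.
    - by apply/measurable_EFinP; exact: mb8.
    - by move=> rho _; rewrite lee_fin mulr_ge0 ?expR_ge0.
    - by rewrite lee_fin.
    by apply: eq_integral => rho _; rewrite -EFinM /G/=; congr (_%:E); ring.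
  rewrite (EFinM (Num.sqrt pi)) (EFinM (Num.sqrt pi) (expR _)) -muleA.
  apply: lee_wpmul2l; first by rewrite lee_fin sqrtr_ge0.
  rewrite EFinM muleCA; apply: lee_wpmul2l; first by rewrite lee_fin.
  exact: gauss_balls.
apply: lee_wpmul2l; first by rewrite lee_fin.
rewrite (@tonelli12 _ _ _ _ _ mu mu (fun z => (G z)%:E)); last 2 first.
- by apply/measurable_EFinP; exact: mG.
- by move=> z; rewrite lee_fin.
have -> : ((\int[mu]_rho Phi n rho)%:E = \int[mu]_rho (Phi n rho)%:E)%E.
  by rewrite /Rintegral fineK//; apply: integrable_fin_num => //; exact: IPhi.
rewrite le_eqVlt; apply/orP; left; apply/eqP; apply: eq_integral => rho _.
have avgfin : avg n rho \is a fin_num.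
  by have [h|h] := leP rho 0; [rewrite avgE0|rewrite avgE// aE// mulr_gt0].
rewrite /Phi EFinM fineK// /avg -ge0_integralZl; last 4 first.
- exact: measurableT.
- apply/measurable_EFinP.
  have mp : measurable_fun [set: R] (fun y : R => (y, rho)) by exact: measurable_fun_pair.
  exact: (measurableT_comp (mavgf n) mp).
- by move=> y _; rewrite lee_fin; exact: (avgf_ge0 n (y, rho)).
- by rewrite lee_fin expR_ge0.
by apply: eq_integral => y _; rewrite -EFinM.
Qed.

Lemma gaussK_lebesgue_pt :
  \int[mu]_y (f y * gaussK (n.+1%:R^-1 ^+ 2) (x - y)) @[n --> \oo] --> 2 * pi * f x.
Proof.
have c0 : 0 < Num.sqrt pi * expR (4^-1) :> R by rewrite mulr_gt0 ?expR_gt0// sqrtr_gt0 pi_gt0.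
apply/cvgrPdist_le => eps eps0.
have /cvgrPdist_le/(_ _ (divr_gt0 eps0 c0)) := cvg_int_Phi; apply: filterS => n.
rewrite sub0r normrN => hn.
have hPhi : \int[mu]_rho Phi n rho <= eps / (Num.sqrt pi * expR (4^-1)) by exact: le_trans (ler_norm _) hn.
rewrite distrC -/(K n _).
have I2 := integrableZl measurableT (f x) (integrable_K n).
have -> : \int[mu]_y (f y * K n y) - 2 * pi * f x = \int[mu]_y (f y * K n y - f x * K n y).
  rewrite (RintegralB measurableT (integrable_fK n) I2).
  have KR : \int[mu]_y K n y = 2 * pi by rewrite /Rintegral; move: (IK n) => ->.
  by rewrite (RintegralZl _ measurableT (integrable_K n)) KR [f x * _]mulrC.
have IB := integrableB measurableT (integrable_fK n) I2.
rewrite -lee_fin; apply: (@le_trans _ _ (\int[mu]_y (D y * K n y)%:E)%E).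
  have -> : (\int[mu]_y (D y * K n y)%:E = \int[mu]_y `|(f y * K n y - f x * K n y)%:E|)%E.
    by apply: eq_integral => y _; rewrite abse_EFin -mulrBl normrM (ger0_norm (K_ge0 n y)).
  have If : (\int[mu]_y (f y * K n y - f x * K n y)%:E)%E \is a fin_num.
    by apply: integrable_fin_num => //; exact: IB.
  have -> : (`|\int[mu]_y (f y * K n y - f x * K n y)|%:E =
      `|\int[mu]_y (f y * K n y - f x * K n y)%:E|)%E by rewrite /Rintegral -abse_EFin fineK.
  apply: le_abse_integral => //; apply/measurable_EFinP.
  by apply: measurable_funB; apply: measurable_funM => //; exact: mK.
apply: (le_trans (DK_le n)); rewrite -EFinM lee_fin.
by rewrite mulrC -ler_pdivlMr.
Qed.

End gaussian_differentiation.

(** * Change of window *)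

Section fourier_inversion.
Context {R : realType}.
Local Notation mu := (@lebesgue_measure R).
Local Notation P := (prodm mu mu).

(** The Gaussian means [A] of the inverse integral are evaluated in two ways: by dominated
    convergence, as the transform is integrable, and by Fubini as an approximate identity applied to
    [f]. Uniqueness of limits gives the formula. *)
Lemma fourier_inversion (f : R -> R[i]) (B : R) (g : R -> R) (v : R) :
  cintegrable mu f -> (forall y, Normc.normc (f y) <= B) -> seq_continuous f ->
  mu.-integrable [set: R] (EFin \o g) -> (forall q, Normc.normc (fourierC f (- q)) <= g q) ->
  fourierC (fun q => fourierC f (- q)) v = ((2 * pi)%:C)%C * f v.
Proof.
move=> If fB fc Ig fg; have mf := cintegrable_measurable If.
pose fh q := fourierC f (- q).
have mfh : cmeasurable fh.
  apply: (@cmeasurable_comp _ _ _ _ _ (fun xi : R => - xi)); first exact: oppr_measurable.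
  exact: cmeasurable_fourierC.
pose eps (n : nat) : R := n.+1%:R^-1 ^+ 2.
have eps0 n : 0 < eps n by rewrite exprn_gt0// invr_gt0.
pose A n := cint mu (fun q => (expi (v * q) * fh q) * ((expR (- (eps n * q ^+ 2)))%:C)%C).
have mvq : cmeasurable (fun q => expi (v * q) * fh q).
  by apply: cmeasurableM => //; apply: cmeasurable_expi; exact: measurable_funM.
have A1 : cvgC A (fourierC fh v).
  apply: (@cint_dct _ _ _ mu (fun n q => (expi (v * q) * fh q) * ((expR (- (eps n * q ^+ 2)))%:C)%C) _ g).
  - by move=> n; apply: cmeasurableM => //; apply: cmeasurable_real; exact: measurable_gauss.
  - exact: mvq.
  - move=> q; suff : cvgC (fun n => (expi (v * q) * fh q) * ((expR (- (eps n * q ^+ 2)))%:C)%C)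
      (expi (v * q) * fh q * ((1 : R)%:C)%C) by rewrite mulr1.
    apply: cvgCM; first exact: cvgC_cst.
    apply: cvgC_real; rewrite -[X in _ --> X](@expR0 R).
    have h : - (eps n * q ^+ 2) @[n --> \oo] --> (0 : R).
      rewrite -[X in _ --> X]oppr0 -[X in _ --> - X](mul0r (q ^+ 2)).
      apply: cvgN; apply: cvgM; last exact: cvg_cst.
      have c := @cvg_harmonic R; rewrite -[X in _ --> X](mul0r (0 : R)); exact: (cvgM c c).
    exact: (cvg_comp _ _ h (@continuous_expR R 0)).
  - exact: Ig.
  - move=> n q; rewrite !Normc.normcM normc_expi mul1r normc_real ger0_norm ?expR_ge0//.
    apply: le_trans (fg q); rewrite ler_piMr ?normc_ge0// expR_le1 oppr_le0.
    by rewrite mulr_ge0 ?sqr_ge0.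
have A2 n : A n = cint mu (fun y => f y * ((gaussK (eps n) (v - y))%:C)%C).
  pose G (z : R * R) := expi (z.2 * (v - z.1)) * (f z.1 * ((expR (- (eps n * z.2 ^+ 2)))%:C)%C).
  have Igs : cintegrable mu (fun q => ((expR (- (eps n * q ^+ 2)))%:C)%C).
    apply: (@cintegrable_le _ _ _ mu _ _ _ (integrable_gauss0 (eps0 n))).
      by apply: cmeasurable_real; exact: measurable_gauss.
    by move=> q; rewrite normc_real ger0_norm ?expR_ge0.
  have Ip := cintegrable_prod If Igs.
  have IG : cintegrable P G.
    apply: (@cintegrable_le _ _ _ P _ _ _ (integrable_normc Ip)).
      apply: cmeasurableM; last exact: cintegrable_measurable Ip.
      apply: cmeasurable_expi; apply: measurable_funM; first exact: measurable_snd.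
      by apply: measurable_funB => //; exact: measurable_fst.
    by move=> z; rewrite /G Normc.normcM normc_expi mul1r.
  transitivity (cint mu (fun q => cint mu (fun y => G (y, q)))).
    apply: eq_cint => q; rewrite /fh /fourierC -cintZ; last exact: cintegrable_fourierC.
    rewrite -cintZr; last by apply: cintegrableZ; exact: cintegrable_fourierC.
    apply: eq_cint => y; rewrite /G/= mulrBr expiD mulNr [v * q]mulrC -mulrN.
    by rewrite mulrN; ring.
  rewrite -(cfubini IG); apply: eq_cint => y.
  rewrite -(fourier_gauss (v - y) (eps0 n)) -cintZ; last exact: cintegrable_gauss_expi0.
  by apply: eq_cint => q; rewrite /G/=; ring.
have A3 : cvgC A (((2 * pi)%:C)%C * f v).
  have -> : A = (fun n => cint mu (fun y => f y * ((gaussK (eps n) (v - y))%:C)%C)).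
    by apply/funext => n; exact: A2.
  exact: (approx_identity1 v mf fB fc).
exact: cvgC_uniq A1 A3.
Qed.

End fourier_inversion.

(** * The short-time Fourier transform of a Gaussian and its inversion *)

Section window.
Context {R : realType}.
Local Notation mu := (@lebesgue_measure R).
Local Notation P := (prodm mu mu).
Variables (psi0 psi1 psi2 : R -> R) (C : R).
Hypotheses (d0 : forall x : R, is_derive x (1 : R) psi0 (psi1 x))
  (d1 : forall x : R, is_derive x (1 : R) psi1 (psi2 x)) (c2 : continuous psi2).
Hypotheses (b0 : forall x, `|psi0 x| <= C * (1 + x ^+ 2)^-1)
  (b1 : forall x, `|psi1 x| <= C * (1 + x ^+ 2)^-1)
  (b2 : forall x, `|psi2 x| <= C * (1 + x ^+ 2)^-1).

Let g (v : R) := expR (- (v ^+ 2 / 2)).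
(** The Gaussian seen through the window placed at [p]; [phi1] and [phi2] are its first two
    derivatives in [v]. *)
Let phi0 p v := g v * psi0 (v - p).
Let phi1 p v := g v * (psi1 (v - p) - v * psi0 (v - p)).
Let phi2 p v := g v * (psi2 (v - p) - 2 * v * psi1 (v - p) + (v ^+ 2 - 1) * psi0 (v - p)).

Let dshift (F : R -> R) (F' : R -> R) (p v : R) : (forall x : R, is_derive x (1 : R) F (F' x)) ->
  is_derive v (1 : R) (fun v => F (v - p)) (F' (v - p)).
Proof.
move=> dF; have dB : is_derive v (1 : R) (fun v : R => v - p) 1 by apply: is_derive_eq; rewrite subr0.
by have := @is_derive1_comp R F (fun v : R => v - p) v _ _ (dF (v - p)) dB; rewrite mulr1.
Qed.

Let dg v : is_derive v (1 : R) g (- v * g v).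
Proof.
rewrite /g; apply: is_derive_eq; rewrite /GRing.scale /= !(mulr0, addr0, scaler0).
by move: (expR _) => e; field.
Qed.

Let dphi0 p v : is_derive v (1 : R) (phi0 p) (phi1 p v).
Proof.
have h0 := dshift p v d0; have hg := dg v.
have h : is_derive v (1 : R) (phi0 p) _ := is_deriveM hg h0.
by apply: (is_derive_eq h); rewrite /GRing.scale /= /phi1; ring.
Qed.

Let dphi1 p v : is_derive v (1 : R) (phi1 p) (phi2 p v).
Proof.
have h0 := dshift p v d0; have h1 := dshift p v d1; have hg := dg v.
have hv : is_derive v (1 : R) (fun v : R => v) 1 by exact: is_derive_id.
have h2 : is_derive v (1 : R) (fun v => v * psi0 (v - p)) (psi0 (v - p) + v * psi1 (v - p)).
  by apply: (is_derive_eq (is_deriveM hv h0)); rewrite /GRing.scale /=; ring.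
have h3 : is_derive v (1 : R) (fun v => psi1 (v - p) - v * psi0 (v - p))
    (psi2 (v - p) - (psi0 (v - p) + v * psi1 (v - p))) := is_deriveB h1 h2.
have h : is_derive v (1 : R) (phi1 p) _ := is_deriveM hg h3.
by apply: (is_derive_eq h); rewrite /GRing.scale /= /phi2; ring.
Qed.

Let cont_of (F F' : R -> R) : (forall x : R, is_derive x (1 : R) F (F' x)) -> continuous F.
Proof.
move=> dF x; apply: differentiable_continuous; apply/derivable1_diffP.
exact: (@ex_derive _ _ _ _ _ _ _ (dF x)).
Qed.

Let cpsi0 : continuous psi0. Proof. exact: cont_of d0. Qed.
Let cpsi1 : continuous psi1. Proof. exact: cont_of d1. Qed.
Let cg : continuous g. Proof. exact: cont_of dg. Qed.

Let cshift (F : R -> R) p : continuous F -> continuous (fun v => F (v - p)).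
Proof.
move=> cF v; apply: (@continuous_comp _ _ _ (fun v : R => v - p) F); last exact: cF.
by apply: cvgB; [exact: cvg_id|exact: cvg_cst].
Qed.

Let cphi2 p : continuous (phi2 p).
Proof.
move=> v; apply: cvgM; first exact: cg.
apply: cvgD; first apply: cvgB; first exact: (cshift c2).
- apply: cvgM; last exact: (cshift cpsi1).
  by apply: cvgM; [exact: cvg_cst|exact: cvg_id].
- apply: cvgM; last exact: (cshift cpsi0).
  by apply: cvgB; [exact: exprn_continuous|exact: cvg_cst].
Qed.

Let C0 : 0 <= C.
Proof. by have := le_trans (normr_ge0 _) (b0 0); rewrite expr0n/= addr0 invr1 mulr1. Qed.

Let theta (x : R) : R := (1 + x ^+ 2)^-1.
Let theta_ge0 x : 0 <= theta x. Proof. by rewrite invr_ge0 addr_ge0 ?sqr_ge0. Qed.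
Let theta_le1 x : theta x <= 1.
Proof. by rewrite invf_le1 ?ltr_wpDr ?sqr_ge0// lerDl sqr_ge0. Qed.

Let B p v : R := 11 * C * (expR (- (4^-1 * v ^+ 2)) * theta (v - p)).

Let B_ge0 p v : 0 <= B p v.
Proof. by rewrite /B !mulr_ge0 ?expR_ge0 ?theta_ge0 ?C0. Qed.

(** Half of the Gaussian exponent is spent on the polynomial factors: [3 + 2 v^2 <= 11 (1 + v^2 / 4)
    <= 11 exp(v^2 / 4)]. *)
Let poly_gauss (v k : R) : 0 <= k -> k <= 3 + 2 * v ^+ 2 -> g v * k <= 11 * expR (- (4^-1 * v ^+ 2)).
Proof.
move=> k0 kv; have -> : g v = expR (- (4^-1 * v ^+ 2)) * expR (- (4^-1 * v ^+ 2)).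
  by rewrite -expRD; congr expR; field.
set e := expR _; have e0 : 0 < e by exact: expR_gt0.
rewrite -mulrA [11 * e]mulrC ler_pM2l//.
have : 1 + 4^-1 * v ^+ 2 <= e^-1 by rewrite /e -expRN opprK; exact: expR_ge1Dx.
move=> h; rewrite mulrC -ler_pdivlMr//; apply: (le_trans kv).
have := sqr_ge0 v; move: h; move: (v ^+ 2) (e^-1) => a b; lra.
Qed.

Let bound_of (p v k y : R) : 0 <= k -> k <= 3 + 2 * v ^+ 2 ->
  `|y| <= k * (C * theta (v - p)) -> `|g v * y| <= B p v.
Proof.
move=> k0 kv yk; rewrite normrM ger0_norm ?expR_ge0//.
apply: (@le_trans _ _ (g v * (k * (C * theta (v - p))))); first by rewrite ler_wpM2l ?expR_ge0.
rewrite mulrA /B.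
have -> : 11 * C * (expR (- (4^-1 * v ^+ 2)) * theta (v - p)) =
    11 * expR (- (4^-1 * v ^+ 2)) * (C * theta (v - p)) by ring.
by apply: ler_wpM2r; [exact: mulr_ge0 C0 (theta_ge0 _)|exact: poly_gauss].
Qed.

Let phi0_le p v : `|phi0 p v| <= B p v.
Proof.
apply: (@bound_of _ _ 1); [exact: ler01|by have := sqr_ge0 v; lra|].
by rewrite mul1r; exact: b0.
Qed.

Let phi1_le p v : `|phi1 p v| <= B p v.
Proof.
apply: (@bound_of _ _ (1 + `|v|)); first by rewrite addr_ge0.
  by have := sqr_ge0 (`|v| - 1); rewrite -[v ^+ 2]real_normK ?num_real//; move: `|v| => a; nra.
apply: (le_trans (ler_normB _ _)); rewrite mulrDl mul1r normrM; apply: lerD; first exact: b1.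
by rewrite ler_wpM2l//; exact: b0.
Qed.

Let phi2_le p v : `|phi2 p v| <= B p v.
Proof.
apply: (@bound_of _ _ (1 + 2 * `|v| + (v ^+ 2 + 1))).
- by rewrite addr_ge0// addr_ge0// ?sqr_ge0// mulr_ge0.
- by have := sqr_ge0 (`|v| - 1); rewrite -[v ^+ 2]real_normK ?num_real//; move: `|v| => a; nra.
apply: (le_trans (ler_normD _ _)); rewrite (mulrDl (1 + 2 * `|v|)); apply: lerD.
  apply: (le_trans (ler_normB _ _)); rewrite (mulrDl 1 (2 * `|v|)) mul1r; apply: lerD; first exact: b2.
  by rewrite !normrM (ger0_norm (ler0n _ 2)) ler_wpM2l ?mulr_ge0//; exact: b1.
rewrite normrM; apply: (@ler_pM R _ _ _ _ (normr_ge0 _) (normr_ge0 _) _ (b0 _)).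
by apply: (le_trans (ler_normB _ _)); rewrite normr1 (ger0_norm (sqr_ge0 v)).
Qed.

Let mB p : measurable_fun [set: R] (B p).
Proof.
apply: measurable_funM => //; apply: measurable_funM; first exact: measurable_gauss.
by apply: (measurableT_comp measurable_cauchy); exact: measurable_funB.
Qed.

Let IB p : mu.-integrable [set: R] (EFin \o B p).
Proof.
have e0 : 0 < 4^-1 :> R by [].
have := integrableZl measurableT (11 * C) (integrable_gauss0 e0).
apply: le_integrable => //; first by apply/measurable_EFinP; exact: mB.
move=> v _; rewrite -EFinM /= lee_fin ger0_norm ?B_ge0// ger0_norm; last first.
  by rewrite !mulr_ge0 ?expR_ge0 ?C0.
by rewrite /B ler_wpM2l ?mulr_ge0 ?C0// ler_piMr ?expR_ge0 ?theta_le1.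
Qed.

Let mphi0 p : measurable_fun [set: R] (phi0 p).
Proof. exact: continuous_measurable_fun (cont_of (dphi0 p)). Qed.
Let mphi2 p : measurable_fun [set: R] (phi2 p).
Proof. exact: continuous_measurable_fun (@cphi2 p). Qed.

(** Combinations of cosine and sine are closed under differentiation, so the real and imaginary
    parts of the transform can share one integration by parts. *)
Let trig (al be q v : R) := al * cos (q * v) + be * sin (q * v).

Let trig_le al be q v : `|trig al be q v| <= `|al| + `|be|.
Proof.
apply: (le_trans (ler_normD _ _)); rewrite !normrM lerD// ler_piMr//.
  by rewrite ler_norml cos_geN1 cos_le1.
by rewrite ler_norml sin_geN1 sin_le1.
Qed.

Let dtrig al be q v : is_derive v (1 : R) (trig al be q) (q * trig be (- al) q v).
Proof.
rewrite /trig; apply: is_derive_eq; rewrite /GRing.scale /= !(mulr0, mul0r, addr0, add0r, mulr1); ring.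
Qed.

Let ctrig al be q : continuous (trig al be q). Proof. exact: cont_of (dtrig al be q). Qed.

Let integrable_trig (F : R -> R) (k al be q p : R) : measurable_fun [set: R] F ->
  (forall v, `|F v| <= k * B p v) ->
  mu.-integrable [set: R] (EFin \o (fun v => F v * trig al be q v)).
Proof.
move=> mF Fk; have := integrableZl measurableT ((`|al| + `|be|) * k) (IB p).
apply: le_integrable => //.
  apply/measurable_EFinP; apply: measurable_funM => //.
  exact: continuous_measurable_fun (@ctrig al be q).
move=> v _; rewrite -EFinM /= lee_fin (le_trans _ (ler_norm _))// normrM -mulrA mulrC.
by rewrite ler_pM ?normr_ge0// trig_le.
Qed.

Let integrable_comb al be q p :
  mu.-integrable [set: R] (EFin \o (fun v => (phi2 p v + q ^+ 2 * phi0 p v) * trig al be q v)).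
Proof.
apply: (@integrable_trig _ (1 + q ^+ 2) _ _ _ p).
  apply: (measurable_funD (mphi2 p)); apply: measurable_funM => //; exact: mphi0.
move=> v; apply: (le_trans (ler_normD _ _)); rewrite mulrDl mul1r (normrM (q ^+ 2)).
apply: lerD; first exact: phi2_le.
by rewrite (ger0_norm (sqr_ge0 _)) ler_wpM2l ?sqr_ge0//; exact: phi0_le.
Qed.

(** Two integrations by parts at once: the integrand is the derivative of
    [H = phi0' trig - phi0 trig'], because the second derivative of [trig] is [- q^2 trig]. [H] is
    bounded by a Gaussian and hence vanishes at infinity. *)
Let parts al be q p : \int[mu]_v ((phi2 p v + q ^+ 2 * phi0 p v) * trig al be q v) = 0.
Proof.
have e0 : 0 < 4^-1 :> R by [].
pose H v := phi1 p v * trig al be q v - phi0 p v * (q * trig be (- al) q v).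
have HB v : `|H v| <= (`|al| + `|be|) * (1 + `|q|) * (11 * C) * expR (- (4^-1 * v ^+ 2)).
  have BB : B p v <= 11 * C * expR (- (4^-1 * v ^+ 2)).
    by rewrite /B ler_wpM2l ?mulr_ge0 ?C0// ler_piMr ?expR_ge0 ?theta_le1.
  apply: (@le_trans _ _ ((`|al| + `|be|) * (1 + `|q|) * B p v)); last first.
    have -> : (`|al| + `|be|) * (1 + `|q|) * (11 * C) * expR (- (4^-1 * v ^+ 2)) =
      (`|al| + `|be|) * (1 + `|q|) * (11 * C * expR (- (4^-1 * v ^+ 2))) by ring.
    by apply: ler_wpM2l => //; apply: mulr_ge0; apply: addr_ge0.
  apply: (le_trans (ler_normB _ _)).
  have -> : (`|al| + `|be|) * (1 + `|q|) * B p v =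
    B p v * (`|al| + `|be|) + B p v * (`|q| * (`|be| + `|- al|)) by rewrite normrN; ring.
  rewrite (normrM (phi1 p v)) (normrM (phi0 p v)) (normrM q); apply: lerD.
    exact: (@ler_pM R _ _ _ _ (normr_ge0 _) (normr_ge0 _) (phi1_le p v) (trig_le al be q v)).
  apply: (@ler_pM R _ _ _ _ (normr_ge0 _) (mulr_ge0 (normr_ge0 _) (normr_ge0 _)) (phi0_le p v)).
  by apply: ler_wpM2l => //; exact: trig_le.
have H0 (u : nat -> R) : (forall n, (u n) ^+ 2 = n%:R ^+ 2) -> H (u n) @[n --> \oo] --> 0.
  move=> un; apply/cvgrPdist_le => eps eps0.
  pose k := (`|al| + `|be|) * (1 + `|q|) * (11 * C).
  have c : (k * expR (- (4^-1 * n%:R ^+ 2))) @[n --> \oo] --> (0 : R).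
    by rewrite -[X in _ --> X](mulr0 k); apply: cvgM; [exact: cvg_cst|exact: cvg_expRN_sqr].
  move/cvgrPdist_le : c => /(_ _ eps0); apply: filterS => n.
  rewrite !sub0r !normrN => h; apply: le_trans (HB _) _; rewrite un.
  exact: le_trans (ler_norm _) h.
apply: (@integral_derivative0 _ H (fun v => (phi2 p v + q ^+ 2 * phi0 p v) * trig al be q v)).
- move=> v.
  have e1 : is_derive v (1 : R) (fun v => phi1 p v * trig al be q v)
      (phi2 p v * trig al be q v + phi1 p v * (q * trig be (- al) q v)).
    by apply: (is_derive_eq (is_deriveM (dphi1 p v) (dtrig al be q v))); rewrite /GRing.scale /=; ring.
  have e2 : is_derive v (1 : R) (fun v => q * trig be (- al) q v) (q * (q * trig (- al) (- be) q v)).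
    exact: (is_deriveZ q (dtrig be (- al) q v)).
  have e3 : is_derive v (1 : R) (fun v => phi0 p v * (q * trig be (- al) q v))
      (phi1 p v * (q * trig be (- al) q v) + phi0 p v * (q * (q * trig (- al) (- be) q v))).
    by apply: (is_derive_eq (is_deriveM (dphi0 p v) e2)); rewrite /GRing.scale /=; ring.
  have e4 : is_derive v (1 : R) H _ := is_deriveB e1 e3.
  by apply: (is_derive_eq e4); rewrite /trig; ring.
- move=> v; apply: cvgM; last exact: ctrig.
  apply: cvgD; first exact: cphi2.
  by apply: cvgM; [exact: cvg_cst|exact: (cont_of (dphi0 p))].
- exact: integrable_comb.
- by apply: H0.
- by apply: H0 => n; rewrite sqrrN.
Qed.

(** [2 * B p] is a majorant of [phi0 - phi2], the function whose transform is [1 + q^2] times that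
    of [phi0]. *)
Definition window_mass (p : R) : R := \int[mu]_v (2 * B p v).

Let phiC p v : R[i] := ((phi0 p v)%:C)%C.

Let Iphi p : cintegrable mu (phiC p).
Proof.
apply: (@cintegrable_le _ _ _ mu _ _ _ (IB p)); first exact: (cmeasurable_real (mphi0 p)).
by move=> v; rewrite normc_real.
Qed.

Let trig_parts al be q p : (1 + q ^+ 2) * \int[mu]_v (phi0 p v * trig al be q v) =
  \int[mu]_v ((phi0 p v - phi2 p v) * trig al be q v).
Proof.
have B1 v : B p v <= 1 * B p v by rewrite mul1r.
have I0 : mu.-integrable [set: R] (EFin \o (fun v => phi0 p v * trig al be q v)).
  by apply: (@integrable_trig _ 1 _ _ _ p (mphi0 p)) => v; rewrite mul1r; exact: phi0_le.
have I1 : mu.-integrable [set: R] (EFin \o (fun v => (phi0 p v - phi2 p v) * trig al be q v)).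
  apply: (@integrable_trig _ 2 _ _ _ p (measurable_funB (mphi0 p) (mphi2 p))).
  move=> v; apply: (le_trans (ler_normB _ _)).
  have -> : 2 * B p v = B p v + B p v by ring.
  exact: (lerD (phi0_le p v) (phi2_le p v)).
have I2 : mu.-integrable [set: R] (EFin \o (fun v => (phi2 p v + q ^+ 2 * phi0 p v) * trig al be q v)).
  exact: integrable_comb.
rewrite -[RHS]addr0 -(parts al be q p) -(RintegralD measurableT I1 I2).
rewrite -(RintegralZl _ measurableT I0); apply: eq_Rintegral => v _; ring.
Qed.

(** Multiplication by [1 + q^2] corresponds to subtracting the second derivative. The resulting
    quadratic decay makes the transform integrable in [q], which is what inversion requires. *)
Lemma window_fourier_le p q :
  Normc.normc (fourierC (phiC p) (- q)) <= window_mass p * (1 + q ^+ 2)^-1.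
Proof.
have q0 : 0 < 1 + q ^+ 2 by rewrite ltr_wpDr// sqr_ge0.
rewrite ler_pdivlMr// mulrC.
pose F v : R[i] := ((phi0 p v - phi2 p v)%:C)%C.
have FB v : Normc.normc (F v) <= 2 * B p v.
  rewrite normc_real; apply: (le_trans (ler_normB _ _)).
  have -> : 2 * B p v = B p v + B p v by ring.
  exact: (lerD (phi0_le p v) (phi2_le p v)).
have I2B := integrableZl measurableT 2 (IB p).
have IF : cintegrable mu F.
  apply: (@cintegrable_le _ _ _ mu _ _ _ I2B FB).
  by apply: cmeasurable_real; exact: (measurable_funB (mphi0 p) (mphi2 p)).
have -> : (1 + q ^+ 2) * Normc.normc (fourierC (phiC p) (- q)) =
    Normc.normc (((1 + q ^+ 2)%:C)%C * fourierC (phiC p) (- q)).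
  by rewrite Normc.normcM normc_real gtr0_norm.
have -> : ((1 + q ^+ 2)%:C)%C * fourierC (phiC p) (- q) = fourierC F (- q).
  have tc v : cos (- q * v) = trig 1 0 (- q) v by rewrite /trig mul1r mul0r addr0.
  have ts v : sin (- q * v) = trig 0 1 (- q) v by rewrite /trig mul1r mul0r add0r.
  apply: cplx_eq; rewrite ?ReM ?ImM /fourierC !Re_cint !Im_cint /= !mul0r ?subr0 ?addr0.
  - have -> : \int[mu]_v complex.Re (expi (- q * v) * phiC p v) = \int[mu]_v (phi0 p v * trig 1 0 (- q) v).
      by apply: eq_Rintegral => v _; rewrite ReM/= mulr0 subr0 -tc mulrC.
    have -> : \int[mu]_v complex.Re (expi (- q * v) * F v) =
        \int[mu]_v ((phi0 p v - phi2 p v) * trig 1 0 (- q) v).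
      by apply: eq_Rintegral => v _; rewrite ReM/= mulr0 subr0 -tc mulrC.
    by rewrite -trig_parts sqrrN.
  - have -> : \int[mu]_v complex.Im (expi (- q * v) * phiC p v) = \int[mu]_v (phi0 p v * trig 0 1 (- q) v).
      by apply: eq_Rintegral => v _; rewrite ImM/= mulr0 add0r -ts mulrC.
    have -> : \int[mu]_v complex.Im (expi (- q * v) * F v) =
        \int[mu]_v ((phi0 p v - phi2 p v) * trig 0 1 (- q) v).
      by apply: eq_Rintegral => v _; rewrite ImM/= mulr0 add0r -ts mulrC.
    by rewrite -trig_parts sqrrN.
apply: le_trans (le_normc_cint (cintegrable_fourierC _ IF)) _.
have nE v : Normc.normc (expi (- q * v) * F v) = Normc.normc (F v).
  by rewrite Normc.normcM normc_expi mul1r.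
have -> : \int[mu]_v Normc.normc (expi (- q * v) * F v) = \int[mu]_v Normc.normc (F v).
  by apply: eq_Rintegral => v _; exact: nE.
apply: le_Rintegral => //; first exact: (integrable_normc IF).
Qed.

Lemma window_inversion p v : fourierC (fun q => fourierC (phiC p) (- q)) v = ((2 * pi)%:C)%C * phiC p v.
Proof.
apply: (@fourier_inversion _ _ (11 * C) (fun q => window_mass p * (1 + q ^+ 2)^-1)).
- exact: Iphi.
- move=> y; rewrite normc_real; apply: (le_trans (phi0_le p y)).
  rewrite /B ler_piMr ?mulr_ge0 ?C0// mulr_ile1 ?expR_ge0 ?theta_ge0 ?theta_le1//.
  by rewrite expR_le1 oppr_le0 mulr_ge0 ?sqr_ge0.
- move=> u s us; apply: cvgC_real.
  have cp : continuous (phi0 p) := cont_of (@dphi0 p).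
  exact: (cvg_comp _ _ us (cp s)).
- exact: (integrableZl measurableT (window_mass p) integrable_cauchy).
- by move=> q; exact: window_fourier_le.
Qed.


Let mpsi0 : measurable_fun [set: R] psi0.
Proof. exact: continuous_measurable_fun cpsi0. Qed.

Let mBB : measurable_fun [set: R * R] (fun z : R * R => 2 * B z.1 z.2).
Proof.
apply: measurable_funM => //; apply: measurable_funM => //; apply: measurable_funM.
  by apply: (measurableT_comp (measurable_gauss _)); exact: measurable_snd.
apply: (measurableT_comp measurable_cauchy).
by apply: measurable_funB; [exact: measurable_snd|exact: measurable_fst].
Qed.

Let window_mass_ge0 p : 0 <= window_mass p.
Proof. by apply: Rintegral_ge0 => v _; rewrite mulr_ge0// B_ge0. Qed.

(** Integrating over [p] first, the shifted Cauchy factor gives [pi] for each [v], and a Gaussian in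
    [v] remains. *)
Let integrable_window_mass : mu.-integrable [set: R] (EFin \o window_mass).
Proof.
apply: (@ge0_integrable _ _ _ mu); first exact: (measurable_Rintegral_param mu mBB).
  exact: window_mass_ge0.
have -> : (\int[mu]_p (window_mass p)%:E = \int[mu]_p \int[mu]_v (2 * B p v)%:E)%E.
  apply: eq_integral => p _; rewrite /window_mass /Rintegral fineK//.
  by apply: integrable_fin_num => //; exact: (integrableZl measurableT 2 (IB p)).
rewrite (@tonelli12 _ _ _ _ _ mu mu (fun z => (2 * B z.1 z.2)%:E)); last 2 first.
- by apply/measurable_EFinP; exact: mBB.
- by move=> z; rewrite lee_fin mulr_ge0// B_ge0.
have e0 : 0 < 4^-1 :> R by [].
have k0 : 0 <= 2 * (11 * C) * pi by rewrite !mulr_ge0 ?C0 ?pi_ge0.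
apply: (@le_lt_trans _ _ (\int[mu]_v (2 * (11 * C) * pi * expR (- (4^-1 * v ^+ 2)))%:E)%E); last first.
  under eq_integral do rewrite EFinM.
  rewrite ge0_integralZl; last 4 first.
  - exact: measurableT.
  - by apply/measurable_EFinP; exact: measurable_gauss.
  - by move=> v _; rewrite lee_fin expR_ge0.
  - by rewrite lee_fin.
  by rewrite (integral_gauss0 e0) -EFinM ltry.
rewrite le_eqVlt; apply/orP; left; apply/eqP; apply: eq_integral => v _.
have -> : (\int[mu]_p (2 * B p v)%:E =
    (2 * (11 * C) * expR (- (4^-1 * v ^+ 2)))%:E * \int[mu]_p (theta (v - p))%:E)%E.
  rewrite -ge0_integralZl; last 4 first.
  - exact: measurableT.
  - by apply/measurable_EFinP; apply: (measurableT_comp measurable_cauchy); exact: measurable_funB.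
  - by move=> p _; rewrite lee_fin theta_ge0.
  - by rewrite lee_fin !mulr_ge0 ?expR_ge0 ?C0.
  by apply: eq_integral => p _; rewrite -EFinM /B; congr (_%:E); ring.
rewrite (@ge0_integral_rshift _ v (fun p => (theta p)%:E)); last 2 first.
- by apply/measurable_EFinP; exact: measurable_cauchy.
- by move=> p; rewrite lee_fin theta_ge0.
by rewrite integral_cauchy -EFinM; congr (_%:E); ring.
Qed.

(** The short-time Fourier transform of the Gaussian at position [pq.1] and frequency [pq.2]; its
    integrability over phase space is the point of the preceding bounds. *)
Let V (pq : R * R) : R[i] := fourierC (phiC pq.1) (- pq.2).
Let dom (pq : R * R) : R := window_mass pq.1 * (1 + pq.2 ^+ 2)^-1.

Let dom_ge0 pq : 0 <= dom pq.
Proof. by apply: mulr_ge0; [exact: window_mass_ge0|exact: theta_ge0]. Qed.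

Let mwm : measurable_fun [set: R] window_mass.
Proof. exact: (measurable_Rintegral_param mu mBB). Qed.

Let mdom : measurable_fun [set: R * R] dom.
Proof.
apply: measurable_funM; first by apply: (measurableT_comp mwm); exact: measurable_fst.
by apply: (measurableT_comp measurable_cauchy); exact: measurable_snd.
Qed.

Let int_dom : (\int[P]_z (dom z)%:E = (\int[mu]_p window_mass p * pi)%:E)%E.
Proof.
rewrite /dom (ge0_integral_prod mwm measurable_cauchy); last 2 first.
- exact: window_mass_ge0.
- exact: theta_ge0.
rewrite integral_cauchy EFinM; congr (_ * _)%E; rewrite /Rintegral fineK//.
by apply: integrable_fin_num => //; exact: integrable_window_mass.
Qed.

Let integrable_dom : P.-integrable [set: R * R] (EFin \o dom).
Proof.
apply: (@ge0_integrable _ _ _ P _ mdom dom_ge0).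
by move: int_dom => ->; rewrite ltry.
Qed.

Let mV : cmeasurable V.
Proof.
apply: (@cmeasurable_cint _ _ _ _ _ mu (fun z : (R * R) * R => expi (- z.1.2 * z.2) * phiC z.1.1 z.2)).
have m11 : measurable_fun [set: (R * R) * R] (fun z => z.1.1).
  by apply: (measurableT_comp measurable_fst); exact: measurable_fst.
have m12 : measurable_fun [set: (R * R) * R] (fun z => z.1.2).
  by apply: (measurableT_comp measurable_snd); exact: measurable_fst.
have m2 : measurable_fun [set: (R * R) * R] (fun z => z.2) by exact: measurable_snd.
apply: cmeasurableM.
  by apply: cmeasurable_expi; apply: measurable_funM => //; exact: measurableT_comp m12.
apply: cmeasurable_real; apply: measurable_funM.
  have mg : measurable_fun [set: R] g by exact: continuous_measurable_fun cg.
  exact: (measurableT_comp mg m2).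
by apply: (measurableT_comp mpsi0); exact: measurable_funB.
Qed.

Let V_le pq : Normc.normc (V pq) <= dom pq. Proof. exact: window_fourier_le. Qed.

(** Fourier inversion in [q], multiplied by the window and integrated over [p], recovers the
    Gaussian times [2 pi n2]. A Gaussian packet is thus a superposition, with integrable
    coefficients [V], of packets with window [psi0] of the same width [sg], each of which pairs with
    [w] to at most [T]. *)
Lemma window_change (n2 sg T x c : R) (w : R -> R[i]) : 0 < n2 -> 0 < sg ->
  (\int[mu]_y (psi0 y ^+ 2)%:E = n2%:E)%E -> cmeasurable w -> (sqnorm w < +oo)%E ->
  (forall x0 xi0 : R, Normc.normc (cint mu (fun y =>
     w y * (expi (- (y * xi0)) * ((psi0 (sg^-1 * (y - x0)))%:C)%C))) <= T) ->
  2 * pi * n2 * Normc.normc (cint mu (fun y =>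
     w y * (expi (- (y * c)) * ((expR (- ((sg^-1 * (y - x)) ^+ 2 / 2)))%:C)%C))) <=
  T * (\int[mu]_p window_mass p * pi).
Proof.
move=> n20 sg0 psin2 mw w2 HM.
have T0 : 0 <= T by exact: le_trans (normc_ge0 _) (HM 0 0).
pose v y := sg^-1 * (y - x).
have mv : measurable_fun [set: R] v by apply: measurable_funM => //; exact: measurable_funB.
pose E (y : R) : R[i] := w y * expi (- (y * c)).
have nE y : Normc.normc (E y) = Normc.normc (w y) by rewrite Normc.normcM normc_expi mulr1.
have mE : cmeasurable E by apply: cmeasurableM => //; apply: cmeasurable_expi; apply: measurableT_comp => //; exact: measurable_funM.
pose k (y : R) (pq : R * R) : R[i] := expi (v y * pq.2) * ((psi0 (v y - pq.1))%:C)%C.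
have nk y pq : Normc.normc (k y pq) = `|psi0 (v y - pq.1)| by rewrite Normc.normcM normc_expi mul1r normc_real.
have mk : cmeasurable (fun z : R * (R * R) => k z.1 z.2).
  have m1 : measurable_fun [set: R * (R * R)] (fun z => v z.1).
    by apply: (measurableT_comp mv); exact: measurable_fst.
  have m2 : measurable_fun [set: R * (R * R)] (fun z => z.2.1).
    by apply: (measurableT_comp measurable_fst); exact: measurable_snd.
  have m3 : measurable_fun [set: R * (R * R)] (fun z => z.2.2).
    by apply: (measurableT_comp measurable_snd); exact: measurable_snd.
  apply: cmeasurableM; first by apply: cmeasurable_expi; exact: measurable_funM.
  by apply: cmeasurable_real; apply: (measurableT_comp mpsi0); exact: measurable_funB.
pose Phi (z : R * (R * R)) : R[i] := E z.1 * (V z.2 * k z.1 z.2).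
have mPhi : cmeasurable Phi.
  apply: cmeasurableM; first by apply: (cmeasurable_comp _ mE); exact: measurable_fst.
  by apply: cmeasurableM => //; apply: (cmeasurable_comp _ mV); exact: measurable_snd.
have psiC z : `|psi0 z| <= C.
  by apply: le_trans (b0 z) _; rewrite ler_piMr ?C0// theta_le1.
have mpsi2 (b : R) : measurable_fun [set: R] (fun y => psi0 (v y - b) ^+ 2).
  by apply: measurable_funX; apply: (measurableT_comp mpsi0); exact: measurable_funB.
have psiv b : (\int[mu]_y (psi0 (v y - b) ^+ 2)%:E = (sg * n2)%:E)%E.
  have sgi : 0 < sg^-1 by rewrite invr_gt0.
  have := @ge0_integral_affine R sg^-1 (- (sg^-1 * x) - b) (fun y => (psi0 y ^+ 2)%:E) sgi.
  rewrite psin2 => h; rewrite EFinM h; last 2 first.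
  - by apply/measurable_EFinP; exact: measurable_funX.
  - by move=> y; rewrite lee_fin sqr_ge0.
  rewrite muleA -EFinM mulfV ?gt_eqF// mul1e; apply: eq_integral => y _.
  by congr ((psi0 _ ^+ 2)%:E); rewrite /v; ring.
have mwpsi (b : R) : measurable_fun [set: R]
    (fun y => (Normc.normc (w y) ^+ 2)%:E + (psi0 (v y - b) ^+ 2)%:E)%E.
  apply: emeasurable_funD; apply/measurable_EFinP; last exact: mpsi2.
  exact: measurable_sqr_normc.
(* For fixed [pq] the integral in [y] is controlled by the squared norms of [w] and of the dilated
   window, which do not depend on [pq]; the integral of [dom] then gives absolute integrability. *)
have IPhi : cintegrable (prodm mu P) Phi.
  apply: cintegrable_lty => //; rewrite tonelli2; last 2 first.
  - by apply/measurable_EFinP; exact: cmeasurable_normc.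
  - by move=> z; rewrite lee_fin normc_ge0.
  have w2E : sqnorm w = (fine (sqnorm w))%:E by rewrite fineK// ge0_fin_numE ?sqnorm_ge0.
  have W0 : 0 <= fine (sqnorm w) + sg * n2.
    by apply: addr_ge0; [rewrite fine_ge0// sqnorm_ge0|rewrite mulr_ge0// ltW].
  apply: (@le_lt_trans _ _ (\int[P]_pq ((fine (sqnorm w) + sg * n2) * dom pq)%:E)%E); last first.
    under eq_integral do rewrite EFinM.
    rewrite ge0_integralZl; last 4 first.
    - exact: measurableT.
    - by apply/measurable_EFinP; exact: mdom.
    - by move=> z _; rewrite lee_fin dom_ge0.
    - by rewrite lee_fin.
    by rewrite int_dom -EFinM ltry.
  apply: ge0_le_integral.
  - exact: measurableT.
  - by move=> pq _; apply: integral_ge0 => y _; rewrite lee_fin normc_ge0.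
  - apply: (@measurable_int1 _ _ _ _ R mu (fun z => Normc.normc (Phi z))); first exact: cmeasurable_normc.
    by move=> z; exact: normc_ge0.
  - by apply/measurable_EFinP; apply: measurable_funM => //; exact: mdom.
  move=> pq _; apply: (@le_trans _ _ (\int[mu]_y ((dom pq)%:E *
      ((Normc.normc (w y) ^+ 2)%:E + (psi0 (v y - pq.1) ^+ 2)%:E)))%E).
    apply: ge0_le_integral.
    - exact: measurableT.
    - by move=> y _; rewrite lee_fin normc_ge0.
    - have mp : measurable_fun [set: R] (fun y : R => (y, pq)) by exact: measurable_fun_pair.
      by apply/measurable_EFinP; apply: cmeasurable_normc; exact: (cmeasurable_comp mp mPhi).
    - by apply: measurable_funeM; exact: mwpsi.
    move=> y _; rewrite -EFinD -EFinM lee_fin (Normc.normcM (E y)) (Normc.normcM (V pq)) nE nk mulrCA.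
    apply: (@ler_pM R _ _ _ _ (normc_ge0 _) _ (V_le pq)).
      exact: mulr_ge0 (normc_ge0 _) (normr_ge0 _).
    rewrite -[psi0 _ ^+ 2]real_normK ?num_real//.
    have := sqr_ge0 (Normc.normc (w y) - `|psi0 (v y - pq.1)|).
    have := mulr_ge0 (normc_ge0 (w y)) (normr_ge0 (psi0 (v y - pq.1))).
    by move: (Normc.normc (w y)) (`|psi0 (v y - pq.1)|) => s t; nra.
  rewrite ge0_integralZl; last 4 first.
  - exact: measurableT.
  - exact: mwpsi.
  - by move=> y _; apply: adde_ge0; rewrite lee_fin sqr_ge0.
  - by rewrite lee_fin dom_ge0.
  rewrite ge0_integralD; last 5 first.
  - exact: measurableT.
  - by move=> y _; rewrite lee_fin sqr_ge0.
  - by apply/measurable_EFinP; exact: measurable_sqr_normc.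
  - by move=> y _; rewrite lee_fin sqr_ge0.
  - by apply/measurable_EFinP; exact: mpsi2.
  by rewrite psiv -/(sqnorm w) w2E -EFinD -EFinM mulrC.
have inner1 y : cint P (fun pq => Phi (y, pq)) =
    ((2 * pi * n2)%:C)%C * (w y * (expi (- (y * c)) * ((g (v y))%:C)%C)).
  have mky : cmeasurable (k y).
    have mp : measurable_fun [set: R * R] (fun pq : R * R => (y, pq)) by exact: measurable_fun_pair.
    exact: (cmeasurable_comp mp mk).
  have Iy : cintegrable P (fun pq => V pq * k y pq).
    apply: (@cintegrable_le _ _ _ P _ _ _ (integrableZl measurableT C integrable_dom)).
      exact: cmeasurableM.
    move=> pq; rewrite (Normc.normcM (V pq)) nk mulrC.
    exact: (@ler_pM R _ _ _ _ (normr_ge0 _) (normc_ge0 _) (psiC _) (V_le pq)).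
  transitivity (E y * cint P (fun pq => V pq * k y pq)).
    rewrite -cintZ; [by apply: eq_cint|exact: Iy].
  rewrite -(cfubini1 Iy).
  have -> : cint mu (fun p => cint mu (fun q => V (p, q) * k y (p, q))) =
      cint mu (fun p => ((2 * pi * (g (v y) * psi0 (v y - p) ^+ 2))%:C)%C).
    apply: eq_cint => p; have := window_inversion p (v y).
    rewrite /fourierC => hinv.
    transitivity (((psi0 (v y - p))%:C)%C * cint mu (fun q => expi (v y * q) * V (p, q))).
      rewrite -cintZ.
        by apply: eq_cint => q; rewrite /k/=; ring.
      have Iq : cintegrable mu (fun q => V (p, q)).
        apply: (@cintegrable_le _ _ _ mu _ _ _ (integrableZl measurableT (window_mass p) integrable_cauchy)).
          have mp : measurable_fun [set: R] (fun q : R => (p, q)) by exact: measurable_fun_pair.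
          exact: (cmeasurable_comp mp mV).
        by move=> q; exact: (V_le (p, q)).
      exact: (cintegrable_fourierC (v y) Iq).
    rewrite hinv /phiC /phi0 -!real_complexM; congr (_%:C)%C; ring.
  rewrite cint_real.
  have -> : \int[mu]_p (2 * pi * (g (v y) * psi0 (v y - p) ^+ 2)) = 2 * pi * (g (v y) * n2).
    rewrite /Rintegral; have -> : (\int[mu]_p (2 * pi * (g (v y) * psi0 (v y - p) ^+ 2))%:E =
        (2 * pi * g (v y))%:E * n2%:E)%E; last by rewrite -EFinM/=; ring.
      rewrite -psin2 -(@ge0_integral_rshift _ (v y) (fun p => (psi0 p ^+ 2)%:E)); last 2 first.
      - by apply/measurable_EFinP; exact: measurable_funX.
      - by move=> p; rewrite lee_fin sqr_ge0.
      rewrite -ge0_integralZl; last 4 first.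
      - exact: measurableT.
      - by apply/measurable_EFinP; apply: measurable_funX; apply: (measurableT_comp mpsi0); exact: measurable_funB.
      - by move=> p _; rewrite lee_fin sqr_ge0.
      - by rewrite lee_fin !mulr_ge0 ?pi_ge0 ?expR_ge0.
      by apply: eq_integral => p _; rewrite -EFinM; congr (_%:E); ring.
  rewrite /E.
  have -> : ((2 * pi * (g (v y) * n2))%:C)%C = ((2 * pi * n2)%:C)%C * ((g (v y))%:C)%C :> R[i].
    by rewrite -(real_complexM (2 * pi * n2)); congr (_%:C)%C; ring.
  ring.
have Ig : cintegrable mu (fun y => w y * (expi (- (y * c)) * ((g (v y))%:C)%C)).
  have := cintegrableZ ((2 * pi * n2)^-1%:C)%C (cintegrable_cint1 IPhi); congr cintegrable.
  apply/funext => y; rewrite inner1 mulrA -real_complexM mulVf ?mul1r//.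
  by rewrite gt_eqF// mulr_gt0// mulr_gt0// pi_gt0.
(* In the original variable, the phase point [(p, q)] is a window packet centred at [x + sg * p]
   with frequency [c - q / sg], up to a unimodular constant. *)
have inner2 pq : Normc.normc (cint mu (fun y => Phi (y, pq))) <= T * dom pq.
  have -> : cint mu (fun y => Phi (y, pq)) = V pq * expi (- (sg^-1 * x * pq.2)) *
      cint mu (fun y => w y * (expi (- (y * (c - sg^-1 * pq.2))) *
        ((psi0 (sg^-1 * (y - (x + sg * pq.1))))%:C)%C)).
    rewrite -cintZ; last first.
      have mj : cmeasurable (fun y : R => expi (- (y * (c - sg^-1 * pq.2))) *
          ((psi0 (sg^-1 * (y - (x + sg * pq.1))))%:C)%C).
        apply: cmeasurableM; first by apply: cmeasurable_expi; apply: measurableT_comp => //; exact: measurable_funM.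
        apply: cmeasurable_real; apply: (measurableT_comp mpsi0).
        by apply: measurable_funM => //; exact: measurable_funB.
      apply: cintegrable_mul => //.
      rewrite /sqnorm (_ : (\int[mu]_y _)%E = (\int[mu]_y (psi0 (v y - pq.1) ^+ 2)%:E)%E).
        by rewrite psiv ltry.
      apply: eq_integral => y _; rewrite Normc.normcM normc_expi mul1r normc_real.
      rewrite real_normK ?num_real//; congr ((psi0 _ ^+ 2)%:E).
      by rewrite /v; field; rewrite gt_eqF.
    apply: eq_cint => y; rewrite /Phi /E /k/=.
    have -> : sg^-1 * (y - (x + sg * pq.1)) = v y - pq.1 by rewrite /v; field; rewrite gt_eqF.
    have -> : expi (- (y * (c - sg^-1 * pq.2))) = expi (- (y * c)) * expi (sg^-1 * y * pq.2).
      by rewrite -expiD; congr expi; ring.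
    have -> : expi (v y * pq.2) = expi (sg^-1 * y * pq.2) * expi (- (sg^-1 * x * pq.2)).
      by rewrite -expiD; congr expi; rewrite /v; ring.
    ring.
  rewrite (Normc.normcM (V pq * _)) (Normc.normcM (V pq)) normc_expi mulr1 mulrC.
  exact: (@ler_pM R _ _ _ _ (normc_ge0 _) (normc_ge0 _) (HM _ _) (V_le pq)).
have -> : 2 * pi * n2 * Normc.normc (cint mu (fun y =>
     w y * (expi (- (y * c)) * ((expR (- ((sg^-1 * (y - x)) ^+ 2 / 2)))%:C)%C))) =
    Normc.normc (cint P (fun pq => cint mu (fun y => Phi (y, pq)))).
  rewrite -(cfubini IPhi); have -> : cint mu (fun y => cint P (fun pq => Phi (y, pq))) =
      ((2 * pi * n2)%:C)%C * cint mu (fun y => w y * (expi (- (y * c)) * ((g (v y))%:C)%C)).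
    by rewrite -cintZ//; apply: eq_cint => y; exact: inner1.
  rewrite (Normc.normcM _ (cint mu _)) normc_real ger0_norm//.
  by rewrite mulr_ge0 ?(ltW n20)// mulr_ge0// pi_ge0.
have I2 := cintegrable_cint2 IPhi.
rewrite -lee_fin (le_trans (le_normc_cinte I2))// EFinM -int_dom -ge0_integralZl; last 4 first.
- exact: measurableT.
- by apply/measurable_EFinP; exact: mdom.
- by move=> z _; rewrite lee_fin dom_ge0.
- by rewrite lee_fin.
apply: ge0_le_integral.
- exact: measurableT.
- by move=> z _; rewrite lee_fin normc_ge0.
- by apply/measurable_EFinP; apply: cmeasurable_normc; exact: cintegrable_measurable I2.
- by apply: measurable_funeM; apply/measurable_EFinP; exact: mdom.
by move=> z _; rewrite -EFinM lee_fin.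
Qed.

End window.

(** * Proof of the theorem *)

Section fatou_sections.
Context d1 d2 (T1 : measurableType d1) (T2 : measurableType d2) (R : realType).
Variable m1 : {sigma_finite_measure set T1 -> \bar R}.
Variable m2 : {sigma_finite_measure set T2 -> \bar R}.

(** Each time slice is determined only up to a null set, so convergence is available for every [x]
    and almost every [y]. To work section by section, the limit is replaced by the lower limit,
    which is jointly measurable, and Tonelli compares the two. *)
Lemma fatou_sections (f_ : nat -> T1 * T2 -> R) (f : T1 * T2 -> R) (B : \bar R) :
  (forall n, measurable_fun [set: T1 * T2] (f_ n)) -> (forall n z, 0 <= f_ n z) ->
  measurable_fun [set: T1 * T2] f -> (forall z, 0 <= f z) ->
  (forall x, {ae m2, forall y, f_ n (x, y) @[n --> \oo] --> f (x, y)}) ->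
  (forall n, (\int[prodm m1 m2]_z (f_ n z)%:E <= B)%E) ->
  (\int[prodm m1 m2]_z (f z)%:E <= B)%E.
Proof.
move=> mf f0 mf' f0' cf fB.
pose Li (z : T1 * T2) : \bar R := limn_einf (fun n => (f_ n z)%:E).
have mLi : measurable_fun [set: T1 * T2] Li.
  have -> : Li = (fun z => - limn_esup (fun n => - (f_ n z)%:E))%E.
    by apply/funext => z; rewrite /Li -[LHS]oppeK -limn_esupN.
  apply: measurableT_comp => //; apply: measurable_fun_limn_esup => n.
  by apply: measurableT_comp => //; apply/measurable_EFinP.
have Li0 z : (0 <= Li z)%E.
  rewrite /Li limn_einf_lim; apply: lime_ge; first exact: is_cvg_einfs.
  by apply: nearW => n; apply/ereal_infP => _ [k _ <-]; rewrite lee_fin.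
apply: (@le_trans _ _ (\int[prodm m1 m2]_z Li z)%E).
  rewrite tonelli1; last 2 first.
  - exact/measurable_EFinP.
  - by move=> z; rewrite lee_fin.
  rewrite tonelli1// le_eqVlt; apply/orP; left; apply/eqP; apply: eq_integral => x _.
  have mp : measurable_fun [set: T2] (fun y : T2 => (x, y)) by exact: measurable_fun_pair.
  apply: ae_eq_integral => //.
  - by apply/measurable_EFinP; exact: (measurableT_comp mf' mp).
  - exact: (measurableT_comp mLi mp).
  apply: filterS (cf x) => y cy _.
  have cE : (f_ n (x, y))%:E @[n --> \oo] --> (f (x, y))%:E.
    by apply: cvg_EFin; [exact: nearW|exact: cy].
  by rewrite /Li; have [-> _] := cvg_limn_einf_sup cE.
have := @fatou _ _ _ (prodm m1 m2) setT measurableT (fun n z => (f_ n z)%:E)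
  (fun n => (measurable_EFinP _ _).2 (mf n)) (fun n z _ => f0 n z).
by move=> /le_trans; apply; exact: limn_einf_bound.
Qed.

End fatou_sections.

Section complex_lebesgue_points.
Context {R : realType}.
Local Notation mu := (@lebesgue_measure R).

Lemma locally_integrable_L2 (f : R -> R) : measurable_fun [set: R] f ->
  (\int[mu]_y (f y ^+ 2)%:E < +oo)%E -> locally_integrable [set: R] f.
Proof.
move=> mf f2; split => //; first exact: openT.
move=> K _ cK; have mK : measurable K by exact: compact_measurable.
apply: (@le_lt_trans _ _ (\int[mu]_(y in K) ((f y ^+ 2)%:E + 1))%E).
  apply: ge0_le_integral => //.
  - by apply/measurable_EFinP; apply: measurable_funTS; exact: measurableT_comp.
  - by apply: emeasurable_funD => //; apply/measurable_EFinP; apply: measurable_funTS; exact: measurable_funX.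
  - move=> y _; rewrite -EFinD lee_fin -[f y ^+ 2]real_normK ?num_real//.
    by have := sqr_ge0 (`|f y| - 1); have := normr_ge0 (f y); move: `|f y| => a; nra.
rewrite ge0_integralD//; last 2 first.
- by move=> y _; rewrite lee_fin sqr_ge0.
- by apply/measurable_EFinP; apply: measurable_funTS; exact: measurable_funX.
apply: lte_add_pinfty.
  apply: le_lt_trans f2; apply: ge0_subset_integral => //.
  - by apply/measurable_EFinP; exact: measurable_funX.
  - by move=> y _; rewrite lee_fin sqr_ge0.
by rewrite integral_cst// mul1e; exact: compact_finite_measure.
Qed.

Lemma ae_cvg_gaussK (w : R -> R[i]) : cmeasurable w -> (sqnorm w < +oo)%E ->
  {ae mu, forall x, cvgC (fun n => cint mu (fun y => w y * ((gaussK (n.+1%:R^-1 ^+ 2) (x - y))%:C)%C))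
    (((2 * pi)%:C)%C * w x)}.
Proof.
move=> [mr mi] w2.
have r2 : (\int[mu]_y ((complex.Re (w y)) ^+ 2)%:E < +oo)%E.
  apply: le_lt_trans w2; apply: ge0_le_integral => //.
  - by move=> y _; rewrite lee_fin sqr_ge0.
  - by apply/measurable_EFinP; exact: measurable_funX.
  - by apply/measurable_EFinP; apply: measurable_sqr_normc; split.
  - by move=> y _; rewrite lee_fin normc_sqr lerDl sqr_ge0.
have i2 : (\int[mu]_y ((complex.Im (w y)) ^+ 2)%:E < +oo)%E.
  apply: le_lt_trans w2; apply: ge0_le_integral => //.
  - by move=> y _; rewrite lee_fin sqr_ge0.
  - by apply/measurable_EFinP; exact: measurable_funX.
  - by apply/measurable_EFinP; apply: measurable_sqr_normc; split.
  - by move=> y _; rewrite lee_fin normc_sqr lerDr sqr_ge0.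
have ar := lebesgue_differentiation (locally_integrable_L2 mr r2).
have ai := lebesgue_differentiation (locally_integrable_L2 mi i2).
have FF : Filter (nbhs (almost_everywhere mu)) by exact: ae_filter_ringOfSetsType.
apply: (@filterS2 _ _ FF _ _ _ _ ar ai) => x xr xi; apply: cvgC_ReIm.
- have := gaussK_lebesgue_pt mr r2 xr.
  have -> : complex.Re (((2 * pi)%:C)%C * w x) = 2 * pi * complex.Re (w x).
    by rewrite ReM/= mul0r subr0.
  have -> : (fun n => complex.Re (cint mu (fun y => w y * ((gaussK (n.+1%:R^-1 ^+ 2) (x - y))%:C)%C))) =
      (fun n => \int[mu]_y (complex.Re (w y) * gaussK (n.+1%:R^-1 ^+ 2) (x - y))).
    apply/funext => n; rewrite Re_cint; apply: eq_Rintegral => y _.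
    by rewrite ReM/= mulr0 subr0.
  by [].
- have := gaussK_lebesgue_pt mi i2 xi.
  have -> : complex.Im (((2 * pi)%:C)%C * w x) = 2 * pi * complex.Im (w x).
    by rewrite ImM/= mul0r addr0.
  have -> : (fun n => complex.Im (cint mu (fun y => w y * ((gaussK (n.+1%:R^-1 ^+ 2) (x - y))%:C)%C))) =
      (fun n => \int[mu]_y (complex.Im (w y) * gaussK (n.+1%:R^-1 ^+ 2) (x - y))).
    apply/funext => n; rewrite Im_cint; apply: eq_Rintegral => y _.
    by rewrite ImM/= mulr0 add0r.
  by [].
Qed.

Lemma cint_shift (f : R -> R[i]) (b : R) : cmeasurable f ->
  cint mu (fun x => f (x + b)) = cint mu f.
Proof.
move=> [mr mi]; apply: cplx_eq; rewrite ?Re_cint ?Im_cint /Rintegral; congr fine.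
- by rewrite (@integral_shift _ b (fun x => (complex.Re (f x))%:E))//; apply/measurable_EFinP.
- by rewrite (@integral_shift _ b (fun x => (complex.Im (f x))%:E))//; apply/measurable_EFinP.
Qed.

(** A Gaussian packet on the frequency side, of frequency centre [c]; the phase places its Fourier
    transform at position [x]. *)
Definition gauss_packet (a x c xi : R) : R[i] :=
  expi (x * xi) * ((expR (- (a * (xi - c) ^+ 2)))%:C)%C.

Lemma cintegrable_gauss_packet (a x c : R) : 0 < a -> cintegrable mu (gauss_packet a x c).
Proof.
move=> a0; have := cintegrable_gauss_expi c x a0; congr cintegrable.
by apply/funext => xi; rewrite /gauss_packet mulrC [x * _]mulrC mulrC.
Qed.

Lemma sqnorm_gauss_packet (a x c : R) : 0 < a -> (sqnorm (gauss_packet a x c) < +oo)%E.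
Proof.
move=> a0; have a20 : 0 < 2 * a by rewrite mulr_gt0.
apply: (@le_lt_trans _ _ (\int[mu]_xi (expR (- (2 * a * (xi - c) ^+ 2)))%:E)%E); last first.
  by rewrite (integral_gauss c a20) ltry.
rewrite le_eqVlt; apply/orP; left; apply/eqP; apply: eq_integral => xi _.
rewrite Normc.normcM normc_expi mul1r normc_real ger0_norm ?expR_ge0//.
by rewrite -expRM_natr; congr (expR _)%:E; ring.
Qed.

Lemma fourier_gauss_packet (a x c y : R) : 0 < a ->
  fourierC (gauss_packet a x c) (- y) = expi ((x - y) * c) * ((gaussK a (x - y))%:C)%C.
Proof.
move=> a0; rewrite /fourierC.
have mf : cmeasurable (fun xi => expi (- y * xi) * gauss_packet a x c xi).
  apply: cmeasurableM; last exact: cintegrable_measurable (cintegrable_gauss_packet x c a0).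
  by apply: cmeasurable_expi; exact: measurable_funM.
rewrite -(cint_shift c mf) -(fourier_gauss (x - y) a0) -cintZ; last exact: cintegrable_gauss_expi0.
apply: eq_cint => xi; rewrite /gauss_packet addrK !mulrA -!expiD; congr (expi _ * _); ring.
Qed.

End complex_lebesgue_points.

Section schwartz_decay.
Context {R : realType}.

Lemma schwartz_is_derive (psi : R -> R) n (x : R) : schwartz psi ->
  is_derive x (1 : R) (derive1n n psi) (derive1n n.+1 psi x).
Proof.
move=> [D _]; apply: DeriveDef; first exact: D.
by rewrite derive1nS derive1E.
Qed.

(** The seminorms with weights 1 and [x^2], added up over the orders 0, 1 and 2, give one constant
    for all three functions. *)
Lemma schwartz_decay (psi : R -> R) : schwartz psi -> exists C : R, forall n x, (n <= 2)%N ->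
  `|derive1n n psi x| <= C * (1 + x ^+ 2)^-1.
Proof.
move=> [_ B].
have one n : exists2 C : R, 0 <= C & forall x, `|derive1n n psi x| <= C * (1 + x ^+ 2)^-1.
  have [C0 h0] := B 0%N n; have [C2 h2] := B 2%N n.
  have C00 : 0 <= C0 by apply: le_trans (h0 0); rewrite expr0 mul1r.
  have C20 : 0 <= C2 by apply: le_trans (h2 0); rewrite mulr_ge0 ?exprn_ge0.
  exists (C0 + C2); first exact: addr_ge0.
  move=> x; have p0 : 0 < 1 + x ^+ 2 by rewrite ltr_wpDr// sqr_ge0.
  rewrite ler_pdivlMr// mulrC mulrDl mul1r lerD//.
    by apply: le_trans (h0 x); rewrite expr0 mul1r.
  by apply: le_trans (h2 x); rewrite real_normK ?num_real.
have [A A0 hA] := one 0%N; have [B' B0 hB] := one 1%N; have [D D0 hD] := one 2%N.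
exists (A + B' + D) => n x n2.
have i0 : 0 <= (1 + x ^+ 2)^-1 by rewrite invr_ge0 addr_ge0 ?sqr_ge0.
case: n n2 => [|[|[|//]]] _; [apply: le_trans (hA x) _|apply: le_trans (hB x) _|apply: le_trans (hD x) _];
  rewrite ler_wpM2r//.
- by rewrite -addrA lerDl addr_ge0.
- by rewrite addrAC lerDr addr_ge0.
- by rewrite lerDr addr_ge0.
Qed.

End schwartz_decay.

(** * From packets with window [psi] to Gaussian packets *)

Section evolution_bounds.
Context {R : realType}.
Local Notation mu := (@lebesgue_measure R).
Local Notation P := (prodm mu mu).

Lemma window_kernel_L2 (psi : R -> R) (n2 sg x0 xi0 : R) : measurable_fun [set: R] psi -> 0 < sg ->
  (\int[mu]_y (psi y ^+ 2)%:E = n2%:E)%E ->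
  cmeasurable (fun y : R => expi (- (y * xi0)) * ((psi (sg^-1 * (y - x0)))%:C)%C) /\
  (sqnorm (fun y : R => expi (- (y * xi0)) * ((psi (sg^-1 * (y - x0)))%:C)%C)%R < +oo)%E.
Proof.
move=> mpsi sg0 psin2; split.
  apply: cmeasurableM; first by apply: cmeasurable_expi; apply: measurableT_comp => //; exact: measurable_funM.
  apply: cmeasurable_real; apply: (measurableT_comp mpsi).
  by apply: measurable_funM => //; exact: measurable_funB.
have sgi : 0 < sg^-1 by rewrite invr_gt0.
have := @ge0_integral_affine R sg^-1 (- (sg^-1 * x0)) (fun y => (psi y ^+ 2)%:E) sgi.
rewrite psin2 => h.
rewrite (_ : sqnorm _ = (sg * n2)%:E) ?ltry// EFinM h; last 2 first.
- by apply/measurable_EFinP; exact: measurable_funX.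
- by move=> y; rewrite lee_fin sqr_ge0.
rewrite muleA -EFinM mulfV ?gt_eqF// mul1e; apply: eq_integral => y _.
rewrite Normc.normcM normc_expi mul1r normc_real real_normK ?num_real//.
by congr ((psi _ ^+ 2)%:E); ring.
Qed.

(** The factor [sqrt lam] undoes the L2 normalisation in [scaling]; the conjugation and the phase of
    [x0 * xi0] do not affect the modulus. *)
Lemma normc_inner_packet (psi : R -> R) (n2 lam x0 xi0 : R) (w : R -> R[i]) :
  measurable_fun [set: R] psi -> 0 < lam ->
  (\int[mu]_y (psi y ^+ 2)%:E = n2%:E)%E -> cmeasurable w -> (sqnorm w < +oo)%E ->
  Normc.normc (cint mu (fun y => w y * (expi (- (y * xi0)) * ((psi (lam^-1 * (y - x0)))%:C)%C))) =
  Num.sqrt lam * Normc.normc (inner (phase_translation (x0, xi0) (scaling lam (embedC psi))) w).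
Proof.
move=> mpsi lam0 psin2 mw w2.
have [mk k2] := window_kernel_L2 x0 xi0 mpsi lam0 psin2.
have I := cintegrable_mul mw mk w2 k2.
have q0 : 0 < Num.sqrt lam by rewrite sqrtr_gt0.
have -> : inner (phase_translation (x0, xi0) (scaling lam (embedC psi))) w =
    (((Num.sqrt lam)^-1)%:C)%C * expi (- (x0 * xi0)) *
    (cint mu (fun y => w y * (expi (- (y * xi0)) * ((psi (lam^-1 * (y - x0)))%:C)%C)))^*%C.
  rewrite -cint_conj// -cintZ; last exact: cintegrable_conj.
  apply: eq_cint => y; rewrite /phase_translation /scaling /embedC/= !conjcM conj_expi opprK.
  have -> : lam `^ (- 2^-1) = (Num.sqrt lam)^-1.
    by rewrite powRN powR12_sqrt// ltW.
  have -> : expi ((y - x0) * xi0) = expi (y * xi0) * expi (- (x0 * xi0)).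
    by rewrite -expiD; congr expi; ring.
  have -> : (((psi (lam^-1 * (y - x0)))%:C)^*)%C = ((psi (lam^-1 * (y - x0)))%:C)%C :> R[i].
    by apply: cplx_eq; rewrite ?Re_conj ?Im_conj/= ?oppr0.
  ring.
rewrite (Normc.normcM (_ * _)) (Normc.normcM (_%:C)%C) normc_expi normc_real normc_conj mulr1.
by rewrite ger0_norm ?invr_ge0 ?(ltW q0)// mulrA mulfV ?gt_eqF// mul1r.
Qed.

Variables (psi : R -> R) (n2 : R).
Hypotheses (psi_schwartz : schwartz psi) (n20 : 0 < n2)
  (psin2 : (\int[mu]_y (psi y ^+ 2)%:E = n2%:E)%E).

Let mpsi : measurable_fun [set: R] psi.
Proof.
apply: continuous_measurable_fun => x; apply: differentiable_continuous; apply/derivable1_diffP.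
exact: (@ex_derive _ _ _ _ _ _ _ (schwartz_is_derive 0 x psi_schwartz)).
Qed.

(** Unnormalised window packets of width [sg] pair with [w] to at most [sqrt sg * m], and
    [window_change] carries this over to Gaussians. The kernel [gaussK] has the amplitude
    [sqrt(2 pi) / sg], so all powers of [sg] cancel against the leading factor and the bound is the
    same at every scale. *)
Lemma gauss_packet_bound : exists2 K : R, 0 <= K & forall (w : R -> R[i]) (m : R),
  cmeasurable w -> (sqnorm w < +oo)%E -> 0 <= m ->
  (forall (z : R * R) (lam : R), 0 < lam ->
     Normc.normc (inner (phase_translation z (scaling lam (embedC psi))) w) <= m) ->
  forall sg x c : R, 0 < sg ->
    sg * Normc.normc (cint mu (fun y => w y *
      (expi ((x - y) * c) * ((gaussK (sg ^+ 2 / 2) (x - y))%:C)%C))) ^+ 2 <= K * m ^+ 2.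
Proof.
have [C decay] := schwartz_decay psi_schwartz.
have D n x := @schwartz_is_derive R psi n x psi_schwartz.
have c2 : continuous (derive1n 2 psi).
  move=> x; apply: differentiable_continuous; apply/derivable1_diffP.
  exact: (@ex_derive _ _ _ _ _ _ _ (D 2%N x)).
have wc := @window_change R psi (derive1n 1 psi) (derive1n 2 psi) C (D 0%N) (D 1%N) c2
  (fun x => decay 0%N x isT) (fun x => decay 1%N x isT) (fun x => decay 2%N x isT) n2.
move: wc; set W := (\int[_]_p _ * pi) => wc.
pose k := W / (2 * pi * n2).
have p2 : 0 < 2 * pi * n2 by rewrite mulr_gt0// mulr_gt0// pi_gt0.
exists (2 * pi * k ^+ 2); first by rewrite mulr_ge0 ?sqr_ge0// mulr_ge0// pi_ge0.
move=> w m mw w2 m0 HM sg x c sg0.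
have q0 : 0 < Num.sqrt sg by rewrite sqrtr_gt0.
have HT x0 xi0 : Normc.normc (cint mu (fun y => w y * (expi (- (y * xi0)) *
    ((psi (sg^-1 * (y - x0)))%:C)%C))) <= Num.sqrt sg * m.
  rewrite (normc_inner_packet x0 xi0 mpsi sg0 psin2 mw w2).
  by rewrite ler_wpM2l ?(ltW q0)// HM.
have := wc sg (Num.sqrt sg * m) x c w n20 sg0 psin2 mw w2 HT.
set G := cint mu _ => hG.
have {}hG : Normc.normc G <= Num.sqrt sg * m * k.
  by rewrite /k mulrA ler_pdivlMr// mulrC.
have -> : cint mu (fun y => w y * (expi ((x - y) * c) * ((gaussK (sg ^+ 2 / 2) (x - y))%:C)%C)) =
    (expi (x * c) * ((Num.sqrt (pi / (sg ^+ 2 / 2)))%:C)%C) * G.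
  have [mk k2] : cmeasurable (fun y : R => expi (- (y * c)) *
      ((expR (- ((sg^-1 * (y - x)) ^+ 2 / 2)))%:C)%C) /\
    (sqnorm (fun y : R => expi (- (y * c)) *
      ((expR (- ((sg^-1 * (y - x)) ^+ 2 / 2)))%:C)%C)%R < +oo)%E.
    have mg : measurable_fun [set: R] (fun v : R => expR (- (v ^+ 2 / 2))).
      have : measurable_fun [set: R] (fun v : R => expR (- (2^-1 * v ^+ 2))) by exact: measurable_gauss.
      by apply: eq_measurable_fun => v _; rewrite mulrC.
    have g2 : (\int[mu]_v (expR (- (v ^+ 2 / 2)) ^+ 2)%:E = (Num.sqrt (pi / 1))%:E)%E.
      rewrite -(@integral_gauss0 R 1 ltr01); apply: eq_integral => v _.
      by rewrite -expRM_natr; congr (expR _)%:E; field.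
    exact: (window_kernel_L2 x c mg sg0 g2).
  rewrite -cintZ; last exact: cintegrable_mul.
  apply: eq_cint => y; rewrite /gaussK.
  have -> : expi ((x - y) * c) = expi (x * c) * expi (- (y * c)) by rewrite -expiD; congr expi; ring.
  have -> : expR (- ((x - y) ^+ 2 / (4 * (sg ^+ 2 / 2)))) = expR (- ((sg^-1 * (y - x)) ^+ 2 / 2)).
    by congr expR; field; rewrite gt_eqF.
  by rewrite (real_complexM (Num.sqrt _)); ring.
rewrite (Normc.normcM (_ * _)) (Normc.normcM (expi _)) normc_expi mul1r normc_real.
rewrite (ger0_norm (sqrtr_ge0 _)) exprMn sqr_sqrtr; last first.
  by apply: divr_ge0; [exact: pi_ge0|rewrite divr_ge0// sqr_ge0].
have hG2 : Normc.normc G ^+ 2 <= sg * m ^+ 2 * k ^+ 2.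
  have -> : sg * m ^+ 2 * k ^+ 2 = (Num.sqrt sg * m * k) ^+ 2.
    by rewrite !exprMn sqr_sqrtr// ltW.
  rewrite lerXn2r ?nnegrE ?normc_ge0//.
  exact: le_trans (normc_ge0 _) hG.
have -> : 2 * pi * k ^+ 2 * m ^+ 2 = sg * (pi / (sg ^+ 2 / 2) * (sg * m ^+ 2 * k ^+ 2)).
  by field; rewrite gt_eqF.
apply: ler_wpM2l; first exact: ltW.
apply: ler_wpM2l => //.
by apply: divr_ge0; [exact: pi_ge0|rewrite divr_ge0// sqr_ge0].
Qed.

End evolution_bounds.

(** * The sextic estimate for the free evolution of L2 data *)

Section evolution_sextic.
Context {R : realType}.
Local Notation mu := (@lebesgue_measure R).
Local Notation P := (prodm mu mu).
Variables (f F : R -> R[i]) (u : R -> R -> R[i]) (A L : R).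
Hypotheses (mu_ : cmeasurable (fun tx : R * R => u tx.1 tx.2))
  (fu : forall t, is_propagator t f (u t)) (fF : is_fourier f F) (fA : sqnorm f = (A ^+ 2)%:E).
Hypothesis packet_le : forall (t sg x c : R), 0 < sg ->
  sg * Normc.normc (cint mu (fun y => u t y *
    (expi ((x - y) * c) * ((gaussK (sg ^+ 2 / 2) (x - y))%:C)%C))) ^+ 2 <= L.

Let mF : cmeasurable F. Proof. by case: fF => _ []. Qed.
Let F2 : (sqnorm F < +oo)%E. Proof. by case: fF => _ /inL2_sqnorm. Qed.

Let inL2u t : cmeasurable (u t) /\ (sqnorm (u t) < +oo)%E.
Proof. by have [G _ [h _ _]] := fu t; split; [case: h|exact: inL2_sqnorm]. Qed.

(** Moves a packet integral of the profile to the space side, where the hypothesis on wave packets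
    is stated, by Parseval for the slice [u t]. *)
Let exchange (t a x c : R) : 0 < a ->
  cint mu (fun xi => F xi * (expi (- (t * xi ^+ 2 / 2)) * gauss_packet a x c xi)) =
  cint mu (fun y => u t y * (expi ((x - y) * c) * ((gaussK a (x - y))%:C)%C)).
Proof.
move=> a0; have [G fG uG] := fu t.
have Ip := cintegrable_gauss_packet x c a0; have p2 := sqnorm_gauss_packet x c a0.
have mp := cintegrable_measurable Ip.
have me : cmeasurable (fun xi : R => expi (- (t * xi ^+ 2 / 2))).
  apply: cmeasurable_expi; apply: measurableT_comp => //; apply: measurable_funM => //.
  by apply: measurable_funM => //; exact: measurable_funX.
(* The propagator at time [t] comes with its own transform [G] of [f], which need not be the
   representative [F]; inside an L2 pairing they are interchangeable. *)
rewrite (is_fourier_uniq fF fG); last 2 first.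
- exact: cmeasurableM.
- apply: le_lt_trans p2; rewrite le_eqVlt; apply/orP; left; apply/eqP.
  by apply: eq_integral => xi _; rewrite Normc.normcM normc_expi mul1r.
transitivity (cint mu (fun xi => (expi (- (t * xi ^+ 2 / 2)) * G xi) * gauss_packet a x c xi)).
  by apply: eq_cint => xi; ring.
rewrite (parseval_fourier uG Ip p2); apply: eq_cint => y.
by rewrite fourier_gauss_packet.
Qed.

(** The damping makes a square-integrable profile integrable, as [sextic_bound] demands. On the
    space side it replaces each slice by its Gaussian means. *)
Let damped (a : R) (xi : R) : R[i] := F xi * ((expR (- (a * xi ^+ 2)))%:C)%C.

Let Idamped a : 0 < a -> cintegrable mu (damped a).
Proof.
move=> a0; apply: cintegrable_mul => //.
  by apply: cmeasurable_real; exact: measurable_gauss.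
apply: le_lt_trans (sqnorm_gauss_packet 0 0 a0); rewrite le_eqVlt; apply/orP; left; apply/eqP.
by apply: eq_integral => xi _; rewrite /gauss_packet Normc.normcM normc_expi mul1r subr0.
Qed.

Let damped_sqnorm a : 0 < a -> exists2 N : R, (\int[mu]_xi (Normc.normc (damped a xi) ^+ 2)%:E = N%:E)%E &
  0 <= N <= 4 * pi * A ^+ 2.
Proof.
move=> a0.
have le : (sqnorm (damped a) <= (4 * pi * A ^+ 2)%:E)%E.
  apply: (@le_trans _ _ (sqnorm F)); last first.
    by have := is_fourier_sqnorm fF; rewrite fA -EFinM.
  apply: ge0_le_integral => //.
  - by move=> xi _; rewrite lee_fin sqr_ge0.
  - by apply/measurable_EFinP; apply: measurable_sqr_normc; exact: cintegrable_measurable (Idamped a0).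
  - by apply/measurable_EFinP; exact: measurable_sqr_normc.
  move=> xi _; rewrite lee_fin lerXn2r ?nnegrE ?normc_ge0//.
  rewrite Normc.normcM normc_real ger0_norm ?expR_ge0// ler_piMr ?normc_ge0//.
  by rewrite expR_le1 oppr_le0 mulr_ge0 ?sqr_ge0// ltW.
have fin : sqnorm (damped a) \is a fin_num.
  by rewrite ge0_fin_numE ?sqnorm_ge0//; exact: le_lt_trans le (ltry _).
exists (fine (sqnorm (damped a))); first by rewrite fineK.
by rewrite fine_ge0 ?sqnorm_ge0//= -lee_fin fineK.
Qed.

(** Damping times packet is again a Gaussian packet, of inverse width [sg] with [sg^2 = s^2 + 2 a],
    up to a prefactor at most 1. Since [|s| <= sg], the bound for undamped packets carries over with
    the same [L] for every [a]. *)
Let wave_damped a s c t x : 0 < a -> s != 0 ->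
  `|s| * Normc.normc (extension (wave (damped a) s c) t x) ^+ 2 <= L.
Proof.
move=> a0 s0; have s20 : 0 < s ^+ 2 by rewrite exprn_even_gt0.
pose sg := Num.sqrt (s ^+ 2 + 2 * a).
have q0 : 0 < s ^+ 2 + 2 * a by rewrite addr_gt0// mulr_gt0.
have sg2 : sg ^+ 2 = s ^+ 2 + 2 * a by rewrite sqr_sqrtr// ltW.
have sg0 : 0 < sg by rewrite sqrtr_gt0.
(* The new centre and the prefactor [kap] come from completing the square in
   [a xi^2 + s^2 (xi - c)^2 / 2]. *)
pose c' := s ^+ 2 * c / (s ^+ 2 + 2 * a).
pose kap := expR (- (a * s ^+ 2 * c ^+ 2 / (s ^+ 2 + 2 * a))).
have sg220 : 0 < sg ^+ 2 / 2 by rewrite sg2 divr_gt0.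
have Ip := cintegrable_gauss_packet x c' sg220; have p2 := sqnorm_gauss_packet x c' sg220.
have mp := cintegrable_measurable Ip.
have Ie : cintegrable mu (fun xi => F xi * (expi (- (t * xi ^+ 2 / 2)) * gauss_packet (sg ^+ 2 / 2) x c' xi)).
  apply: cintegrable_mul => //.
    apply: cmeasurableM => //.
    apply: cmeasurable_expi; apply: measurableT_comp => //; apply: measurable_funM => //.
    by apply: measurable_funM => //; exact: measurable_funX.
  apply: le_lt_trans p2; rewrite le_eqVlt; apply/orP; left; apply/eqP.
  by apply: eq_integral => xi _; rewrite Normc.normcM normc_expi mul1r.
have -> : extension (wave (damped a) s c) t x = (kap%:C)%C *
    cint mu (fun xi => F xi * (expi (- (t * xi ^+ 2 / 2)) * gauss_packet (sg ^+ 2 / 2) x c' xi)).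
  rewrite -cintZ//; apply: eq_cint => xi; rewrite /osc /wave /damped /gauss_packet /energy /packet.
  have -> : expi (t * - (xi ^+ 2 / 2) + x * xi) = expi (- (t * xi ^+ 2 / 2)) * expi (x * xi).
    by rewrite -expiD; congr expi; ring.
  have eE : expR (- (a * xi ^+ 2)) * expR (- (s ^+ 2 * (xi - c) ^+ 2 / 2)) =
      kap * expR (- (sg ^+ 2 / 2 * (xi - c') ^+ 2)).
    by rewrite /kap -!expRD sg2; congr expR; rewrite /c'; field; rewrite gt_eqF.
  transitivity (expi (- (t * xi ^+ 2 / 2)) * expi (x * xi) * F xi *
    ((expR (- (a * xi ^+ 2)) * expR (- (s ^+ 2 * (xi - c) ^+ 2 / 2)))%:C)%C).
    by rewrite real_complexM; ring.
  by rewrite eE real_complexM; ring.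
rewrite exchange// (Normc.normcM (kap%:C)%C) normc_real (ger0_norm (expR_ge0 _)) exprMn.
set X := Normc.normc _; apply: le_trans (packet_le t x c' sg0); rewrite -/X.
have ssg : `|s| <= sg.
  by rewrite -sqrtr_sqr /sg ler_sqrt ?(ltW q0)// lerDl mulr_ge0// ltW.
apply: ler_pM => //; first by rewrite mulr_ge0 ?sqr_ge0.
rewrite ler_piMl ?sqr_ge0// expr_le1 ?expR_ge0// expR_le1 oppr_le0 divr_ge0 ?(ltW q0)//.
by rewrite mulr_ge0 ?sqr_ge0// mulr_ge0 ?sqr_ge0// ltW.
Qed.

(** The damped profiles satisfy the sextic bound uniformly in the damping, and their evolutions
    converge to [2 pi u] almost everywhere on each slice; this explains the factor [(2 pi)^6]. *)
Lemma evolution_sextic :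
  (((2 * pi) ^+ 6)%:E * \int[P]_z (Normc.normc (u z.1 z.2) ^+ 6)%:E <=
   (sextic_const * L * (4 * pi * A ^+ 2) ^+ 2)%:E)%E.
Proof.
have L0 : 0 <= L.
  by apply: le_trans (packet_le 0 0 0 ltr01); rewrite mulr_ge0 ?sqr_ge0.
have mu6 : measurable_fun [set: R * R] (fun z => Normc.normc (u z.1 z.2) ^+ 6).
  by apply: measurable_funX; exact: cmeasurable_normc.
have p60 : 0 <= (2 * pi) ^+ 6 :> R by rewrite exprn_ge0// mulr_ge0// pi_ge0.
rewrite -ge0_integralZl; last 4 first.
- exact: measurableT.
- exact/measurable_EFinP.
- by move=> z _; rewrite lee_fin exprn_ge0// normc_ge0.
- by rewrite lee_fin.
pose a (n : nat) : R := n.+1%:R^-1 ^+ 2.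
have a0 n : 0 < a n by rewrite exprn_gt0// invr_gt0.
pose U n (z : R * R) := extension (damped (a n)) z.1 z.2.
(* The damped evolution is a Gaussian packet integral with frequency centre 0, hence a Gaussian mean
   of the slice. *)
have UE n z : U n z = cint mu (fun y => u z.1 y * ((gaussK (a n) (z.2 - y))%:C)%C).
  transitivity (cint mu (fun xi => F xi * (expi (- (z.1 * xi ^+ 2 / 2)) * gauss_packet (a n) z.2 0 xi))).
    apply: eq_cint => xi; rewrite /osc /damped /gauss_packet /energy subr0.
    have -> : expi (z.1 * - (xi ^+ 2 / 2) + z.2 * xi) = expi (- (z.1 * xi ^+ 2 / 2)) * expi (z.2 * xi).
      by rewrite -expiD; congr expi; ring.
    ring.
  by rewrite exchange//; apply: eq_cint => y; rewrite mulr0 expi0 mul1r.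
apply: (@fatou_sections _ _ _ _ R mu mu (fun n z => Normc.normc (U n z) ^+ 6)
  (fun z => (2 * pi) ^+ 6 * Normc.normc (u z.1 z.2) ^+ 6)).
- move=> n; apply: measurable_funX; apply: cmeasurable_normc; apply: cmeasurable_osc_int => //.
    exact: measurable_energy.
  exact: cintegrable_measurable (Idamped (a0 n)).
- by move=> n z; rewrite exprn_ge0// normc_ge0.
- exact: measurable_funM.
- by move=> z; rewrite mulr_ge0// exprn_ge0// normc_ge0.
- move=> t; have [mt t2] := inL2u t.
  have FF : Filter (nbhs (almost_everywhere mu)) by exact: ae_filter_ringOfSetsType.
  apply: (@filterS _ _ FF _ _ _ (ae_cvg_gaussK mt t2)) => x cx.
  have cn := cvgC_normc cx.
  have -> : (2 * pi) ^+ 6 * Normc.normc (u (t, x).1 (t, x).2) ^+ 6 =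
      Normc.normc (((2 * pi)%:C)%C * u t x) ^+ 6.
    by rewrite Normc.normcM normc_real ger0_norm ?exprMn// mulr_ge0// pi_ge0.
  have -> : (fun n => Normc.normc (U n (t, x)) ^+ 6) =
      (fun n => Normc.normc (cint mu (fun y => u t y * ((gaussK (a n) (x - y))%:C)%C)) ^+ 6).
    by apply/funext => n; rewrite UE.
  exact: (@cvg_comp _ _ _ _ (fun r : R => r ^+ 6) _ _ _ cn (@exprn_continuous R 6 _)).
move=> n; have [N NE /andP[N0 NA]] := damped_sqnorm (a0 n).
have := sextic_bound (Idamped (a0 n)) NE (fun s c t x s0 => wave_damped c t x (a0 n) s0).
move=> /le_trans; apply; rewrite lee_fin; apply: ler_wpM2l.
  by rewrite mulr_ge0// sextic_const_ge0.
by apply: lerXn2r; rewrite ?nnegrE// (le_trans N0).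
Qed.

End evolution_sextic.

Theorem theorem1p3 (R : realType) (psi : R -> R)
    (psi_schwartz : schwartz psi)
    (psi_even : forall x : R, psi (- x) = psi x)
    (psi_norm : cLnorm (@lebesgue_measure R) 2%:E (embedC psi)
                = ((2 * pi) `^ (- 2^-1))%:E) :
  exists beta c : R, [/\ 0 < beta, 0 < c &
    forall (f : R -> R[i]) (u : R -> R -> R[i]) (A eps : R),
      inL2 f ->
      free_evolution f u ->
      cLnorm (@lebesgue_measure R) 2%:E f = A%:E ->
      0 < eps ->
      (eps%:E <= spacetime_norm 6%:E u)%E ->
      ((c * eps * (eps / A) `^ beta)%:E <=
       ereal_sup [set y : \bar R | exists (z : R * R) (lam t : R), (0 < lam)%R /\
         y = (Normc.normc (inner (phase_translation z (scaling lam (embedC psi)))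
                           (u t)))%:E])%E].
Proof.
pose n2 : R := ((2 * pi) `^ (- 2^-1)) ^+ 2.
have p0 : 0 < 2 * pi :> R by rewrite mulr_gt0// pi_gt0.
have n20 : 0 < n2 by rewrite exprn_gt0// powR_gt0.
have psin2 : (\int[@lebesgue_measure R]_y (psi y ^+ 2)%:E = n2%:E)%E.
  rewrite -(cLnorm_sqnorm (powR_ge0 _ _) psi_norm); apply: eq_integral => y _.
  by rewrite normc_real real_normK ?num_real.
have [K K0 packets] := gauss_packet_bound psi_schwartz n20 psin2.
(* [sextic_const * K] multiplies the squared supremum, [(4 pi)^2] comes from the squared bound on
   the norm of the Fourier transform, and [(2 pi)^6] from the normalisation of [extension]. *)
pose C : R := sextic_const * K * (4 * pi) ^+ 2 / (2 * pi) ^+ 6.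
have C0 : 0 <= C.
  apply: divr_ge0; last by rewrite exprn_ge0// ltW.
  by rewrite mulr_ge0 ?sqr_ge0// mulr_ge0// sextic_const_ge0.
have s1 : 0 < Num.sqrt C + 1 by rewrite ltr_wpDl ?sqrtr_ge0.
(* The exponent 2 results from [eps^6 <= C m^2 A^4] after taking square roots. The added 1 keeps the
   constant well defined and positive, since only [0 <= C] has been shown. *)
exists 2, (Num.sqrt C + 1)^-1; split; [exact: ltr0n|by rewrite invr_gt0|].
move=> f u A eps fL2 [mu_ fu] fA eps0 le.
set S := [set y : \bar R | _].
have inS (z : R * R) (lam t : R) : 0 < lam ->
    S (Normc.normc (inner (phase_translation z (scaling lam (embedC psi))) (u t)))%:E.
  by move=> lam0; exists z, lam, t.
have S0 : (0 <= ereal_sup S)%E.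
  by apply: le_trans (ereal_sup_ubound (inS (0, 0) 1 0 ltr01)); rewrite lee_fin normc_ge0.
(* An infinite supremum makes the claim trivial; otherwise it is a real number [m]. *)
have [->|Sfin] := eqVneq (ereal_sup S) +oo%E; first by rewrite leey.
have Sm : ereal_sup S = (fine (ereal_sup S))%:E.
  by rewrite fineK// ge0_fin_numE// lt_neqAle Sfin leey.
move: Sm; set m := fine _ => Sm; rewrite Sm lee_fin.
have m0 : 0 <= m by rewrite -lee_fin -Sm.
have A0 : 0 <= A by rewrite -lee_fin -fA Lnorm_ge0.
have f2 := cLnorm_sqnorm A0 fA.
(* The propagator at any one time supplies a Fourier transform of [f]; time 0 is taken. *)
have [F fF _] := fu 0.
have packet_le (t sg x c : R) : 0 < sg -> sg * Normc.normc (cint (@lebesgue_measure R) (fun y => u t y *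
    (expi ((x - y) * c) * ((gaussK (sg ^+ 2 / 2) (x - y))%:C)%C))) ^+ 2 <= K * m ^+ 2.
  have [G _ [ut _ _]] := fu t.
  apply: (packets (u t) m ut.1 (inL2_sqnorm ut) m0) => z lam lam0.
  by rewrite -lee_fin -Sm; apply: ereal_sup_ubound; exact: inS.
have sextic := evolution_sextic mu_ fu fF f2 packet_le.
have eps6 : ((eps ^+ 6)%:E <= \int[prodm (@lebesgue_measure R) (@lebesgue_measure R)]_z
    (Normc.normc (u z.1 z.2) ^+ 6)%:E)%E.
  have -> : (\int[prodm (@lebesgue_measure R) (@lebesgue_measure R)]_z
      (Normc.normc (u z.1 z.2) ^+ 6)%:E = spacetime_norm 6%:E u `^ 6)%E.
    rewrite /spacetime_norm /cLnorm poweR_Lnorm ?pnatr_eq0//; apply: eq_integral => z _.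
    by rewrite gee0_abs ?lee_fin ?normc_ge0// poweR_EFin powR_mulrn ?normc_ge0.
  have -> : (eps ^+ 6)%:E = (eps%:E `^ 6)%E by rewrite poweR_EFin powR_mulrn// ltW.
  apply: gt0_ler_poweR => //; rewrite in_itv/= leey andbT; first by rewrite lee_fin ltW.
  exact: Lnorm_ge0.
have p6 : 0 < (2 * pi) ^+ 6 :> R by rewrite exprn_gt0.
have main : eps ^+ 6 <= C * m ^+ 2 * A ^+ 4.
  rewrite -(ler_pM2l p6) -lee_fin EFinM.
  have -> : (2 * pi) ^+ 6 * (C * m ^+ 2 * A ^+ 4) = sextic_const * (K * m ^+ 2) * (4 * pi * A ^+ 2) ^+ 2.
    rewrite /C; move: (sextic_const) ((2 * pi) ^+ 6 : R) p6 => sc q q0.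
    by field; rewrite gt_eqF.
  by apply: le_trans sextic; apply: lee_wpmul2l => //; rewrite lee_fin ltW.
rewrite powR_mulrn ?divr_ge0 ?(ltW eps0)//.
(* For [A = 0] the quotient [eps / A] is 0 by convention, so the left side vanishes. *)
have [A_eq0|An0] := eqVneq A 0; first by rewrite A_eq0 invr0 mulr0 expr0n/= mulr0.
have Apos : 0 < A by rewrite lt_neqAle eq_sym An0.
rewrite -mulrA ler_pdivrMl//.
(* Both sides are nonnegative, and the square of the left side is [eps^6 / A^4], so this is the
   square root of [main]. *)
have q : eps * (eps / A) ^+ 2 <= Num.sqrt C * m.
  have l0 : 0 <= eps * (eps / A) ^+ 2 by apply: mulr_ge0 (sqr_ge0 _); exact: ltW.
  have r0 : 0 <= Num.sqrt C * m by apply: mulr_ge0 => //; exact: sqrtr_ge0.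
  rewrite -(@ler_pXn2r _ 2)//.
  rewrite exprMn [leRHS]exprMn sqr_sqrtr//.
  have -> : eps ^+ 2 * ((eps / A) ^+ 2) ^+ 2 = eps ^+ 6 / A ^+ 4 by field.
  by rewrite ler_pdivrMr ?exprn_gt0.
by apply: (le_trans q); rewrite mulrDl mul1r lerDl.
Qed.
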